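(* Let $(L_t)_{t\in\mathbb{R}}$ be a two-sided Lévy process with $\mathbb{E}L_1=0$ and $\mathbb{E}L_1^4<\infty$, let $\varphi_1,\varphi_2:\mathbb{R}\to\mathbb{R}$ be functions in $L^2$, let $X^i_t=\int_{\mathbb{R}}\varphi_i(t-s)\,dL_s$ for $t\in\mathbb{R}$ and $i=1,2$, let $\Delta>0$, and for $n\in\mathbb{N}$ set $S_n=\sum_{t=1}^nX^1_{t\Delta}X^2_{t\Delta}$. Suppose that the following conditions hold: (i) There are $\alpha_1,\alpha_2\in[1,\infty]$ with $1/\alpha_1+1/\alpha_2=1$ such that, for $i=1,2$, the sequence $s\mapsto\int_{\mathbb{R}}|\varphi_i(t)\varphi_i(t+s\Delta)|\,dt$, $s\in\mathbb{Z}$, belongs to $\ell^{\alpha_i}$. (ii) The sequence $s\mapsto\int_{\mathbb{R}}|\varphi_1(t)\varphi_2(t+s\Delta)|\,dt$, $s\in\mathbb{Z}$, belongs to $\ell^2$. (iii) The function $t\mapsto\sum_{s\in\mathbb{Z}}|\varphi_1(t+s\Delta)\varphi_2(t+s\Delta)|$ belongs to $L^2([0,\Delta])$. Then, as $n\to\infty$, $(S_n-\mathbb{E}S_n)/\sqrt{n}$ converges in distribution to a Gaussian random variable with mean zero and variance $$\eta^2=\kappa_4\int_0^\Delta\Bigl(\sum_{s\in\mathbb{Z}}\varphi_1(t+s\Delta)\varphi_2(t+s\Delta)\Bigr)^2dt+\sum_{s\in\mathbb{Z}}\gamma_{11}(s\Delta)\gamma_{22}(s\Delta)+\sum_{s\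in\mathbb{Z}}\gamma_{12}(s\Delta)\gamma_{21}(s\Delta).$$
   Context: A one-sided Lévy process $(L_t)_{t\geq 0}$ with $L_0=0$ is a càdlàg process with stationary and independent increments. A two-sided Lévy process is $L_t=L^1_t\mathbf{1}_{t\geq 0}-L^2_{(-t)-}\mathbf{1}_{t<0}$, $t\in\mathbb{R}$, where $(L^1_t)_{t\geq0}$ and $(L^2_t)_{t\geq 0}$ are independent copies of a one-sided Lévy process. For deterministic measurable $f\in L^2$, the integral $\int_{\mathbb{R}}f(t)\,dL_t$ is the usual Lévy integral, defined as a limit in probability of integrals of simple functions. $L^p$ denotes the space of measurable functions $f:\mathbb{R}\to\mathbb{R}$ with $\int_{\mathbb R}|f|^p<\infty$ (Lebesgue measure). $\ell^p$ denotes the space of $a:\mathbb{Z}\to\mathbb{R}$ with $\sum_{t\in\mathbb{Z}}|a(t)|^p<\infty$ for $p<\infty$, and $\sup_{t\in\mathbb{Z}}|a(t)|<\infty$ for $p=\infty$; by convention $1/\infty=0$. $\sigma^2=\mathbb{E}L_1^2$, $\kappa_4=\mathbb{E}L_1^4-3\sigma^4$, and for $i,j\in\{1,2\}$, $$\gamma_{ij}(h)=\mathbb{E}[X^i_0X^j_h]=\sigma^2\int_{\mathbb{R}}\varphi_i(t)\varphi_j(t+h)\,dt,\quad h\in\mathbb{R}.$$ A Gaussian random variable with variance $0$ is understood as the constant equal to its mean. *)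

(* Defs.v *)
From HB Require Import structures.
From mathcomp Require Import all_boot all_order all_algebra.
From mathcomp Require Import all_classical all_reals all_analysis.

Set Implicit Arguments.
Unset Strict Implicit.
Unset Printing Implicit Defensive.

Import Order.TTheory GRing.Theory Num.Theory.
Import numFieldNormedType.Exports.

Local Open Scope classical_set_scope.
Local Open Scope ring_scope.

(** Processes are maps [X : R -> T -> R], written [X t w]. *)

Section processes.
Context (R : realType) (d : measure_display) (T : measurableType d)
        (P : probability T R).

(* Any of the sets [B i] may be [setT], so the product rule over the whole
   family contains the product rule over every subfamily. *)
Definition mutually_independent (n : nat) (Y : 'I_n -> T -> R) : Prop :=
  forall B : 'I_n -> set R, (forall i, measurable (B i)) ->
    P (\bigcap_(i in [set: 'I_n]) (Y i @^-1` B i))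
    = \big[mule/1%E]_(i < n) P (Y i @^-1` B i).

Definition same_distribution (Y Z : T -> R) : Prop :=
  forall B : set R, measurable B -> P (Y @^-1` B) = P (Z @^-1` B).

(* A one-sided process only matters at times [t >= 0]; its values at negative
   times are unconstrained and never used. *)
Record one_sided_levy (L : R -> T -> R) : Prop := OneSidedLevy {
  levy_measurable : forall t, 0 <= t -> measurable_fun [set: T] (L t);
  levy_start0 : forall w, L 0 w = 0;
  levy_right_continuous : forall w t, 0 <= t -> L u w @[u --> t^'+] --> L t w;
  levy_left_limits : forall w t, 0 < t -> cvg (L u w @[u --> t^'-]);
  levy_independent_increments : forall (n : nat) (t : nat -> R),
    0 <= t 0%N -> {homo t : i j / (i <= j)%N >-> i <= j} ->
    mutually_independent (fun (i : 'I_n) w => L (t i.+1) w - L (t i) w);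
  levy_stationary_increments : forall s t h, 0 <= s -> s <= t -> 0 <= h ->
    same_distribution (fun w => L (t + h) w - L (s + h) w)
                      (fun w => L t w - L s w)
}.

(* The sigma-algebra on path space generated by the coordinates at times
   [t >= 0]. *)
Definition cylinder_sigma : set (set (R -> R)) :=
  <<s [set E | exists t, 0 <= t /\
        exists2 B : set R, measurable B & E = [set x | B (x t)]] >>.

Definition sample_path (X : R -> T -> R) (w : T) : R -> R := fun t => X t w.

Definition same_law (X Y : R -> T -> R) : Prop :=
  forall E, cylinder_sigma E -> P (sample_path X @^-1` E) = P (sample_path Y @^-1` E).

Definition independent_processes (X Y : R -> T -> R) : Prop :=
  forall E F, cylinder_sigma E -> cylinder_sigma F ->
    P (sample_path X @^-1` E `&` sample_path Y @^-1` F)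
    = (P (sample_path X @^-1` E) * P (sample_path Y @^-1` F))%E.

Definition two_sided_levy (L : R -> T -> R) : Prop :=
  exists L1 L2 : R -> T -> R,
    [/\ one_sided_levy L1, one_sided_levy L2, same_law L1 L2,
        independent_processes L1 L2 &
        forall t w, L t w =
          if 0 <= t then L1 t w else - lim (L2 u w @[u --> (- t)^'-])].

Definition cvg_in_probability (Y : nat -> T -> R) (Z : T -> R) : Prop :=
  forall e : R, 0 < e ->
    P [set w | e <= `|Y n w - Z w|] @[n --> \oo] --> 0%E.

(* [(a, (s, t))] stands for the simple function [a 1_(s, t]]. *)
Definition step_data : Type := seq (R * (R * R)).

Definition step_wf (g : step_data) : bool := all (fun u => u.2.1 <= u.2.2) g.

Definition step_fun (g : step_data) (x : R) : R :=
  \sum_(u <- g) u.1 * \1_(`]u.2.1, u.2.2]) x.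

Definition step_integral (L : R -> T -> R) (g : step_data) (w : T) : R :=
  \sum_(u <- g) u.1 * (L u.2.2 w - L u.2.1 w).

(* [Y] is a version of the Levy integral of [f]: such integrals are determined
   only up to almost sure equality, hence a relation. *)
Definition is_levy_integral (L : R -> T -> R) (f : R -> R) (Y : T -> R) : Prop :=
  measurable_fun [set: T] Y /\
  exists g : nat -> step_data,
    [/\ forall n, step_wf (g n),
        Lnorm (@lebesgue_measure R) 2%:E (fun x => (step_fun (g n) x - f x)%:E)
          @[n --> \oo] --> 0%E &
        cvg_in_probability (fun n => step_integral L (g n)) Y].

Definition cvg_in_distribution
    (Y : nat -> T -> R) (mu : probability (measurableTypeR R) R) : Prop :=
  forall f : R -> R, continuous f -> bounded_fun f ->
    ('E_P[fun w => f (Y n w)] @[n --> \oo] --> \int[mu]_x (f x)%:E)%E.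

Definition cross_cov (X Y : R -> T -> R) (h : R) : R :=
  fine ('E_P[fun w => (X 0 w * Y h w)%R])%E.

End processes.

Section analysis.
Context (R : realType).

(* [normal_prob] takes a standard deviation, and it is not a point mass when
   that deviation is 0. *)
Definition gaussian (m v : R) : probability (measurableTypeR R) R :=
  if v == 0 then [the probability _ _ of @dirac _ (measurableTypeR R) m R]
  else [the probability _ _ of normal_prob m (Num.sqrt v)].

(* An infinite value of [a] excludes membership in l^p(Z) when [p > 0]. *)
Definition in_lp (p : \bar R) (a : int -> \bar R) : Prop :=
  match p with
  | r%:E => (\esum_(s in [set: int]) (`|a s| `^ r) < +oo)%E
  | +oo%E => (ereal_sup [set `|a s| | s in [set: int]] < +oo)%E
  | -oo%E => False
  end.

(* Meaningful for absolutely summable families only. *)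
Definition zsum (a : int -> R) : R :=
  let b := fun s => (a s)%:E in
  fine (esum [set: int] (b^\+)%E - esum [set: int] (b^\-)%E)%E.

Definition abs_corr (f g : R -> R) (h : R) : \bar R :=
  (\int[@lebesgue_measure R]_t `|f t * g (t + h)|%:E)%E.

End analysis.

(* Main.v *)
Require Import Defs.
From HB Require Import structures.
From mathcomp Require Import all_boot all_order all_algebra.
From mathcomp Require Import all_classical all_reals all_analysis.
From mathcomp Require Import measurable_realfun.
From mathcomp Require Import zify ring lra.
Import Order.TTheory GRing.Theory Num.Theory.
Import numFieldNormedType.Exports.
Set Implicit Arguments.
Unset Strict Implicit.
Unset Printing Implicit Defensive.
Local Open Scope classical_set_scope.
Local Open Scope ring_scope.

(** The products of the two moving averages at the times [t * Delta] form a
    stationary sequence.  If both kernels had bounded support, products far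
    apart would be independent and the classical theorem for such sequences
    would apply.  The three conditions say that covariances are absolutely
    summable over all lags, even after absolute values are taken inside every
    integral; this uniformity lets kernels of bounded support replace the given
    ones at a cost that is small in L^2, uniformly in the number of summands.

    Covariances.  For kernels that are constant on the cells of a grid the
    integrals are linear forms in independent increments, whose mixed fourth
    moments are one cumulant and three pairings ([linear_form_fourth]).  The
    formula passes to the limit for pairs of kernels whose product is also
    square-integrable, because such a pair and its product can be approximated
    simultaneously ([dyadic_approx], [fourth_moment]).  Subtracting the means
    leaves the function [cov] of the lag, and its majorant [cov_bound] is
    summable: condition (i) enters through Young's inequality
    ([zsummable_conjugate]), condition (ii) through [zsummable_sqr_reflect], and
    condition (iii) through Tonelli's theorem, by which the correlations of the
    product p of the kernels over all lags add up to the square of its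
    periodization, integrated over one period ([esum_correlation],
    [zsum_correlation]).  By Cesaro's theorem the variances of the normalized
    sums converge to the sum of all covariances ([double_sum_cesaro]), which is
    the constant of the statement ([zsum_cov_kernels]).

    Approximation.  Cutting the kernels off outside a large interval produces an
    error whose covariances are dominated by four times [cov_bound] and vanish
    in the limit lag by lag, so that their sum vanishes ([tannery]).  Kernels
    on a fixed interval are then replaced by dyadic step functions; there only
    boundedly many lags matter, and convergence at lag zero is enough
    ([normalized_sumB_short_range]).

    Limit law.  The property that is carried along is [stein_clt]: the
    difference E[W f(W)] - E[W^2] E[f'(W)] tends to 0 for smooth bounded f.  It
    holds for bounded functions of overlapping windows of independent noise
    ([bounded_stein_clt]), hence for products of linear forms by truncating the
    noise ([linear_product_stein_clt]), it survives approximation in L^2 that is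
    uniform in n ([stein_clt_approx]), and together with convergence of the
    variances it implies convergence to the normal law, including the
    degenerate one ([stein_criterion]).

    Of the driving process the argument uses the record [levy_noise]: moments of
    increments, and independence over grids.  [two_sided_levy_noise] derives it
    from the definition, where finiteness and linear growth in time of the
    moments have to be propagated from time 1, and [levy_integral_wiener] shows
    that integrals defined through convergence in probability are limits in
    L^2. *)

(** * Integrable and square-integrable functions over a measure *)

Section integration.
Context d (T : measurableType d) (R : realType) (mu : {measure set T -> \bar R}).
Implicit Types f g h : T -> R.

Definition L1 f := mu.-integrable setT (EFin \o f).
Definition L2 f := measurable_fun setT f /\ L1 (fun x => f x ^+ 2).
Definition Ex f : R := \int[mu]_x f x.

Lemma L1_measurable f : L1 f -> measurable_fun setT f.
Proof. by move=> /integrableP[/measurable_EFinP]. Qed.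

Lemma eq_L1 f g : f =1 g -> L1 f -> L1 g.
Proof. by move=> /funext ->. Qed.

Lemma L1D f g : L1 f -> L1 g -> L1 (fun x => f x + g x).
Proof. by move=> f1 g1; apply: (integrableD measurableT f1 g1). Qed.

Lemma L1Z c f : L1 f -> L1 (fun x => c * f x).
Proof. by move=> f1; apply: (integrableZl measurableT c f1). Qed.

Lemma L1N f : L1 f -> L1 (fun x => - f x).
Proof. by move=> /(L1Z (-1)); apply: eq_L1 => x; rewrite mulN1r. Qed.

Lemma L1B f g : L1 f -> L1 g -> L1 (fun x => f x - g x).
Proof. by move=> f1 /L1N g1; exact: L1D. Qed.

Lemma L1_0 : L1 (fun=> 0).
Proof. exact: integrable0. Qed.

Lemma L1_sum (I : Type) (s : seq I) (p : pred I) (F : I -> T -> R) :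
  (forall i, p i -> L1 (F i)) -> L1 (fun x => \sum_(i <- s | p i) F i x).
Proof.
move=> F1; elim: s => [|i s ih].
  by apply: (eq_L1 _ L1_0) => x; rewrite big_nil.
case pi : (p i).
  by apply: (eq_L1 _ (L1D (F1 _ pi) ih)) => x; rewrite big_cons pi.
by apply: (eq_L1 _ ih) => x; rewrite big_cons pi.
Qed.

Lemma L1_abs f : L1 f -> L1 (fun x => `|f x|).
Proof. exact: integrable_norm. Qed.

Lemma L1_le f g : measurable_fun setT f -> (forall x, `|f x| <= g x) ->
  L1 g -> L1 f.
Proof.
move=> mf fg; apply: le_integrable => //; first exact/measurable_EFinP.
by move=> x _; rewrite /= lee_fin (le_trans (fg x))// ler_norm.
Qed.

Lemma L1_ge0 f : measurable_fun setT f -> (forall x, 0 <= f x) ->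
  (\int[mu]_x (f x)%:E < +oo)%E -> L1 f.
Proof.
move=> mf f0 foo; apply/integrableP; split; first exact/measurable_EFinP.
by under eq_integral do rewrite /= ger0_norm//.
Qed.

Lemma measurable_abs f : measurable_fun setT f ->
  measurable_fun setT (fun x => `|f x|).
Proof. by move=> mf; exact: measurableT_comp. Qed.

Lemma measurable_abs_ge f e : measurable_fun setT f ->
  measurable [set x | e <= `|f x|].
Proof.
move=> /measurable_abs mf; rewrite -[X in measurable X]setTI.
rewrite [X in measurable X](_ : _ = [set: T] `&` (fun x => `|f x|) @^-1` `[e, +oo[).
  exact: mf.
by congr setI; apply/seteqP; split => x /=; rewrite in_itv/= andbT.
Qed.

Lemma measurable_abs_gt (W : T -> R) (A : R) : measurable_fun setT W ->
  measurable [set w | A < `|W w|].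
Proof.
move=> /measurable_abs mW; rewrite -[X in measurable X]setTI.
rewrite [X in measurable X](_ : _ = [set: T] `&` (fun x => `|W x|) @^-1` `]A, +oo[).
  exact: mW.
by congr setI; apply/seteqP; split => x /=; rewrite in_itv/= andbT.
Qed.

Lemma eq_Ex f g : f =1 g -> Ex f = Ex g.
Proof. by move=> /funext ->. Qed.

Lemma EFin_Ex f : L1 f -> (\int[mu]_x (f x)%:E)%E = (Ex f)%:E.
Proof. by move=> f1; rewrite /Ex /Rintegral fineK//; exact: integrable_fin_num. Qed.

Lemma ExD f g : L1 f -> L1 g -> Ex (fun x => f x + g x) = Ex f + Ex g.
Proof. by move=> f1 g1; exact: RintegralD. Qed.

Lemma ExB f g : L1 f -> L1 g -> Ex (fun x => f x - g x) = Ex f - Ex g.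
Proof. by move=> f1 g1; exact: RintegralB. Qed.

Lemma ExZ c f : L1 f -> Ex (fun x => c * f x) = c * Ex f.
Proof. by move=> f1; exact: RintegralZl. Qed.

Lemma ExN f : L1 f -> Ex (fun x => - f x) = - Ex f.
Proof.
by move=> f1; rewrite -mulN1r -ExZ//; apply: eq_Ex => x; rewrite mulN1r.
Qed.

Lemma Ex0 : Ex (fun=> 0) = 0.
Proof. by rewrite /Ex /Rintegral integral0. Qed.

Lemma Ex_sum (I : Type) (s : seq I) (p : pred I) (F : I -> T -> R) :
  (forall i, p i -> L1 (F i)) ->
  Ex (fun x => \sum_(i <- s | p i) F i x) = \sum_(i <- s | p i) Ex (F i).
Proof.
move=> F1; elim: s => [|i s ih].
  by rewrite big_nil -[RHS]Ex0; apply: eq_Ex => x; rewrite big_nil.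
rewrite big_cons; case pi : (p i); last first.
  by rewrite -ih; apply: eq_Ex => x; rewrite big_cons pi.
rewrite -ih -ExD; [|exact: F1|exact: L1_sum].
by apply: eq_Ex => x; rewrite big_cons pi.
Qed.

Lemma Ex_ge0 f : (forall x, 0 <= f x) -> 0 <= Ex f.
Proof. by move=> f0; exact: Rintegral_ge0. Qed.

Lemma le_Ex f g : L1 f -> L1 g -> (forall x, f x <= g x) -> Ex f <= Ex g.
Proof. by move=> f1 g1 fg; apply: le_Rintegral. Qed.

Lemma ler_norm_Ex f : L1 f -> `|Ex f| <= Ex (fun x => `|f x|).
Proof. by move=> f1; apply: le_normr_Rintegral. Qed.

Lemma ae_eq_Ex f g : measurable_fun setT f -> measurable_fun setT g ->
  {ae mu, forall x, f x = g x} -> Ex f = Ex g.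
Proof.
move=> mf mg fg; rewrite /Ex /Rintegral; congr fine.
apply: ae_eq_integral => //; try exact/measurable_EFinP.
by apply: filterS fg => x -> _.
Qed.

Lemma ae_L1 f g : measurable_fun setT f -> measurable_fun setT g ->
  {ae mu, forall x, f x = g x} -> L1 f -> L1 g.
Proof.
move=> mf mg fg /integrableP[_ foo]; apply/integrableP; split.
  exact/measurable_EFinP.
rewrite (le_lt_trans _ foo)// le_eqVlt; apply/orP; left; apply/eqP.
apply: ae_eq_integral => //; try exact/measurableT_comp/measurable_EFinP.
by apply: filterS fg => x /= -> _.
Qed.

(** ** Square-integrable functions *)

Lemma eq_L2 f g : f =1 g -> L2 f -> L2 g.
Proof. by move=> /funext ->. Qed.

Lemma L2_measurable f : L2 f -> measurable_fun setT f. Proof. by case. Qed.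

Lemma L2_sqr f : L2 f -> L1 (fun x => f x ^+ 2). Proof. by case. Qed.

Lemma L2M f g : L2 f -> L2 g -> L1 (fun x => f x * g x).
Proof.
move=> [mf f2] [mg g2]; apply: (L1_le _ _ (L1D f2 g2)).
  exact: measurable_funM.
by move=> x; rewrite normrM -(real_normK (num_real (f x)))
  -(real_normK (num_real (g x))); have := sqr_ge0 (`|f x| - `|g x|);
  have := normr_ge0 (f x); have := normr_ge0 (g x); nra.
Qed.

Lemma L2D f g : L2 f -> L2 g -> L2 (fun x => f x + g x).
Proof.
move=> /[dup] f2 [mf fs] /[dup] g2 [mg gs]; split.
  exact: measurable_funD.
apply: (eq_L1 _ (L1D fs (L1D (L1Z 2 (L2M f2 g2)) gs))) => x; ring.
Qed.

Lemma L2Z c f : L2 f -> L2 (fun x => c * f x).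
Proof.
move=> [mf f2]; split; first exact: measurable_funM.
by apply: (eq_L1 _ (L1Z (c ^+ 2) f2)) => x; ring.
Qed.

Lemma L2N f : L2 f -> L2 (fun x => - f x).
Proof. by move=> /(L2Z (-1)); apply: eq_L2 => x; rewrite mulN1r. Qed.

Lemma L2B f g : L2 f -> L2 g -> L2 (fun x => f x - g x).
Proof. by move=> f1 /L2N g1; exact: L2D. Qed.

Lemma L2_0 : L2 (fun=> 0).
Proof. by split => //; apply: (eq_L1 _ L1_0) => x; rewrite expr0n. Qed.

Lemma L2_sum (I : Type) (s : seq I) (p : pred I) (F : I -> T -> R) :
  (forall i, p i -> L2 (F i)) -> L2 (fun x => \sum_(i <- s | p i) F i x).
Proof.
move=> F1; elim: s => [|i s ih].
  by apply: (eq_L2 _ L2_0) => x; rewrite big_nil.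
case pi : (p i).
  by apply: (eq_L2 _ (L2D (F1 _ pi) ih)) => x; rewrite big_cons pi.
by apply: (eq_L2 _ ih) => x; rewrite big_cons pi.
Qed.

Lemma L2_le f g : measurable_fun setT f -> (forall x, `|f x| <= `|g x|) ->
  L2 g -> L2 f.
Proof.
move=> mf fg [mg g2]; split => //; apply: (L1_le _ _ g2).
  exact: measurable_funX.
move=> x; rewrite normrX -(real_normK (num_real (g x))).
by rewrite lerXn2r ?nnegrE.
Qed.

Lemma ae_L2 f g : measurable_fun setT g ->
  {ae mu, forall x, f x = g x} -> L2 f -> L2 g.
Proof.
move=> mg fg [mf f2]; split => //; apply: (ae_L1 _ _ _ f2).
- exact: measurable_funX.
- exact: measurable_funX.
- by apply: filterS fg => x ->.
Qed.

Lemma L2_abs f : L2 f -> L2 (fun x => `|f x|).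
Proof.
by move=> f2; apply: (L2_le (measurable_abs (L2_measurable f2)) _ f2) => x;
  rewrite normr_id.
Qed.

(** The discriminant of the nonnegative polynomial t |-> E (f + t g)^2. *)
Lemma cauchy_schwarz f g : L2 f -> L2 g ->
  Ex (fun x => f x * g x) ^+ 2 <=
  Ex (fun x => f x ^+ 2) * Ex (fun x => g x ^+ 2).
Proof.
move=> f2 g2; set a := Ex (fun x => f x ^+ 2).
set b := Ex (fun x => f x * g x); set c := Ex (fun x => g x ^+ 2).
have H t : 0 <= a + t * (2 * b) + t ^+ 2 * c.
  have -> : a + t * (2 * b) + t ^+ 2 * c = Ex (fun x => (f x + t * g x) ^+ 2).
    have fs := L2_sqr f2; have gs := L2_sqr g2; have fg := L2M f2 g2.
    rewrite /a /b /c -(ExZ (t ^+ 2))// -(ExZ 2)// -(ExZ t) -?ExD.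
    - by apply: eq_Ex => x; ring.
    - exact: L1D (L1Z _ (L1Z _ _)).
    - exact: L1Z.
    - exact: fs.
    - exact: (L1Z _ (L1Z _ fg)).
    - exact: L1Z.
  by apply: Ex_ge0 => x; exact: sqr_ge0.
have a0 : 0 <= a by apply: Ex_ge0 => x; exact: sqr_ge0.
have c0 : 0 <= c by apply: Ex_ge0 => x; exact: sqr_ge0.
have [c00|cn0] := eqVneq c 0.
  have [->|bn0] := eqVneq b 0; first by rewrite expr0n mulr_ge0.
  have := H (- (a + 1) / (2 * b)); rewrite c00 mulr0 addr0.
  by rewrite divfK ?mulf_neq0 ?pnatr_eq0//; lra.
have := H (- b / c).
have -> : a + - b / c * (2 * b) + (- b / c) ^+ 2 * c = a - b ^+ 2 / c.
  by field.
rewrite subr_ge0 ler_pdivrMr ?lt_def ?cn0//.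
Qed.

Definition nrm f : R := Num.sqrt (Ex (fun x => f x ^+ 2)).

Lemma nrm_ge0 f : 0 <= nrm f. Proof. exact: sqrtr_ge0. Qed.

Lemma sqr_nrm f : nrm f ^+ 2 = Ex (fun x => f x ^+ 2).
Proof. by rewrite /nrm sqr_sqrtr// Ex_ge0// => x; exact: sqr_ge0. Qed.

Lemma eq_nrm f g : f =1 g -> nrm f = nrm g.
Proof. by move=> /funext ->. Qed.

Lemma ler_dot_nrm f g : L2 f -> L2 g -> `|Ex (fun x => f x * g x)| <= nrm f * nrm g.
Proof.
move=> f2 g2; rewrite -(@ler_pXn2r _ 2)// ?nnegrE ?mulr_ge0 ?nrm_ge0//.
by rewrite exprMn !sqr_nrm real_normK ?num_real//; exact: cauchy_schwarz.
Qed.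

Lemma nrm_tri f g : L2 f -> L2 g -> nrm (fun x => f x + g x) <= nrm f + nrm g.
Proof.
move=> f2 g2; rewrite -(@ler_pXn2r _ 2)// ?nnegrE ?addr_ge0 ?nrm_ge0//.
rewrite sqr_nrm; have -> : Ex (fun x => (f x + g x) ^+ 2) =
    nrm f ^+ 2 + 2 * Ex (fun x => f x * g x) + nrm g ^+ 2.
  have fs := L2_sqr f2; have gs := L2_sqr g2; have fg := L2M f2 g2.
  rewrite !sqr_nrm -(ExZ 2)// -?ExD//.
  - by apply: eq_Ex => x; ring.
  - by apply: L1D => //; exact: L1Z.
  - exact: L1Z.
by have := ler_norm (Ex (fun x => f x * g x)); have := ler_dot_nrm f2 g2; nra.
Qed.

Lemma nrm_abs f : nrm (fun x => `|f x|) = nrm f.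
Proof.
by rewrite /nrm; congr Num.sqrt; apply: eq_Ex => x; rewrite real_normK ?num_real.
Qed.

Lemma nrmN f : nrm (fun x => - f x) = nrm f.
Proof. by rewrite /nrm; congr Num.sqrt; apply: eq_Ex => x; rewrite sqrrN. Qed.

Lemma nrmZ c f : L2 f -> nrm (fun x => c * f x) = `|c| * nrm f.
Proof.
move=> f2; rewrite -sqrtr_sqr -sqrtrM ?sqr_ge0// -ExZ; last exact: L2_sqr.
by rewrite /nrm; congr Num.sqrt; apply: eq_Ex => x; rewrite exprMn.
Qed.

Lemma nrm_sub_tri f g h : L2 f -> L2 g -> L2 h ->
  nrm (fun x => f x - h x) <= nrm (fun x => f x - g x) + nrm (fun x => g x - h x).
Proof.
move=> f2 g2 h2; rewrite (eq_nrm (g := fun x => (f x - g x) + (g x - h x))).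
  by apply: nrm_tri; exact: L2B.
by move=> x; ring.
Qed.

Lemma nrm_le f g : measurable_fun setT f -> (forall x, `|f x| <= `|g x|) ->
  L2 g -> nrm f <= nrm g.
Proof.
move=> mf fg g2; rewrite /nrm ler_sqrt; last by apply: Ex_ge0 => x; exact: sqr_ge0.
apply: le_Ex; [exact: (L2_sqr (L2_le mf fg g2))|exact: L2_sqr|].
move=> x; rewrite -(real_normK (num_real (f x))) -(real_normK (num_real (g x))).
by rewrite lerXn2r ?nnegrE.
Qed.

Lemma Ex_sqr0_ae f : L2 f -> Ex (fun x => f x ^+ 2) = 0 ->
  {ae mu, forall x, f x = 0}.
Proof.
move=> [mf f2] f0.
have : (\int[mu]_x `|(f x ^+ 2)%:E| = 0)%E.
  under eq_integral do rewrite /= ger0_norm ?sqr_ge0//.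
  by rewrite EFin_Ex// f0.
have mf2 : measurable_fun setT (fun x => (f x ^+ 2)%:E).
  by apply/measurable_EFinP; exact: measurable_funX.
move=> /(ae_eq_integral_abs mu measurableT mf2).
apply: filterS => x /(_ I) /= [] /eqP.
by rewrite sqrf_eq0 => /eqP.
Qed.

Lemma nrm_eq0_ae f : L2 f -> nrm f = 0 -> {ae mu, forall x, f x = 0}.
Proof. by move=> f2 f0; apply: Ex_sqr0_ae => //; rewrite -sqr_nrm f0 expr0n. Qed.

(** ** Limit theorems *)

Lemma Ex_dominated (F : nat -> T -> R) f g :
  (forall n, measurable_fun setT (F n)) -> measurable_fun setT f ->
  (forall x, F n x @[n --> \oo] --> f x) -> L1 g ->
  (forall n x, `|F n x| <= g x) ->
  L1 f /\ Ex (F n) @[n --> \oo] --> Ex f.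
Proof.
move=> mF mf Ff g1 Fg.
have [|||||] := @dominated_convergence _ T R mu setT measurableT
  (fun n x => (F n x)%:E) (fun x => (f x)%:E) (fun x => (g x)%:E).
- by move=> n; exact/measurable_EFinP.
- exact/measurable_EFinP.
- by apply/nearW => x _; apply: cvg_EFin; [exact: nearW|exact: Ff].
- exact: g1.
- by apply/nearW => x n _; rewrite lee_fin.
move=> f1 _ Hc; split => //.
by rewrite /Ex /Rintegral; apply: fine_cvg; rewrite EFin_Ex in Hc.
Qed.

Lemma nrm_dominated (F : nat -> T -> R) f g :
  (forall n, measurable_fun setT (F n)) -> measurable_fun setT f ->
  (forall x, F n x @[n --> \oo] --> f x) -> L2 g ->
  (forall n x, `|F n x| <= g x) ->
  nrm (fun x => F n x - f x) @[n --> \oo] --> (0 : R).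
Proof.
move=> mF mf Ff g2 Fg.
have fg x : `|f x| <= g x.
  have Hc : `|F n x| @[n --> \oo] --> `|f x| by apply: cvg_norm; exact: Ff.
  rewrite -(cvg_lim _ Hc)//; apply: limr_le; first by apply: cvgP Hc.
  by apply/nearW => n; exact: Fg.
have H n x : `|(F n x - f x) ^+ 2| <= 4 * g x ^+ 2.
  rewrite ger0_norm ?sqr_ge0//; have := Fg n x; have := fg x.
  by rewrite !ler_norml => /andP[? ?] /andP[? ?]; nra.
have [||||_] := @Ex_dominated (fun n x => (F n x - f x) ^+ 2) (fun=> 0)
    (fun x => 4 * g x ^+ 2) _ _ _ _ H.
- by move=> n; apply: measurable_funX; exact: measurable_funB.
- by [].
- move=> x; have Hc : F n x - f x @[n --> \oo] --> (0 : R).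
    by rewrite -(subrr (f x)); apply: cvgB; [exact: Ff|exact: cvg_cst].
  by rewrite -[X in _ --> X](mulr0 (0 : R)); exact: (cvgM Hc Hc).
- exact: L1Z (L2_sqr g2).
rewrite Ex0 => Hc; rewrite -(@sqrtr0 R).
by apply: (cvg_comp _ _ Hc); exact: sqrt_continuous.
Qed.

(** Fatou's lemma with the upper bound stated as an eventual one, which is the
    form that Cauchy sequences provide. *)
Lemma Ex_fatou (F : nat -> T -> R) f (C : R) :
  (forall n, measurable_fun setT (F n)) -> (forall n x, 0 <= F n x) ->
  (forall n, L1 (F n)) -> (forall x, F n x @[n --> \oo] --> f x) ->
  (forall e : R, 0 < e -> \forall n \near \oo, Ex (F n) <= C + e) ->
  measurable_fun setT f -> L1 f /\ Ex f <= C.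
Proof.
move=> mF F0 F1 Ff FC mf.
have f0 x : 0 <= f x.
  rewrite -(cvg_lim _ (Ff x))//; apply: limr_ge; first exact: cvgP (Ff x).
  by apply/nearW => n; exact: F0.
suff H : (\int[mu]_x (f x)%:E <= C%:E)%E.
  have f1 : L1 f by apply: L1_ge0 => //; rewrite (le_lt_trans H)// ltry.
  by split => //; rewrite -lee_fin -EFin_Ex.
have E : (\int[mu]_x (f x)%:E = \int[mu]_x limn_einf (fun n => (F n x)%:E))%E.
  apply: eq_integral => x _.
  have Hc : (F n x)%:E @[n --> \oo] --> (f x)%:E.
    by apply: cvg_EFin; [exact: nearW|exact: Ff].
  rewrite is_cvg_limn_einfE; first by rewrite (cvg_lim _ Hc).
  exact: cvgP Hc.
rewrite E; have := @fatou _ T R mu setT measurableT (fun n x => (F n x)%:E).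
move=> /(_ _ _)/le_trans; apply.
- by move=> n; exact/measurable_EFinP.
- by move=> n x _; rewrite lee_fin.
apply/lee_addgt0Pr => e e0; rewrite limn_einf_lim.
apply: lime_le; first exact: is_cvg_einfs.
near=> n; rewrite (@le_trans _ _ (Ex (F n))%:E)//.
  rewrite -EFin_Ex//; apply: ereal_inf_lbound; exists n => //=.
by rewrite -EFinD lee_fin; near: n; exact: FC.
Unshelve. all: by end_near. Qed.

(** A squeeze in which the bound holds everywhere, so that it serves for
    sequences and for double sequences alike. *)
Lemma cvg_norm_le (I : Type) (F : set_system I) (FF : Filter F)
    (u v : I -> R) (l : R) :
  (forall i, `|u i - l| <= v i) -> v @ F --> (0 : R) -> u @ F --> l.
Proof.
move=> uv v0; apply/cvgrPdist_le => e e0.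
have /cvgrPdist_le/(_ _ e0) := v0; apply: filterS => i.
rewrite sub0r normrN distrC; apply: le_trans; rewrite (le_trans (uv i))//.
exact: ler_norm.
Qed.

(** Inner products are jointly continuous; an arbitrary filter is used so that
    it also applies to double sequences. *)
Lemma cvg_dot (I : Type) (F : set_system I) (FF : ProperFilter F)
    (a b : I -> T -> R) f g :
  (forall i, L2 (a i)) -> (forall i, L2 (b i)) -> L2 f -> L2 g ->
  nrm (fun x => a i x - f x) @[i --> F] --> (0 : R) ->
  nrm (fun x => b i x - g x) @[i --> F] --> (0 : R) ->
  Ex (fun x => a i x * b i x) @[i --> F] --> Ex (fun x => f x * g x).
Proof.
move=> a2 b2 f2 g2 af bg.
pose v i := nrm (fun x => a i x - f x) * nrm (fun x => b i x - g x) +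
   nrm (fun x => a i x - f x) * nrm g + nrm f * nrm (fun x => b i x - g x).
apply: (@cvg_norm_le _ F _ _ v) => [i|].
  have af2 := L2B (a2 i) f2; have bg2 := L2B (b2 i) g2.
  rewrite -ExB; [|exact: L2M|exact: L2M].
  rewrite (eq_Ex (g := fun x => ((a i x - f x) * (b i x - g x) +
    (a i x - f x) * g x) + f x * (b i x - g x))); last by move=> x; ring.
  rewrite ExD; [|by apply: L1D; exact: L2M|exact: L2M].
  rewrite ExD; [|exact: L2M|exact: L2M].
  by rewrite (le_trans (ler_normD _ _))// lerD ?ler_dot_nrm//
    (le_trans (ler_normD _ _))// lerD ?ler_dot_nrm.
rewrite [X in _ --> X](_ : _ = 0 * 0 + 0 * nrm g + nrm f * 0); last by ring.
by apply: cvgD; [apply: cvgD|]; apply: cvgM => //; exact: cvg_cst.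
Qed.

End integration.
Arguments eq_Ex {d T R mu f g}.
Arguments eq_nrm {d T R mu f g}.

Section probability_space.
Context d (T : measurableType d) (R : realType) (P : probability T R).
Implicit Types f g h : T -> R.

Lemma L1_cst c : L1 P (fun=> c).
Proof. exact: finite_measure_integrable_cst. Qed.

Lemma Ex_cst c : Ex P (fun=> c) = c.
Proof. by rewrite /Ex Rintegral_cst//= probability_setT mulr1. Qed.

Lemma L1_bounded f C : measurable_fun setT f -> (forall x, `|f x| <= C) -> L1 P f.
Proof. by move=> mf fC; apply: (L1_le mf fC); exact: L1_cst. Qed.

Lemma L2_cst c : L2 P (fun=> c).
Proof. by split; [|exact: L1_cst]. Qed.

Lemma L2_bounded f C : measurable_fun setT f -> (forall x, `|f x| <= C) -> L2 P f.
Proof.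
move=> mf fC; apply: (L2_le mf _ (L2_cst C)) => x.
by rewrite (le_trans (fC x))// ler_norm.
Qed.

Lemma L2_L1 f : L2 P f -> L1 P f.
Proof.
by move=> f2; apply: eq_L1 (L2M f2 (L2_cst 1)) => x; rewrite mulr1.
Qed.

Lemma nrm_cst c : nrm P (fun=> c) = `|c|.
Proof. by rewrite /nrm Ex_cst sqrtr_sqr. Qed.

Lemma ler_Ex_nrm f : L2 P f -> `|Ex P f| <= nrm P f.
Proof.
move=> f2; have := ler_dot_nrm f2 (L2_cst 1); rewrite nrm_cst normr1 mulr1.
by rewrite (eq_Ex (g := f))// => x; rewrite mulr1.
Qed.

Lemma ler_Ex_abs_nrm f : L2 P f -> Ex P (fun x => `|f x|) <= nrm P f.
Proof.
move=> f2; apply: le_trans (ler_norm _) _.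
by apply: le_trans (ler_Ex_nrm (L2_abs f2)) _; rewrite nrm_abs.
Qed.

Lemma Ex_center_sqr f : L2 P f ->
  Ex P (fun x => (f x - Ex P f) ^+ 2) = Ex P (fun x => f x ^+ 2) - Ex P f ^+ 2.
Proof.
move=> f2; rewrite (eq_Ex (g := fun x => f x ^+ 2 + ((- 2 * Ex P f) * f x
  + Ex P f ^+ 2))); last by move=> x; ring.
rewrite !ExD ?ExZ ?Ex_cst; first by ring.
- exact: L1_cst.
- exact: L2_L1.
- exact/L1Z/L2_L1.
- exact: L1_cst.
- exact: L2_sqr.
- by apply: L1D; [exact/L1Z/L2_L1|exact: L1_cst].
Qed.

Lemma chebyshev f (e : R) : L2 P f -> 0 < e ->
  fine (P [set x | e <= `|f x|]) <= Ex P (fun x => f x ^+ 2) / e ^+ 2.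
Proof.
move=> f2 e0; have mE := measurable_abs_ge e (L2_measurable f2).
rewrite ler_pdivlMr ?exprn_gt0// mulrC.
have -> : fine (P [set x | e <= `|f x|]) = Ex P (\1_[set x | e <= `|f x|]).
  by rewrite /Ex /Rintegral integral_indic// setIT.
have i1 : L1 P (\1_[set x | e <= `|f x|]) by exact: integrable_indic.
rewrite -ExZ//; apply: le_Ex; [exact: L1Z|exact: L2_sqr|move=> x].
rewrite indicE; have [/set_mem /= ef|_] := boolP (x \in _); last first.
  by rewrite mulr0 sqr_ge0.
by rewrite mulr1 -(real_normK (num_real (f x))) lerXn2r// nnegrE ltW.
Qed.

(** The in-probability Fatou lemma, proved on truncations: with
    |V| /\ M <= |V_k| + e off the event |V_k - V| >= e. *)
Lemma Ex_sqr_fatou_probability (V_ : nat -> T -> R) (V : T -> R) (C : R) :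
  (forall k, L2 P (V_ k)) -> measurable_fun setT V ->
  cvg_in_probability P V_ V -> 0 <= C ->
  (forall e : R, 0 < e -> \forall k \near \oo, nrm P (V_ k) <= C + e) ->
  L2 P V /\ nrm P V <= C.
Proof.
move=> V2 mV VV C0 VC.
pose F n x : R := Num.min `|V x| n%:R.
have mF n : measurable_fun setT (F n).
  by apply: measurable_minr => //; exact: measurableT_comp.
have F0 n x : 0 <= F n x by rewrite /F le_min normr_ge0 ler0n.
have Fb n x : `|F n x| <= n%:R by rewrite ger0_norm// /F ge_min lexx orbT.
have F2 n : L2 P (F n) by exact: L2_bounded (mF n) (Fb n).
(* On the exceptional event F n is at most n, and the event has small probability. *)
have H n (e : R) : 0 < e -> Ex P (fun x => F n x ^+ 2) <= (C + e) ^+ 2.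
  move=> e0; apply/ler_addgt0Pr => e' e'0.
  have e20 : 0 < e / 2 by rewrite divr_gt0.
  have e'n : 0 < e' / (n%:R ^+ 2 + 1).
    by rewrite divr_gt0// ltr_wpDl// sqr_ge0.
  have /fine_cvgP[pfin pcvg] := VV _ e20.
  have /cvgrPdist_le/(_ _ e'n) pe := pcvg.
  near \oo => k.
  have Vk : nrm P (V_ k) <= C + e / 2 by near: k; exact: VC.
  have pk : `|0 - fine (P [set w | e / 2 <= `|V_ k w - V w|])| <=
      e' / (n%:R ^+ 2 + 1) by near: k; exact: pe.
  pose A := [set w | e / 2 <= `|V_ k w - V w|].
  have mVk : measurable_fun setT (fun w => V_ k w - V w).
    exact: measurable_funB (L2_measurable (V2 k)) mV.
  have mA : measurable A by exact: measurable_abs_ge.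
  have i1 : L1 P (\1_A) by exact: integrable_indic.
  have Va2 := L2D (L2_abs (V2 k)) (L2_cst (e / 2)).
  apply: (@le_trans _ _ (Ex P (fun x => (`|V_ k x| + e / 2) ^+ 2
     + n%:R ^+ 2 * \1_A x))).
    apply: le_Ex; [exact: L2_sqr|apply: L1D;[exact: L2_sqr|exact: L1Z]|move=> x].
    rewrite indicE; have [/set_mem /= xA|/negP xA] := boolP (x \in A).
      rewrite mulr1 ler_wpDl ?sqr_ge0// lerXn2r ?nnegrE//.
      by rewrite /F ge_min lexx orbT.
    rewrite mulr0 addr0 lerXn2r ?nnegrE ?addr_ge0 ?(ltW e20)//.
    rewrite /F ge_min; apply/orP; left.
    have : `|V_ k x - V x| < e / 2.
      by rewrite ltNge; apply/negP => ?; apply: xA; exact/mem_set.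
    have := ler_normB (V_ k x) (V_ k x - V x); rewrite opprB addrCA subrr addr0.
    by lra.
  rewrite ExD; [|exact: L2_sqr|exact: L1Z].
  rewrite ExZ// -sqr_nrm; apply: lerD.
    rewrite lerXn2r ?nnegrE ?nrm_ge0 ?addr_ge0 ?(ltW e0)//.
    apply: (le_trans (nrm_tri (L2_abs (V2 k)) (L2_cst (e / 2)))).
    rewrite nrm_cst (gtr0_norm e20) nrm_abs.
    by move: Vk; lra.
  have -> : Ex P (\1_A) = fine (P A).
    by rewrite /Ex /Rintegral integral_indic// setIT.
  move: pk; rewrite -/A.
  rewrite sub0r normrN => /(le_trans (ler_norm _)).
  rewrite ler_pdivlMr ?ltr_wpDl ?sqr_ge0//.
  have : 0 <= fine (P A) by exact: fine_ge0.
  by nra.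
have HC n : Ex P (fun x => F n x ^+ 2) <= C ^+ 2.
  apply/ler_addgt0Pr => e e0.
  have d0 : 0 < Num.min 1 (e / (2 * C + 1)).
    by rewrite lt_min ltr01 divr_gt0// ltr_wpDl// mulr_ge0.
  apply: (le_trans (H n _ d0)); set dd := Num.min _ _.
  have d1 : dd <= 1 by rewrite /dd ge_min lexx.
  have : dd <= e / (2 * C + 1) by rewrite /dd ge_min lexx orbT.
  rewrite ler_pdivlMr ?ltr_wpDl ?mulr_ge0//.
  by rewrite -/dd in d0; nra.
have [||||||V1 VC2] := @Ex_fatou _ T R P (fun n x => F n x ^+ 2) (fun x => V x ^+ 2) (C ^+ 2).
- by move=> n; exact: measurable_funX.
- by move=> n x; exact: sqr_ge0.
- by move=> n; exact: L2_sqr.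
- move=> x; apply/cvgrPdist_le => e e0; near=> n.
  rewrite /F min_l; last by near: n; exact: nbhs_infty_ger.
  by rewrite real_normK ?num_real// subrr normr0 ltW.
- by move=> e e0; apply/nearW => n; rewrite (le_trans (HC n))// lerDl ltW.
- exact: measurable_funX.
split; first by split.
by rewrite -(@ler_pXn2r _ 2)// ?nnegrE ?nrm_ge0// sqr_nrm.
Unshelve. all: by end_near. Qed.

Lemma Ex_sqr_fatou (V_ : nat -> T -> R) (V : T -> R) (C : R) :
  (forall k, L2 P (V_ k)) -> measurable_fun setT V ->
  (forall x, V_ k x @[k --> \oo] --> V x) -> 0 <= C ->
  (forall e : R, 0 < e -> \forall k \near \oo, Ex P (fun x => V_ k x ^+ 2) <= C + e) ->
  L2 P V /\ Ex P (fun x => V x ^+ 2) <= C.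
Proof.
move=> V2 mV VV C0 VC.
have [||||||V1 VC2] := @Ex_fatou _ T R P (fun n x => V_ n x ^+ 2) (fun x => V x ^+ 2) C.
- by move=> n; apply: measurable_funX; exact: L2_measurable.
- by move=> n x; exact: sqr_ge0.
- by move=> n; exact: L2_sqr.
- by move=> x; apply: cvgM; exact: VV.
- exact: VC.
- exact: measurable_funX.
by split.
Qed.

End probability_space.

(** * Stein's equation for the centred normal law *)

Section pointwise_derivatives.
Context (R : realType).
Implicit Types (f g : R -> R) (x a b : R).

Lemma is_derive1D f g x a b : is_derive x 1 f a -> is_derive x 1 g b ->
  is_derive x 1 (fun y => f y + g y) (a + b).
Proof. exact: is_deriveD. Qed.

Lemma is_derive1Z c f x a : is_derive x 1 f a ->
  is_derive x 1 (fun y => c * f y) (c * a).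
Proof. exact: is_deriveZ. Qed.

Lemma is_derive1M f g x a b : is_derive x 1 f a -> is_derive x 1 g b ->
  is_derive x 1 (fun y => f y * g y) (f x * b + g x * a).
Proof. exact: is_deriveM. Qed.

Lemma is_derive1_eq f x a b : is_derive x 1 f a -> a = b -> is_derive x 1 f b.
Proof. by move=> + <-. Qed.

Lemma is_derive1_ext f g x a : f =1 g -> is_derive x 1 f a -> is_derive x 1 g a.
Proof. by move=> /funext ->. Qed.

Lemma is_derive1_cont f x a : is_derive x 1 f a -> {for x, continuous f}.
Proof. by case=> df _; exact/differentiable_continuous/derivable1_diffP. Qed.

Lemma is_derive_expR_sqr a x :
  is_derive x 1 (fun y : R => expR (a * y ^+ 2)) (2 * a * x * expR (a * x ^+ 2)).
Proof.
have H3 := is_derive1Z a (is_derive1M (is_derive_id x 1) (is_derive_id x 1)).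
have H4 := @is_derive1_comp R expR (fun y => a * (y * y)) x _ _ (is_derive_expR (a * (x * x))) H3.
by apply: (is_derive1_eq H4); rewrite expr2; ring.
Qed.

End pointwise_derivatives.

Section normal_density.
Context (R : realType) (s : R).
Hypothesis s0 : 0 < s.
Let p : R -> R := normal_pdf 0 s.

Let E (x : R) : R := expR (x ^+ 2 / (s ^+ 2 *+ 2)).

Let E_gt0 x : 0 < E x. Proof. exact: expR_gt0. Qed.

Let pE x : p x = normal_peak s * (E x)^-1.
Proof.
by rewrite /p normal_pdfE ?gt_eqF// /normal_fun subr0 mulNr expRN.
Qed.

Let peak_gt0 : 0 < normal_peak s. Proof. by rewrite normal_peak_gt0// gt_eqF. Qed.

Let p_gt0 x : 0 < p x. Proof. by rewrite pE mulr_gt0// invr_gt0. Qed.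

Let is_derive_p (x : R) : is_derive x 1 p (- x / s ^+ 2 * p x).
Proof.
have H := is_derive1Z (normal_peak s) (is_derive_expR_sqr (- (s ^+ 2 *+ 2)^-1) x).
have pE' y : p y = normal_peak s * expR (- (s ^+ 2 *+ 2)^-1 * y ^+ 2).
  by rewrite pE /E -expRN; congr (_ * expR _); rewrite mulNr [in RHS]mulrC.
apply: (@is_derive1_ext _ (fun y => normal_peak s * expR (- (s ^+ 2 *+ 2)^-1 * y ^+ 2))).
  by move=> y; rewrite pE'.
by apply: (is_derive1_eq H); rewrite pE'; field; rewrite gt_eqF.
Qed.

Let p_opp x : p (- x) = p x. Proof. by rewrite !pE /E sqrrN. Qed.

Let p_cvg0 : p n%:R @[n --> \oo] --> (0 : R).
Proof.
pose c := Num.min 1 ((s ^+ 2 *+ 2)^-1).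
have c0 : 0 < c by rewrite lt_min ltr01 invr_gt0 pmulrn_lgt0 ?exprn_gt0.
apply: (@cvg_norm_le _ _ _ _ _ (fun n => normal_peak s / c * harmonic n)).
  move=> n; rewrite subr0 gtr0_norm// pE -[leRHS]mulrA ler_wpM2l ?(ltW peak_gt0)//.
  rewrite /harmonic /= -invfM lef_pV2 ?posrE ?mulr_gt0//.
  apply: le_trans (expR_ge1Dx _); rewrite -natr1 mulrDr mulr1 addrC; apply: lerD.
    by rewrite /c ge_min lexx.
  rewrite mulrC; apply: ler_pM => //; first exact: ltW.
    by rewrite -natrX ler_nat; case: n => // n; rewrite expnS expn1 leq_pmulr.
  by rewrite /c ge_min lexx orbT.
rewrite [X in _ --> X](_ : _ = normal_peak s / c * 0); last by rewrite mulr0.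
by apply: cvgM; [exact: cvg_cst|exact: cvg_harmonic].
Qed.

(** The maximum principle behind all the bounds below: where r is bounded by M
    and x > 0, the functions t |-> M p(t) / x +- q(t) p(t) are nonincreasing on
    [x, +oo[ and vanish at infinity, hence are nonnegative at x. *)
Let stein_bound_pos (q dq r : R -> R) (M x : R) :
  (forall y : R, is_derive y 1 q (dq y)) ->
  (forall y, s ^+ 2 * dq y - y * q y = r y) -> (forall y, `|r y| <= M) ->
  q n%:R * p n%:R @[n --> \oo] --> (0 : R) -> 0 < x -> `|x * q x| <= M.
Proof.
move=> dqE qr rM qp x0.
have M0 : 0 <= M by apply: le_trans (rM 0); exact: normr_ge0.
suff H (b : R) : `|b| <= 1 -> - (b * (x * q x)) <= M.
  rewrite ler_norml -[X in X <= M]opprK -mulN1r -(opprK (_ * _)) !opprK.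
  have := H 1; have := H (-1); rewrite normrN1 normr1 lexx => /(_ isT) h1 /(_ isT) h2.
  by apply/andP; split; lra.
move=> b1.
pose v (t : R) := M / x * p t + b * (q t * p t).
pose dv (t : R) := M / x * (- t / s ^+ 2 * p t) + b * (r t * p t / s ^+ 2).
have vE (t : R) : is_derive t 1 v (dv t).
  have H := is_derive1D (is_derive1Z (M / x) (is_derive_p t))
    (is_derive1Z b (is_derive1M (dqE t) (is_derive_p t))).
  apply: (is_derive1_eq H); rewrite /dv -(qr t).
  by field; rewrite (gt_eqF s0) (gt_eqF x0).
have dv0 t : x <= t -> dv t <= 0.
  move=> xt; have t0 : 0 < t by rewrite (lt_le_trans x0).
  have -> : dv t = p t / s ^+ 2 * (- (M * (t / x)) + b * r t).
    by rewrite /dv; field; rewrite (gt_eqF s0) (gt_eqF x0).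
  rewrite mulr_ge0_le0// ?divr_ge0 ?(ltW (p_gt0 _)) ?sqr_ge0//.
  have : M <= M * (t / x) by rewrite ler_peMr// ler_pdivlMr// mul1r.
  have : b * r t <= M.
    rewrite (le_trans (ler_norm _))// normrM (le_trans _ (rM t))//.
    by rewrite ler_piMl.
  by lra.
have cv : continuous v.
  by move=> t; exact: is_derive1_cont (vE t).
have vx n : x <= n%:R -> v n%:R <= v x.
  move=> xn; apply: (@ler0_derive1_nincry _ v x) => //.
  - move=> y; rewrite in_itv/= andbT => /ltW xy.
    by rewrite derive1E; have := vE y => /@derive_val ->; exact: dv0.
  - exact: continuous_subspaceT.
have v0 : v n%:R @[n --> \oo] --> (0 : R).
  rewrite [X in _ --> X](_ : _ = M / x * 0 + b * 0); last by ring.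
  apply: cvgD; apply: cvgM => //; exact: cvg_cst.
have : 0 <= v x.
  rewrite -(cvg_lim _ v0)//; apply: limr_le; first exact: cvgP v0.
  by near=> n; apply: vx; near: n; exact: nbhs_infty_ger.
have -> : v x = p x / x * (M + b * (x * q x)).
  by rewrite /v; field; rewrite gt_eqF.
by rewrite pmulr_rge0 ?divr_gt0//; lra.
Unshelve. all: by end_near. Qed.

Lemma stein_bound (q dq r : R -> R) (M : R) :
  (forall y : R, is_derive y 1 q (dq y)) ->
  (forall y, s ^+ 2 * dq y - y * q y = r y) -> (forall y, `|r y| <= M) ->
  q n%:R * p n%:R @[n --> \oo] --> (0 : R) ->
  q (- n%:R) * p n%:R @[n --> \oo] --> (0 : R) -> forall x, `|x * q x| <= M.
Proof.
move=> dqE qr rM qp qpN x.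
have M0 : 0 <= M by apply: le_trans (rM 0); exact: normr_ge0.
have [x0|x0|->] := ltgtP x 0; last by rewrite mul0r normr0.
  have := @stein_bound_pos (fun y => - q (- y)) (fun y => dq (- y))
    (fun y => r (- y)) M (- x).
  rewrite opprK mulrNN; apply.
  - move=> y.
    have H := is_derive1Z (-1) (is_derive1_comp (dqE (- y)) (is_deriveNid y 1)).
    apply: (@is_derive1_ext _ (fun y => -1 * (q \o -%R) y)) => [z|].
      by rewrite mulN1r.
    by apply: (is_derive1_eq H); ring.
  - by move=> y; rewrite -qr; ring.
  - by move=> y.
  - rewrite -[X in _ --> X]oppr0; under eq_fun do rewrite mulNr.
    exact: cvgN.
  - by rewrite oppr_gt0.
exact: (stein_bound_pos dqE qr rM qp).
Qed.

(** The normal law is given by its density, so the expectation is computed by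
    changing variables with the Radon-Nikodym derivative. *)
Lemma integral_normal_prob (h : R -> R) (C : R) : measurable_fun setT h ->
  (forall x, `|h x| <= C) ->
  Ex (normal_prob 0 s) h = Ex lebesgue_measure (fun x => h x * p x).
Proof.
move=> mh hC; pose N : probability (measurableTypeR R) R := normal_prob 0 s.
have hi : L1 N h by exact: (@L1_bounded _ (measurableTypeR R) R N h C mh hC).
have /= := Radon_Nikodym_change_of_variables (normal_prob_dominates 0 s)
  measurableT hi.
rewrite /Ex /Rintegral => <-; congr fine.
have mp : measurable_fun setT (fun x => (p x)%:E).
  by apply/measurable_EFinP; exact: measurable_normal_pdf.
apply: ae_eq_integral => //.
- apply: emeasurable_funM; first exact/measurable_EFinP.
  by apply: measurable_int; apply: Radon_Nikodym_integrable; exact: normal_prob_dominates.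
- by apply/measurable_EFinP; apply: measurable_funM => //; exact: measurable_normal_pdf.
have : ae_eq lebesgue_measure setT
    (Radon_Nikodym (charge_of_finite_measure N) lebesgue_measure) (fun x => (p x)%:E).
  apply: integral_ae_eq => //.
    by apply: Radon_Nikodym_integrable; exact: normal_prob_dominates.
  move=> A _ mA; rewrite -Radon_Nikodym_integral//; exact: normal_prob_dominates.
by apply: filterS => x /= + _ => /(_ I) ->.
Qed.

Lemma ler_norm_Ex_normal (h : R -> R) (C : R) : measurable_fun setT h ->
  (forall x, `|h x| <= C) -> `|Ex (normal_prob 0 s) h| <= C.
Proof.
move=> mh hC; pose N : probability (measurableTypeR R) R := normal_prob 0 s.
have hi := @L1_bounded _ (measurableTypeR R) R N h C mh hC.
rewrite (le_trans (ler_norm_Ex hi))//.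
have := le_Ex (L1_abs hi) (L1_cst N C) hC.
by rewrite (Ex_cst N).
Qed.

(** The antiderivative of (h - E h(Z)) p vanishes at both ends of the line
    precisely because E h(Z) has been subtracted, so that [stein_bound] applies
    to its quotient by p, and then a second time to the derivative. *)
Lemma stein_solution (h dh : R -> R) (C : R) :
  (forall x : R, is_derive x 1 h (dh x)) ->
  (forall x, `|h x| <= C) -> (forall x, `|dh x| <= C) ->
  exists f df ddf : R -> R, exists K : R,
    [/\ forall x : R, is_derive x 1 f (df x), forall x : R, is_derive x 1 df (ddf x),
        forall x, [/\ `|f x| <= K, `|df x| <= K & `|ddf x| <= K] &
        forall x, s ^+ 2 * df x - x * f x = h x - Ex (normal_prob 0 s) h].
Proof.
move=> hE hC dhC; pose c := Ex (normal_prob 0 s) h.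
have ch : continuous h by move=> x; exact: is_derive1_cont (hE x).
have mh : measurable_fun setT h by exact: continuous_measurable_fun.
have mp : measurable_fun setT p by exact: measurable_normal_pdf.
have cp : continuous p by apply: continuous_normal_pdf; rewrite gt_eqF.
have C0 : 0 <= C by apply: le_trans (hC 0); exact: normr_ge0.
have cC : `|c| <= C by exact: ler_norm_Ex_normal.
pose leb := @lebesgue_measure R.
have p1 : L1 leb p by exact: integrable_normal_pdf.
(* The integrand of the classical solution, f = F / p with F' = u up to a constant factor. *)
pose u x := (h x - c) * p x.
have hp1 : L1 leb (fun x => h x * p x).
  apply: (L1_le _ _ (L1Z C p1)); first exact: measurable_funM.
  by move=> x; rewrite normrM (gtr0_norm (p_gt0 x)) ler_pM2r.
have u1 : L1 leb u.
  by apply: (eq_L1 _ (L1B hp1 (L1Z c p1))) => x; rewrite /u mulrBl.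
have u0 : Ex leb u = 0.
  rewrite (@eq_Ex _ _ R leb u (fun x => h x * p x - c * p x)); last first.
    by move=> x; rewrite /u mulrBl.
  rewrite ExB//; last exact: L1Z.
  rewrite ExZ// -(integral_normal_prob mh hC) -/c.
  have -> : Ex leb p = 1.
    by rewrite /Ex /Rintegral /p integral_normal_pdf.
  by rewrite mulr1 subrr.
have cu : continuous u.
  move=> x; apply: cvgM; last exact: cp.
  by apply: cvgB; [exact: ch|exact: cvg_cst].
pose F x := \int[leb]_(t in `]-oo, x]) u t.
have FE (x : R) : is_derive x 1 F (u x).
  have [|||dF dFE] := @continuous_FTC1 R u -oo%O x (x + 1) _ _ _ (cu x).
  - by rewrite ltrDl.
  - exact: (integrableS measurableT _ _ u1).
  - by rewrite ltNyr.
  by apply: DeriveDef; [exact: dF|rewrite -derive1E; exact: dFE].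
have Fpatch x : F x = Ex leb (u \_ `]-oo, x]) by rewrite /F Rintegral_mkcond.
have mpatch x : measurable_fun setT (u \_ `]-oo, x]).
  by apply/measurable_restrict => //; exact: measurable_funTS (L1_measurable u1).
have dpatch x y : `|(u \_ `]-oo, x]) y| <= `|u y|.
  by rewrite patchE; case: ifP => // _; rewrite normr0.
have Fpos : F n%:R @[n --> \oo] --> (0 : R).
  rewrite -u0; under eq_fun do rewrite Fpatch.
  have pc y : (u \_ `]-oo, n%:R]) y @[n --> \oo] --> u y.
    apply/cvgrPdist_le => e e0; near=> n.
    rewrite patchE mem_set ?subrr ?normr0 ?ltW//=.
    by rewrite in_itv/=; near: n; exact: nbhs_infty_ger.
  have [_] := @Ex_dominated _ _ R leb (fun n => u \_ `]-oo, n%:R]) u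
    (fun y => `|u y|) (fun n => mpatch n%:R) (L1_measurable u1) pc
    (L1_abs u1) (fun n => dpatch n%:R).
  exact.
have Fneg : F (- n%:R) @[n --> \oo] --> (0 : R).
  rewrite -(Ex0 leb); under eq_fun do rewrite Fpatch.
  have pc y : (u \_ `]-oo, - n%:R]) y @[n --> \oo] --> (0 : R).
    apply/cvgrPdist_le => e e0; near=> n.
    rewrite patchE ifF ?subrr ?normr0 ?ltW//=.
    apply/negbTE; rewrite notin_setE /= in_itv/=; apply/negP.
    by rewrite -ltNge ltrNl; near: n; exact: nbhs_infty_gtr.
  have [_] := @Ex_dominated _ _ R leb (fun n => u \_ `]-oo, - n%:R]) (fun=> 0)
    (fun y => `|u y|) (fun n => mpatch (- n%:R)) (measurable_cst _) pc
    (L1_abs u1) (fun n => dpatch (- n%:R)).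
  exact.
(* k = 1 / (s^2 p), written as an exponential so that it can be differentiated. *)
pose k (x : R) := (s ^+ 2 * normal_peak s)^-1 * expR ((s ^+ 2 *+ 2)^-1 * x ^+ 2).
have kE (x : R) : is_derive x 1 k (x / s ^+ 2 * k x).
  apply: (is_derive1_eq (is_derive1Z _ (is_derive_expR_sqr _ x))).
  by rewrite /k; field; rewrite !gt_eqF.
have kp x : k x * p x = (s ^+ 2)^-1.
  rewrite /k pE /E (mulrC (x ^+ 2)); field.
  by rewrite !gt_eqF ?expR_gt0.
pose f x := F x * k x.
pose df x := (h x - c + x * f x) / s ^+ 2.
have fE (x : R) : is_derive x 1 f (df x).
  apply: (is_derive1_eq (is_derive1M (FE x) (kE x))).
  have -> : k x * u x = (h x - c) * (k x * p x) by rewrite /u; ring.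
  by rewrite kp /df /f; ring.
have stein x : s ^+ 2 * df x - x * f x = h x - c.
  by rewrite /df mulrC divfK ?addrK// expf_neq0// gt_eqF.
have hc x : `|h x - c| <= 2 * C.
  by rewrite (le_trans (ler_normB _ _))//; have := hC x; lra.
have fp0 x : f x * p x = F x * (s ^+ 2)^-1 by rewrite /f -mulrA kp.
have xf x : `|x * f x| <= 2 * C.
  apply: (stein_bound fE stein hc).
    under eq_fun do rewrite fp0; rewrite -(mul0r (s ^+ 2)^-1).
    exact: (cvgM Fpos (cvg_cst _)).
  under eq_fun do rewrite -p_opp fp0; rewrite -(mul0r (s ^+ 2)^-1).
  exact: (cvgM Fneg (cvg_cst _)).
have s20 : 0 < s ^+ 2 by rewrite exprn_gt0.
have dfB x : `|df x| <= 4 * C / s ^+ 2.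
  rewrite /df normrM (gtr0_norm (x := _^-1)) ?invr_gt0// ler_pM2r ?invr_gt0//.
  by rewrite (le_trans (ler_normD _ _))//; have := hc x; have := xf x; lra.
(* Away from 0 the bound on x f(x) suffices; near 0 the mean value theorem compares f x with f 1. *)
have fB x : `|f x| <= 2 * C + 2 * (4 * C / s ^+ 2).
  have B0 : 0 <= 4 * C / s ^+ 2 by apply: le_trans (dfB 0); exact: normr_ge0.
  have [x1|x1] := leP 1 `|x|.
    apply: (@le_trans _ _ (2 * C)); last by rewrite lerDl mulr_ge0.
    apply: le_trans (xf x); by rewrite [leRHS]normrM ler_peMl.
  have [x1' x1''] : - 1 < x /\ x < 1 by move: x1; rewrite ltr_norml => /andP[].
  have cf : {within `[x, 1], continuous f}.
    by apply: continuous_subspaceT => y; exact: is_derive1_cont (fE y).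
  have [y _ fy] := @MVT _ f df x 1 x1'' (fun y _ => fE y) cf.
  have : `|f 1 - f x| <= 2 * (4 * C / s ^+ 2).
    rewrite fy normrM mulrC; apply: ler_pM => //.
    by rewrite ger0_norm; lra.
  have := xf 1; rewrite mul1r.
  by have := ler_normB (f 1) (f 1 - f x); rewrite opprB addrCA subrr addr0; lra.
pose ddf x := (dh x + (f x + x * df x)) / s ^+ 2.
have dfE (x : R) : is_derive x 1 df (ddf x).
  have H := is_derive1Z (s ^+ 2)^-1 (is_derive1D (hE x)
     (is_derive1D (is_derive_cst (- c) x 1) (is_derive1M (is_derive_id x 1) (fE x)))).
  apply: (@is_derive1_ext _ (fun y => (s ^+ 2)^-1 * (h y + (- c + y * f y)))).
    by move=> y; rewrite /df mulrC addrA.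
  by apply: (is_derive1_eq H); rewrite /ddf; ring.
have B0 : 0 <= 4 * C / s ^+ 2 by apply: le_trans (dfB 0); exact: normr_ge0.
have dfp0 (g : nat -> R) : df (g n) * p n%:R @[n --> \oo] --> (0 : R).
  apply: (@cvg_norm_le _ _ _ _ _ (fun n => 4 * C / s ^+ 2 * p n%:R)) => [n|].
    by rewrite subr0 normrM (gtr0_norm (p_gt0 _)) ler_pM2r.
  rewrite -(mulr0 (4 * C / s ^+ 2)).
  by apply: cvgM; [exact: cvg_cst|exact: p_cvg0].
pose M := C + (2 * C + 2 * (4 * C / s ^+ 2)).
(* The derivative df solves the same equation with right-hand side dh + f. *)
have xdf x : `|x * df x| <= M.
  apply: (@stein_bound df ddf (fun x => dh x + f x) M dfE) => //.
  - by move=> y; rewrite /ddf mulrC divfK ?expf_neq0 ?gt_eqF//; ring.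
  - move=> y; rewrite (le_trans (ler_normD _ _))// /M.
    by have := dhC y; have := fB y; lra.
have ddfB x : `|ddf x| <= 2 * M / s ^+ 2.
  rewrite /ddf normrM (gtr0_norm (x := _^-1)) ?invr_gt0// ler_pM2r ?invr_gt0//.
  rewrite (le_trans (ler_normD _ _))//.
  have := ler_normD (f x) (x * df x); have := dhC x; have := fB x; have := xdf x.
  by rewrite /M; lra.
exists f, df, ddf, (M + (4 * C / s ^+ 2 + 2 * M / s ^+ 2)); split => // x.
have M0 : 0 <= M by apply: le_trans (xdf 0); exact: normr_ge0.
have M20 : 0 <= 2 * M / s ^+ 2 by apply: le_trans (ddfB 0); exact: normr_ge0.
have fM : `|f x| <= M by apply: le_trans (fB x) _; rewrite /M; lra.
by have := dfB x; have := ddfB x; split; lra.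
Unshelve. all: by end_near. Qed.

End normal_density.

Section stein_tests.
Context (R : realType).
Implicit Types (f df g h dh : R -> R) (K x y : R).

Lemma mean_value f df K : (forall x : R, is_derive x 1 f (df x)) ->
  (forall x, `|df x| <= K) -> forall x y, `|f x - f y| <= K * `|x - y|.
Proof.
move=> fE dfK.
have H x y : x < y -> `|f y - f x| <= K * `|y - x|.
  move=> xy.
  have cf : {within `[x, y], continuous f}.
    by apply: continuous_subspaceT => z; exact: is_derive1_cont (fE z).
  have [z _ ->] := @MVT _ f df x y xy (fun y _ => fE y) cf.
  by rewrite normrM ler_wpM2r.
move=> x y; have [xy|xy|->] := ltgtP x y; last by rewrite !subrr normr0 mulr0.
  by rewrite distrC (distrC x); exact: H.
exact: H.
Qed.

(** Solutions of Stein's equation for smooth right-hand sides are of this kind.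
    One constant serves all bounds, including the Lipschitz bound on the derivative. *)
Definition stein_test f df K :=
  [/\ forall x : R, is_derive x 1 f (df x), forall x, `|f x| <= K,
      forall x, `|df x| <= K & forall x y, `|df x - df y| <= K * `|x - y|].

Lemma stein_test_ge0 f df K : stein_test f df K -> 0 <= K.
Proof. by case=> _ fK _ _; apply: le_trans (fK 0); exact: normr_ge0. Qed.

Lemma stein_test_lipschitz f df K x y : stein_test f df K ->
  `|f x - f y| <= K * `|x - y|.
Proof. by case=> fE _ dfK _; exact: mean_value fE dfK x y. Qed.

Lemma stein_test_taylor f df K x y : stein_test f df K ->
  `|f x - f y - (x - y) * df y| <= K * (x - y) ^+ 2.
Proof.
move=> /[dup] /stein_test_ge0 K0 [fE _ _ dfl].
have cf a b : {within `[a, b], continuous f}.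
  by apply: continuous_subspaceT => z; exact: is_derive1_cont (fE z).
have H z : `|z - y| <= `|x - y| -> f x - f y = df z * (x - y) ->
    `|f x - f y - (x - y) * df y| <= K * (x - y) ^+ 2.
  move=> zy ->; rewrite mulrC -mulrBr normrM -(real_normK (num_real (x - y))).
  rewrite mulrC expr2 mulrA ler_wpM2r// (le_trans (dfl _ _))// ler_wpM2l//.
have [xy|yx|->] := ltgtP x y; last by rewrite !subrr mul0r subr0 normr0 expr0n mulr0.
  have [z + fz] := @MVT _ f df x y xy (fun y _ => fE y) (cf x y).
  rewrite in_itv/= => /andP[xz zy]; apply: (H z).
    by rewrite !ltr0_norm ?subr_lt0// lerN2 lerD2r ltW.
  by rewrite -opprB fz -mulrN opprB.
have [z + fz] := @MVT _ f df y x yx (fun y _ => fE y) (cf y x).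
rewrite in_itv/= => /andP[yz zx]; apply: (H z) => //.
by rewrite !gtr0_norm ?subr_gt0// lerD2r ltW.
Qed.

Lemma lipschitz_continuous f K : 0 <= K ->
  (forall x y, `|f x - f y| <= K * `|x - y|) -> continuous f.
Proof.
move=> K0 fl x; apply/cvgrPdist_le => e e0.
have K1 : 0 < K + 1 by rewrite ltr_wpDl.
apply/nbhs_ballP; exists (e / (K + 1)) => /=; first by rewrite divr_gt0.
move=> y; rewrite /ball/= => /ltW; rewrite ler_pdivlMr// mulrC => xy.
rewrite (le_trans (fl _ _))// (le_trans _ xy)//.
by rewrite ler_wpM2r// lerDl.
Qed.

Lemma stein_test_measurable f df K : stein_test f df K ->
  measurable_fun setT f /\ measurable_fun setT df.
Proof.
move=> /[dup] /stein_test_ge0 K0 [fE _ _ dfl]; split.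
  by apply: continuous_measurable_fun => x; exact: is_derive1_cont (fE x).
apply: continuous_measurable_fun => x.
exact: lipschitz_continuous K0 dfl x.
Qed.

(** Uniform continuity near a compact interval; the second point may leave it. *)
Lemma continuous_uniform g (A e : R) : continuous g -> 0 < e ->
  exists2 r : R, 0 < r <= 1 &
    forall x y, `|x| <= A -> `|x - y| < r -> `|g x - g y| <= e.
Proof.
move=> cg e0.
have := @segment_compact R (- A) A; rewrite compact_near_coveringP.
move=> /(_ R (0:R)^'+ (fun r x => forall y, `|x - y| < r -> `|g x - g y| <= e)).
move=> /(_ _)[].
  move=> x _; have e20 : 0 < e / 2 by rewrite divr_gt0.
  have /cvgrPdist_le/(_ _ e20)/nbhs_ballP[r /= r0 xr] := cg x.
  have r20 : 0 < r / 2 by rewrite divr_gt0.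
  exists (ball x (r / 2), `]0, (r / 2)[%classic) => /=.
    split; first exact: nbhsx_ballx.
    near=> s; rewrite /= in_itv/=; apply/andP; split.
      by near: s; exact: nbhs_right_gt.
    by near: s; exact: nbhs_right_lt.
  move=> [z s] /= [xz]; rewrite in_itv/= => /andP[s0 sr] y zy.
  have h1 : `|g x - g z| <= e / 2.
    by apply: xr; move: xz; rewrite /ball/=; lra.
  have h2 : `|g x - g y| <= e / 2.
    apply: xr; rewrite /ball/= (splitr r).
    have -> : x - y = (x - z) + (z - y) by ring.
    by rewrite (le_lt_trans (ler_normD _ _))// ltrD// (lt_trans zy).
  have -> : g z - g y = - (g x - g z) + (g x - g y) by ring.
  by rewrite (le_trans (ler_normD _ _))// normrN (splitr e) lerD.
move=> r /= r0 H.
exists (Num.min (r / 2) 1).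
  by rewrite lt_min ltr01 divr_gt0//= ge_min lexx orbT.
move=> x y xA xy; apply: (H (r / 2)) => //=.
- by rewrite sub0r normrN gtr0_norm ?divr_gt0// ltr_pdivrMr// ltr_pMr// ltr1n.
- by rewrite divr_gt0.
- by rewrite in_itv/= -ler_norml.
- by rewrite (lt_le_trans xy)// ge_min lexx.
Unshelve. all: by end_near. Qed.

(** Moving averages of a cut-off of g: differentiable by the fundamental theorem
    of calculus and close to g on [-A, A] by uniform continuity. *)
Lemma smooth_approximation g (C A e : R) : continuous g ->
  (forall x, `|g x| <= C) -> 0 < e -> 0 <= A ->
  exists h dh, exists K, [/\ forall x : R, is_derive x 1 h (dh x),
    forall x, `|dh x| <= K, forall x, `|h x| <= C &
    forall x, `|x| <= A -> `|h x - g x| <= e].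
Proof.
move=> cg gC e0 A0.
have C0 : 0 <= C by apply: le_trans (gC 0); exact: normr_ge0.
(* A continuous cut-off that is 1 on [-(A + 1), A + 1], a margin of 1 for the averaging window. *)
pose tau x : R := Num.max 0 (Num.min 1 (A + 2 - `|x|)).
have tau0 x : 0 <= tau x by rewrite /tau le_max lexx.
have tau1 x : tau x <= 1 by rewrite /tau ge_max ler01 ge_min lexx.
have tauA x : `|x| <= A + 1 -> tau x = 1.
  move=> xA; rewrite /tau min_l; last lra.
  by rewrite max_r.
have taua x : A + 2 < `|x| -> tau x = 0.
  move=> xA; rewrite /tau max_l// ge_min; apply/orP; right; lra.
have ctau : continuous tau.
  apply: (@lipschitz_continuous _ 1) => // x y; rewrite mul1r.
  have : `| `|x| - `|y| | <= `|x - y| by exact: ler_dist_dist.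
  rewrite /tau; move: (`|x|) (`|y|) => a b ab; apply: le_trans ab.
  rewrite /Num.max /Num.min; do 4 case: ifPn; rewrite -?leNgt => *;
    rewrite ler_norml; apply/andP; split;
    have := ler_norm (a - b); have := ler_norm (b - a); rewrite (distrC b a); lra.
pose g0 x := g x * tau x.
have g0C x : `|g0 x| <= C.
  by rewrite normrM (ger0_norm (tau0 x)) (le_trans _ (gC x))// ler_piMr.
have cg0 : continuous g0 by move=> x; apply: cvgM; [exact: cg|exact: ctau].
pose leb := @lebesgue_measure R.
have g01 : L1 leb g0.
  apply: (@L1_le _ _ R leb g0 (fun x => C * \1_(`[- (A + 2), A + 2]) x)).
  - exact: continuous_measurable_fun.
  - move=> x; rewrite indicE; have [_|/negP xA] := boolP (x \in _).
      by rewrite mulr1.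
    rewrite mulr0 /g0 taua ?mulr0 ?normr0// ltNge; apply/negP.
    by rewrite ler_norml => xA'; apply: xA; rewrite inE/= in_itv.
  - by apply: L1Z; exact: integrable_indic_itv.
pose G x := \int[leb]_(t in `]-oo, x]) g0 t.
have GE (x : R) : is_derive x 1 G (g0 x).
  have [|||dF dFE] := @continuous_FTC1 R g0 -oo%O x (x + 1) _ _ _ (cg0 x).
  - by rewrite ltrDl.
  - exact: (integrableS measurableT _ _ g01).
  - by rewrite ltNyr.
  by apply: DeriveDef; [exact: dF|rewrite -derive1E; exact: dFE].
have [r /andP[r0 r1] gr] := @continuous_uniform g A e cg e0.
pose h x := r^-1 * (G (x + r) + (-1) * G x).
pose dh x := r^-1 * (g0 (x + r) + (-1) * g0 x).
have hE (x : R) : is_derive x 1 h (dh x).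
  have H := @is_derive1_comp R G (fun y => y + r) x _ _ (GE (x + r))
     (is_derive1D (is_derive_id x 1) (is_derive_cst r x 1)).
  have H' := is_derive1Z r^-1 (is_derive1D H (is_derive1Z (-1) (GE x))).
  by apply: (is_derive1_eq H'); rewrite /dh addr0 mulr1.
have hg x : exists2 z, x < z < x + r & h x = g0 z.
  have cG : {within `[x, x + r], continuous G}.
    by apply: continuous_subspaceT => z; exact: is_derive1_cont (GE z).
  have xr : x < x + r by rewrite ltrDl.
  have [z + Gz] := @MVT _ G g0 x (x + r) xr (fun y _ => GE y) cG.
  rewrite in_itv/= => xz; exists z => //.
  rewrite /h mulN1r Gz addrAC subrr add0r mulrC mulfK// gt_eqF//.
exists h, dh, (r^-1 * (2 * C)); split => //.
- move=> x; rewrite normrM (gtr0_norm (x := r^-1)) ?invr_gt0// ler_pM2l ?invr_gt0//.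
  rewrite mulN1r (le_trans (ler_normB _ _))//.
  by have := g0C x; have := g0C (x + r); lra.
- by move=> x; have [z _ ->] := hg x.
- move=> x xA; have [z /andP[xz zr] ->] := hg x.
  rewrite /g0 tauA ?mulr1; first by rewrite distrC gr// ltr0_norm; lra.
  by move: xA; rewrite !ler_norml => /andP[? ?]; apply/andP; split; lra.
Qed.

End stein_tests.

(** Both functions are bounded by C, so they differ by 2 C at most on the event
    where W leaves [-A, A]. *)
Lemma Ex_close_on d (T : measurableType d) (R : realType) (N : probability T R)
    (W : T -> R) (g h : R -> R) (C A e : R) :
  measurable_fun setT W -> measurable_fun setT g -> measurable_fun setT h ->
  (forall x, `|g x| <= C) -> (forall x, `|h x| <= C) -> 0 <= e ->
  (forall x, `|x| <= A -> `|h x - g x| <= e) ->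
  `|Ex N (fun w => h (W w)) - Ex N (fun w => g (W w))| <=
  e + 2 * C * fine (N [set w | A < `|W w|]).
Proof.
move=> mW mg mh gC hC e0 hg.
have mhW : measurable_fun setT (fun w => h (W w)) by exact: measurableT_comp.
have mgW : measurable_fun setT (fun w => g (W w)) by exact: measurableT_comp.
have h1 : L1 N (fun w => h (W w)) by exact: L1_bounded mhW (fun w => hC _).
have g1 : L1 N (fun w => g (W w)) by exact: L1_bounded mgW (fun w => gC _).
have C0 : 0 <= C by apply: le_trans (gC 0); exact: normr_ge0.
set B := [set w | A < `|W w|].
have mB : measurable B by exact: measurable_abs_gt.
have B1 : L1 N (\1_B) by exact: integrable_indic.
rewrite -ExB//; apply: le_trans (ler_norm_Ex (L1B h1 g1)) _.
have -> : e + 2 * C * fine (N B) = Ex N (fun w => e + 2 * C * \1_B w).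
  rewrite ExD; [|exact: L1_cst|exact: L1Z].
  by rewrite Ex_cst ExZ//; congr (_ + _ * _); rewrite /Ex /Rintegral integral_indic// setIT.
apply: le_Ex; [exact/L1_abs/L1B|apply: L1D; [exact: L1_cst|exact: L1Z]|move=> w].
rewrite indicE; have [wB|/negP wB] := boolP (w \in B).
  rewrite mulr1 (le_trans (ler_normB _ _))//.
  by have := gC (W w); have := hC (W w); lra.
rewrite mulr0 addr0; apply: hg; rewrite leNgt; apply/negP => wA.
by apply: wB; rewrite inE.
Qed.

Section stein_criterion.
Context d (T : measurableType d) (R : realType) (P : probability T R).

(** What Stein's method establishes about W; unlike convergence in law itself,
    it is visibly stable under small perturbations in L^2. *)
Definition stein_clt (W : nat -> T -> R) := forall f df K, stein_test f df K ->
  Ex P (fun w => W n w * f (W n w)) -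
  Ex P (fun w => W n w ^+ 2) * Ex P (fun w => df (W n w)) @[n --> \oo] --> (0 : R).

Lemma cvg_in_distributionP (W : nat -> T -> R)
    (mu : probability (measurableTypeR R) R) :
  (forall n, measurable_fun setT (W n)) ->
  (forall g, continuous g -> forall C, (forall x, `|g x| <= C) ->
    Ex P (fun w => g (W n w)) @[n --> \oo] --> Ex mu g) ->
  cvg_in_distribution P W mu.
Proof.
move=> mW H g cg [M [_ gM]].
have gC x : `|g x| <= M + 1 by apply: gM => //; rewrite ltrDl.
have mg : measurable_fun setT g by exact: continuous_measurable_fun.
have g1 n : L1 P (fun w => g (W n w)).
  by apply: (@L1_bounded _ _ _ P _ (M + 1)) => //; exact: measurableT_comp.
have g1' := @L1_bounded _ (measurableTypeR R) R mu g (M + 1) mg gC.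
rewrite EFin_Ex//.
rewrite (_ : (fun n => _) = (fun n => (Ex P (fun w => g (W n w)))%:E)).
  by apply: cvg_EFin; [exact: nearW|exact: H cg _ gC].
by apply/funext => n; rewrite unlock; exact: EFin_Ex.
Qed.

(** Stein's method turns the cancellation [stein_clt] into convergence in law:
    solve Stein's equation for a smooth approximation h of the test function. *)
Lemma stein_criterion (W : nat -> T -> R) (eta2 : R) : (forall n, L2 P (W n)) ->
  0 <= eta2 -> Ex P (fun w => W n w ^+ 2) @[n --> \oo] --> eta2 ->
  stein_clt W -> cvg_in_distribution P W (gaussian 0 eta2).
Proof.
move=> W2 eta0 Weta Wstein; apply: cvg_in_distributionP => [n|g cg C gC].
  exact: L2_measurable.
have mg : measurable_fun setT g by exact: continuous_measurable_fun.
have C0 : 0 <= C by apply: le_trans (gC 0); exact: normr_ge0.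
pose v n := Ex P (fun w => W n w ^+ 2).
have cheb n (A : R) : 0 < A -> fine (P [set w | A < `|W n w|]) <= v n / A ^+ 2.
  move=> A0; apply: le_trans (chebyshev (W2 n) A0).
  apply: fine_le; rewrite ?fin_num_measure//.
  - exact/measurable_abs_gt/L2_measurable.
  - exact/measurable_abs_ge/L2_measurable.
  - apply: le_measure; rewrite ?inE.
    + exact/measurable_abs_gt/L2_measurable.
    + exact/measurable_abs_ge/L2_measurable.
    + by move=> w /= /ltW.
(* With vanishing variance, Chebyshev's inequality alone gives convergence to the point mass. *)
rewrite /gaussian; case: eqVneq => [eta00|etan0].
  rewrite eta00 in Weta.
  have D0 : Ex [the probability (measurableTypeR R) R of
      @dirac _ (measurableTypeR R) 0 R] g = g 0.
    rewrite /Ex /Rintegral integral_dirac//=; last exact/measurable_EFinP.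
    by rewrite indicE mem_set ?mul1r.
  refine (eq_ind_r (fun l : R => Ex P (fun w => g (W n w)) @[n --> \oo] --> l) _ D0).
  apply/cvgrPdist_le => e e0; have e20 : 0 < e / 2 by rewrite divr_gt0.
  have /cvgrPdist_le/(_ _ e20)/nbhs_ballP[r /= r0 gr] := cg 0.
  have r20 : 0 < r / 2 by rewrite divr_gt0.
  have b0 : 0 < e / 2 * (r / 2) ^+ 2 / (2 * C + 1).
    by rewrite divr_gt0 ?mulr_gt0 ?exprn_gt0// ltr_wpDl ?mulr_ge0.
  have /cvgrPdist_le/(_ _ b0) Wb := Weta.
  near=> n.
  have vn : v n <= e / 2 * (r / 2) ^+ 2 / (2 * C + 1).
    have : `|0 - v n| <= e / 2 * (r / 2) ^+ 2 / (2 * C + 1) by near: n; exact: Wb.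
    by rewrite sub0r normrN; apply: le_trans; exact: ler_norm.
  rewrite -(Ex_cst P (g 0)).
  have := @Ex_close_on _ _ _ P (W n) g (fun=> g 0) C (r / 2) (e / 2) (L2_measurable (W2 n))
    mg (measurable_cst _) gC (fun=> gC 0) (ltW e20) _.
  move=> /(_ _)/le_trans; apply.
    move=> x xr; apply: gr; rewrite /ball/= sub0r normrN (le_lt_trans xr)//.
    by rewrite ltr_pdivrMr// ltr_pMr// ltr1n.
  rewrite [leRHS](splitr e) lerD2l.
  apply: (@le_trans _ _ (2 * C * (v n / (r / 2) ^+ 2))).
    by rewrite ler_wpM2l ?mulr_ge0//; exact: cheb.
  rewrite mulrA ler_pdivrMr ?exprn_gt0//.
  have v0 : 0 <= v n by apply: Ex_ge0 => x; exact: sqr_ge0.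
  move: vn; rewrite ler_pdivlMr; last by rewrite ltr_wpDl ?mulr_ge0.
  apply: le_trans; rewrite mulrC ler_wpM2l// lerDl//.
have etap : 0 < eta2 by rewrite lt_def etan0.
pose s := Num.sqrt eta2; have s0 : 0 < s by rewrite sqrtr_gt0.
have s2 : s ^+ 2 = eta2 by rewrite sqr_sqrtr.
pose N : probability (measurableTypeR R) R := normal_prob 0 s.
change (Ex P (fun w => g (W n w)) @[n --> \oo] --> Ex N g).
have tailN : fine (N [set x : measurableTypeR R | n%:R < `|x|]) @[n --> \oo] --> (0 : R).
  have mB n : measurable [set x : measurableTypeR R | n%:R < `|x|].
    exact: (@measurable_abs_gt _ (measurableTypeR R) R id n%:R (@measurable_id _ _ _)).
  have NE n : fine (N [set x : measurableTypeR R | n%:R < `|x|]) =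
      Ex N (\1_[set x : measurableTypeR R | n%:R < `|x|]).
    by rewrite /Ex /Rintegral integral_indic// setIT.
  under eq_fun do rewrite NE; rewrite -(Ex0 N).
  have pc x : \1_[set x : measurableTypeR R | n%:R < `|x|] x @[n --> \oo] --> (0 : R).
    apply/cvgrPdist_le => e e0; near=> n.
    rewrite indicE memNset ?subrr ?normr0 ?ltW//= => /ltW; apply/negP.
    by rewrite -ltNge; near: n; exact: nbhs_infty_gtr.
  have b1 n x : `|\1_[set x : measurableTypeR R | n%:R < `|x|] x| <= 1 :> R.
    by rewrite indicE; case: (x \in _); rewrite ?normr1 ?normr0.
  have [_] := @Ex_dominated _ (measurableTypeR R) R N
    (fun n => \1_[set x : measurableTypeR R | n%:R < `|x|]) (fun=> 0) (fun=> 1)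
    (fun n => measurable_indic (mB n)) (measurable_cst _) pc (L1_cst N 1) b1.
  exact.
have vB : \forall n \near \oo, v n <= eta2 + 1.
  have /cvgrPdist_le/(_ _ ltr01) := Weta; apply: filterS => n.
  by rewrite distrC ler_norml => /andP[_]; rewrite lerBlDl.
apply/cvgrPdist_le => e e0; have e60 : 0 < e / 6 by rewrite divr_gt0.
(* Tightness: A bounds the tails of the normal law and of all W n at once. *)
have [A [A0 AN AW]] : exists A : R, [/\ 0 < A,
    2 * C * fine (N [set x : measurableTypeR R | A < `|x|]) <= e / 6 &
    2 * C * ((eta2 + 1) / A ^+ 2) <= e / 6].
  have C1 : 0 < 2 * C + 1 by rewrite ltr_wpDl// mulr_ge0.
  have b0 : 0 < e / 6 / (2 * C + 1) by rewrite divr_gt0.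
  have /cvgrPdist_le/(_ _ b0) tN := tailN.
  near \oo => n; exists n%:R; split.
  - by near: n; exact: nbhs_infty_gtr.
  - have : `|0 - fine (N [set x : measurableTypeR R | n%:R < `|x|])| <=
        e / 6 / (2 * C + 1) by near: n; exact: tN.
    rewrite sub0r normrN => /(le_trans (ler_norm _)).
    rewrite ler_pdivlMr// mulrC; apply: le_trans.
    by rewrite ler_wpM2r ?lerDl// fine_ge0.
  - have n1 : 1 <= n%:R :> R by near: n; exact: nbhs_infty_ger.
    have n0 : 0 < n%:R :> R by rewrite (lt_le_trans ltr01).
    rewrite mulrA ler_pdivrMr ?exprn_gt0//.
    have h3 : 2 * C * (eta2 + 1) / (e / 6) <= n%:R.
      by near: n; exact: nbhs_infty_ger.
    move: h3; rewrite ler_pdivrMr// => h3; apply: (le_trans h3).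
    by rewrite mulrC ler_wpM2l ?(ltW e60)// expr2 ler_peMl// ltW.
have [h [dh [K [hE dhK hC hg]]]] := smooth_approximation cg gC e60 (ltW A0).
have hC' x : `|h x| <= C + `|K| by rewrite (le_trans (hC x))// lerDl.
have dhC' x : `|dh x| <= C + `|K|.
  by rewrite (le_trans (dhK x))// (le_trans (ler_norm K))// lerDr.
have mh : measurable_fun setT h.
  by apply: continuous_measurable_fun => x; exact: is_derive1_cont (hE x).
have [f [df [ddf [K' [fE dfE fK stein]]]]] := stein_solution s0 hE hC' dhC'.
have tf : stein_test f df K'.
  split=> //; [by move=> x; have [] := fK x|by move=> x; have [] := fK x|].
  by apply: (mean_value dfE) => x; have [] := fK x.
have [mf mdf] := stein_test_measurable tf.
have H := Wstein _ _ _ tf.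
(* Stein's equation evaluated at W n; the variance of W n replaces eta2 up to an error. *)
have Eh n : Ex P (fun w => h (W n w)) - Ex N h =
    - (Ex P (fun w => W n w * f (W n w)) - v n * Ex P (fun w => df (W n w))) +
    (eta2 - v n) * Ex P (fun w => df (W n w)).
  have df1 : L1 P (fun w => df (W n w)).
    apply: (@L1_bounded _ _ _ P _ K'); last by move=> w; have [] := fK (W n w).
    exact: measurableT_comp (L2_measurable (W2 n)).
  have f2 : L2 P (fun w => f (W n w)).
    apply: (@L2_bounded _ _ _ P _ K'); last by move=> w; have [] := fK (W n w).
    exact: measurableT_comp (L2_measurable (W2 n)).
  have h1 : L1 P (fun w => h (W n w)).
    apply: (@L1_bounded _ _ _ P _ C); last by move=> w.
    exact: measurableT_comp (L2_measurable (W2 n)).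
  rewrite -[in LHS](Ex_cst P (Ex N h)) -ExB//; last exact: L1_cst.
  rewrite (eq_Ex (g := fun w => eta2 * df (W n w) - W n w * f (W n w))); last first.
    by move=> w; rewrite -s2 stein.
  rewrite ExB; [|exact: L1Z|exact: L2M]; rewrite ExZ//; ring.
have K'0 := stein_test_ge0 tf.
have b0 : 0 < e / 6 / (K' + 1) by rewrite divr_gt0// ltr_wpDl.
have /cvgrPdist_le/(_ _ b0) Weta' := Weta.
have /cvgrPdist_le/(_ _ e60) H' := H.
near=> n.
have i1 : `|Ex P (fun w => h (W n w)) - Ex P (fun w => g (W n w))| <= e / 6 + e / 6.
  apply: le_trans (Ex_close_on P (L2_measurable (W2 n)) mg mh gC hC (ltW e60) hg) _.
  rewrite lerD2l; apply: le_trans AW; rewrite ler_wpM2l ?mulr_ge0//.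
  apply: le_trans (cheb n _ A0) _; rewrite ler_pM2r ?invr_gt0 ?exprn_gt0//.
  by near: n; exact: vB.
have i2 : `|Ex N h - Ex N g| <= e / 6 + e / 6.
  have := @Ex_close_on _ (measurableTypeR R) R N id g h C A (e / 6)
    (@measurable_id _ _ _) mg mh gC hC (ltW e60) hg.
  by move=> /le_trans; apply; rewrite lerD2l.
have i3 : `|Ex P (fun w => h (W n w)) - Ex N h| <= e / 6 + e / 6.
  rewrite Eh (le_trans (ler_normD _ _))// lerD// ?normrN.
    rewrite -[X in `|X|]opprK normrN -sub0r.
    by near: n; exact: H'.
  rewrite normrM; have ve : `|eta2 - v n| <= e / 6 / (K' + 1).
    by near: n; exact: Weta'.
  have dfK' : `|Ex P (fun w => df (W n w))| <= K'.
    have df1 : L1 P (fun w => df (W n w)).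
      apply: (@L1_bounded _ _ _ P _ K'); last by move=> w; have [] := fK (W n w).
      exact: measurableT_comp (L2_measurable (W2 n)).
    apply: le_trans (ler_norm_Ex df1) _; rewrite -(Ex_cst P K').
    apply: le_Ex; [exact: L1_abs|exact: L1_cst|].
    by move=> w; have [] := fK (W n w).
  apply: le_trans (ler_pM (normr_ge0 _) (normr_ge0 _) ve dfK') _.
  by rewrite mulrAC ler_pdivrMr ?ltr_wpDl// ler_wpM2l ?(ltW e60)// lerDl.
have -> : Ex N g - Ex P (fun w => g (W n w)) = (Ex P (fun w => h (W n w)) -
  Ex P (fun w => g (W n w))) - (Ex N h - Ex N g) -
  (Ex P (fun w => h (W n w)) - Ex N h) by ring.
rewrite (le_trans (ler_normB _ _))// (le_trans (lerD (ler_normB _ _) (lexx _)))//.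
by lra.
Unshelve. all: by end_near. Qed.

End stein_criterion.

(** * Independence *)

Section independent_pair.
Context d (T : measurableType d) (R : realType) (P : probability T R).

Definition indep_rv (U V : T -> R) := forall C D : set R,
  measurable C -> measurable D ->
  P (U @^-1` C `&` V @^-1` D) = (P (U @^-1` C) * P (V @^-1` D))%E.

(** The joint law of (U, V) agrees with the product of the marginal laws on
    rectangles, hence everywhere; then apply Fubini. *)
Lemma indep_rv_Ex (U V : T -> R) : L1 P U -> L1 P V -> indep_rv U V ->
  L1 P (fun w => U w * V w) /\ Ex P (fun w => U w * V w) = Ex P U * Ex P V.
Proof.
move=> U1 V1 UV; have mU := L1_measurable U1; have mV := L1_measurable V1.
pose U' : {mfun T >-> R} := HB.pack U (isMeasurableFun.Build _ _ _ _ U mU).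
pose V' : {mfun T >-> R} := HB.pack V (isMeasurableFun.Build _ _ _ _ V mV).
pose Z w := (U w, V w).
have mZ : measurable_fun setT Z by exact: measurable_fun_pair.
pose Z' : {mfun T >-> (R * R)%type} := HB.pack Z (isMeasurableFun.Build _ _ _ _ Z mZ).
pose m1 : probability R R := distribution P U'.
pose m2 : probability R R := distribution P V'.
pose m : probability (R * R)%type R := distribution P Z'.
have mE A : measurable A -> (m1 \x m2)%E A = m A.
  by apply: (@product_measure_unique _ _ _ _ _ m1 m2 m) => C D mC mD; exact: UV.
have mmul : measurable_fun [set: R * R] (fun z : R * R => z.1 * z.2).
  by apply: measurable_funM; [exact: measurable_fst|exact: measurable_snd].
have i1 : (\int[m1]_x `|x|%:E < +oo)%E.
  rewrite ge0_integral_distribution//; last exact/measurable_EFinP/measurable_abs.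
  by have /integrableP[] := U1.
have i2 : (\int[m2]_x `|x|%:E < +oo)%E.
  rewrite ge0_integral_distribution//; last exact/measurable_EFinP/measurable_abs.
  by have /integrableP[] := V1.
have m1i : m1.-integrable setT (EFin : R -> \bar R).
  by apply/integrableP; split => //; exact/measurable_EFinP.
have m2i : m2.-integrable setT (EFin : R -> \bar R).
  by apply/integrableP; split => //; exact/measurable_EFinP.
have iprod : ((m1 \x m2)%E).-integrable setT (fun z : R * R => (z.1 * z.2)%:E).
  apply/integrable12ltyP; first exact/measurable_EFinP.
  rewrite (eq_integral (fun x : R => `|x|%:E * \int[m2]_y `|y|%:E)%E); last first.
    move=> x _ /=; rewrite -ge0_integralZl//; last exact/measurable_EFinP/measurable_abs.
    by apply: eq_integral => y _; rewrite normrM.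
  have [c c0 ->] : exists2 c : R, 0 <= c & (\int[m2]_y `|y|%:E)%E = c%:E.
    exists (fine (\int[m2]_y `|y|%:E)%E); first exact/fine_ge0/integral_ge0.
    by rewrite fineK// ge0_fin_numE//; exact: integral_ge0.
  rewrite ge0_integralZr//; last exact/measurable_EFinP/measurable_abs.
  by rewrite muleC lte_mul_pinfty.
have eqm (f : R * R -> \bar R) : (\int[m1 \x m2]_z f z = \int[m]_z f z)%E.
  by apply: eq_measure_integral => A mA _; exact: mE.
have UV1 : L1 P (fun w => U w * V w).
  apply/integrableP; split.
    by apply/measurable_EFinP; exact: measurable_funM.
  have := @ge0_integral_distribution _ _ _ _ _ P Z' (fun z => `|(z.1 * z.2)%:E|%E).
  rewrite /comp /= => <-//; last exact/measurable_EFinP/measurable_abs.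
  by rewrite -/m -eqm; have /integrableP[] := iprod.
split => //; apply/EFin_inj; rewrite -EFin_Ex//.
have := @integral_distribution _ _ _ _ _ P Z' (fun z => (z.1 * z.2)%:E).
rewrite /comp /= => <-//; last exact/measurable_EFinP.
rewrite -/m -eqm -integral12_prod_meas1//= /fubini_F /=.
rewrite (eq_integral (fun x : R => x%:E * (Ex P V)%:E)%E); last first.
  move=> x _; under eq_integral do rewrite EFinM.
  rewrite integralZl// integral_distribution//; first by rewrite -EFin_Ex.
rewrite integralZr// integral_distribution//.
by rewrite EFin_Ex// EFinM.
Qed.

End independent_pair.

Section independent_family.
Context d (T : measurableType d) (R : realType) (P : probability T R).
Variable Z : nat -> T -> R.
Hypothesis mZ : forall j, measurable_fun setT (Z j).
Hypothesis iZ : forall n, mutually_independent P (fun i : 'I_n => Z i).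
Implicit Types A B : nat -> Prop.

(** The pi-system of cylinders that only involve the variables indexed by A. *)
Definition cylinders A : set (set T) := [set E | exists n (C : nat -> set R),
  [/\ forall j, measurable (C j), forall j, ~ A j -> C j = setT &
      E = \bigcap_(j in [set i | (i < n)%N]) (Z j @^-1` C j)]].

(** Measurability with respect to the noise variables with indices in A, phrased on
    the type of the generated sigma-algebra so that all measurability lemmas apply to it. *)
Definition measurable_on A (U : T -> R) :=
  measurable_fun [set: g_sigma_algebraType (cylinders A)]
    (U : g_sigma_algebraType (cylinders A) -> R).

Lemma cylinder_measurable A E : cylinders A E -> measurable E.
Proof.
move=> [n [C [mC _ ->]]]; apply: fin_bigcap_measurable => //.
by move=> j _; rewrite -[X in measurable X]setTI; exact: mZ.
Qed.

(** Two cylinders can be written over a common range of indices. *)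
Lemma cylinder_widen A E m : cylinders A E -> exists2 n, (m <= n)%N &
  exists C : nat -> set R, [/\ forall j, measurable (C j),
    forall j, ~ A j -> C j = setT &
    forall k, (n <= k)%N -> E = \bigcap_(j in [set i | (i < k)%N]) (Z j @^-1` C j)].
Proof.
move=> [n [C [mC AC ->]]]; exists (maxn m n); first exact: leq_maxl.
exists (fun j => if (j < n)%N then C j else setT); split.
- by move=> j; case: ifP.
- by move=> j Aj; case: ifP => // _; exact: AC.
- move=> k; rewrite geq_max => /andP[_ nk]; apply/seteqP; split => w /= Ew j /=.
    by case: ifP => // jn _; exact: Ew.
  by move=> jn; have := Ew j; rewrite /= jn => /(_ (leq_trans jn nk)).
Qed.

Lemma cylindersI A : setI_closed (cylinders A).
Proof.
move=> E F /(cylinder_widen 0)[n1 _ [C [mC AC CE]]] /(cylinder_widen 0)[n2 _ [D [mD AD DE]]].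
exists (maxn n1 n2), (fun j => C j `&` D j); split.
- by move=> j; exact: measurableI.
- by move=> j Aj; rewrite AC// AD// setTI.
- rewrite (CE _ (leq_maxl n1 n2)) (DE _ (leq_maxr n1 n2)) -bigcapI.
  by apply: eq_bigcapr => j _.
Qed.

Lemma cylindersT A : cylinders A setT.
Proof.
by exists 0%N, (fun=> setT); split => //; apply/seteqP; split => // w _ j.
Qed.

Lemma cylinder_preimage A j C : A j -> measurable C -> cylinders A (Z j @^-1` C).
Proof.
move=> Aj mC; exists j.+1, (fun i => if i == j then C else setT); split.
- by move=> i; case: ifP.
- by move=> i; case: eqP => // ->.
- apply/seteqP; split => w /= Cw.
    by move=> i _ /=; case: eqP => // ->.
  by have := Cw j; rewrite /= eqxx ltnS leqnn; exact.
Qed.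

Lemma prob_cylinder n (C : nat -> set R) : (forall j, measurable (C j)) ->
  P (\bigcap_(j in [set i | (i < n)%N]) (Z j @^-1` C j)) =
  (\big[mule/1%E]_(i < n) P (Z i @^-1` C i))%E.
Proof.
move=> mC; rewrite -(@iZ n (fun i => C i))//; congr (P _).
apply/seteqP; split => w /= Cw.
  by move=> i _; apply: Cw => /=.
by move=> j /= jn; exact: (Cw (Ordinal jn)).
Qed.

Lemma indep_cylinders A B E F : (forall j, A j -> ~ B j) ->
  cylinders A E -> cylinders B F -> P (E `&` F) = (P E * P F)%E.
Proof.
move=> AB /(cylinder_widen 0)[n1 _ [C [mC AC CE]]] /(cylinder_widen 0)[n2 _ [D [mD BD DE]]].
pose n := maxn n1 n2.
rewrite (CE n) ?leq_maxl// (DE n) ?leq_maxr// !prob_cylinder//.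
rewrite -bigcapI (eq_bigcapr (G := fun j => Z j @^-1` (C j `&` D j)))//.
rewrite prob_cylinder; last by move=> j; exact: measurableI.
rewrite -big_split /=; apply: eq_bigr => i _.
have [Ai|nAi] := pselect (A i).
  by rewrite (BD i (AB i Ai)) setIT preimage_setT probability_setT mule1.
by rewrite (AC i nAi) setTI preimage_setT probability_setT mul1e.
Qed.

(** For fixed F, the two finite measures E |-> P (E & F) and E |-> P E * P F agree on a
    pi-system, hence on the sigma-algebra that it generates. *)
Let indep_half (G : set (set T)) F : G `<=` measurable -> setI_closed G ->
  G setT -> measurable F ->
  (forall E, G E -> P (E `&` F) = (P E * P F)%E) ->
  forall E, <<s G >> E -> P (E `&` F) = (P E * P F)%E.
Proof.
move=> Gm GI GT mF GF E sE.
have PF0 : 0 <= fine (P F) by exact: fine_ge0.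
have PFE : (P F = (fine (P F))%:E)%E by rewrite fineK// fin_num_measure.
have cov : \bigcup_(k in [set: nat]) [set: T] = setT.
  by apply/seteqP; split => // w _; exists 0%N.
have agree X : G X -> mrestr P mF X = mscale (NngNum PF0) P X.
  by move=> GX; rewrite /mrestr /mscale /= GF// muleC -PFE.
have fin_cov (k : nat) : (mrestr P mF setT < +oo)%E.
  by rewrite /mrestr setTI (le_lt_trans (probability_le1 _ _)) ?ltry.
have := @g_sigma_algebra_measure_unique _ R T G Gm (fun=> setT) (fun=> GT) cov
  (mrestr P mF) (mscale (NngNum PF0) P) GI agree fin_cov E sE.
by move=> H; apply: (etrans H); rewrite [RHS]muleC [in RHS]PFE.
Qed.

Lemma measurable_on_cylinder A U C : measurable_on A U -> measurable C ->
  <<s cylinders A >> (U @^-1` C).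
Proof. by move=> mU mC; have := mU measurableT C mC; rewrite setTI. Qed.

Lemma sub_sigma_measurable A E : <<s cylinders A >> E -> measurable E.
Proof.
move: E; apply: smallest_sub; first exact: sigma_algebra_measurable.
by move=> E; exact: cylinder_measurable.
Qed.

Lemma measurable_on_measurable A U : measurable_on A U -> measurable_fun setT U.
Proof.
move=> mU _ C mC; rewrite setTI.
by apply: (@sub_sigma_measurable A); exact: measurable_on_cylinder.
Qed.

(** Independence of cylinders over disjoint index sets extends to the generated
    sigma-algebras, one argument at a time. *)
Lemma measurable_on_indep A B U V : (forall j, A j -> ~ B j) ->
  measurable_on A U -> measurable_on B V -> indep_rv P U V.
Proof.
move=> AB mU mV C D mC mD.
have sU := measurable_on_cylinder mU mC; have sV := measurable_on_cylinder mV mD.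
apply: (@indep_half (cylinders A)) => //.
- by move=> E; exact: cylinder_measurable.
- exact: cylindersI.
- exact: cylindersT.
- exact: sub_sigma_measurable sV.
- move=> E AE; rewrite setIC muleC.
  apply: (@indep_half (cylinders B)) => //.
  + by move=> F; exact: cylinder_measurable.
  + exact: cylindersI.
  + exact: cylindersT.
  + exact: cylinder_measurable AE.
  + by move=> F BF; rewrite setIC muleC; exact: (indep_cylinders AB).
Qed.

Lemma measurable_on_sub A B U : (forall j, A j -> B j) ->
  measurable_on A U -> measurable_on B U.
Proof.
move=> AB mU _ C mC; rewrite setTI.
apply: (@sub_sigma_algebra2 _ _ (cylinders B) (cylinders A)).
  move=> E [n [D [mD AD ->]]]; exists n, D; split => // j nB; apply: AD.
  by move=> /AB.
exact: measurable_on_cylinder.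
Qed.

Lemma measurable_on_coord A j : A j -> measurable_on A (Z j).
Proof.
move=> Aj _ C mC; rewrite setTI; apply: sub_sigma_algebra.
exact: cylinder_preimage.
Qed.

Lemma measurable_on_Ex A B U V : (forall j, A j -> ~ B j) ->
  measurable_on A U -> measurable_on B V -> L1 P U -> L1 P V ->
  L1 P (fun w => U w * V w) /\ Ex P (fun w => U w * V w) = Ex P U * Ex P V.
Proof.
move=> AB mU mV U1 V1; apply: indep_rv_Ex => //.
exact: (measurable_on_indep AB).
Qed.

Lemma measurable_on_sum A (I : Type) (s : seq I) (p : pred I) (F : I -> T -> R) :
  (forall i, p i -> measurable_on A (F i)) ->
  measurable_on A (fun w => \sum_(i <- s | p i) F i w).
Proof.
move=> mF; elim: s => [|i s ih].
  have -> : (fun w => \sum_(i <- [::] | p i) F i w) = (fun=> 0).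
    by apply/funext => w; rewrite big_nil.
  exact: measurable_cst.
case pi : (p i).
  have -> : (fun w => \sum_(i <- i :: s | p i) F i w) =
      (fun w => F i w + \sum_(i <- s | p i) F i w).
    by apply/funext => w; rewrite big_cons pi.
  by apply: measurable_funD => //; exact: mF.
have -> : (fun w => \sum_(i <- i :: s | p i) F i w) =
    (fun w => \sum_(i <- s | p i) F i w).
  by apply/funext => w; rewrite big_cons pi.
exact: ih.
Qed.

End independent_family.

(** * The Stein identity for short-range dependent sums *)

Section stein_clt_stability.
Context d (T : measurableType d) (R : realType) (P : probability T R).

(** All four facts hold because the test function and its derivative are bounded. *)
Lemma stein_test_L2 (f df : R -> R) (K : R) (W : T -> R) : stein_test f df K ->
  measurable_fun setT W ->
  [/\ L2 P (fun w => f (W w)), L2 P (fun w => df (W w)),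
      nrm P (fun w => f (W w)) <= K & `|Ex P (fun w => df (W w))| <= K].
Proof.
move=> tf mW; have [mf mdf] := stein_test_measurable tf.
have K0 := stein_test_ge0 tf; have [_ fK dfK _] := tf.
have f2 : L2 P (fun w => f (W w)).
  by apply: (@L2_bounded _ _ _ P _ K) => //; exact: measurableT_comp.
have df2 : L2 P (fun w => df (W w)).
  by apply: (@L2_bounded _ _ _ P _ K) => //; exact: measurableT_comp.
split => //.
- rewrite -(ger0_norm K0) -(nrm_cst P K); apply: nrm_le (L2_measurable f2) _ (L2_cst P K).
  by move=> w; rewrite (ger0_norm K0).
- apply: le_trans (ler_norm_Ex (L2_L1 df2)) _; rewrite -(Ex_cst P K).
  by apply: le_Ex; [exact/L1_abs/L2_L1|exact: L1_cst|].
Qed.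

(** Both terms of the Stein identity are Lipschitz in L^2 on bounded sets, hence
    the identity passes to L^2-limits that are uniform in n. *)
Lemma stein_clt_approx (W : nat -> T -> R) (B : R) : (forall n, L2 P (W n)) ->
  (forall n, nrm P (W n) <= B) ->
  (forall e : R, 0 < e -> exists W', [/\ forall n, L2 P (W' n), stein_clt P W' &
     \forall n \near \oo, nrm P (fun w => W n w - W' n w) <= e]) ->
  stein_clt P W.
Proof.
move=> W2 WB app f df K tf.
have K0 := stein_test_ge0 tf.
have B0 : 0 <= B by apply: le_trans (WB 0%N); exact: nrm_ge0.
pose C := K + (B + 1) * K + ((B + (B + 1)) * K + (B + 1) ^+ 2 * K).
have C0 : 0 <= C by rewrite /C !addr_ge0 ?mulr_ge0 ?addr_ge0 ?exprn_ge0 ?addr_ge0.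
apply/cvgrPdist_le => e e0.
have e'0 : 0 < Num.min 1 (e / 2 / (C + 1)).
  by rewrite lt_min ltr01 !divr_gt0// ltr_wpDl.
have [W' [W'2 W'clt W'W]] := app _ e'0.
have e20 : 0 < e / 2 by rewrite divr_gt0.
have /cvgrPdist_le/(_ _ e20) H := W'clt _ _ _ tf.
near=> n.
have nW : nrm P (fun w => W n w - W' n w) <= Num.min 1 (e / 2 / (C + 1)) by near: n.
have H1 : `|0 - (Ex P (fun w => W' n w * f (W' n w)) -
  Ex P (fun w => W' n w ^+ 2) * Ex P (fun w => df (W' n w)))| <= e / 2 by near: n.
set dl := nrm P (fun w => W n w - W' n w) in nW.
have dl0 : 0 <= dl by exact: nrm_ge0.
have dl1 : dl <= 1 by apply: le_trans nW _; rewrite ge_min lexx.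
have dle : dl <= e / 2 / (C + 1) by apply: le_trans nW _; rewrite ge_min lexx orbT.
have d2 := L2B (W2 n) (W'2 n).
have W'B : nrm P (W' n) <= B + 1.
  have := nrm_tri (W2 n) (L2N d2); rewrite nrmN -/dl.
  rewrite (eq_nrm (g := W' n)); last by move=> w; ring.
  by have := WB n; lra.
have [f2 df2 fn dfn] := stein_test_L2 tf (L2_measurable (W2 n)).
have [f2' df2' fn' dfn'] := stein_test_L2 tf (L2_measurable (W'2 n)).
have fd : nrm P (fun w => f (W n w) - f (W' n w)) <= K * dl.
  rewrite -(ger0_norm K0) -nrmZ//; apply: nrm_le.
  - exact: L2_measurable (L2B f2 f2').
  - by move=> w; rewrite normrM (ger0_norm K0); exact: stein_test_lipschitz tf.
  - exact: L2Z.
have dfd : nrm P (fun w => df (W n w) - df (W' n w)) <= K * dl.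
  rewrite -(ger0_norm K0) -nrmZ//; apply: nrm_le.
  - exact: L2_measurable (L2B df2 df2').
  - by move=> w; rewrite normrM (ger0_norm K0); have [_ _ _] := tf; exact.
  - exact: L2Z.
pose a := Ex P (fun w => W n w * f (W n w)).
pose a' := Ex P (fun w => W' n w * f (W' n w)).
pose b := Ex P (fun w => W n w ^+ 2); pose b' := Ex P (fun w => W' n w ^+ 2).
pose c := Ex P (fun w => df (W n w)); pose c' := Ex P (fun w => df (W' n w)).
(* The two terms of the identity for W and for W' differ by multiples of dl. *)
have aa' : `|a - a'| <= dl * (K + (B + 1) * K).
  rewrite /a /a' -ExB; [|exact: L2M|exact: L2M].
  rewrite (eq_Ex (g := fun w => (W n w - W' n w) * f (W n w) +
    W' n w * (f (W n w) - f (W' n w)))); last by move=> w; ring.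
  rewrite ExD; [|exact: L2M|by apply: L2M => //; exact: L2B].
  rewrite (le_trans (ler_normD _ _))// mulrDr lerD//.
    by rewrite (le_trans (ler_dot_nrm d2 f2))// ler_wpM2l.
  rewrite (le_trans (ler_dot_nrm (W'2 n) (L2B f2 f2')))//.
  have -> : dl * ((B + 1) * K) = (B + 1) * (K * dl) by ring.
  by apply: ler_pM; rewrite ?nrm_ge0.
have bb' : `|b - b'| <= dl * (B + (B + 1)).
  rewrite /b /b' -ExB; [|exact: L2_sqr|exact: L2_sqr].
  rewrite (eq_Ex (g := fun w => (W n w - W' n w) * (W n w + W' n w))); last first.
    by move=> w; ring.
  rewrite (le_trans (ler_dot_nrm d2 (L2D (W2 n) (W'2 n))))// ler_wpM2l//.
  by rewrite (le_trans (nrm_tri (W2 n) (W'2 n)))// lerD.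
have cc' : `|c - c'| <= K * dl.
  rewrite /c /c' -ExB; [|exact: L2_L1|exact: L2_L1].
  by rewrite (le_trans (ler_Ex_nrm (L2B df2 df2'))).
have b'B : `|b'| <= (B + 1) ^+ 2.
  rewrite /b' -sqr_nrm ger0_norm ?sqr_ge0//.
  by rewrite lerXn2r ?nnegrE ?nrm_ge0 ?addr_ge0.
move: H1; rewrite !sub0r !normrN -/a' -/b' -/c' -/a -/b -/c => H1.
have -> : a - b * c = (a' - b' * c') + ((a - a') - ((b - b') * c + b' * (c - c'))) by ring.
rewrite (le_trans (ler_normD _ _))// (splitr e) lerD//.
apply: (@le_trans _ _ (dl * C)); last first.
  have : dl * (C + 1) <= e / 2 by rewrite -ler_pdivlMr// ltr_wpDl.
  by apply: le_trans; rewrite ler_wpM2l// lerDl.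
apply: le_trans (ler_normB _ _) _; rewrite /C [leRHS]mulrDr; apply: lerD => //.
apply: le_trans (ler_normD _ _) _; rewrite [leRHS]mulrDr; apply: lerD; rewrite normrM.
  by rewrite mulrA; apply: ler_pM.
have -> : dl * ((B + 1) ^+ 2 * K) = (B + 1) ^+ 2 * (K * dl) by ring.
by apply: ler_pM.
Unshelve. all: by end_near. Qed.

End stein_clt_stability.

(** ** Sums with finitely many nonzero covariances per row *)

(** Indices within distance M, without subtraction on natural numbers. *)
Definition close (M s t : nat) : bool := (s <= t + M)%N && (t <= s + M)%N.

Lemma closexx M s : close M s s. Proof. by rewrite /close leq_addr. Qed.

Lemma sum_close_le (R : realType) (M n s : nat) (v : R) : 0 <= v ->
  \sum_(t < n | close M s t) v <= (2 * M + 1)%:R * v.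
Proof.
move=> v0; rewrite big_const iter_addr addr0 -[leLHS]mulr_natl ler_wpM2r// ler_nat.
have -> : (2 * M + 1 = size (iota (s - M) (2 * M + 1)))%N by rewrite size_iota.
rewrite cardE -(size_map val); apply: uniq_leq_size.
  by rewrite map_inj_uniq ?enum_uniq//; exact: val_inj.
move=> _ /mapP[t + ->] /=; rewrite mem_enum unfold_in /close mem_iota => /andP[h1 h2].
by apply/andP; split; lia.
Qed.

Section short_range.
Context d (T : measurableType d) (R : realType) (P : probability T R).

Lemma Ex_sqr_sum (n : nat) (y : nat -> T -> R) : (forall t, L2 P (y t)) ->
  Ex P (fun w => (\sum_(t < n) y t w) ^+ 2) =
  \sum_(s < n) \sum_(t < n) Ex P (fun w => y s w * y t w).
Proof.
move=> y2.
rewrite (eq_Ex (g := fun w => \sum_(s < n) \sum_(t < n) y s w * y t w)); last first.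
  by move=> w; rewrite expr2 mulr_suml; apply: eq_bigr => s _; rewrite mulr_sumr.
rewrite Ex_sum; last by move=> s _; apply: L1_sum => t _; exact: L2M.
by apply: eq_bigr => s _; rewrite Ex_sum// => t _; exact: L2M.
Qed.

(** Each row of the covariance matrix has at most 2 M + 1 nonzero entries, and by
    the Cauchy-Schwarz inequality each entry is at most v. *)
Lemma Ex_sqr_sum_short_range (M n : nat) (y : nat -> T -> R) (v : R) :
  (forall t, L2 P (y t)) ->
  (forall s t, ~~ close M s t -> Ex P (fun w => y s w * y t w) = 0) ->
  (forall t, Ex P (fun w => y t w ^+ 2) <= v) ->
  Ex P (fun w => (\sum_(t < n) y t w) ^+ 2) <= n%:R * ((2 * M + 1)%:R * v).
Proof.
move=> y2 y0 yv.
have v0 : 0 <= v by apply: le_trans (yv 0%N); apply: Ex_ge0 => w; exact: sqr_ge0.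
have st s t : Ex P (fun w => y s w * y t w) <= v.
  apply: le_trans (ler_norm _) _; apply: le_trans (ler_dot_nrm (y2 s) (y2 t)) _.
  have h u : nrm P (y u) <= Num.sqrt v by rewrite ler_sqrt.
  by rewrite -[leRHS](sqr_sqrtr v0) expr2 ler_pM ?nrm_ge0.
rewrite Ex_sqr_sum//.
apply: (@le_trans _ _ (\sum_(s < n) (2 * M + 1)%:R * v)); last first.
  by rewrite sumr_const card_ord -[leLHS]mulr_natl.
apply: ler_sum => s _; rewrite (bigID (fun t : 'I_n => close M s t)) /=.
rewrite [X in _ + X]big1 ?addr0; last by move=> t /y0.
by apply: le_trans (sum_close_le M n s v0); exact: ler_sum.
Qed.

End short_range.

Lemma cvg_inv_sqrt (R : realType) : (Num.sqrt (n%:R : R))^-1 @[n --> \oo] --> (0 : R).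
Proof.
apply/cvgrPdist_le => e e0; near=> n.
rewrite sub0r normrN ger0_norm ?invr_ge0 ?sqrtr_ge0//.
have en : e ^- 2 <= n%:R by near: n; exact: nbhs_infty_ger.
have n0 : 0 < n%:R :> R by apply: lt_le_trans en; rewrite invr_gt0 exprn_gt0.
rewrite -(invrK e) lef_pV2 ?posrE ?sqrtr_gt0 ?invr_gt0//.
rewrite -(@ler_pXn2r _ 2)// ?nnegrE ?sqrtr_ge0 ?invr_ge0 ?(ltW e0)//.
by rewrite sqr_sqrtr ?ler0n// exprVn.
Unshelve. all: by end_near. Qed.

Section bounded_short_range_clt.
Context d (T : measurableType d) (R : realType) (P : probability T R).
Variable Z : nat -> T -> R.
Hypothesis mZ : forall j, measurable_fun setT (Z j).
Hypothesis iZ : forall n, mutually_independent P (fun i : 'I_n => Z i).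
Variables q K : nat.
Hypothesis q0 : (0 < q)%N.

(** The window of noise variables that the t-th summand may use. *)
Definition window (t j : nat) := (t * q <= j < t * q + K)%N.

Lemma windows_far s t j : ~~ close K s t -> window s j -> ~ window t j.
Proof.
rewrite /close /window negb_and -!ltnNge => st /andP[h1 h2] /andP[h3 h4].
by case/orP: st => st; nia.
Qed.

Lemma window_dot0 (y : nat -> T -> R) s t :
  (forall u, measurable_on Z (window u) (y u)) -> (forall u, L1 P (y u)) ->
  (forall u, Ex P (y u) = 0) -> ~~ close K s t ->
  Ex P (fun w => y s w * y t w) = 0.
Proof.
move=> my y1 y0 st.
have [_ ->] := measurable_on_Ex mZ iZ (fun j => @windows_far s t j st) (my s) (my t) (y1 s) (y1 t).
by rewrite y0 mul0r.
Qed.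

(** Stein's method with local dependence.  The part [far t] of W is independent of
    y_t, so that E[y_t f(far t)] = 0, and Taylor's formula around W replaces
    f(W) - f(far t) by c nb_t f'(W).  The remaining factor V, the sum of the local
    products, is again a short-range sum, hence concentrated at its mean E[W^2]. *)
Lemma bounded_stein_clt (y : nat -> T -> R) (B : R) :
  (forall t, measurable_on Z (window t) (y t)) ->
  (forall t w, `|y t w| <= B) -> (forall t, Ex P (y t) = 0) ->
  stein_clt P (fun n w => (Num.sqrt n%:R)^-1 * \sum_(t < n) y t w).
Proof.
move=> my yB y0 f df Kf tf.
have Kf0 := stein_test_ge0 tf; have [mf mdf] := stein_test_measurable tf.
have [_ fK dfK _] := tf.
have B0 : 0 <= B.
  by apply: le_trans (yB 0%N (point : T)); exact: normr_ge0.
have mT t : measurable_fun setT (y t) by exact: (measurable_on_measurable mZ (my t)).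
have y2 t : L2 P (y t) by exact: L2_bounded (mT t) (yB t).
have y1 t := L2_L1 (y2 t).
have dot0 s t : ~~ close K s t -> Ex P (fun w => y s w * y t w) = 0.
  exact: window_dot0.
pose k2 : R := (2 * K + 1)%:R.
have k20 : 0 <= k2 by exact: ler0n.
(* A1 bounds the deviation of V, whose terms interact within distance 3 K; A2 bounds the Taylor
   remainder. *)
pose A1 := Num.sqrt ((2 * (3 * K) + 1)%:R * (B * (k2 * B)) ^+ 2).
pose A2 := B * (Kf * (k2 * B) ^+ 2).
apply: (@cvg_norm_le _ _ _ _ _ (fun n => (A1 * Kf + A2) * (Num.sqrt n%:R)^-1)); last first.
  rewrite [X in _ --> X](_ : _ = (A1 * Kf + A2) * 0); last by rewrite mulr0.
  by apply: cvgM; [exact: cvg_cst|exact: cvg_inv_sqrt].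
move=> n; rewrite subr0; set c := (Num.sqrt n%:R)^-1.
have c0 : 0 <= c by rewrite invr_ge0 sqrtr_ge0.
have cn : c ^+ 2 * n%:R <= 1.
  rewrite /c exprVn sqr_sqrtr ?ler0n//; case: n @c c0 => [|n] *.
    by rewrite mulr0.
  by rewrite mulVf// pnatr_eq0.
set W := (fun w => c * \sum_(t < n) y t w).
have mW : measurable_fun setT W.
  apply: measurable_funM => //; apply: measurable_sum => t; exact: mT.
have W2 : L2 P W by apply: L2Z; apply: L2_sum => t _; exact: y2.
have [f2 df2 fn dfn] := stein_test_L2 P tf mW.
pose far (t : nat) w := c * \sum_(s < n | ~~ close K t s) y s w.
pose nb (t : nat) w := \sum_(s < n | close K t s) y s w.
have nbB t w : `|nb t w| <= k2 * B.
  apply: le_trans (ler_norm_sum _ _ _) _.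
  by apply: le_trans (sum_close_le K n t B0); apply: ler_sum => s _; exact: yB.
have Wsplit t w : W w = c * nb t w + far t w.
  by rewrite /W (bigID (fun s : 'I_n => close K t s)) /= mulrDr.
have mfar t : measurable_on Z (fun j => exists2 s, ~~ close K t s & window s j) (far t).
  apply: measurable_funM; first exact: measurable_cst.
  apply: measurable_on_sum => s ts; apply: (measurable_on_sub _ (my s)) => j js.
  by exists s.
have mfarT t := measurable_on_measurable mZ (mfar t).
have ffar t : Ex P (fun w => y t w * f (far t w)) = 0.
  have dis j : window t j -> ~ (exists2 s, ~~ close K t s & window s j).
    by move=> tj [s ts sj]; exact: (windows_far ts tj sj).
  have mf' := measurableT_comp mf (mfar t).
  have [/L2_L1 f1 _ _ _] := stein_test_L2 P tf (mfarT t).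
  have [_ ->] := measurable_on_Ex mZ iZ dis (my t) mf' (y1 t) f1.
  by rewrite y0 mul0r.
pose z (t : nat) w := y t w * nb t w.
have mnbZ t : measurable_on Z (fun j => exists2 s, close K t s & window s j) (nb t).
  apply: measurable_on_sum => s ts; apply: (measurable_on_sub _ (my s)) => j js.
  by exists s.
have mnb t := measurable_on_measurable mZ (mnbZ t).
have nb2 t : L2 P (nb t) by exact: L2_bounded (mnb t) (nbB t).
have zB t w : `|z t w| <= B * (k2 * B) by rewrite normrM ler_pM.
have z2 t : L2 P (z t).
  by apply: L2_bounded (zB t); exact: measurable_funM.
pose V w := c ^+ 2 * \sum_(t < n) z t w.
have V2 : L2 P V by apply: L2Z; apply: L2_sum => t _; exact: z2.
have EV : Ex P (fun w => W w ^+ 2) = Ex P V.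
  have -> : Ex P V = c ^+ 2 * \sum_(t < n) Ex P (z t).
    rewrite /V ExZ; last by apply: L1_sum => t _; exact: L2_L1.
    by rewrite Ex_sum// => t _; exact: L2_L1.
  rewrite (eq_Ex (g := fun w => c ^+ 2 * (\sum_(t < n) y t w) ^+ 2)); last first.
    by move=> w; rewrite /W exprMn.
  rewrite ExZ; last by apply: L2_sqr; apply: L2_sum => t _; exact: y2.
  rewrite Ex_sqr_sum//; congr (_ * _); apply: eq_bigr => t _.
  rewrite (bigID (fun s : 'I_n => close K t s)) /=.
  rewrite [X in _ + X]big1 ?addr0; last by move=> s /dot0.
  rewrite -Ex_sum; last by move=> s _; exact: L2M.
  by apply: eq_Ex => w; rewrite /z mulr_sumr.
pose r (t : nat) w := y t w * (f (W w) - f (far t w) - c * nb t w * df (W w)).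
have rB t w : `|r t w| <= c ^+ 2 * A2.
  have := stein_test_taylor (far t w) (W w) tf.
  have -> : far t w - W w = - (c * nb t w) by rewrite (Wsplit t w); ring.
  have -> : f (far t w) - f (W w) - - (c * nb t w) * df (W w) =
    - (f (W w) - f (far t w) - c * nb t w * df (W w)) by ring.
  rewrite normrN sqrrN => h.
  have -> : c ^+ 2 * A2 = B * (Kf * (c ^+ 2 * (k2 * B) ^+ 2)) by rewrite /A2; ring.
  rewrite normrM ler_pM// (le_trans h)// ler_wpM2l// exprMn ler_wpM2l ?sqr_ge0//.
  rewrite -(real_normK (num_real (nb t w))).
  by rewrite lerXn2r ?nnegrE ?mulr_ge0//; exact: nbB.
have far2 t : L2 P (fun w => f (far t w)).
  by have [] := stein_test_L2 P tf (mfarT t).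
have ydf t : L2 P (fun w => z t w * df (W w)).
  apply: (@L2_bounded _ _ _ P _ (B * (k2 * B) * Kf)).
    exact: measurable_funM (L2_measurable (z2 t)) (L2_measurable df2).
  by move=> w; rewrite normrM ler_pM.
have rE t : r t = fun w => y t w * f (W w) - y t w * f (far t w) - c * (z t w * df (W w)).
  by apply/funext => w; rewrite /r /z; ring.
have r1 t : L1 P (r t).
  rewrite rE; apply: L1B; first by apply: L1B; exact: L2M.
  exact/L1Z/L2_L1.
have main : Ex P (fun w => W w * f (W w)) =
    Ex P (fun w => V w * df (W w)) + c * \sum_(t < n) Ex P (r t).
  rewrite (eq_Ex (g := fun w => c * \sum_(t < n) (y t w * f (W w)))); last first.
    by move=> w; rewrite /W -mulrA mulr_suml.
  rewrite ExZ; last by apply: L1_sum => t _; exact: L2M.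
  rewrite (eq_Ex (f := fun w => V w * df (W w))
      (g := fun w => c ^+ 2 * \sum_(t < n) (z t w * df (W w)))); last first.
    by move=> w; rewrite /V -mulrA mulr_suml.
  rewrite ExZ; last by apply: L1_sum => t _; exact: L2_L1.
  rewrite !Ex_sum; [|by move=> t _; exact: L2_L1|by move=> t _; exact: L2M].
  rewrite [RHS](_ : _ = c * (c * \sum_(t < n) Ex P (fun w => z t w * df (W w)) +
    \sum_(t < n) Ex P (r t))); last by ring.
  congr (_ * _); rewrite mulr_sumr -big_split /=.
  apply: eq_bigr => t _; rewrite rE ExB; [|by apply: L1B; exact: L2M|exact/L1Z/L2_L1].
  rewrite ExB; [|exact: L2M|exact: L2M].
  rewrite ffar ExZ; last exact: L2_L1.
  by ring.
rewrite main EV.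
have -> : Ex P (fun w => V w * df (W w)) + c * (\sum_(t < n) Ex P (r t)) -
    Ex P V * Ex P (fun w => df (W w)) =
    Ex P (fun w => (V w - Ex P V) * df (W w)) + c * (\sum_(t < n) Ex P (r t)).
  rewrite (eq_Ex (f := fun w => (V w - Ex P V) * df (W w))
    (g := fun w => V w * df (W w) - Ex P V * df (W w))); last first.
    by move=> w; rewrite mulrBl.
  rewrite ExB; [|exact: L2M|exact/L1Z/L2_L1].
  rewrite ExZ; last exact: L2_L1.
  by ring.
rewrite (le_trans (ler_normD _ _))// mulrDl lerD//.
  have Vc2 : L2 P (fun w => V w - Ex P V) by apply: L2B => //; exact: L2_cst.
  apply: (le_trans (ler_dot_nrm Vc2 df2)).
  have dfn2 : nrm P (fun w => df (W w)) <= Kf.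
    rewrite -(ger0_norm Kf0) -(nrm_cst P Kf); apply: nrm_le (L2_measurable df2) _ (L2_cst P Kf).
    by move=> w; rewrite (ger0_norm Kf0).
  rewrite [leRHS]mulrAC; apply: ler_pM; rewrite ?nrm_ge0//.
  rewrite -(@ler_pXn2r _ 2)// ?nnegrE ?nrm_ge0 ?mulr_ge0 ?sqrtr_ge0//.
  rewrite sqr_nrm exprMn sqr_sqrtr; last by rewrite mulr_ge0 ?ler0n ?sqr_ge0.
  pose y' t w := z t w - Ex P (z t).
  have y'2 t : L2 P (y' t) by apply: L2B => //; exact: L2_cst.
  have y'v t : Ex P (fun w => y' t w ^+ 2) <= (B * (k2 * B)) ^+ 2.
    rewrite Ex_center_sqr//; apply: (@le_trans _ _ (Ex P (fun w => z t w ^+ 2))).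
      by rewrite lerBlDr lerDl sqr_ge0.
    rewrite -(Ex_cst P ((B * (k2 * B)) ^+ 2)).
    apply: le_Ex; [exact: L2_sqr|exact: L1_cst|move=> w].
    rewrite -(real_normK (num_real (z t w))).
    by rewrite lerXn2r ?nnegrE ?mulr_ge0//; exact: zB.
  have y'm t : measurable_on Z (fun j => exists2 s, close K t s & window s j) (y' t).
    apply: measurable_funB; last exact: measurable_cst.
    apply: measurable_funM.
      apply: (measurable_on_sub _ (my t)) => j tj; exists t => //; exact: closexx.
    exact: mnbZ.
  (* A local product uses windows at distance at most K from its own, so two of them overlap
     only within distance 3 K. *)
  have y'0 s t : ~~ close (3 * K) s t -> Ex P (fun w => y' s w * y' t w) = 0.
    move=> st.
    have dis j : (exists2 u, close K s u & window u j) ->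
        ~ (exists2 u, close K t u & window u j).
      move=> [s' ss' sj] [t' tt' tj]; apply: (@windows_far s' t' j _ sj tj).
      by move: st ss' tt'; rewrite /close; lia.
    have [_ ->] := measurable_on_Ex mZ iZ dis (y'm s) (y'm t) (L2_L1 (y'2 s)) (L2_L1 (y'2 t)).
    by rewrite {1}/y' ExB ?Ex_cst ?subrr ?mul0r//; [exact: L2_L1|exact: L1_cst].
  have := @Ex_sqr_sum_short_range _ _ _ P (3 * K) n y' _ y'2 y'0 y'v.
  have -> : Ex P (fun w => (V w - Ex P V) ^+ 2) =
      (c ^+ 2) ^+ 2 * Ex P (fun w => (\sum_(t < n) y' t w) ^+ 2).
    rewrite -ExZ; last by apply: L2_sqr; apply: L2_sum => t _; exact: y'2.
    apply: eq_Ex => w; rewrite -exprMn; congr (_ ^+ 2).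
    rewrite /V ExZ; last by apply: L1_sum => t _; exact: L2_L1.
    rewrite Ex_sum; last by move=> t _; exact: L2_L1.
    rewrite -mulrBr -sumrB; congr (_ * _); apply: eq_bigr => t _.
  move=> h; apply: (@le_trans _ _ ((c ^+ 2) ^+ 2 * (n%:R * ((2 * (3 * K) + 1)%:R *
    (B * (k2 * B)) ^+ 2)))); first by rewrite ler_wpM2l ?exprn_ge0.
  rewrite expr2 -mulrA (mulrA (c ^+ 2) n%:R) mulrC ler_wpM2r ?sqr_ge0//.
  by rewrite ler_piMl// mulr_ge0 ?ler0n ?sqr_ge0.
rewrite normrM (ger0_norm c0) mulrC ler_wpM2r//.
apply: le_trans (ler_norm_sum _ _ _) _.
apply: (@le_trans _ _ (\sum_(t < n) c ^+ 2 * A2)).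
  apply: ler_sum => t _; apply: le_trans (ler_norm_Ex (r1 t)) _.
  rewrite -(Ex_cst P (c ^+ 2 * A2)).
  by apply: le_Ex; [exact: L1_abs|exact: L1_cst|exact: rB].
rewrite sumr_const card_ord -[leLHS]mulr_natl mulrA mulrC (mulrC n%:R).
by rewrite ler_piMr// /A2 !mulr_ge0 ?sqr_ge0.
Qed.

End bounded_short_range_clt.

(** * Fourth moments *)

Section fourth_moments.
Context d (T : measurableType d) (R : realType) (P : probability T R).
Implicit Types f g : T -> R.

Definition L4 f := measurable_fun setT f /\ L2 P (fun w => f w ^+ 2).

(** The square of the L^4 norm, which keeps square roots out of the estimates. *)
Definition nrm4 f := nrm P (fun w => f w ^+ 2).

Lemma nrm_le_sqrt f c : nrm P f ^+ 2 <= c -> nrm P f <= Num.sqrt c.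
Proof. by rewrite sqr_nrm; exact: ler_wsqrtr. Qed.

Lemma L4_measurable f : L4 f -> measurable_fun setT f. Proof. by case. Qed.

Lemma L4_sqr f : L4 f -> L2 P (fun w => f w ^+ 2). Proof. by case. Qed.

Lemma L4_L2 f : L4 f -> L2 P f.
Proof. by move=> [mf f2]; split => //; exact: L2_L1. Qed.

Lemma L4_L1 f : L4 f -> L1 P f. Proof. by move=> /L4_L2/L2_L1. Qed.

Lemma L4_bounded f C : measurable_fun setT f -> (forall w, `|f w| <= C) -> L4 f.
Proof.
move=> mf fC; split => //; apply: (@L2_bounded _ _ _ P _ (C ^+ 2)).
  exact: measurable_funX.
move=> w; rewrite normrX; have C0 : 0 <= C by apply: le_trans (fC w).
by rewrite lerXn2r ?nnegrE.
Qed.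

Lemma eq_L4 f g : f =1 g -> L4 f -> L4 g. Proof. by move=> /funext ->. Qed.

Lemma L4Z c f : L4 f -> L4 (fun w => c * f w).
Proof.
move=> [mf f2]; split; first exact: measurable_funM.
by apply: eq_L2 (L2Z (c ^+ 2) f2) => w; rewrite exprMn.
Qed.

Lemma L4N f : L4 f -> L4 (fun w => - f w).
Proof. by move=> f4; apply: eq_L4 (L4Z (-1) f4) => w; rewrite mulN1r. Qed.

Let sqrD_le (x y : R) : (x + y) ^+ 2 <= 2 * x ^+ 2 + 2 * y ^+ 2.
Proof. by rewrite -subr_ge0 (_ : _ - _ = (x - y) ^+ 2) ?sqr_ge0//; ring. Qed.

Lemma nrm4D f g : L4 f -> L4 g ->
  L4 (fun w => f w + g w) /\ nrm4 (fun w => f w + g w) <= 2 * nrm4 f + 2 * nrm4 g.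
Proof.
move=> f4 g4; have [mf f2] := f4; have [mg g2] := g4.
have h2 := L2D (L2Z 2 f2) (L2Z 2 g2).
have mfg : measurable_fun setT (fun w => (f w + g w) ^+ 2).
  by apply: measurable_funX; exact: measurable_funD.
have le w : `|(f w + g w) ^+ 2| <= `|2 * f w ^+ 2 + 2 * g w ^+ 2|.
  by apply: le_trans (ler_norm _); rewrite ger0_norm ?sqr_ge0//; exact: sqrD_le.
split; first by split; [exact: measurable_funD|exact: L2_le h2].
apply: le_trans (nrm_le mfg le h2) _; apply: le_trans (nrm_tri (L2Z 2 f2) (L2Z 2 g2)) _.
by rewrite !nrmZ// ger0_norm.
Qed.

Lemma L4D f g : L4 f -> L4 g -> L4 (fun w => f w + g w).
Proof. by move=> f4 g4; have [] := nrm4D f4 g4. Qed.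

Lemma L4B f g : L4 f -> L4 g -> L4 (fun w => f w - g w).
Proof. by move=> f4 g4; exact: L4D (L4N g4). Qed.

Lemma L4_0 : L4 (fun=> 0).
Proof. by apply: (@L4_bounded _ 0) => // w; rewrite normr0. Qed.

Lemma L4_sum (I : Type) (s : seq I) (p : pred I) (F : I -> T -> R) :
  (forall i, p i -> L4 (F i)) -> L4 (fun w => \sum_(i <- s | p i) F i w).
Proof.
move=> F4; elim: s => [|i s IH].
  by apply: eq_L4 L4_0 => w; rewrite big_nil.
have [pi|npi] := boolP (p i).
  by apply: eq_L4 (L4D (F4 _ pi) IH) => w; rewrite big_cons pi.
by apply: eq_L4 IH => w; rewrite big_cons (negbTE npi).
Qed.

Lemma nrm4Z c f : L4 f -> nrm4 (fun w => c * f w) = c ^+ 2 * nrm4 f.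
Proof.
move=> [_ f2]; rewrite -(ger0_norm (sqr_ge0 c)) -nrmZ//.
by apply: eq_nrm => w; rewrite exprMn.
Qed.

Lemma L4M f g : L4 f -> L4 g -> L2 P (fun w => f w * g w).
Proof.
move=> [mf f2] [mg g2]; split; first exact: measurable_funM.
by apply: eq_L1 (L2M f2 g2) => w; rewrite exprMn.
Qed.

Lemma L4_L1_cube f : L4 f -> L1 P (fun w => f w ^+ 3).
Proof. by move=> f4; apply: eq_L1 (L2M (L4_L2 f4) (L4_sqr f4)) => w; rewrite -exprS. Qed.

Lemma L4_L1_four f : L4 f -> L1 P (fun w => f w ^+ 4).
Proof. by move=> f4; apply: eq_L1 (L2_sqr (L4_sqr f4)) => w; rewrite -exprM. Qed.

Lemma sqr_nrmM f g : L4 f -> L4 g -> nrm P (fun w => f w * g w) ^+ 2 <= nrm4 f * nrm4 g.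
Proof.
move=> [mf f2] [mg g2]; rewrite sqr_nrm (eq_Ex (g := fun w => f w ^+ 2 * g w ^+ 2)).
  exact: le_trans (ler_norm _) (ler_dot_nrm f2 g2).
by move=> w; rewrite exprMn.
Qed.

(** The constant depends on the coefficients but not on the variables, so it is
    uniform over translates of the noise. *)
Lemma nrm4_linear (K : nat) (a : nat -> R) : exists2 C, 0 <= C &
  forall (z : nat -> T -> R) (m : R), (forall k, L4 (z k)) -> (forall k, nrm4 (z k) <= m) ->
  nrm4 (fun w => \sum_(k < K) a k * z k w) <= C * m.
Proof.
elim: K => [|K [C C0 IH]].
  exists 0 => // z m _ _; rewrite mul0r /nrm4 (eq_nrm (g := fun=> 0)) ?nrm_cst ?normr0//.
  by move=> w; rewrite big_ord0 expr0n.
exists (2 * C + 2 * a K ^+ 2); first by rewrite (addr_ge0 (mulr_ge0 _ C0))// mulr_ge0 ?sqr_ge0.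
move=> z m z4 zm.
have s4 : L4 (fun w => \sum_(k < K) a k * z k w) by apply: L4_sum => k _; exact: L4Z.
have [_ h] := nrm4D s4 (L4Z (a K) (z4 K)).
rewrite [nrm4 _](_ : _ = nrm4 (fun w => \sum_(k < K) a k * z k w + a K * z K w)); last first.
  by rewrite /nrm4; apply: eq_nrm => w; rewrite big_ord_recr.
apply: le_trans h _; rewrite [leRHS]mulrDl -2![in leRHS]mulrA; apply: lerD; rewrite ler_wpM2l//.
  exact: IH.
by rewrite nrm4Z// ler_wpM2l ?sqr_ge0.
Qed.

End fourth_moments.

(** * Truncation *)

Definition clip (R : realType) (r x : R) : R := Num.max (- r) (Num.min r x).

Section clip.
Context (R : realType).
Implicit Types r x y : R.

Lemma clip_cases r x : 0 <= r ->
  [\/ x < - r /\ clip r x = - r, - r <= x <= r /\ clip r x = x | r < x /\ clip r x = r].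
Proof.
rewrite /clip => r0; have [h1|h1] := leP x r; last first.
  by constructor 3; split => //; rewrite max_r//; lra.
by have [h2|h2] := leP (- r) x; [constructor 2|constructor 1].
Qed.

Lemma clip_bound r x : 0 <= r -> `|clip r x| <= r.
Proof. by move=> r0; rewrite ler_norml; case: (clip_cases x r0) => [] [h ->]; lra. Qed.

Lemma clip_le r x : 0 <= r -> `|clip r x| <= `|x|.
Proof.
move=> r0; have := ler_norm x; have := ler_norm (- x); rewrite normrN ler_norml => h1 h2.
by case: (clip_cases x r0) => [] [h ->]; lra.
Qed.

Lemma clip_sub_le r x : 0 <= r -> `|x - clip r x| <= `|x|.
Proof.
move=> r0; have := ler_norm x; have := ler_norm (- x); rewrite normrN ler_norml => h1 h2.
by case: (clip_cases x r0) => [] [h ->]; lra.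
Qed.

Lemma clip_id r x : `|x| <= r -> clip r x = x.
Proof. by rewrite ler_norml /clip => /andP[h1 h2]; rewrite min_r// max_r. Qed.

Lemma clip_lipschitz r x y : 0 <= r -> `|clip r x - clip r y| <= `|x - y|.
Proof.
move=> r0; have := ler_norm (x - y); have := ler_norm (y - x).
rewrite distrC ler_norml => h1 h2.
by case: (clip_cases x r0) => [] [h ->]; case: (clip_cases y r0) => [] [h' ->]; lra.
Qed.

Lemma measurable_clip d (T : measurableType d) r (f : T -> R) :
  measurable_fun setT f -> measurable_fun setT (fun w => clip r (f w)).
Proof. by move=> mf; apply: measurable_maxr => //; exact: measurable_minr. Qed.

Lemma clip_cvg x : clip n%:R x @[n --> \oo] --> x.
Proof.
apply/cvgrPdist_le => e e0; near=> n; rewrite clip_id ?subrr ?normr0 ?ltW//.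
by near: n; exact: nbhs_infty_gtr.
Unshelve. all: by end_near. Qed.

End clip.

Section truncated_noise.
Context d (T : measurableType d) (R : realType) (P : probability T R).

Lemma L4_clip r (f : T -> R) : 0 <= r -> measurable_fun setT f ->
  L4 P (fun w => clip r (f w)).
Proof.
move=> r0 mf; apply: (@L4_bounded _ _ _ _ _ r); first exact: measurable_clip.
by move=> w; exact: clip_bound.
Qed.

Lemma nrm4_clip_le r (f : T -> R) : 0 <= r -> L4 P f ->
  nrm4 P (fun w => clip r (f w)) <= nrm4 P f.
Proof.
move=> r0 [mf f2]; apply: nrm_le f2.
  by apply: measurable_funX; exact: measurable_clip.
by move=> w; rewrite !normrX lerXn2r ?nnegrE//; exact: clip_le.
Qed.

Lemma nrm4_clip_cvg (f : T -> R) : L4 P f ->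
  nrm4 P (fun w => f w - clip n%:R (f w)) @[n --> \oo] --> (0 : R).
Proof.
move=> [mf f2].
pose F (n : nat) w := (f w - clip n%:R (f w)) ^+ 2.
have mF n : measurable_fun setT (F n).
  by apply: measurable_funX; apply: measurable_funB => //; exact: measurable_clip.
have Ff w : F n w @[n --> \oo] --> (0 : R).
  have Hc : f w - clip n%:R (f w) @[n --> \oo] --> (0 : R).
    by rewrite -(subrr (f w)); apply: cvgB; [exact: cvg_cst|exact: clip_cvg].
  by rewrite -[X in _ --> X](mulr0 (0 : R)); exact: (cvgM Hc Hc).
have Fg n w : `|F n w| <= f w ^+ 2.
  rewrite /F normrX -(real_normK (num_real (f w))) lerXn2r ?nnegrE//.
  exact: clip_sub_le.
have := nrm_dominated mF (measurable_cst (0 : R)) Ff f2 Fg.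
apply: cvg_trans; apply: near_eq_cvg; apply/nearW => n.
by rewrite /nrm4; apply: eq_nrm => w; rewrite /F /cst subr0.
Qed.

(** Both expectations are integrals against the common law on the line. *)
Lemma same_distribution_Ex (U V : T -> R) (f : R -> R) :
  measurable_fun setT U -> measurable_fun setT V -> measurable_fun setT f ->
  same_distribution P U V -> L1 P (fun w => f (U w)) ->
  L1 P (fun w => f (V w)) /\ Ex P (fun w => f (V w)) = Ex P (fun w => f (U w)).
Proof.
move=> mU mV mf UV fU1.
pose U' : {mfun T >-> R} := HB.pack U (isMeasurableFun.Build _ _ _ _ U mU).
pose V' : {mfun T >-> R} := HB.pack V (isMeasurableFun.Build _ _ _ _ V mV).
pose m1 : probability R R := distribution P U'.
pose m2 : probability R R := distribution P V'.
have eqm (g : R -> \bar R) : (\int[m1]_z g z = \int[m2]_z g z)%E.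
  by apply: eq_measure_integral => A mA _; exact: UV.
have fV1 : L1 P (fun w => f (V w)).
  apply/integrableP; split; first by apply/measurable_EFinP; exact: measurableT_comp.
  have := @ge0_integral_distribution _ _ _ _ _ P V' (fun z => `|(f z)%:E|%E).
  rewrite /comp /= => <-//; last exact/measurable_EFinP/measurable_abs.
  rewrite -/m2 -eqm.
  have := @ge0_integral_distribution _ _ _ _ _ P U' (fun z => `|(f z)%:E|%E).
  rewrite /comp /= => ->//; last exact/measurable_EFinP/measurable_abs.
  by have /integrableP[] := fU1.
split => //; apply/EFin_inj; rewrite -!EFin_Ex//.
have := @integral_distribution _ _ _ _ _ P V' (fun z => (f z)%:E).
rewrite /comp /= => <-//; last exact/measurable_EFinP.
have := @integral_distribution _ _ _ _ _ P U' (fun z => (f z)%:E).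
rewrite /comp /= => <-//; last exact/measurable_EFinP.
Qed.

Lemma same_distribution_nrm4 (U V : T -> R) (f : R -> R) :
  measurable_fun setT U -> measurable_fun setT V -> measurable_fun setT f ->
  same_distribution P U V -> L4 P (fun w => f (U w)) ->
  L4 P (fun w => f (V w)) /\ nrm4 P (fun w => f (V w)) = nrm4 P (fun w => f (U w)).
Proof.
move=> mU mV mf UV [mfU [_ fU]].
have mf4 : measurable_fun setT (fun x : R => (f x ^+ 2) ^+ 2).
  by apply: measurable_funX; exact: measurable_funX.
have [h1 h2] := same_distribution_Ex mU mV mf4 UV fU.
have mfV : measurable_fun setT (fun w => f (V w)) by exact: measurableT_comp.
by split; [split => //; split => //; exact: measurable_funX|rewrite /nrm4 /nrm h2].
Qed.

Lemma measurable_on_subc (Z : nat -> T -> R) (A : nat -> Prop) (U : T -> R) (c : R) :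
  measurable_on Z A U -> measurable_on Z A (fun w => U w - c).
Proof. by move=> mU; apply: measurable_funB => //; exact: measurable_cst. Qed.

Lemma measurable_on_subr (Z : nat -> T -> R) A (U V : T -> R) :
  measurable_on Z A U -> measurable_on Z A V -> measurable_on Z A (fun w => U w - V w).
Proof. by move=> mU mV; exact: measurable_funB. Qed.

Section product_of_linear_forms.
Variable Z : nat -> T -> R.
Hypothesis Z4 : forall j, L4 P (Z j).
Hypothesis iZ : forall n, mutually_independent P (fun i : 'I_n => Z i).
Hypothesis sZ : forall j, same_distribution P (Z 0%N) (Z j).
Variables q K : nat.
Hypothesis q0 : (0 < q)%N.
Variables a b : nat -> R.

Let y (t : nat) w :=
  (\sum_(k < K) a k * Z (t * q + k) w) * (\sum_(k < K) b k * Z (t * q + k) w).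

(** Truncating the noise at a high level changes all the summands by equally little in
    L^2, because the noise variables have one law and products are continuous from L^4 to
    L^2.  Short-range dependence turns this into a bound on the sums that is uniform in n,
    and the truncated summands are bounded. *)
Lemma linear_product_stein_clt :
  stein_clt P (fun n w => (Num.sqrt n%:R)^-1 * \sum_(t < n) (y t w - Ex P (y t))).
Proof.
have mZ j := L4_measurable (Z4 j).
pose m := nrm4 P (Z 0%N); have m0 : 0 <= m by exact: nrm_ge0.
have Zm j : nrm4 P (Z j) = m.
  by have [_] := same_distribution_nrm4 (mZ 0%N) (mZ j) (@measurable_id _ R setT) (sZ j) (Z4 0%N).
pose Tr r j w := clip r (Z j w).
have Tr4 r j : 0 <= r -> L4 P (Tr r j) by move=> r0; exact: L4_clip.
pose e r := nrm4 P (fun w => Z 0%N w - Tr r 0%N w).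
have Tre r j : 0 <= r -> nrm4 P (fun w => Z j w - Tr r j w) = e r.
  move=> r0; have mf : measurable_fun setT (fun x : R => x - clip r x).
    by apply: measurable_funB => //; exact: measurable_clip.
  by have [] := same_distribution_nrm4 (mZ 0%N) (mZ j) mf (sZ j) (L4B (Z4 0%N) (Tr4 r _ r0)).
have [Ca Ca0 HCa] := nrm4_linear P K a; have [Cb Cb0 HCb] := nrm4_linear P K b.
pose lin (c : nat -> R) (z : nat -> T -> R) t w := \sum_(k < K) c k * z (t * q + k)%N w.
have La z v t : (forall j, L4 P (z j)) -> (forall j, nrm4 P (z j) <= v) ->
    nrm4 P (lin a z t) <= Ca * v.
  by move=> z4 zv; exact: (HCa (fun k => z (t * q + k)%N)).
have Lb z v t : (forall j, L4 P (z j)) -> (forall j, nrm4 P (z j) <= v) ->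
    nrm4 P (lin b z t) <= Cb * v.
  by move=> z4 zv; exact: (HCb (fun k => z (t * q + k)%N)).
have lin4 c z t : (forall j, L4 P (z j)) -> L4 P (lin c z t).
  by move=> z4; apply: L4_sum => k _; exact: L4Z.
have linB c z z' t w : lin c z t w - lin c z' t w = lin c (fun j w => z j w - z' j w) t w.
  by rewrite /lin -sumrB; apply: eq_bigr => k _; rewrite mulrBr.
have linm c z t : (forall j, measurable_on Z (eq j) (z j)) ->
    measurable_on Z (window q K t) (lin c z t).
  move=> mz; apply: measurable_on_sum => k _; apply: measurable_funM; first exact: measurable_cst.
  by apply: (measurable_on_sub _ (mz _)) => j <-; rewrite /window leq_addr/= ltn_add2l.
have Zon j : measurable_on Z (eq j) (Z j) by exact: measurable_on_coord.
have Tron r j : measurable_on Z (eq j) (Tr r j).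
    exact: (@measurable_clip R _ (g_sigma_algebraType (cylinders Z (eq j))) r _ (Zon j)).
pose y' r t w := lin a (Tr r) t w * lin b (Tr r) t w.
have y2 t : L2 P (y t) by apply: L4M; exact: lin4.
have y'2 r t : 0 <= r -> L2 P (y' r t) by move=> r0; apply: L4M; apply: lin4 => j; exact: Tr4.
have dist r t : 0 <= r ->
    nrm P (fun w => y t w - y' r t w) <= 2 * Num.sqrt (Ca * Cb * m * e r).
  move=> r0; have ZT4 j := L4B (Z4 j) (Tr4 r j r0); have T4 j := Tr4 r j r0.
  rewrite (eq_nrm (g := fun w => lin a (fun j w => Z j w - Tr r j w) t w * lin b Z t w +
    lin a (Tr r) t w * lin b (fun j w => Z j w - Tr r j w) t w)); last first.
    by move=> w; rewrite -!linB /y' /y -/(lin a Z t w) -/(lin b Z t w); ring.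
  apply: le_trans (nrm_tri (L4M (lin4 _ _ _ ZT4) (lin4 _ _ _ Z4)) (L4M (lin4 _ _ _ T4) (lin4 _ _ _ ZT4))) _.
  have e0 : 0 <= e r by exact: nrm_ge0.
  rewrite mulr2n mulrDl mul1r; apply: lerD.
    apply: nrm_le_sqrt; apply: le_trans (sqr_nrmM (lin4 _ _ _ ZT4) (lin4 _ _ _ Z4)) _.
    rewrite (_ : Ca * Cb * m * e r = (Ca * e r) * (Cb * m)); last by ring.
    apply: ler_pM; rewrite ?nrm_ge0//.
      by apply: La => // k; rewrite Tre.
    by apply: Lb => // k; rewrite Zm.
  apply: nrm_le_sqrt; apply: le_trans (sqr_nrmM (lin4 _ _ _ T4) (lin4 _ _ _ ZT4)) _.
  rewrite (_ : Ca * Cb * m * e r = (Ca * m) * (Cb * e r)); last by ring.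
  apply: ler_pM; rewrite ?nrm_ge0//.
    by apply: La => // k; rewrite -(Zm k); exact: nrm4_clip_le.
  by apply: Lb => // k; rewrite Tre.
(* A bound per summand gives a bound on the normalized sum, uniformly in n. *)
have near_ (z : nat -> T -> R) v : (forall t, L2 P (z t)) ->
    (forall t, measurable_on Z (window q K t) (z t)) ->
    (forall t, nrm P (z t) <= v) -> forall n,
    nrm P (fun w => (Num.sqrt n%:R)^-1 * \sum_(t < n) (z t w - Ex P (z t))) <=
      Num.sqrt ((2 * K + 1)%:R * v ^+ 2).
  move=> z2 mz zv n.
  have zc2 t : L2 P (fun w => z t w - Ex P (z t)) by apply: L2B => //; exact: L2_cst.
  have s2 : L2 P (fun w => \sum_(t < n) (z t w - Ex P (z t))) by exact: L2_sum.
  apply: nrm_le_sqrt; rewrite nrmZ// exprMn sqr_nrm real_normK ?num_real//.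
  rewrite exprVn sqr_sqrtr ?ler0n//.
  have zc0 t : Ex P (fun w => z t w - Ex P (z t)) = 0.
    by rewrite ExB ?Ex_cst ?subrr//; [exact: L2_L1|exact: L1_cst].
  have mzc t : measurable_on Z (window q K t) (fun w => z t w - Ex P (z t)).
    exact: (measurable_on_subc _ (mz t)).
  have dot0 s t := window_dot0 mZ iZ q0 mzc (fun t => L2_L1 (zc2 t)) zc0 (s:=s) (t:=t).
  have zv2 t : Ex P (fun w => (z t w - Ex P (z t)) ^+ 2) <= v ^+ 2.
    rewrite Ex_center_sqr//; apply: (@le_trans _ _ (Ex P (fun w => z t w ^+ 2))).
      by rewrite lerBlDr lerDl sqr_ge0.
    by rewrite -sqr_nrm lerXn2r ?nnegrE ?nrm_ge0//; apply: le_trans (zv t); exact: nrm_ge0.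
  have h := @Ex_sqr_sum_short_range _ _ _ P K n _ _ zc2 dot0 zv2.
  case: n s2 h => [|n] s2 h.
    by rewrite invr0 mul0r mulr_ge0 ?sqr_ge0.
  by rewrite mulrC ler_pdivrMr ?ltr0n// mulrC.
have yv t : nrm P (y t) <= Num.sqrt (Ca * m * (Cb * m)).
  apply: nrm_le_sqrt.
  apply: le_trans (sqr_nrmM (lin4 a _ t Z4) (lin4 b _ t Z4)) _.
  by apply: ler_pM; rewrite ?nrm_ge0//; [apply: La|apply: Lb] => // k; rewrite Zm.
have my t : measurable_on Z (window q K t) (y t).
  by apply: measurable_funM; exact: linm.
apply: (@stein_clt_approx _ _ _ P _ (Num.sqrt ((2 * K + 1)%:R * (Num.sqrt (Ca * m * (Cb * m))) ^+ 2))).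
- move=> n; apply: L2Z; apply: L2_sum => t _; apply: L2B => //; exact: L2_cst.
- by apply: near_.
move=> eps eps0.
pose D := (2 * K + 1)%:R * 4 * (Ca * Cb * m).
have D0 : 0 <= D by rewrite !mulr_ge0.
have de : 0 < eps ^+ 2 / (D + 1) by rewrite divr_gt0 ?exprn_gt0// ltr_wpDl.
have /cvgrPdist_le/(_ _ de)[N _ /(_ N (leqnn N))] := nrm4_clip_cvg (Z4 0%N).
rewrite sub0r normrN -/(e N%:R) (ger0_norm (nrm_ge0 _ _)) => eN.
exists (fun n w => (Num.sqrt n%:R)^-1 * \sum_(t < n) (y' N%:R t w - Ex P (y' N%:R t))).
have N0 : 0 <= N%:R :> R by [].
have my' t : measurable_on Z (window q K t) (y' N%:R t).
  by apply: measurable_funM; exact: linm.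
have linbound c : exists B, forall t w, `|lin c (Tr N%:R) t w| <= B.
  exists (\sum_(k < K) `|c k| * N%:R) => t w; apply: le_trans (ler_norm_sum _ _ _) _.
  by apply: ler_sum => k _; rewrite normrM ler_wpM2l//; exact: clip_bound.
split.
- move=> n; apply: L2Z; apply: L2_sum => t _; apply: L2B; [exact: y'2|exact: L2_cst].
- have [Ba HBa] := linbound a; have [Bb HBb] := linbound b.
  have y'B t w : `|y' N%:R t w| <= Ba * Bb by rewrite normrM; apply: ler_pM.
  apply: (@bounded_stein_clt _ _ _ P Z mZ iZ q K q0
    (fun t w => y' N%:R t w - Ex P (y' N%:R t)) (Ba * Bb + Ba * Bb)).
  + by move=> t; exact: (measurable_on_subc _ (my' t)).
  + move=> t w; apply: le_trans (ler_normB _ _) _; apply: lerD => //.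
    apply: le_trans (ler_norm_Ex (L2_L1 (y'2 _ t N0))) _; rewrite -(Ex_cst P (Ba * Bb)).
    by apply: le_Ex; [exact/L1_abs/L2_L1/y'2|exact: L1_cst|].
  + by move=> t; rewrite ExB ?Ex_cst ?subrr//; [exact/L2_L1/y'2|exact: L1_cst].
apply/nearW => n.
pose z t w := y t w - y' N%:R t w.
have z2 t : L2 P (z t) by apply: L2B => //; exact: y'2.
rewrite (eq_nrm (g := fun w => (Num.sqrt n%:R)^-1 * \sum_(t < n) (z t w - Ex P (z t)))); last first.
  move=> w; rewrite -mulrBr -sumrB; congr (_ * _); apply: eq_bigr => t _.
  by rewrite /z ExB; [ring|exact: L2_L1|exact/L2_L1/y'2].
apply: le_trans (near_ z _ z2 _ (fun t => dist _ t N0) n) _.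
  by move=> t; exact: (measurable_on_subr (my t) (my' t)).
rewrite -(ger0_norm (ltW eps0)) -sqrtr_sqr; apply: ler_wsqrtr.
rewrite exprMn sqr_sqrtr; last by rewrite !mulr_ge0// nrm_ge0.
have -> : (2 * K + 1)%:R * (2 ^+ 2 * (Ca * Cb * m * e N%:R)) = D * e N%:R by rewrite /D; ring.
apply: (@le_trans _ _ ((D + 1) * e N%:R)).
  by rewrite ler_wpM2r ?nrm_ge0// lerDl.
by rewrite mulrC -ler_pdivlMr// ltr_wpDl.
Qed.

End product_of_linear_forms.

End truncated_noise.

(** * Moments of Levy processes *)

Section linear_growth.
Context (R : realType).

Lemma additive_mulrn (v : R -> R) (t : R) (n : nat) :
  (forall s t : R, 0 <= s -> 0 <= t -> v (s + t) = v s + v t) -> 0 <= t ->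
  v (n%:R * t) = n%:R * v t.
Proof.
move=> vD t0; have v0 : v 0 = 0.
  by have := vD 0 0 (lexx _) (lexx _); rewrite addr0 => /eqP; rewrite -subr_eq subrr => /eqP.
elim: n => [|n IH]; first by rewrite !mul0r.
by rewrite -addn1 natrD !mulrDl !mul1r vD ?mulr_ge0// IH.
Qed.

(** Additivity gives the formula at rational times, and monotonicity, which follows
    from nonnegativity, at all others. *)
Lemma additive_ge0_linear (v : R -> R) :
  (forall s t : R, 0 <= s -> 0 <= t -> v (s + t) = v s + v t) ->
  (forall t : R, 0 <= t -> 0 <= v t) -> forall t : R, 0 <= t -> v t = t * v 1.
Proof.
move=> vD v0 t t0; have v1 : 0 <= v 1 by exact: v0.
have vmono s u : 0 <= s -> s <= u -> v s <= v u.
  move=> s0 su; rewrite -(subrK s u) vD ?subr_ge0// lerDr v0// subr_ge0//.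
have vn n : v n%:R = n%:R * v 1 by rewrite -{1}[n%:R]mulr1 additive_mulrn.
(* Both v (n t) and n t v 1 lie between k v 1 and (k + 1) v 1 for k the integer part of n t. *)
suff H (n : nat) : `|n%:R * (v t - t * v 1)| <= v 1.
  apply/eqP; rewrite -subr_eq0 -normr_eq0 eq_le normr_ge0 andbT leNgt; apply/negP => h0.
  pose n := Num.bound (v 1 / `|v t - t * v 1|).
  have := H n; rewrite normrM normr_nat -ler_pdivlMr// leNgt => /negP; apply.
  by apply: archi_boundP; rewrite divr_ge0.
have nt0 : 0 <= n%:R * t by rewrite mulr_ge0.
have /andP[h1 h2] := truncn_itv nt0; set k := Num.truncn _ in h1 h2.
have := vmono _ _ (ler0n _ k) h1; have := vmono _ _ nt0 (ltW h2).
rewrite !vn additive_mulrn// => h3 h4; rewrite mulrBr mulrA ler_norml.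
by move: h3; rewrite -natr1; nra.
Qed.

End linear_growth.

Lemma le_sqr (R : realType) (x y : R) : 0 <= x -> x <= y -> x ^+ 2 <= y ^+ 2.
Proof. by move=> x0 xy; rewrite lerXn2r ?nnegrE// (le_trans x0). Qed.

Section independence_tools.
Context d (T : measurableType d) (R : realType) (P : probability T R).

Lemma indep_rv_comp (U V : T -> R) (f g : R -> R) : measurable_fun setT f ->
  measurable_fun setT g -> indep_rv P U V -> indep_rv P (fun w => f (U w)) (fun w => g (V w)).
Proof.
move=> mf mg UV C D mC mD; apply: (UV (f @^-1` C) (g @^-1` D)).
  by rewrite -[X in measurable X]setTI; exact: mf.
by rewrite -[X in measurable X]setTI; exact: mg.
Qed.

Lemma ae_prob_eq (A B : set T) : measurable A -> measurable B ->
  {ae P, forall w, A w <-> B w} -> P A = P B.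
Proof.
move=> mA mB AB.
rewrite -(setIT A) -(setIT B) -!integral_indic//.
apply: ae_eq_integral => //.
- by apply/measurable_EFinP; exact: measurable_indic.
- by apply/measurable_EFinP; exact: measurable_indic.
apply: filterS AB => w ABw _; rewrite !indicE; congr ((_ : bool)%:R)%:E.
by apply/idP/idP => /set_mem ?; apply/mem_set/ABw.
Qed.

(** Weighting by h (V) = (1 + V^2)^-2 makes U^4 comparable to (U + V)^4 + 1, and independence
    factors the weight out. *)
Lemma indep_sum_L4 (U V : T -> R) : measurable_fun setT U -> measurable_fun setT V ->
  indep_rv P U V -> L4 P (fun w => U w + V w) -> L4 P U.
Proof.
move=> mU mV UV S4.
pose h (v : R) := ((1 + v ^+ 2)^-1) ^+ 2.
have hp (v : R) : 0 < 1 + v ^+ 2 by rewrite ltr_pwDl// sqr_ge0.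
have h0 v : 0 <= h v by exact: sqr_ge0.
have inv1 v : (1 + v ^+ 2)^-1 <= 1 :> R by rewrite invf_le1// lerDl sqr_ge0.
have h1 v : h v <= 1 by rewrite /h expr_le1// ?inv1// invr_ge0 ltW.
have mi : measurable_fun setT (fun v : R => (1 + v ^+ 2)^-1).
  apply: continuous_measurable_fun => x; apply: cvgV; first by rewrite gt_eqF.
  by apply: cvgD; [exact: cvg_cst|exact: exprn_continuous].
have mh : measurable_fun setT h by exact: measurable_funX.
have v4h v : (v ^+ 2) ^+ 2 * h v <= 1.
  rewrite /h -exprMn expr_le1//; last by rewrite mulr_ge0 ?sqr_ge0// invr_ge0 ltW.
  by rewrite ler_pdivrMr// mul1r lerDr.
have hV2 : L2 P (fun w => (1 + V w ^+ 2)^-1).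
  apply: (@L2_bounded _ _ _ P _ 1); first exact: (measurableT_comp mi mV).
  by move=> w; rewrite ger0_norm// invr_ge0 ltW.
pose c := Ex P (fun w => h (V w)).
have c0 : 0 < c.
  rewrite lt_neqAle Ex_ge0 ?andbT; last by move=> w; exact: h0.
  apply/eqP => c0; have := Ex_sqr0_ae hV2 (esym c0); move=> [N [mN N0 HN]].
  have : P setT = 0%E.
    apply: (@subset_measure0 _ _ _ P _ N) => // w _; apply: HN => /= /eqP.
    by rewrite invr_eq0 gt_eqF.
  by rewrite probability_setT => /eqP; rewrite eqe oner_eq0.
pose C := Ex P (fun w => 8 * ((U w + V w) ^+ 2) ^+ 2 + 8).
have C1 : L1 P (fun w => 8 * ((U w + V w) ^+ 2) ^+ 2 + 8).
  by apply: L1D; [apply/L1Z/L2_sqr/L4_sqr|exact: L1_cst].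
pose F n w := (clip n%:R (U w) ^+ 2) ^+ 2.
have mclip n : measurable_fun setT (fun x : R => (clip n%:R x ^+ 2) ^+ 2).
  by apply: measurable_funX; apply: measurable_funX; exact: measurable_clip.
have F1 n : L1 P (F n).
  by apply: L2_sqr; apply: L4_sqr; exact: L4_clip.
have FU n w : F n w <= (U w ^+ 2) ^+ 2.
  apply: le_sqr; first exact: sqr_ge0.
  by rewrite -[leLHS]real_normK ?num_real// -[leRHS]real_normK ?num_real// le_sqr// clip_le.
have Ub w : (U w ^+ 2) ^+ 2 * h (V w) <= 8 * ((U w + V w) ^+ 2) ^+ 2 + 8.
  have := v4h (V w); have := h0 (V w); have := h1 (V w).
  set H := h (V w); set u := U w; set v := V w => H1 H0 H4.
  have E4 : (u ^+ 2) ^+ 2 <= 8 * ((u + v) ^+ 2) ^+ 2 + 8 * (v ^+ 2) ^+ 2.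
    have E2 (x y : R) : (x + y) ^+ 2 <= 2 * x ^+ 2 + 2 * y ^+ 2.
      by rewrite -subr_ge0 (_ : _ - _ = (x - y) ^+ 2) ?sqr_ge0//; ring.
    have e1 : u ^+ 2 <= 2 * (u + v) ^+ 2 + 2 * v ^+ 2.
      by have := E2 (u + v) (- v); rewrite addrK sqrrN.
    have e2 := E2 (2 * (u + v) ^+ 2) (2 * v ^+ 2).
    have e3 : (u ^+ 2) ^+ 2 <= (2 * (u + v) ^+ 2 + 2 * v ^+ 2) ^+ 2.
      by apply: le_sqr e1; exact: sqr_ge0.
    by apply: le_trans e3 _; apply: le_trans e2 _; rewrite !exprMn -!natrX !mulrA -!natrM.
  have A0 : 0 <= ((u + v) ^+ 2) ^+ 2 by exact: sqr_ge0.
  have : (u ^+ 2) ^+ 2 * H <= (8 * ((u + v) ^+ 2) ^+ 2 + 8 * (v ^+ 2) ^+ 2) * H.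
    by rewrite ler_wpM2r.
  by nra.
have FC n : Ex P (F n) <= C / c.
  rewrite ler_pdivlMr//.
  have iF := indep_rv_comp (mclip n) mh UV.
  have hV1 : L1 P (fun w => h (V w)) by exact: L2_sqr hV2.
  have [Fh1 <-] := indep_rv_Ex (F1 n) hV1 iF.
  apply: le_Ex => // w; apply: le_trans (Ub w).
  by rewrite ler_wpM2r//; exact: FU.
split => //; split; first exact: measurable_funX.
have [] // := @Ex_fatou _ _ _ P F (fun w => (U w ^+ 2) ^+ 2) (C / c) _ _ F1 _ _ _.
- by move=> n; exact: L1_measurable (F1 n).
- by move=> n x; exact: sqr_ge0.
- move=> w; have h2 : clip n%:R (U w) @[n --> \oo] --> U w by exact: clip_cvg.
  by apply: (cvgM (f := fun n => clip n%:R (U w) ^+ 2)); exact: (cvgM h2 h2).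
- by move=> e e0; apply/nearW => n; rewrite (le_trans (FC n))// lerDl ltW.
- by apply: measurable_funX; exact: measurable_funX.
Qed.

End independence_tools.

Section one_sided.
Context d (T : measurableType d) (R : realType) (P : probability T R).
Variable L : R -> T -> R.
Hypothesis HL : one_sided_levy P L.
Hypothesis L4_1 : L4 P (L 1).

Let mL t : 0 <= t -> measurable_fun setT (L t).
Proof. exact: (levy_measurable HL). Qed.

Let L0 w : L 0 w = 0. Proof. exact: (levy_start0 HL). Qed.

Definition incr (L : R -> T -> R) (s t : R) (w : T) : R := L t w - L s w.

Lemma measurable_incr s t : 0 <= s -> 0 <= t -> measurable_fun setT (incr L s t).
Proof. by move=> s0 t0; apply: measurable_funB; exact: mL. Qed.

Lemma levy_same s h : 0 <= s -> 0 <= h -> same_distribution P (L h) (incr L s (s + h)).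
Proof.
move=> s0 h0 B mB; have := levy_stationary_increments HL (lexx 0) h0 s0 mB.
rewrite add0r (addrC h s) => ->; congr (P _); apply/seteqP.
by split => w /=; rewrite /incr L0 subr0.
Qed.

Lemma levy_indep s t : 0 <= s -> s <= t -> indep_rv P (L s) (incr L s t).
Proof.
move=> s0 st C D mC mD.
pose tm (i : nat) : R := if i is i'.+1 then (if i' is 0 then s else t) else 0.
have tmm : {homo tm : i j / (i <= j)%N >-> i <= j}.
  case=> [|[|i]] [|[|j]] //= _; exact: le_trans st.
have := @levy_independent_increments _ _ _ _ _ HL 2 tm (lexx _) tmm.
move=> /(_ (fun i => if (i : nat) == 0%N then C else D)).
rewrite big_ord_recl big_ord1.
have -> : P (L s @^-1` C) = P ((fun w => L s w - L 0 w) @^-1` C).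
  by congr (P _); apply/seteqP; split => w /=; rewrite L0 subr0.
move=> <-.
  congr (P _); apply/seteqP; split => w /=.
    by move=> [wC wD] [[|[|i]] Hi] _ //=; rewrite L0 subr0.
  move=> H; split; last exact: (H (lift ord0 ord0)).
  by have := H ord0 Logic.I; rewrite /= L0 subr0.
by move=> i; case: ifP.
Qed.

(** For t <= 1 the variable L_1 is the sum of L_t and an independent increment; longer
    times are reached by adding unit increments. *)
Lemma levy_L4 t : 0 <= t -> L4 P (L t).
Proof.
have le1 s : 0 <= s -> s <= 1 -> L4 P (L s).
  move=> s0 s1; have m1 := mL s0; have m2 := measurable_incr s0 ler01.
  apply: (indep_sum_L4 m1 m2 (levy_indep s0 s1)).
  by apply: eq_L4 L4_1 => w; rewrite /incr addrC subrK.
have [n tn] : exists n : nat, t <= n%:R.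
  by exists (Num.bound `|t|); apply/ltW; apply: le_lt_trans (ler_norm t) (archi_boundP _).
elim: n t tn => [|n IH] t tn t0; first by apply: le1 => //; exact: le_trans tn ler01.
have [t1|t1] := leP t 1; first exact: le1.
have t10 : 0 <= t - 1 by rewrite subr_ge0 ltW.
have sd : same_distribution P (L 1) (incr L (t - 1) t).
  by have := levy_same t10 ler01; rewrite subrK.
have [h _] := same_distribution_nrm4 (mL ler01) (measurable_incr t10 t0)
  (@measurable_id _ R setT) sd L4_1.
apply: eq_L4 (L4D (IH _ _ t10) h) => [w|]; first by rewrite /incr addrC subrK.
by rewrite lerBlDr natr1.
Qed.

Lemma incr_L4 s t : 0 <= s -> 0 <= t -> L4 P (incr L s t).
Proof. by move=> s0 t0; apply: L4B; exact: levy_L4. Qed.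

Lemma incr_Ex (f : R -> R) s h : 0 <= s -> 0 <= h -> measurable_fun setT f ->
  L1 P (fun w => f (L h w)) -> Ex P (fun w => f (incr L s (s + h) w)) = Ex P (fun w => f (L h w)).
Proof.
move=> s0 h0 mf f1; have m2 := measurable_incr s0 (addr_ge0 s0 h0).
by have [] := same_distribution_Ex (mL h0) m2 mf (levy_same s0 h0) f1.
Qed.

(** Mixed moments of L_s and of the increment after s, which has the law of L_t. *)
Let EM (f g : R -> R) s t : 0 <= s -> 0 <= t -> measurable_fun setT f -> measurable_fun setT g ->
  L1 P (fun w => f (L s w)) -> L1 P (fun w => g (L t w)) ->
  L1 P (fun w => f (L s w) * g (incr L s (s + t) w)) /\
  Ex P (fun w => f (L s w) * g (incr L s (s + t) w)) =
  Ex P (fun w => f (L s w)) * Ex P (fun w => g (L t w)).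
Proof.
move=> s0 t0 mf mg f1 g1; have m2 := measurable_incr s0 (addr_ge0 s0 t0).
have sst : s <= s + t by rewrite lerDl.
have [h1 h2] := same_distribution_Ex (mL t0) m2 mg (levy_same s0 t0) g1.
have [h3 ->] := indep_rv_Ex f1 h1 (indep_rv_comp mf mg (levy_indep s0 sst)).
by rewrite h2.
Qed.

Let mid : measurable_fun setT (fun x : R => x). Proof. exact: measurable_id. Qed.
Let mX n : measurable_fun setT (fun x : R => x ^+ n). Proof. exact: measurable_funX. Qed.

Lemma levy_mean_additive s t : 0 <= s -> 0 <= t ->
  Ex P (L (s + t)) = Ex P (L s) + Ex P (L t).
Proof.
move=> s0 t0; have e : Ex P (incr L s (s + t)) = Ex P (L t).
  exact: (incr_Ex s0 t0 mid (L4_L1 (levy_L4 t0))).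
rewrite -e -ExD; [|exact/L4_L1/levy_L4|exact/L4_L1/incr_L4/addr_ge0].
by apply: eq_Ex => w; rewrite /incr addrCA subrr addr0.
Qed.

Let variance t := Ex P (fun w => L t w ^+ 2) - Ex P (L t) ^+ 2.

Let variance_ge0 t : 0 <= t -> 0 <= variance t.
Proof.
move=> t0; rewrite /variance -Ex_center_sqr; last exact/L4_L2/levy_L4.
by apply: Ex_ge0 => w; exact: sqr_ge0.
Qed.

(** Unlike the mean, the variance is nonnegative, so additivity makes it linear without any
    appeal to the regularity of paths. *)
Lemma levy_variance t : 0 <= t -> variance t = t * variance 1.
Proof.
apply: (additive_ge0_linear (v := variance)); last exact: variance_ge0.
move=> s u s0 u0.
have s4 := levy_L4 s0; have u4 := levy_L4 u0; have su0 := addr_ge0 s0 u0.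
have [xy1 xy] := EM s0 u0 mid mid (L4_L1 s4) (L4_L1 u4).
have yy := incr_Ex s0 u0 (mX 2) (L2_sqr (L4_L2 u4)).
have y2 := L2_sqr (L4_L2 (incr_L4 s0 su0)).
rewrite /variance levy_mean_additive//.
rewrite (eq_Ex (g := fun w => L s w ^+ 2 + 2 * (L s w * incr L s (s + u) w) +
  incr L s (s + u) w ^+ 2)); last by move=> w; rewrite /incr; ring.
have s2 := L2_sqr (L4_L2 s4).
rewrite ExD//; last by apply: L1D => //; exact: L1Z.
by rewrite ExD ?ExZ ?xy ?yy//; [ring|exact: L1Z].
Qed.

Hypothesis mean1 : Ex P (L 1) = 0.

(** The mean vanishes at rational times by additivity.  Càdlàg paths carry this
    over to all times: for small s, L_s is close to 0 in probability and to
    its mean in L^2. *)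
Lemma levy_mean0 t : 0 <= t -> Ex P (L t) = 0.
Proof.
move=> t0; pose m t := Ex P (L t).
have m1 : m 1 = 0 by [].
have mD : forall s u : R, 0 <= s -> 0 <= u -> m (s + u) = m s + m u by exact: levy_mean_additive.
(* The distance from t to the next multiple of 1 / (n + 1), where the mean is known to be 0. *)
pose s_ (n : nat) : R := (Num.truncn (n.+1%:R * t)).+1%:R / n.+1%:R - t.
have s_itv n : 0 < s_ n <= n.+1%:R^-1.
  have nt0 : 0 <= n.+1%:R * t by rewrite mulr_ge0.
  have /andP[h1 h2] := truncn_itv nt0; rewrite /s_ subr_gt0 ltr_pdivlMr// mulrC h2/=.
  by rewrite lerBlDr ler_pdivrMr// mulrDl mulVf ?pnatr_eq0// -natr1 addrC lerD2l (mulrC t).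
have s0 n : 0 <= s_ n by have /andP[/ltW] := s_itv n.
have ms n : m (s_ n) = - m t.
  apply/eqP; rewrite -subr_eq0 opprK -mD// /s_ subrK additive_mulrn ?invr_ge0//.
  have : n.+1%:R * m n.+1%:R^-1 = 0.
    by rewrite -additive_mulrn ?invr_ge0// divff ?pnatr_eq0.
  by move=> /eqP; rewrite mulf_eq0 pnatr_eq0/= => /eqP ->; rewrite mulr0.
have scvg : s_ @ \oo --> (0 : R).
  apply: (@cvg_norm_le _ _ _ _ _ (fun n => n.+1%:R^-1)); last exact: cvg_harmonic.
  by move=> n; rewrite subr0 ger0_norm//; have /andP[] := s_itv n.
have Lcvg w : `|clip 1 (L (s_ n) w)| @[n --> \oo] --> (0 : R).
  have h := levy_right_continuous HL (lexx 0) (w:=w).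
  have [+ _] := @cvg_at_rightP R (L ^~ w) 0 (L 0 w); move=> /(_ h s_); rewrite L0 => h2.
  have h3 : L (s_ n) w @[n --> \oo] --> (0 : R).
    by apply: h2; split => // n; have /andP[] := s_itv n.
  apply: (@cvg_norm_le _ _ _ _ _ (fun n => `|L (s_ n) w|)).
    by move=> n; rewrite subr0 normr_id clip_le.
  by rewrite -(@normr0 _ R); exact: cvg_norm.
have mc n : measurable_fun setT (fun w => `|clip 1 (L (s_ n) w)|).
  exact/measurable_abs/measurable_clip/mL.
have lc1 n w : `| `|clip 1 (L (s_ n) w)| | <= 1 by rewrite normr_id clip_bound.
have [_ EL] := Ex_dominated mc (measurable_cst (0 : R)) Lcvg (L1_cst P 1)
  lc1.
have bound n : `|clip 1 (- m t)| <= Num.sqrt (variance 1) * (Num.sqrt n.+1%:R)^-1 +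
    Ex P (fun w => `|clip 1 (L (s_ n) w)|).
  have s4 := levy_L4 (s0 n); have s2 := L4_L2 s4.
  have c1 : L1 P (fun w => `|clip 1 (L (s_ n) w)|).
    by apply: (@L1_bounded _ _ _ P _ 1) => // w; rewrite normr_id clip_bound.
  have d2 : L2 P (fun w => L (s_ n) w - m (s_ n)) by apply: L2B => //; exact: L2_cst.
  rewrite -(ms n) -(Ex_cst P `|clip 1 (m (s_ n))|).
  apply: (@le_trans _ _ (Ex P (fun w => `|L (s_ n) w - m (s_ n)| + `|clip 1 (L (s_ n) w)|))).
    apply: le_Ex => [||w]; first exact: L1_cst.
      by apply: L1D => //; apply/L1_abs/L2_L1.
    have -> : clip 1 (m (s_ n)) = clip 1 (L (s_ n) w) -
      (clip 1 (L (s_ n) w) - clip 1 (m (s_ n))) by ring.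
    rewrite [leRHS]addrC; apply: le_trans (ler_normB _ _) _; rewrite lerD2l.
    exact: clip_lipschitz.
  rewrite ExD//; last by apply/L1_abs/L2_L1.
  rewrite lerD2r; apply: le_trans (ler_Ex_abs_nrm d2) _.
  rewrite -sqrtrV// -sqrtrM ?variance_ge0//.
  apply: nrm_le_sqrt; rewrite sqr_nrm Ex_center_sqr// -/(variance _) levy_variance//.
  rewrite mulrC ler_wpM2l//; first exact: variance_ge0.
  by have /andP[] := s_itv n.
have lim0 : Num.sqrt (variance 1) * (Num.sqrt n.+1%:R)^-1 +
    Ex P (fun w => `|clip 1 (L (s_ n) w)|) @[n --> \oo] --> (0 : R).
  rewrite [X in _ --> X](_ : _ = Num.sqrt (variance 1) * 0 + 0); last by ring.
  apply: cvgD; last by rewrite -(Ex0 P); exact: EL.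
  apply: cvgM; first exact: cvg_cst.
  by have := @cvg_inv_sqrt R; rewrite -(cvg_shiftS _ _).
have c0 : `|clip 1 (- m t)| <= 0.
  rewrite -(cvg_lim _ lim0)//; apply: limr_ge; first exact: cvgP lim0.
  by apply/nearW => n; exact: bound.
move: c0; rewrite normr_le0 -/(m t) => /eqP.
by case: (clip_cases (- m t) ler01) => [] [h ->]; lra.
Qed.

Let sigma2 := Ex P (fun w => L 1 w ^+ 2).
Let kappa4 := Ex P (fun w => L 1 w ^+ 4) - 3 * sigma2 ^+ 2.

Lemma levy_sqr t : 0 <= t -> Ex P (fun w => L t w ^+ 2) = t * sigma2.
Proof.
move=> t0; have := levy_variance t0.
by rewrite /variance !levy_mean0// expr0n/= !subr0.
Qed.

(** The fourth cumulant k is additive in time, and it is nonnegative: k u = n k (u / n),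
    and the negative part of k (u / n) is at most of order 1 / n^2. *)
Lemma levy_fourth t : 0 <= t ->
  Ex P (fun w => L t w ^+ 4) = t * kappa4 + 3 * (t * sigma2) ^+ 2.
Proof.
pose k t := Ex P (fun w => L t w ^+ 4) - 3 * (t * sigma2) ^+ 2.
have kD : forall s u : R, 0 <= s -> 0 <= u -> k (s + u) = k s + k u.
  move=> s u s0 u0; have s4 := levy_L4 s0; have u4 := levy_L4 u0; have su0 := addr_ge0 s0 u0.
  have i4 := incr_L4 s0 su0.
  have s1 := L4_L1 s4; have u1 := L4_L1 u4.
  have s2 := L2_sqr (L4_L2 s4); have u2 := L2_sqr (L4_L2 u4).
  have s3 := L4_L1_cube s4; have u3 := L4_L1_cube u4.
  have [e31 E31] := EM s0 u0 (mX 3) mid s3 u1.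
  have [e22 E22] := EM s0 u0 (mX 2) (mX 2) s2 u2.
  have [e13 E13] := EM s0 u0 mid (mX 3) s1 u3.
  have E4 := incr_Ex s0 u0 (mX 4) (L4_L1_four u4).
  have f1 := L4_L1_four s4; have f2 := L4_L1_four i4.
  rewrite /k (eq_Ex (g := fun w => L s w ^+ 4 + (4 * (L s w ^+ 3 * incr L s (s + u) w) +
    (6 * (L s w ^+ 2 * incr L s (s + u) w ^+ 2) +
    (4 * (L s w * incr L s (s + u) w ^+ 3) + incr L s (s + u) w ^+ 4)))));
    last by move=> w; rewrite /incr; ring.
  have z1 := L1Z 4 e31; have z2 := L1Z 6 e22; have z3 := L1Z 4 e13.
  rewrite ExD//; last by do 2?[apply: L1D => //]; exact: L1D.
  rewrite ExD//; last by do 1?[apply: L1D => //]; exact: L1D.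
  rewrite ExD//; last exact: L1D.
  rewrite ExD// !ExZ// E31 E22 E13 E4 !levy_sqr// !levy_mean0//; ring.
move=> t0; suff : k t = t * k 1 by rewrite /k mul1r -/kappa4 => <-; rewrite subrK.
apply: additive_ge0_linear => // u u0.
apply/ler_addgt0Pr => e e0.
pose c := 3 * (u * sigma2) ^+ 2; have c0 : 0 <= c by rewrite mulr_ge0 ?sqr_ge0.
pose n := (Num.bound (c / e)).
have cn : c / e < n%:R by apply: archi_boundP; rewrite divr_ge0// ltW.
have n0 : 0 < n%:R :> R by apply: le_lt_trans cn; rewrite divr_ge0// ltW.
have u'0 : 0 <= u / n%:R by rewrite divr_ge0.
have -> : k u = n%:R * k (u / n%:R).
  by rewrite -additive_mulrn// mulrC divfK// gt_eqF.
apply: (@le_trans _ _ (- (c / n%:R) + e)).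
  by rewrite addrC subr_ge0 ler_pdivrMr// mulrC -ler_pdivrMr// ltW.
rewrite lerD2r.
have -> : - (c / n%:R) = n%:R * (- (3 * (u / n%:R * sigma2) ^+ 2)).
  by rewrite /c; field; rewrite gt_eqF.
rewrite ler_wpM2l ?(ltW n0)// /k -[leLHS]add0r lerD2r.
by apply: Ex_ge0 => w; rewrite exprn_even_ge0.
Qed.

(** The increments over [u, s] tend to 0 in L^2 as u increases to s, and they converge
    pointwise to the jump at s. *)
Lemma levy_left_limit s : 0 < s ->
  measurable_fun setT (fun w => lim (L u w @[u --> s^'-])) /\
  {ae P, forall w, lim (L u w @[u --> s^'-]) = L s w}.
Proof.
move=> s0; pose u_ (n : nat) : R := s - s / n.+2%:R.
have uitv n : 0 <= u_ n < s.
  rewrite /u_ subr_ge0 ler_pdivrMr// ler_peMr ?(ltW s0)//=; last by rewrite ler1n.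
  by rewrite ltrBlDr ltrDl divr_gt0.
have ucvg : u_ @ \oo --> s.
  apply: (@cvg_norm_le _ _ _ _ _ (fun n => s * n.+1%:R^-1)).
    move=> n; rewrite /u_ addrC addKr normrN ger0_norm ?divr_ge0 ?(ltW s0)//.
    by rewrite ler_wpM2l ?(ltW s0)// lef_pV2 ?posrE// ler_nat.
  rewrite -[X in _ --> X](mulr0 s); apply: cvgM; [exact: cvg_cst|exact: cvg_harmonic].
pose l w := lim (L u w @[u --> s^'-]).
have Lcvg w : L (u_ n) w @[n --> \oo] --> l w.
  have h := levy_left_limits HL s0 (w:=w).
  have [+ _] := @cvg_at_leftP R (L ^~ w) s (l w); move=> /(_ h u_).
  by apply; split => // n; have /andP[] := uitv n.
have u0 n : 0 <= u_ n by have /andP[] := uitv n.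
have ml : measurable_fun setT l.
  by apply: (measurable_fun_cvg (fun n => mL (u0 n))) => w _; exact: Lcvg.
split => //.
have V2 n : L2 P (fun w => incr L (u_ n) s w) by apply: L4_L2; apply: incr_L4 => //; exact: ltW.
have mlL : measurable_fun setT (fun w => L s w - l w).
  by apply: measurable_funB => //; exact/mL/ltW.
have Vcvg w : incr L (u_ n) s w @[n --> \oo] --> L s w - l w.
  by apply: cvgB; [exact: cvg_cst|exact: Lcvg].
have Vle (e : R) : 0 < e -> \forall n \near \oo, Ex P (fun w => incr L (u_ n) s w ^+ 2) <= 0 + e.
  move=> e0; have c : (s - u_ n) * sigma2 @[n --> \oo] --> (0 : R).
    rewrite -[X in _ --> X](mul0r sigma2) -(subrr s).
    by apply: cvgM; [apply: cvgB => //; exact: cvg_cst|exact: cvg_cst].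
  have /cvgrPdist_le/(_ _ e0) := c; apply: filterS => n.
  rewrite sub0r normrN add0r; apply: le_trans; apply: le_trans (ler_norm _).
  have sn0 : 0 <= s - u_ n by have /andP[_ /ltW] := uitv n; rewrite subr_ge0.
  have := incr_Ex (u0 n) sn0 (mX 2) (L2_sqr (L4_L2 (levy_L4 sn0))).
  by rewrite addrC subrK => ->; rewrite levy_sqr.
have [D2 D0] := Ex_sqr_fatou V2 mlL Vcvg (lexx 0) Vle.
have D00 : Ex P (fun w => (L s w - l w) ^+ 2) = 0.
  by apply/eqP; rewrite eq_le D0/=; apply: Ex_ge0 => w; exact: sqr_ge0.
apply: filterS (Ex_sqr0_ae D2 D00) => w /eqP.
by rewrite subr_eq0 => /eqP.
Qed.

End one_sided.

(** ** Two-sided processes *)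

(** Increments over the cells of the grid of mesh [dl], counted from the grid point [- m * dl]. *)
Definition grid_noise d (T : measurableType d) (R : realType) (L : R -> T -> R) (m : nat) (dl : R) (i : nat) :=
  incr L ((i%:R - m%:R) * dl) ((i.+1%:R - m%:R) * dl).

(** What the rest of the argument uses of a two-sided Levy process: moments of
    increments, and independence of the increments over a regular grid, indexed by
    the natural numbers from an arbitrary grid point on the left. *)
Record levy_noise d (T : measurableType d) (R : realType) (P : probability T R)
    (L : R -> T -> R) (sigma2 kappa4 : R) : Prop := LevyNoise {
  noise_L4 : forall s t, L4 P (incr L s t);
  noise_mean : forall s t, Ex P (incr L s t) = 0;
  noise_sqr : forall s t, Ex P (fun w => incr L s t w ^+ 2) = `|t - s| * sigma2;
  noise_fourth : forall s t, Ex P (fun w => incr L s t w ^+ 4) =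
    `|t - s| * kappa4 + 3 * (`|t - s| * sigma2) ^+ 2;
  noise_indep : forall (m n : nat) (dl : R), 0 < dl ->
    mutually_independent P (fun i : 'I_n => grid_noise L m dl i);
  noise_same : forall (m i : nat) (dl : R), 0 < dl ->
    same_distribution P (grid_noise L m dl 0) (grid_noise L m dl i) }.

Section joining.
Context d (T : measurableType d) (R : realType) (P : probability T R).

Lemma same_distribution_ae (U U' V V' : T -> R) :
  measurable_fun setT U -> measurable_fun setT U' -> measurable_fun setT V ->
  measurable_fun setT V' -> {ae P, forall w, U w = U' w} -> {ae P, forall w, V w = V' w} ->
  same_distribution P U' V' -> same_distribution P U V.
Proof.
move=> mU mU' mV mV' UU' VV' H B mB.
have pre (W : T -> R) : measurable_fun setT W -> measurable (W @^-1` B).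
  by move=> mW; rewrite -[X in measurable X]setTI; exact: mW.
rewrite (_ : P (U @^-1` B) = P (U' @^-1` B)).
  rewrite H//; apply/esym/ae_prob_eq; [exact: pre|exact: pre|].
  by apply: filterS VV' => w /= ->.
by apply: ae_prob_eq; [exact: pre|exact: pre|apply: filterS UU' => w /= ->].
Qed.

Lemma mutually_independent_ae n (Z Z' : 'I_n -> T -> R) :
  (forall i, measurable_fun setT (Z i)) -> (forall i, measurable_fun setT (Z' i)) ->
  (forall i, {ae P, forall w, Z i w = Z' i w}) ->
  mutually_independent P Z' -> mutually_independent P Z.
Proof.
move=> mZ mZ' ZZ' iZ' B mB.
have pre (W : T -> R) i : measurable_fun setT W -> measurable (W @^-1` B i).
  by move=> mW; rewrite -[X in measurable X]setTI; exact: mW.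
have -> : (\big[mule/1%E]_(i < n) P (Z i @^-1` B i) = \big[mule/1%E]_(i < n) P (Z' i @^-1` B i))%E.
  apply: eq_bigr => i _; apply: ae_prob_eq; [exact: pre|exact: pre|].
  by apply: filterS (ZZ' i) => w /= ->.
rewrite -iZ'//; apply: ae_prob_eq.
- by apply: fin_bigcap_measurable => // i _; exact: pre.
- by apply: fin_bigcap_measurable => // i _; exact: pre.
apply: filterS (filter_forall _ ZZ') => w zz.
by split => h i _; have := h i Logic.I; rewrite /= zz.
Qed.

(** Two independent sequences of independent variables, joined into the sequence
    B_(m-1), ..., B_0, A_0, A_1, ...: the increments to the left and to the right of the
    origin, in order of time. *)
Lemma mutually_independent_join (m : nat) (A B : nat -> T -> R) :
  (forall n, mutually_independent P (fun i : 'I_n => A i)) ->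
  (forall n, mutually_independent P (fun i : 'I_n => B i)) ->
  (forall n (C D : nat -> set R), (forall j, measurable (C j)) -> (forall j, measurable (D j)) ->
    P (\bigcap_(j in [set i | (i < n)%N]) (A j @^-1` C j) `&`
       \bigcap_(j in [set i | (i < n)%N]) (B j @^-1` D j)) =
    (P (\bigcap_(j in [set i | (i < n)%N]) (A j @^-1` C j)) *
       P (\bigcap_(j in [set i | (i < n)%N]) (B j @^-1` D j)))%E) ->
  forall n, mutually_independent P
    (fun i : 'I_n => if (m <= i)%N then A (i - m)%N else B (m - i.+1)%N).
Proof.
move=> iA iB iAB n S mS.
pose S' (j : nat) := if (insub j : option 'I_n) is Some i then S i else setT.
have mS' j : measurable (S' j) by rewrite /S'; case: insubP.
have S'S (i : 'I_n) : S' i = S i by rewrite /S' valK.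
have S'T j : (n <= j)%N -> S' j = setT.
  by move=> nj; rewrite /S' insubF// ltnNge nj.
pose Z (j : nat) := if (m <= j)%N then A (j - m)%N else B (m - j.+1)%N.
pose D j := if (j < m)%N then S' (m - j.+1)%N else setT.
have mD j : measurable (D j) by rewrite /D; case: ifP.
pose N := (m + n)%N.
have -> : \bigcap_(i in [set: 'I_n]) ((if (m <= i)%N then A (i - m)%N else B (m - i.+1)%N) @^-1` S i) =
    \bigcap_(j in [set i | (i < N)%N]) (A j @^-1` S' (m + j)%N) `&`
    \bigcap_(j in [set i | (i < N)%N]) (B j @^-1` D j).
  apply/seteqP; split => w /= H.
    have H' j : S' j (Z j w).
      have [nj|jn] := leqP n j; first by rewrite S'T.
      by have := H (Ordinal jn) Logic.I; rewrite /= -S'S.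
    split => j /= jN; first by have := H' (m + j)%N; rewrite /Z leq_addr addKn.
    rewrite /D; case: ifPn => // jm; have := H' (m - j.+1)%N; rewrite /Z ifF; last by lia.
    by rewrite (_ : (m - (m - j.+1).+1)%N = j)//; lia.
  move=> i _; have [H1 H2] := H; case: ifPn => mi.
    have := H1 (i - m)%N; rewrite /= subnKC// S'S; apply; rewrite /N.
    by have := ltn_ord i; lia.
  have := H2 (m - i.+1)%N; rewrite /= /D ifT; last by lia.
  by rewrite (_ : (m - (m - i.+1).+1)%N = i); [rewrite S'S; apply; rewrite /N; lia|lia].
rewrite iAB// (prob_cylinder iA)// (prob_cylinder iB)//.
transitivity (\big[mule/1%E]_(i < N) P (Z i @^-1` S' i))%E; last first.
  rewrite /N addnC big_split_ord /= [X in (_ * X)%E]big1 ?mule1; last first.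
    by move=> i _; rewrite S'T ?leq_addr// preimage_setT probability_setT.
  by apply: eq_bigr => i _; rewrite S'S.
rewrite muleC [RHS](@big_split_ord _ _ _ m n) /=; congr (mule _ _).
  rewrite /N big_split_ord /= [X in (_ * X)%E]big1 ?mule1; last first.
    by move=> i _; rewrite /D ifF ?preimage_setT ?probability_setT//; lia.
  rewrite (reindex_inj rev_ord_inj) /=; apply: eq_bigr => i _.
  have im := ltn_ord i; rewrite /Z /D ifT ?ifF; [|by lia|by lia].
  by rewrite (_ : (m - (m - i.+1).+1)%N = i)//; lia.
rewrite /N addnC big_split_ord /= [X in (_ * X)%E]big1 ?mule1; last first.
  by move=> i _; rewrite S'T ?preimage_setT ?probability_setT//; lia.
by apply: eq_bigr => i _; rewrite /Z leq_addr addKn.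
Qed.

End joining.

Section two_sided.
Context d (T : measurableType d) (R : realType) (P : probability T R).
Variables U V : R -> T -> R.
Hypothesis HU : one_sided_levy P U.
Hypothesis HV : one_sided_levy P V.
Hypothesis UVlaw : same_law P U V.
Hypothesis UVind : independent_processes P U V.
Hypothesis U4 : L4 P (U 1).
Hypothesis U0 : Ex P (U 1) = 0.

(** A type for path space, on which coordinates and increments are measurable functions. *)
Let path := g_sigma_algebraType [set E : set (R -> R) | exists t, 0 <= t /\
  exists2 B : set R, measurable B & E = [set x | B (x t)]].

Let coord t : 0 <= t -> measurable_fun [set: path] (fun x : path => x t : R).
Proof.
move=> t0 _ B mB; rewrite setTI; apply: sub_sigma_algebra.
by exists t; split => //; exists B.
Qed.

Let mpath (f : path -> R) B : measurable_fun setT f -> measurable B ->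
  @cylinder_sigma R (f @^-1` B).
Proof. by move=> mf mB; have := mf measurableT B mB; rewrite setTI. Qed.

Let same_UV t : 0 <= t -> same_distribution P (U t) (V t).
Proof. by move=> t0 B mB; exact: (UVlaw (mpath (coord t0) mB)). Qed.

Let mU t : 0 <= t -> measurable_fun setT (U t). Proof. exact: (levy_measurable HU). Qed.
Let mV t : 0 <= t -> measurable_fun setT (V t). Proof. exact: (levy_measurable HV). Qed.

Let sigma2 := Ex P (fun w => U 1 w ^+ 2).
Let kappa4 := Ex P (fun w => U 1 w ^+ 4) - 3 * sigma2 ^+ 2.

Let mX n : measurable_fun setT (fun x : R => x ^+ n). Proof. exact: measurable_funX. Qed.

Let V4 : L4 P (V 1).
Proof.
by have [] := same_distribution_nrm4 (mU ler01) (mV ler01) (@measurable_id _ R setT)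
  (same_UV ler01) U4.
Qed.

Let V0 : Ex P (V 1) = 0.
Proof.
rewrite -U0; have [_] := same_distribution_Ex (mU ler01) (mV ler01) (@measurable_id _ R setT)
  (same_UV ler01) (L4_L1 U4).
by [].
Qed.

Let V2 : Ex P (fun w => V 1 w ^+ 2) = sigma2.
Proof.
by have [] := same_distribution_Ex (mU ler01) (mV ler01) (mX 2) (same_UV ler01) (L2_sqr (L4_L2 U4)).
Qed.

Let V44 : Ex P (fun w => V 1 w ^+ 4) - 3 * sigma2 ^+ 2 = kappa4.
Proof.
by have [_ ->] := same_distribution_Ex (mU ler01) (mV ler01) (mX 4) (same_UV ler01) (L4_L1_four U4).
Qed.

(** Up to null sets the left limits in the definition of a two-sided process
    may be replaced by values. *)
Let M t w : R := if 0 <= t then U t w else - V (- t) w.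

Let mM t : measurable_fun setT (M t).
Proof.
rewrite /M; have [t0|t0] := leP 0 t; first exact: mU.
 apply: measurable_funN => //; apply: mV.
by rewrite oppr_ge0 ltW.
Qed.

Let indep_UV s t : 0 <= s -> 0 <= t -> indep_rv P (U s) (V t).
Proof.
by move=> s0 t0 C D mC mD; exact: (UVind (mpath (coord s0) mC) (mpath (coord t0) mD)).
Qed.

(** An increment that straddles 0 is the sum of two independent pieces, for which second
    and fourth cumulants add up. *)
Let moments s t : s <= t -> [/\ L4 P (incr M s t), Ex P (incr M s t) = 0,
  Ex P (fun w => incr M s t w ^+ 2) = (t - s) * sigma2 &
  Ex P (fun w => incr M s t w ^+ 4) = (t - s) * kappa4 + 3 * ((t - s) * sigma2) ^+ 2].
Proof.
have one (X : R -> T -> R) (HX : one_sided_levy P X) (X4 : L4 P (X 1)) (X0 : Ex P (X 1) = 0)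
  (X2 : Ex P (fun w => X 1 w ^+ 2) = sigma2)
  (X44 : Ex P (fun w => X 1 w ^+ 4) - 3 * sigma2 ^+ 2 = kappa4)
  a b : 0 <= a -> a <= b -> [/\ L4 P (incr X a b), Ex P (incr X a b) = 0,
  Ex P (fun w => incr X a b w ^+ 2) = (b - a) * sigma2 &
  Ex P (fun w => incr X a b w ^+ 4) = (b - a) * kappa4 + 3 * ((b - a) * sigma2) ^+ 2].
  move=> a0 ab; have b0 := le_trans a0 ab; have ba0 : 0 <= b - a by rewrite subr_ge0.
  have l4 := levy_L4 HX X4 ba0; have E f mf f1 := @incr_Ex _ _ _ _ _ HX f a _ a0 ba0 mf f1.
  rewrite [a + (b - a)]addrC subrK in E.
  split; first exact: incr_L4.
  - have := E _ (@measurable_id _ R setT) (L4_L1 l4).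
    by move=> E1; rewrite -[RHS](levy_mean0 HX X4 X0 ba0); exact: E1.
  - by rewrite (E _ (mX 2) (L2_sqr (L4_L2 l4))) levy_sqr// X2.
  - by rewrite (E _ (mX 4) (L4_L1_four l4)) levy_fourth// X2 X44.
have oneU := one U HU U4 U0 erefl erefl; have oneV := one V HV V4 V0 V2 V44.
move=> st; have [s0|s0] := leP 0 s.
  have t0 := le_trans s0 st; have [h1 h2 h3 h4] := oneU _ _ s0 st.
  have E : incr M s t = incr U s t by apply/funext => w; rewrite /incr /M s0 t0.
  by rewrite E.
have ns0 : 0 <= - s by rewrite oppr_ge0 ltW.
have [t0|t0] := leP 0 t; last first.
  have nt0 : 0 <= - t by rewrite oppr_ge0 ltW.
  have nst : - t <= - s by rewrite lerN2.
  have [h1 h2 h3 h4] := oneV _ _ nt0 nst.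
  have E : incr M s t = incr V (- t) (- s).
    by apply/funext => w; rewrite /incr /M !leNgt s0 t0 /=; ring.
  by rewrite E; split; rewrite // ?h3 ?h4 opprK [- s + t]addrC.
have [u4 u1 u2 u44] := oneU 0 t (lexx _) t0.
have [v4 v1 v2 v44] := oneV 0 (- s) (lexx _) ns0.
have E : incr M s t = fun w => U t w + V (- s) w.
  by apply/funext => w; rewrite /incr /M t0 leNgt s0 /=; ring.
have EU : U t = incr U 0 t by apply/funext => w; rewrite /incr (levy_start0 HU) subr0.
have EV : V (- s) = incr V 0 (- s) by apply/funext => w; rewrite /incr (levy_start0 HV) subr0.
have ind := indep_UV t0 ns0.
rewrite E; rewrite -EU in u4 u1 u2 u44; rewrite -EV in v4 v1 v2 v44.
rewrite !subr0 in u2 u44 v2 v44.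
have u31 := L4_L1 u4; have v31 := L4_L1 v4.
have u32 := L2_sqr (L4_L2 u4); have v32 := L2_sqr (L4_L2 v4).
have u33 := L4_L1_cube u4; have v33 := L4_L1_cube v4.
have u34 := L4_L1_four u4; have v34 := L4_L1_four v4.
have [e11 E11] := indep_rv_Ex u31 v31 ind.
have [e31 E31] := indep_rv_Ex u33 v31 (indep_rv_comp (mX 3) (@measurable_id _ R setT) ind).
have [e22 E22] := indep_rv_Ex u32 v32 (indep_rv_comp (mX 2) (mX 2) ind).
have [e13 E13] := indep_rv_Ex u31 v33 (indep_rv_comp (@measurable_id _ R setT) (mX 3) ind).
split; first exact: L4D.
- by rewrite ExD// u1 v1 addr0.
- rewrite (eq_Ex (g := fun w => U t w ^+ 2 + (2 * (U t w * V (- s) w) + V (- s) w ^+ 2))).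
    rewrite ExD//; last by apply: L1D => //; exact: L1Z.
    by rewrite ExD ?ExZ ?E11 ?u1 ?u2 ?v2//; [ring|exact: L1Z].
  by move=> w; ring.
- rewrite (eq_Ex (g := fun w => U t w ^+ 4 + (4 * (U t w ^+ 3 * V (- s) w) +
    (6 * (U t w ^+ 2 * V (- s) w ^+ 2) + (4 * (U t w * V (- s) w ^+ 3) + V (- s) w ^+ 4)))));
    last by move=> w; ring.
  have z1 := L1Z 4 e31; have z2 := L1Z 6 e22; have z3 := L1Z 4 e13.
  rewrite ExD//; last by do 2?[apply: L1D => //]; exact: L1D.
  rewrite ExD//; last by do 1?[apply: L1D => //]; exact: L1D.
  rewrite ExD//; last exact: L1D.
  rewrite ExD// !ExZ// E31 E22 E13 u1 u2 u44 v1 v2 v44; ring.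
Qed.

Variable L : R -> T -> R.
Hypothesis HL : forall t w, L t w =
  if 0 <= t then U t w else - lim (V u w @[u --> (- t)^'-]).

Let LM t : measurable_fun setT (L t) /\ {ae P, forall w, L t w = M t w}.
Proof.
have E : L t = fun w => if 0 <= t then U t w else - lim (V u w @[u --> (- t)^'-]).
  exact/funext.
rewrite E /M; have [t0|t0] := leP 0 t; first by split; [exact: mU|exact/nearW].
have nt0 : 0 < - t by rewrite oppr_gt0.
have [ml el] := levy_left_limit HV V4 V0 nt0.
by split; [exact: measurable_funN|apply: filterS el => w ->].
Qed.

Let incrLM s t : measurable_fun setT (incr L s t) /\
  {ae P, forall w, incr L s t w = incr M s t w}.
Proof.
have [ms es] := LM s; have [mt et] := LM t; split; first exact: measurable_funB.
by apply: filterS2 es et => w; rewrite /incr => -> ->.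
Qed.

Let mincrM s t : measurable_fun setT (incr M s t).
Proof. by apply: measurable_funB; exact: mM. Qed.

(** The grid contains the origin, so every cell lies on one side of it. *)
Let gridM (m i : nat) (dl : R) : 0 < dl -> grid_noise M m dl i =
  if (m <= i)%N then incr U ((i - m)%N%:R * dl) ((i - m).+1%:R * dl)
  else incr V ((m - i.+1)%N%:R * dl) ((m - i.+1).+1%:R * dl).
Proof.
move=> dl0; rewrite /grid_noise; have [mi|im] := leqP m i; apply/funext => w.
  have -> : (i%:R - m%:R) * dl = (i - m)%N%:R * dl by rewrite natrB.
  have -> : (i.+1%:R - m%:R) * dl = (i - m).+1%:R * dl by rewrite -subSn// natrB// leqW.
  by rewrite /incr /M !ifT// mulr_ge0// ltW.
have -> : (i.+1%:R - m%:R) * dl = - ((m - i.+1)%N%:R * dl) by rewrite natrB//; ring.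
have -> : (i%:R - m%:R) * dl = - ((m - i)%N%:R * dl) by rewrite natrB 1?ltnW//; ring.
rewrite -subSn// subSS /incr /M (@ifF _ (0 <= - ((m - i)%N%:R * dl))); last first.
  by apply/negbTE; rewrite -ltNge oppr_lt0 mulr_gt0// ltr0n subn_gt0.
rewrite !opprK oppr_ge0; case: leP => h; last by rewrite addrC.
have -> : (m - i.+1)%N%:R * dl = 0.
  by apply/eqP; rewrite eq_le h mulr_ge0// ltW.
by rewrite oppr0 (levy_start0 HU) (levy_start0 HV) add0r subr0.
Qed.

(** Events about increments over the grid are events of path space, to which the
    independence of the two processes applies. *)
Let grid_event (X : R -> T -> R) (dl : R) n (C : nat -> set R) : 0 < dl ->
  (forall j, measurable (C j)) -> exists2 E, @cylinder_sigma R E &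
  \bigcap_(j in [set i | (i < n)%N]) (incr X (j%:R * dl) (j.+1%:R * dl) @^-1` C j) =
  sample_path X @^-1` E.
Proof.
move=> dl0 mC.
pose f (j : nat) (x : path) : R := x (j.+1%:R * dl) - x (j%:R * dl).
have mf j : measurable_fun setT (f j).
  by apply: measurable_funB; apply: coord; rewrite mulr_ge0// ltW.
exists (\bigcap_(j in [set i | (i < n)%N]) (f j @^-1` C j)) => //.
have : measurable (\bigcap_(j in [set i | (i < n)%N]) (f j @^-1` C j)).
  apply: fin_bigcap_measurable => // j _.
  by rewrite -[X in measurable X]setTI; exact: mf.
by [].
Qed.

Lemma two_sided_levy_noise : levy_noise P L sigma2 kappa4.
Proof.
have mom s t : [/\ L4 P (incr M s t), Ex P (incr M s t) = 0,
  Ex P (fun w => incr M s t w ^+ 2) = `|t - s| * sigma2 &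
  Ex P (fun w => incr M s t w ^+ 4) = `|t - s| * kappa4 + 3 * (`|t - s| * sigma2) ^+ 2].
  have [st|/ltW ts] := leP s t; first by rewrite ger0_norm ?subr_ge0//; exact: moments.
  have [h1 h2 h3 h4] := moments ts.
  have E w : incr M s t w = - incr M t s w by rewrite /incr opprB.
  rewrite distrC ger0_norm ?subr_ge0//; split.
  - by apply: eq_L4 (L4N h1) => w; rewrite E.
  - by rewrite (eq_Ex (g := fun w => - incr M t s w)) ?ExN ?h2 ?oppr0//; exact: L4_L1.
  - by rewrite -h3; apply: eq_Ex => w; rewrite E sqrrN.
  - by rewrite -h4; apply: eq_Ex => w; rewrite E; ring.
have aeX (f : R -> R) s t : measurable_fun setT f ->
    {ae P, forall w, f (incr L s t w) = f (incr M s t w)}.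
  by move=> mf; have [_] := incrLM s t; apply: filterS => w ->.
have ExLM (f : R -> R) s t : measurable_fun setT f ->
    Ex P (fun w => f (incr L s t w)) = Ex P (fun w => f (incr M s t w)).
  move=> mf; apply: ae_eq_Ex (aeX f s t mf).
    by have [h _] := incrLM s t; exact: measurableT_comp.
  exact: measurableT_comp (mincrM s t).
have sameA j (dl : R) : 0 < dl -> same_distribution P (U dl) (incr U (j%:R * dl) (j.+1%:R * dl)).
  move=> dl0; have := levy_same HU (_ : 0 <= j%:R * dl) (ltW dl0).
  by rewrite -natr1 mulrDl mul1r; apply; rewrite mulr_ge0// ltW.
have sameB j (dl : R) : 0 < dl -> same_distribution P (U dl) (incr V (j%:R * dl) (j.+1%:R * dl)).
  move=> dl0 B mB; rewrite same_UV ?ltW//.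
  have := levy_same HV (_ : 0 <= j%:R * dl) (ltW dl0).
  by rewrite -natr1 mulrDl mul1r; apply => //; rewrite mulr_ge0// ltW.
split.
- move=> s t; have [[m4 m2] _ _ _] := mom s t; have [ml ae] := incrLM s t; split => //.
  apply: ae_L2 m2; first exact: measurable_funX.
  by apply: filterS ae => w ->.
- move=> s t; have [_ <- _ _] := mom s t; exact: (ExLM _ _ _ (@measurable_id _ R setT)).
- by move=> s t; have [_ _ <- _] := mom s t; exact: (ExLM _ _ _ (mX 2)).
- by move=> s t; have [_ _ _ <-] := mom s t; exact: (ExLM _ _ _ (mX 4)).
- move=> m n dl dl0.
  apply: (@mutually_independent_ae _ _ _ _ _ _ (fun i : 'I_n => grid_noise M m dl i)).
  + by move=> i; have [] := incrLM ((i%:R - m%:R) * dl) ((i.+1%:R - m%:R) * dl).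
  + by move=> i; exact: mincrM.
  + by move=> i; have [] := incrLM ((i%:R - m%:R) * dl) ((i.+1%:R - m%:R) * dl).
  have -> : (fun i : 'I_n => grid_noise M m dl i) = (fun i : 'I_n => if (m <= i)%N
      then incr U ((i - m)%N%:R * dl) ((i - m).+1%:R * dl)
      else incr V ((m - i.+1)%N%:R * dl) ((m - i.+1).+1%:R * dl)).
    by apply/funext => i; exact: gridM.
  have grid0 (k : nat) : 0 <= (fun i : nat => i%:R * dl) k by rewrite mulr_ge0// ltW.
  have gridm : {homo (fun i : nat => i%:R * dl) : i j / (i <= j)%N >-> i <= j}.
    by move=> i j ij; apply: ler_wpM2r; [exact: ltW|rewrite ler_nat].
  apply: (@mutually_independent_join _ _ _ _ m
    (fun j => incr U (j%:R * dl) (j.+1%:R * dl)) (fun j => incr V (j%:R * dl) (j.+1%:R * dl))).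
  + by move=> k; exact: (@levy_independent_increments _ _ _ _ _ HU k _ (grid0 0%N) gridm).
  + by move=> k; exact: (@levy_independent_increments _ _ _ _ _ HV k _ (grid0 0%N) gridm).
  + move=> k C D mC mD; have [E cE ->] := grid_event U k dl0 mC.
    by have [F cF ->] := grid_event V k dl0 mD; exact: UVind.
- move=> m i dl dl0.
  have [m0 e0] := incrLM ((0%:R - m%:R) * dl) ((1%:R - m%:R) * dl).
  have [mi ei] := incrLM ((i%:R - m%:R) * dl) ((i.+1%:R - m%:R) * dl).
  apply: same_distribution_ae m0 (mincrM _ _) mi (mincrM _ _) e0 ei _ => B mB.
  rewrite -!/(grid_noise M m dl _) !gridM//.
  have sAB k : P ((if (m <= k)%N then incr U ((k - m)%N%:R * dl) ((k - m).+1%:R * dl)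
      else incr V ((m - k.+1)%N%:R * dl) ((m - k.+1).+1%:R * dl)) @^-1` B) = P (U dl @^-1` B).
    by case: ifP => _; rewrite -?sameA -?sameB.
  by rewrite !sAB.
Qed.

End two_sided.

(** * The stochastic integral as an isometry *)

Section step_functions.
Context (R : realType).
Let leb := @lebesgue_measure R.
Implicit Types g : step_data R.

Lemma leb_itv (a b : R) : leb `]a, b] = (Num.max 0 (b - a))%:E.
Proof.
rewrite /leb lebesgue_measure_itv/= lte_fin; case: ltP => ab.
  by rewrite -EFinD max_r// subr_ge0 ltW.
by rewrite max_l// subr_le0.
Qed.

Lemma L2_itv (a b : R) : L2 leb (\1_`]a, b]).
Proof.
split; first exact: measurable_indic.
apply: (@eq_L1 _ _ _ leb (\1_`]a, b])).
  by move=> x; rewrite indicE; case: (_ \in _); rewrite /= ?expr1n ?expr0n.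
apply: L1_ge0 => //; rewrite integral_indic//= setIT.
by rewrite (_ : lebesgue_measure _ = leb `]a, b])// leb_itv ltry.
Qed.

(** The length of the intersection in the form that polarization produces for increments;
    see [Ex_incrM]. *)
Lemma Ex_itvM (s t s' t' : R) : s <= t -> s' <= t' ->
  Ex leb (fun x => \1_`]s, t] x * \1_`]s', t'] x) =
  (`|t - s'| + `|s - t'| - `|t - t'| - `|s - s'|) / 2.
Proof.
move=> st st'.
pose a := Num.max s s'; pose b := Num.min t t'.
have E x : \1_`]s, t] x * \1_`]s', t'] x = \1_`]a, b] x :> R.
  rewrite !indicE -natrM mulnb !mem_setE !in_itv/= gt_max le_min.
  by congr ((_ : bool)%:R); rewrite andbACA.
rewrite (@eq_Ex _ _ R leb _ _ E) /Ex /Rintegral integral_indic//= setIT.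
rewrite (_ : lebesgue_measure _ = leb `]a, b])// leb_itv /= /a /b.
have aux (x y : R) : `|x - y| = Num.max x y - Num.min x y.
  by case: (leP x y) => h; [rewrite distrC|]; rewrite ger0_norm ?subr_ge0// ltW.
rewrite !aux; case: (leP s s') => ?; case: (leP t t') => ?; case: (leP t s') => ?;
  case: (leP s t') => ?; case: leP => ?; lra.
Qed.

Lemma step_fun_L2 g : L2 leb (step_fun g).
Proof.
apply: (@eq_L2 _ _ _ leb (fun x => \sum_(u <- g) u.1 * \1_(`]u.2.1, u.2.2]) x)) => //.
by apply: L2_sum => u _; apply: L2Z; exact: L2_itv.
Qed.

Lemma step_fun_cat g g' x : step_fun (g ++ g') x = step_fun g x + step_fun g' x.
Proof. by rewrite /step_fun big_cat. Qed.

Lemma cat_step_wf g g' : step_wf g -> step_wf g' -> step_wf (g ++ g').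
Proof. by rewrite /step_wf all_cat => -> ->. Qed.

Definition scale_step (c : R) g : step_data R := [seq (c * u.1, u.2) | u <- g].

Lemma scale_step_wf c g : step_wf g -> step_wf (scale_step c g).
Proof. by rewrite /step_wf all_map. Qed.

Lemma step_funZ c g x : step_fun (scale_step c g) x = c * step_fun g x.
Proof.
by rewrite /step_fun big_map mulr_sumr; apply: eq_bigr => u _; rewrite mulrA.
Qed.

End step_functions.

Section Lnorm2.
Context (R : realType).
Let leb := @lebesgue_measure R.

Lemma Lnorm2_nrm (f : R -> R) : L2 leb f ->
  Lnorm leb 2%:E (fun x => (f x)%:E) = (nrm leb f)%:E.
Proof.
move=> f2; rewrite unlock /=.
have -> : (\int[leb]_x (`|f x| `^ 2)%:E = \int[leb]_x (f x ^+ 2)%:E)%E.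
  by apply: eq_integral => x _; rewrite powR_mulrn ?normr_ge0// real_normK ?num_real.
rewrite (EFin_Ex (L2_sqr f2)) poweR_EFin powR12_sqrt//.
by apply: Ex_ge0 => x; exact: sqr_ge0.
Qed.

Lemma Lfun2_L2 (f : R -> R) : f \in Lfun leb 2%:E -> L2 leb f.
Proof.
move=> f2; have mf : measurable_fun setT f by have /set_mem := sub_Lfun_mfun f2.
split => //; have := Lfun2_integrable_sqr f2.
by congr (leb.-integrable _ _); apply/funext => x.
Qed.

End Lnorm2.

Section isometry.
Context d (T : measurableType d) (R : realType) (P : probability T R).
Variables (L : R -> T -> R) (sigma2 kappa4 : R).
Hypothesis HN : levy_noise P L sigma2 kappa4.
Let leb := @lebesgue_measure R.

Lemma noise_var_ge0 : 0 <= sigma2.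
Proof.
have := noise_sqr HN 0 1; rewrite subr0 normr1 mul1r => <-.
by apply: Ex_ge0 => w; exact: sqr_ge0.
Qed.

(** Polarization: (a - b) (c - e) is a combination of squared increments, whose
    expectations are known. *)
Lemma Ex_incrM (s t s' t' : R) : Ex P (fun w => incr L s t w * incr L s' t' w) =
  sigma2 * ((`|t - s'| + `|s - t'| - `|t - t'| - `|s - s'|) / 2).
Proof.
pose D a b := fun w => incr L a b w ^+ 2.
have D1 a b : L1 P (D a b) by apply: L2_sqr; apply: L4_L2; exact: noise_L4 HN a b.
rewrite (eq_Ex (g := fun w => 2^-1 * ((D s' t w + D t' s w) - (D t' t w + D s' s w)))); last first.
  by move=> w; rewrite /D /incr; field.
rewrite ExZ; last by apply: L1B; exact: L1D.
rewrite ExB; [|exact: L1D|exact: L1D].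
rewrite !ExD// /D !(noise_sqr HN); ring.
Qed.

Lemma step_integral_cat g g' w :
  step_integral L (g ++ g') w = step_integral L g w + step_integral L g' w.
Proof. by rewrite /step_integral big_cat. Qed.

Lemma step_integralZ c g w : step_integral L (scale_step c g) w = c * step_integral L g w.
Proof.
by rewrite /step_integral big_map mulr_sumr; apply: eq_bigr => u _; rewrite mulrA.
Qed.

Lemma step_integral_L4 g : L4 P (step_integral L g).
Proof.
by apply: L4_sum => u _; apply: L4Z; exact: noise_L4 HN u.2.1 u.2.2.
Qed.

Lemma step_integral_L2 g : L2 P (step_integral L g).
Proof. exact/L4_L2/step_integral_L4. Qed.

(** Both sides are bilinear, and they agree on single intervals by [Ex_incrM] and
    [Ex_itvM]. *)
Lemma step_isometry g g' : step_wf g -> step_wf g' ->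
  Ex P (fun w => step_integral L g w * step_integral L g' w) =
  sigma2 * Ex leb (fun x => step_fun g x * step_fun g' x).
Proof.
move=> wg wg'.
have iL2 u : L2 P (incr L u.2.1 u.2.2) by apply: L4_L2; exact: noise_L4 HN _ _.
have lhs : Ex P (fun w => step_integral L g w * step_integral L g' w) =
    \sum_(u <- g) \sum_(v <- g') (u.1 * v.1) *
      Ex P (fun w => incr L u.2.1 u.2.2 w * incr L v.2.1 v.2.2 w).
  rewrite (eq_Ex (g := fun w => \sum_(u <- g) \sum_(v <- g') (u.1 * v.1) *
      (incr L u.2.1 u.2.2 w * incr L v.2.1 v.2.2 w))); last first.
    move=> w; rewrite /step_integral mulr_suml; apply: eq_bigr => u _.
    by rewrite mulr_sumr; apply: eq_bigr => v _; rewrite /incr; ring.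
  rewrite Ex_sum; last by move=> u _; apply: L1_sum => v _; apply: L1Z; exact: L2M.
  apply: eq_bigr => u _; rewrite Ex_sum; last by move=> v _; apply: L1Z; exact: L2M.
  by apply: eq_bigr => v _; rewrite ExZ//; exact: L2M.
have rhs : Ex leb (fun x => step_fun g x * step_fun g' x) =
    \sum_(u <- g) \sum_(v <- g') (u.1 * v.1) *
      Ex leb (fun x => \1_`]u.2.1, u.2.2] x * \1_`]v.2.1, v.2.2] x).
  rewrite (@eq_Ex _ _ R leb _ (fun x => \sum_(u <- g) \sum_(v <- g') (u.1 * v.1) *
      (\1_`]u.2.1, u.2.2] x * \1_`]v.2.1, v.2.2] x))); last first.
    move=> x; rewrite /step_fun mulr_suml; apply: eq_bigr => u _.
    by rewrite mulr_sumr; apply: eq_bigr => v _; ring.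
  have mm u v : L1 leb (fun x : R => \1_`]u.2.1, u.2.2] x * \1_`]v.2.1, v.2.2] x).
    by apply: L2M; exact: L2_itv.
  rewrite Ex_sum; last by move=> u _; apply: L1_sum => v _; apply: L1Z; exact: mm.
  apply: eq_bigr => u _; rewrite Ex_sum; last by move=> v _; apply: L1Z; exact: mm.
  by apply: eq_bigr => v _; rewrite ExZ//; exact: mm.
rewrite lhs rhs mulr_sumr; apply: eq_big_seq => u ug.
rewrite mulr_sumr; apply: eq_big_seq => v vg.
rewrite Ex_incrM Ex_itvM; first by rewrite mulrCA.
  by have /allP/(_ _ ug) := wg.
by have /allP/(_ _ vg) := wg'.
Qed.

Lemma nrm_step_integralB g g' : step_wf g -> step_wf g' ->
  nrm P (fun w => step_integral L g w - step_integral L g' w) =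
  Num.sqrt sigma2 * nrm leb (fun x => step_fun g x - step_fun g' x).
Proof.
move=> wg wg'; pose h := g ++ scale_step (-1) g'.
have wh : step_wf h by exact: cat_step_wf (scale_step_wf _ _).
rewrite (eq_nrm (g := step_integral L h)); last first.
  by move=> w; rewrite step_integral_cat step_integralZ mulN1r.
rewrite (@eq_nrm _ _ R leb _ (step_fun h)); last first.
  by move=> w; rewrite step_fun_cat step_funZ mulN1r.
rewrite /nrm -sqrtrM ?noise_var_ge0//; congr (Num.sqrt _); rewrite -step_isometry//.
Qed.

(** [Y] is the integral of [f] in the sense of the L^2 completion, for which the isometry
    and the fourth moments pass to the limit. *)
Definition wiener (f : R -> R) (Y : T -> R) : Prop := [/\ L2 leb f, L2 P Y &
  exists g : nat -> step_data R, [/\ forall n, step_wf (g n),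
    nrm leb (fun x => step_fun (g n) x - f x) @[n --> \oo] --> (0 : R) &
    nrm P (fun w => step_integral L (g n) w - Y w) @[n --> \oo] --> (0 : R)]].

Lemma wiener_step g : step_wf g -> wiener (step_fun g) (step_integral L g).
Proof.
move=> wg; split; [exact: step_fun_L2|exact: step_integral_L2|].
exists (fun=> g); split => //.
  rewrite [nrm _ _](_ : _ = 0); first exact: cvg_cst.
  rewrite (@eq_nrm _ _ R leb _ (fun=> 0)); last by move=> x; rewrite subrr.
  rewrite /nrm (@eq_Ex _ _ R leb _ (fun=> 0)) ?Ex0 ?sqrtr0//.
  by move=> x; rewrite expr0n.
rewrite [nrm _ _](_ : _ = 0); first exact: cvg_cst.
rewrite (eq_nrm (g := fun=> 0)) ?nrm_cst ?normr0//.
by move=> x; rewrite subrr.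
Qed.

(** Convergence in probability of the integrals of steps together with the
    isometry gives convergence in L^2, by Fatou applied to differences. *)
Lemma levy_integral_wiener f Y : L2 leb f -> is_levy_integral P L f Y -> wiener f Y.
Proof.
move=> f2 [mY [g [wg gf gY]]].
have gf2 n := L2B (step_fun_L2 (g n)) f2.
have gf0 : nrm leb (fun x => step_fun (g n) x - f x) @[n --> \oo] --> (0 : R).
  move: gf; rewrite (_ : (fun n => _) = fun n => (nrm leb (fun x => step_fun (g n) x - f x))%:E).
    by move=> /fine_cvgP[].
  by apply/funext => n; exact: Lnorm2_nrm (gf2 n).
have iL n := step_integral_L2 (g n).
have s0 := sqrtr_ge0 sigma2.
(* The integrals of g n - g k converge to that of g n minus Y as k grows. *)
have key n : L2 P (fun w => step_integral L (g n) w - Y w) /\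
    nrm P (fun w => step_integral L (g n) w - Y w) <=
      Num.sqrt sigma2 * nrm leb (fun x => step_fun (g n) x - f x).
  apply: (@Ex_sqr_fatou_probability _ _ _ P
    (fun k w => step_integral L (g n) w - step_integral L (g k) w)).
  - by move=> k; exact: L2B.
  - exact: measurable_funB (L2_measurable (iL n)) mY.
  - move=> e e0; have := gY e e0; apply: cvg_trans; apply: near_eq_cvg; apply/nearW => k.
    congr (P _); apply/seteqP; split => w /=;
      rewrite (_ : step_integral L (g n) w - step_integral L (g k) w -
        (step_integral L (g n) w - Y w) = - (step_integral L (g k) w - Y w)) ?normrN//; ring.
  - by rewrite mulr_ge0// nrm_ge0.
  - move=> e e0; have e'0 : 0 < e / (Num.sqrt sigma2 + 1) by rewrite divr_gt0// ltr_wpDl.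
    have /cvgrPdist_le/(_ _ e'0) := gf0; apply: filterS => k.
    rewrite sub0r normrN ger0_norm ?nrm_ge0// => hk.
    rewrite nrm_step_integralB//.
    have tri : nrm leb (fun x => step_fun (g n) x - step_fun (g k) x) <=
        nrm leb (fun x => step_fun (g n) x - f x) + nrm leb (fun x => step_fun (g k) x - f x).
      have := nrm_tri (gf2 n) (L2N (gf2 k)); rewrite nrmN; apply: le_trans.
      rewrite le_eqVlt; apply/orP; left; apply/eqP; apply: (@eq_nrm _ _ R leb) => x; ring.
    apply: (le_trans (ler_wpM2l s0 tri)); rewrite mulrDr lerD2l.
    apply: le_trans (ler_wpM2l s0 hk) _.
    rewrite mulrCA ler_piMr ?(ltW e0)// ler_pdivrMr ?ltr_wpDl// mul1r lerDl//.
have Y2 : L2 P Y.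
  have [h _] := key 0%N; apply: eq_L2 (L2B (iL 0%N) h) => w; ring.
split => //; exists g; split => //.
apply: (@cvg_norm_le _ _ _ _ _ (fun n => Num.sqrt sigma2 * nrm leb (fun x => step_fun (g n) x - f x))).
  by move=> n; rewrite subr0 ger0_norm ?nrm_ge0//; have [] := key n.
by rewrite -[X in _ --> X](mulr0 (Num.sqrt sigma2)); apply: cvgM => //; exact: cvg_cst.
Qed.

Lemma wiener_dot f f' Y Y' : wiener f Y -> wiener f' Y' ->
  Ex P (fun w => Y w * Y' w) = sigma2 * Ex leb (fun x => f x * f' x).
Proof.
move=> [f2 Y2 [g [wg gf gY]]] [f'2 Y'2 [g' [wg' gf' gY']]].
have gL n := step_fun_L2 (g n); have g'L n := step_fun_L2 (g' n).
have iL n := step_integral_L2 (g n); have i'L n := step_integral_L2 (g' n).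
have h1 := cvg_dot eventually_filter iL i'L Y2 Y'2 gY gY'.
have h2 := cvg_dot eventually_filter gL g'L f2 f'2 gf gf'.
have h3 : Ex P (fun w => step_integral L (g n) w * step_integral L (g' n) w)
    @[n --> \oo] --> sigma2 * Ex leb (fun x => f x * f' x).
  rewrite (_ : (fun n => _) = (fun n => sigma2 * Ex leb (fun x => step_fun (g n) x * step_fun (g' n) x))).
    by apply: cvgM; [exact: cvg_cst|exact: h2].
  by apply/funext => n; exact: step_isometry.
by rewrite -(cvg_lim _ h1)// -(cvg_lim _ h3).
Qed.

Lemma wienerB f f' Y Y' : wiener f Y -> wiener f' Y' ->
  wiener (fun x => f x - f' x) (fun w => Y w - Y' w).
Proof.
move=> [f2 Y2 [g [wg gf gY]]] [f'2 Y'2 [g' [wg' gf' gY']]].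
split; [exact: L2B|exact: L2B|].
exists (fun n => g n ++ scale_step (-1) (g' n)); split.
- by move=> n; exact: cat_step_wf (scale_step_wf _ _).
- apply: (@cvg_norm_le _ _ _ _ _ (fun n => nrm leb (fun x => step_fun (g n) x - f x) +
    nrm leb (fun x => step_fun (g' n) x - f' x))); last by rewrite -(addr0 (0 : R)); exact: cvgD.
  move=> n; rewrite subr0 ger0_norm ?nrm_ge0//.
  have h1 := L2B (step_fun_L2 (g n)) f2; have h2 := L2B (step_fun_L2 (g' n)) f'2.
  have := nrm_tri h1 (L2N h2); rewrite nrmN; apply: le_trans.
  rewrite le_eqVlt; apply/orP; left; apply/eqP; apply: (@eq_nrm _ _ R leb) => x.
  by rewrite step_fun_cat step_funZ; ring.
- apply: (@cvg_norm_le _ _ _ _ _ (fun n => nrm P (fun x => step_integral L (g n) x - Y x) +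
    nrm P (fun x => step_integral L (g' n) x - Y' x))); last by rewrite -(addr0 (0 : R)); exact: cvgD.
  move=> n; rewrite subr0 ger0_norm ?nrm_ge0//.
  have h1 := L2B (step_integral_L2 (g n)) Y2; have h2 := L2B (step_integral_L2 (g' n)) Y'2.
  have := nrm_tri h1 (L2N h2); rewrite nrmN; apply: le_trans.
  rewrite le_eqVlt; apply/orP; left; apply/eqP; apply: eq_nrm => x.
  by rewrite step_integral_cat step_integralZ; ring.
Qed.

Lemma wiener_nrm f Y : wiener f Y -> nrm P Y = Num.sqrt sigma2 * nrm leb f.
Proof. by move=> w; rewrite /nrm -sqrtrM ?noise_var_ge0// -(wiener_dot w w). Qed.

Lemma wiener_nrmB f f' Y Y' : wiener f Y -> wiener f' Y' ->
  nrm P (fun w => Y w - Y' w) = Num.sqrt sigma2 * nrm leb (fun x => f x - f' x).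
Proof. by move=> w w'; exact: wiener_nrm (wienerB w w'). Qed.

Lemma wiener_L2 f Y : wiener f Y -> L2 P Y. Proof. by case. Qed.

Lemma wiener_unique f Y Y' : wiener f Y -> wiener f Y' -> {ae P, forall w, Y w = Y' w}.
Proof.
move=> w w'; have h := wiener_nrmB w w'.
have d2 := L2B (wiener_L2 w) (wiener_L2 w').
have := nrm_eq0_ae d2; rewrite h (@eq_nrm _ _ R leb _ (fun=> 0)); last by move=> x; rewrite subrr.
rewrite /nrm (@eq_Ex _ _ R leb _ (fun=> 0)); last by move=> x; rewrite expr0n.
rewrite Ex0 sqrtr0 mulr0 => /(_ erefl); apply: filterS => x /eqP.
by rewrite subr_eq0 => /eqP.
Qed.

End isometry.

(** * Fourth moments of stochastic integrals *)

Section linear_forms.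
Context d (T : measurableType d) (R : realType) (P : probability T R).
Variable Z : nat -> T -> R.
Hypothesis Z4 : forall j, L4 P (Z j).
Hypothesis iZ : forall n, mutually_independent P (fun i : 'I_n => Z i).
Variables v k : R.
Hypothesis Z0 : forall j, Ex P (Z j) = 0.
Hypothesis Z2 : forall j, Ex P (fun w => Z j w ^+ 2) = v.
Hypothesis Z44 : forall j, Ex P (fun w => Z j w ^+ 4) = k + 3 * v ^+ 2.

Let lin (n : nat) (a : nat -> R) w := \sum_(j < n) a j * Z j w.

Let mZ j : measurable_fun setT (Z j). Proof. exact: L4_measurable. Qed.

Let lin4 n a : L4 P (lin n a).
Proof. by apply: L4_sum => j _; exact: L4Z. Qed.

Let linS n a w : lin n.+1 a w = lin n a w + a n * Z n w.
Proof. by rewrite /lin big_ord_recr. Qed.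

Let mlin n a : measurable_on Z (fun j => (j < n)%N) (lin n a).
Proof.
apply: measurable_on_sum => j _; apply: measurable_funM; first exact: measurable_cst.
by apply: (measurable_on_coord (A := fun j => (j < n)%N)) => /=.
Qed.

Let split_Ex n (U V : T -> R) : measurable_on Z (fun j => (j < n)%N) U -> L1 P U ->
  measurable_on Z (eq n) V -> L1 P V ->
  L1 P (fun w => U w * V w) /\ Ex P (fun w => U w * V w) = Ex P U * Ex P V.
Proof.
move=> mU U1 mV V1.
have dis j : (j < n)%N -> ~ n = j by move=> jn nj; move: jn; rewrite nj ltnn.
exact: (measurable_on_Ex mZ iZ dis mU mV U1 V1).
Qed.

Let mZX n i : measurable_on Z (eq n) (fun w => Z n w ^+ i).
Proof. by apply: measurable_funX; exact: measurable_on_coord. Qed.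

Let mZ1 n : measurable_on Z (eq n) (Z n). Proof. exact: measurable_on_coord. Qed.

Let lin_mean n a : Ex P (lin n a) = 0.
Proof.
rewrite /lin Ex_sum; last by move=> j _; apply: L1Z; exact: L4_L1.
by apply: big1 => j _; rewrite ExZ ?Z0 ?mulr0//; exact: L4_L1.
Qed.

Lemma linear_form_dot n a b :
  Ex P (fun w => lin n a w * lin n b w) = v * \sum_(j < n) a j * b j.
Proof.
elim: n => [|n IH].
  rewrite big_ord0 mulr0 (eq_Ex (g := fun=> 0)) ?Ex0// => w.
  by rewrite /lin big_ord0 mul0r.
have A1 := L4_L1 (lin4 n a); have B1 := L4_L1 (lin4 n b); have z1 := L4_L1 (Z4 n).
have [e1 E1] := split_Ex (@mlin n a) A1 (@mZ1 n) z1.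
have [e2 E2] := split_Ex (@mlin n b) B1 (@mZ1 n) z1.
have AB := L2M (L4_L2 (lin4 n a)) (L4_L2 (lin4 n b)).
have zz := L2_sqr (L4_L2 (Z4 n)).
rewrite (eq_Ex (g := fun w => lin n a w * lin n b w + (b n * (lin n a w * Z n w) +
  (a n * (lin n b w * Z n w) + a n * b n * Z n w ^+ 2)))); last first.
  by move=> w; rewrite !linS; ring.
have f1 := L1Z (b n) e1; have f2 := L1Z (a n) e2; have f3 := L1Z (a n * b n) zz.
rewrite ExD//; last by apply: L1D => //; exact: L1D.
rewrite ExD//; last exact: L1D.
rewrite ExD// !ExZ// E1 E2 IH Z0 Z2 big_ord_recr /=; ring.
Qed.

(** By induction on the number of variables: adding an independent centred
    variable only contributes through its second and fourth moments. *)
Lemma linear_form_fourth n a b c e :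
  Ex P (fun w => lin n a w * lin n b w * (lin n c w * lin n e w)) =
  k * \sum_(j < n) a j * b j * (c j * e j) +
  v ^+ 2 * ((\sum_(j < n) a j * b j) * (\sum_(j < n) c j * e j) +
            (\sum_(j < n) a j * c j) * (\sum_(j < n) b j * e j) +
            (\sum_(j < n) a j * e j) * (\sum_(j < n) b j * c j)).
Proof.
elim: n => [|n IH].
  rewrite !big_ord0 !(mulr0, addr0) (eq_Ex (g := fun=> 0)) ?Ex0// => w.
  by rewrite /lin big_ord0 !mul0r.
pose A := lin n a; pose B := lin n b; pose C := lin n c; pose E := lin n e.
have [A4 B4 C4 E4] : [/\ L4 P A, L4 P B, L4 P C & L4 P E] by split; exact: lin4.
have [mA mB mC mE] : [/\ measurable_on Z (fun j => (j < n)%N) A,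
  measurable_on Z (fun j => (j < n)%N) B, measurable_on Z (fun j => (j < n)%N) C &
  measurable_on Z (fun j => (j < n)%N) E] by split; exact: mlin.
have t1 (F G H : T -> R) : L4 P F -> L4 P G -> L4 P H -> L1 P (fun w => F w * G w * H w).
  by move=> F4 G4 H4; exact: L2M (L4M F4 G4) (L4_L2 H4).
have t2 (F G : T -> R) : L4 P F -> L4 P G -> L1 P (fun w => F w * G w).
  by move=> F4 G4; exact: L2M (L4_L2 F4) (L4_L2 G4).
pose G1 w := a n * (B w * C w * E w) + (b n * (A w * C w * E w) +
  (c n * (A w * B w * E w) + e n * (A w * B w * C w))).
pose G2 w := a n * b n * (C w * E w) + (a n * c n * (B w * E w) + (a n * e n * (B w * C w) +
  (b n * c n * (A w * E w) + (b n * e n * (A w * C w) + c n * e n * (A w * B w))))).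
pose G3 w := a n * b n * c n * E w + (a n * b n * e n * C w +
  (a n * c n * e n * B w + b n * c n * e n * A w)).
have G11 : L1 P G1.
  by apply: L1D; [|apply: L1D; [|apply: L1D]]; apply: L1Z; exact: t1.
have G31 : L1 P G3.
  by apply: L1D; [|apply: L1D; [|apply: L1D]]; apply: L1Z; exact: L4_L1.
have tl1 : L1 P (fun w => b n * e n * (A w * C w) + c n * e n * (A w * B w)).
  by apply: L1D; apply: L1Z; exact: t2.
have tl2 := L1D (L1Z (b n * c n) (t2 _ _ A4 E4)) tl1.
have tl3 := L1D (L1Z (a n * e n) (t2 _ _ B4 C4)) tl2.
have tl4 := L1D (L1Z (a n * c n) (t2 _ _ B4 E4)) tl3.
have G21 : L1 P G2 := L1D (L1Z (a n * b n) (t2 _ _ C4 E4)) tl4.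
have G20 : Ex P G2 = v * (a n * b n * (\sum_(j < n) c j * e j) +
    a n * c n * (\sum_(j < n) b j * e j) + a n * e n * (\sum_(j < n) b j * c j) +
    b n * c n * (\sum_(j < n) a j * e j) + b n * e n * (\sum_(j < n) a j * c j) +
    c n * e n * (\sum_(j < n) a j * b j)).
  rewrite /G2 ExD//; last by apply: L1Z; exact: t2.
  rewrite ExD//; last by apply: L1Z; exact: t2.
  rewrite ExD//; last by apply: L1Z; exact: t2.
  rewrite ExD//; last by apply: L1Z; exact: t2.
  rewrite ExD//; [|by apply: L1Z; exact: t2|by apply: L1Z; exact: t2].
  rewrite !ExZ ?linear_form_dot; [ring|exact: t2..].
have G30 : Ex P G3 = 0.
  have o (x : R) F : L4 P F -> L1 P (fun w => x * F w) by move=> F4; exact/L1Z/L4_L1.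
  rewrite /G3 ExD; [|exact: o|by apply: L1D; [exact: o|apply: L1D; exact: o]].
  rewrite ExD; [|exact: o|by apply: L1D; exact: o].
  rewrite ExD; [|exact: o|exact: o].
  by rewrite !ExZ ?lin_mean ?mulr0 ?addr0//; exact: L4_L1.
have mc (F : T -> R) (x : R) : measurable_on Z (fun j => (j < n)%N) F ->
    measurable_on Z (fun j => (j < n)%N) (fun w => x * F w).
  by move=> mF; apply: measurable_funM => //; exact: measurable_cst.
have mD (F G : T -> R) : measurable_on Z (fun j => (j < n)%N) F ->
    measurable_on Z (fun j => (j < n)%N) G ->
    measurable_on Z (fun j => (j < n)%N) (fun w => F w + G w).
  by move=> mF mG; exact: measurable_funD.
have mM (F G : T -> R) : measurable_on Z (fun j => (j < n)%N) F ->
    measurable_on Z (fun j => (j < n)%N) G ->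
    measurable_on Z (fun j => (j < n)%N) (fun w => F w * G w).
  by move=> mF mG; exact: measurable_funM.
have m3 x F G H (mF : measurable_on Z (fun j => (j < n)%N) F)
    (mG : measurable_on Z (fun j => (j < n)%N) G) (mH : measurable_on Z (fun j => (j < n)%N) H) :=
  mc _ x (mM _ _ (mM _ _ mF mG) mH).
have m2 x F G (mF : measurable_on Z (fun j => (j < n)%N) F)
    (mG : measurable_on Z (fun j => (j < n)%N) G) := mc _ x (mM _ _ mF mG).
have mG1 : measurable_on Z (fun j => (j < n)%N) G1.
  exact: (mD _ _ (m3 _ _ _ _ mB mC mE) (mD _ _ (m3 _ _ _ _ mA mC mE)
    (mD _ _ (m3 _ _ _ _ mA mB mE) (m3 _ _ _ _ mA mB mC)))).
have mG2 : measurable_on Z (fun j => (j < n)%N) G2.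
  exact: (mD _ _ (m2 _ _ _ mC mE) (mD _ _ (m2 _ _ _ mB mE) (mD _ _ (m2 _ _ _ mB mC)
    (mD _ _ (m2 _ _ _ mA mE) (mD _ _ (m2 _ _ _ mA mC) (m2 _ _ _ mA mB)))))).
have mG3 : measurable_on Z (fun j => (j < n)%N) G3.
  exact: (mD _ _ (mc _ _ mE) (mD _ _ (mc _ _ mC) (mD _ _ (mc _ _ mB) (mc _ _ mA)))).
have [e1 E1] := split_Ex mG1 G11 (@mZ1 n) (L4_L1 (Z4 n)).
have [e2 E2] := split_Ex mG2 G21 (@mZX n 2) (L2_sqr (L4_L2 (Z4 n))).
have [e3 E3] := split_Ex mG3 G31 (@mZX n 3) (L4_L1_cube (Z4 n)).
have z4 := L1Z (a n * b n * c n * e n) (L4_L1_four (Z4 n)).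
have abce := L2M (L4M A4 B4) (L4M C4 E4).
rewrite (eq_Ex (g := fun w => A w * B w * (C w * E w) + (G1 w * Z n w + (G2 w * Z n w ^+ 2 +
  (G3 w * Z n w ^+ 3 + a n * b n * c n * e n * Z n w ^+ 4))))); last first.
  by move=> w; rewrite !linS -/(A w) -/(B w) -/(C w) -/(E w) /G1 /G2 /G3; ring.
rewrite ExD//; last by do 2?[apply: L1D => //]; exact: L1D.
rewrite ExD//; last by do 1?[apply: L1D => //]; exact: L1D.
rewrite ExD//; last exact: L1D.
rewrite ExD// ExZ ?IH ?E1 ?E2 ?E3 ?G20 ?G30 ?Z0 ?Z2 ?Z44; last exact: L4_L1_four.
rewrite !big_ord_recr /=; ring.
Qed.

End linear_forms.

(** ** Functions that are constant on the cells of a grid *)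

Section cells.
Context (R : realType).
Let leb := @lebesgue_measure R.
Implicit Types (dl : R) (m : nat) (f : R -> R).

(** Cells are open on the left and closed on the right, like the intervals of step
    functions, and the value is read at the right end point. *)
Definition cellwise dl m f :=
  (forall (i : int) x, (i - 1)%:~R * dl < x <= i%:~R * dl -> f x = f (i%:~R * dl)) /\
  (forall x, ~~ (- (m%:R * dl) < x <= m%:R * dl) -> f x = 0).

Definition grid_step dl m f : step_data R :=
  [seq (f ((j.+1%:R - m%:R) * dl), ((j%:R - m%:R) * dl, (j.+1%:R - m%:R) * dl))
     | j <- iota 0 (2 * m)].

Lemma grid_step_wf dl m f : 0 < dl -> step_wf (grid_step dl m f).
Proof.
move=> dl0; rewrite /step_wf all_map; apply/allP => j _ /=.
by rewrite ler_pM2r// lerD2r ler_nat.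
Qed.

Lemma cell_index dl x : 0 < dl -> exists i : int, (i - 1)%:~R * dl < x <= i%:~R * dl.
Proof.
move=> dl0; exists (Num.ceil (x / dl)).
have /andP[h1 h2] := ceil_itv (x / dl).
by rewrite -ltr_pdivlMr// -ler_pdivrMr// h1.
Qed.

Lemma step_fun_grid dl m f x : 0 < dl -> cellwise dl m f ->
  step_fun (grid_step dl m f) x = f x.
Proof.
move=> dl0 [fc f0]; rewrite /step_fun big_map.
have ind (j : nat) (i : int) : (i - 1)%:~R * dl < x <= i%:~R * dl ->
    (x \in (`](j%:R - m%:R) * dl, (j.+1%:R - m%:R) * dl] : interval R)) = (j%:Z + 1 - m%:Z == i).
  move=> /andP[h1 h2]; rewrite in_itv/=.
  have e1 : j%:R - m%:R = (j%:Z - m%:Z)%:~R :> R by rewrite intrB.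
  have e2 : j.+1%:R - m%:R = (j%:Z + 1 - m%:Z)%:~R :> R by rewrite intrB intrD -natr1.
  rewrite e1 e2; apply/idP/eqP => [/andP[h3 h4]|ij].
    have g1 := lt_le_trans h3 h2; have g2 := lt_le_trans h1 h4.
    rewrite ltr_pM2r// ltr_int in g1; rewrite ltr_pM2r// ltr_int in g2.
    by lia.
  rewrite -ij in h1 h2; rewrite h2 andbT; apply: le_lt_trans h1.
  by rewrite ler_pM2r// ler_int; lia.
have [i Hi] := cell_index x dl0.
have [xin|xout] := boolP (- (m%:R * dl) < x <= m%:R * dl); last first.
  rewrite f0// big_seq big1// => j; rewrite mem_iota add0n /= => jm.
  rewrite indicE mem_setE (ind _ _ Hi); case: eqP => [ij|]; last by rewrite mulr0.
  case/negP: xout; have /andP[h1 h2] := Hi; rewrite -ij in h1 h2.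
  apply/andP; split.
    apply: le_lt_trans h1; rewrite -mulNr ler_pM2r// -[m%:R]/(m%:Z%:~R) -intrN ler_int.
    by lia.
  by apply: le_trans h2 _; rewrite ler_pM2r// -[m%:R]/(m%:Z%:~R) ler_int; lia.
have /andP[h1 h2] := Hi; have /andP[x1 x2] := xin.
have g1 := lt_le_trans x1 h2; have g2 := lt_le_trans h1 x2.
rewrite -mulNr ltr_pM2r// -[m%:R]/(m%:Z%:~R) -intrN ltr_int in g1.
rewrite ltr_pM2r// -[m%:R]/(m%:Z%:~R) ltr_int in g2.
pose j0 := absz (i + m%:Z - 1)%R.
have j0E : j0%:Z + 1 - m%:Z = i by rewrite /j0; lia.
have j0m : j0 \in iota 0 (2 * m) by rewrite mem_iota /j0; lia.
rewrite (bigD1_seq j0) ?iota_uniq//= big1 ?addr0; last first.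
  move=> j jj0; rewrite indicE mem_setE (ind _ _ Hi); case: eqP => [ij|]; last by rewrite mulr0.
  by case/eqP: jj0; lia.
rewrite indicE mem_setE (ind _ _ Hi) j0E eqxx mulr1 [RHS](fc _ _ Hi).
by congr (f (_ * _)); rewrite -j0E intrB intrD -natr1.
Qed.

Lemma cellwise_L2 dl m f : 0 < dl -> cellwise dl m f -> L2 leb f.
Proof.
move=> dl0 fc; apply: (@eq_L2 _ _ _ leb (step_fun (grid_step dl m f))).
  by move=> x; exact: step_fun_grid.
exact: step_fun_L2.
Qed.

Lemma cellwiseM dl m f g : cellwise dl m f -> cellwise dl m g ->
  cellwise dl m (fun x => f x * g x).
Proof.
move=> [fc f0] [gc g0]; split => [i x xi|x xm]; first by rewrite (fc _ _ xi) (gc _ _ xi).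
by rewrite f0// mul0r.
Qed.

Lemma cellwise_Ex dl m f : 0 < dl -> cellwise dl m f ->
  Ex leb f = dl * \sum_(j < 2 * m) f ((j.+1%:R - m%:R) * dl).
Proof.
move=> dl0 fc.
rewrite (@eq_Ex _ _ R leb _ (fun x => \sum_(j < 2 * m) f ((j.+1%:R - m%:R) * dl) *
   \1_`](j%:R - m%:R) * dl, (j.+1%:R - m%:R) * dl] x)); last first.
  move=> x; rewrite -(step_fun_grid x dl0 fc) /step_fun big_map.
  rewrite -[in RHS](big_mkord xpredT (fun j => f ((j.+1%:R - m%:R) * dl) *
     \1_`](j%:R - m%:R) * dl, (j.+1%:R - m%:R) * dl] x)).
  by rewrite /index_iota subn0.
have i1 (a b : R) : L1 leb (\1_`]a, b]).
  have [_ ] := L2_itv a b; apply: eq_L1 => x.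
  by rewrite indicE; case: (_ \in _); rewrite /= ?expr1n ?expr0n.
rewrite Ex_sum; last by move=> j _; exact: L1Z.
rewrite mulr_sumr; apply: eq_bigr => j _; rewrite ExZ// mulrC; congr (_ * _).
rewrite /Ex /Rintegral integral_indic//= setIT.
rewrite leb_itv /=.
rewrite -natr1 max_r; first ring.
by rewrite subr_ge0 ler_pM2r// lerD2r lerDl.
Qed.

Lemma cellwise_refine dl m f (p : nat) : (0 < p)%N -> 0 < dl ->
  cellwise (p%:R * dl) m f -> cellwise dl (m * p)%N f.
Proof.
move=> p0 dl0 [fc f0]; split; last by move=> x; rewrite natrM -mulrA; exact: f0.
move=> i x /andP[x1 x2].
have pR : 0 < p%:R :> R by rewrite ltr0n.
have pdl0 : 0 < p%:R * dl by rewrite mulr_gt0.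
have [i' Hi'] := cell_index (i%:~R * dl) pdl0.
rewrite (fc _ _ Hi'); apply: fc; have /andP[h1 h2] := Hi'.
rewrite (le_trans x2 h2) andbT; apply: le_lt_trans x1.
move: h1; rewrite !mulrA -[p%:R]/(p%:Z%:~R) -!intrM ltr_pM2r// ltr_int ler_pM2r// ler_int.
by lia.
Qed.

Lemma cellwise_widen dl m m' f : 0 < dl -> (m <= m')%N -> cellwise dl m f -> cellwise dl m' f.
Proof.
move=> dl0 mm' [fc f0]; split => // x /negP xm; apply: f0; apply/negP => /andP[x1 x2].
have h : m%:R * dl <= m'%:R * dl by rewrite ler_pM2r// ler_nat.
by apply: xm; rewrite (le_trans x2 h) andbT; apply: le_lt_trans x1; rewrite lerN2.
Qed.

End cells.

Section fourth_moment_cellwise.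
Context d (T : measurableType d) (R : realType) (P : probability T R).
Variables (L : R -> T -> R) (sigma2 kappa4 : R).
Hypothesis HN : levy_noise P L sigma2 kappa4.
Let leb := @lebesgue_measure R.

Lemma step_integral_grid dl m (f : R -> R) w : step_integral L (grid_step dl m f) w =
  \sum_(j < 2 * m) f ((j.+1%:R - m%:R) * dl) * grid_noise L m dl j w.
Proof.
rewrite /step_integral big_map.
rewrite -(big_mkord xpredT (fun j => f ((j.+1%:R - m%:R) * dl) * grid_noise L m dl j w)).
by rewrite /index_iota subn0.
Qed.

(** The explicit sum is one version of the integral, and versions agree almost surely. *)
Lemma wiener_cellwise dl m f Y : 0 < dl -> cellwise dl m f -> wiener P L f Y ->
  {ae P, forall w, Y w = \sum_(j < 2 * m) f ((j.+1%:R - m%:R) * dl) * grid_noise L m dl j w}.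
Proof.
move=> dl0 fc fY; have := wiener_step HN (grid_step_wf m f dl0).
have -> : step_fun (grid_step dl m f) = f by apply/funext => x; exact: step_fun_grid.
move=> fY'; apply: filterS (wiener_unique HN fY fY') => w ->.
exact: step_integral_grid.
Qed.

Lemma grid_noise_L4 m dl j : L4 P (grid_noise L m dl j).
Proof. exact: noise_L4 HN _ _. Qed.

Lemma grid_noise_moments m dl j : 0 < dl -> [/\ Ex P (grid_noise L m dl j) = 0,
  Ex P (fun w => grid_noise L m dl j w ^+ 2) = dl * sigma2 &
  Ex P (fun w => grid_noise L m dl j w ^+ 4) = dl * kappa4 + 3 * (dl * sigma2) ^+ 2].
Proof.
move=> dl0; have e : `|(j.+1%:R - m%:R) * dl - (j%:R - m%:R) * dl| = dl.
  by rewrite -natr1 (_ : _ - _ = dl) ?gtr0_norm//; ring.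
split; first exact: noise_mean HN _ _.
- by rewrite /grid_noise (noise_sqr HN) e.
- by rewrite /grid_noise (noise_fourth HN) e.
Qed.

Lemma wiener_cellwise_L4 dl m f Y : 0 < dl -> cellwise dl m f -> wiener P L f Y -> L4 P Y.
Proof.
move=> dl0 fc fY; have ae := wiener_cellwise dl0 fc fY; have [_ Y2 _] := fY.
have mY := L2_measurable Y2; split => //.
apply: (ae_L2 (f := fun w => (\sum_(j < 2 * m) f ((j.+1%:R - m%:R) * dl) * grid_noise L m dl j w) ^+ 2)).
- exact: measurable_funX.
- by apply: filterS ae => w ->.
- by apply: L4_sqr; apply: L4_sum => j _; apply: L4Z; exact: grid_noise_L4.
Qed.

(** On a common grid the integrals are linear forms in the noise, up to null sets, and
    sums over cells are integrals. *)
Lemma fourth_moment_cellwise dl m f1 f2 f3 f4 Y1 Y2 Y3 Y4 : 0 < dl ->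
  cellwise dl m f1 -> cellwise dl m f2 -> cellwise dl m f3 -> cellwise dl m f4 ->
  wiener P L f1 Y1 -> wiener P L f2 Y2 -> wiener P L f3 Y3 -> wiener P L f4 Y4 ->
  Ex P (fun w => Y1 w * Y2 w * (Y3 w * Y4 w)) =
  kappa4 * Ex leb (fun x => f1 x * f2 x * (f3 x * f4 x)) +
  sigma2 ^+ 2 * (Ex leb (fun x => f1 x * f2 x) * Ex leb (fun x => f3 x * f4 x) +
   Ex leb (fun x => f1 x * f3 x) * Ex leb (fun x => f2 x * f4 x) +
   Ex leb (fun x => f1 x * f4 x) * Ex leb (fun x => f2 x * f3 x)).
Proof.
move=> dl0 c1 c2 c3 c4 w1 w2 w3 w4.
pose Z := grid_noise L m dl; pose a (f : R -> R) (j : nat) := f ((j.+1%:R - m%:R) * dl).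
have Z4 j : L4 P (Z j) by exact: grid_noise_L4.
have iZ n : mutually_independent P (fun i : 'I_n => Z i) by exact: noise_indep HN _ _ _ _.
have Z0 j : Ex P (Z j) = 0 by have [] := @grid_noise_moments m dl j dl0.
have Z2 j : Ex P (fun w => Z j w ^+ 2) = dl * sigma2.
  by have [] := @grid_noise_moments m dl j dl0.
have Z44 j : Ex P (fun w => Z j w ^+ 4) = dl * kappa4 + 3 * (dl * sigma2) ^+ 2.
  by have [] := @grid_noise_moments m dl j dl0.
pose lin f w := \sum_(j < 2 * m) a f j * Z j w.
have mY f Y : wiener P L f Y -> measurable_fun setT Y by case=> _ [].
have ml f : measurable_fun setT (lin f).
  by apply: L4_measurable; apply: L4_sum => j _; exact: L4Z.
rewrite (ae_eq_Ex (g := fun w => lin f1 w * lin f2 w * (lin f3 w * lin f4 w))); first last.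
- have h1 := wiener_cellwise dl0 c1 w1; have h2 := wiener_cellwise dl0 c2 w2.
  have h3 := wiener_cellwise dl0 c3 w3; have h4 := wiener_cellwise dl0 c4 w4.
  have h12 : {ae P, forall w, Y1 w * Y2 w = lin f1 w * lin f2 w} by apply: filterS2 h1 h2 => w -> ->.
  by apply: filterS3 h12 h3 h4 => w -> -> ->.
- by do 2!apply: measurable_funM => //; exact: measurable_funM.
- apply: measurable_funM; apply: measurable_funM;
    [exact: mY w1|exact: mY w2|exact: mY w3|exact: mY w4].
rewrite (linear_form_fourth Z4 iZ Z0 Z2 Z44 (2 * m) (a f1) (a f2) (a f3) (a f4)).
rewrite (cellwise_Ex dl0 (cellwiseM (cellwiseM c1 c2) (cellwiseM c3 c4))).
rewrite (cellwise_Ex dl0 (cellwiseM c1 c2)) (cellwise_Ex dl0 (cellwiseM c3 c4)).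
rewrite (cellwise_Ex dl0 (cellwiseM c1 c3)) (cellwise_Ex dl0 (cellwiseM c2 c4)).
rewrite (cellwise_Ex dl0 (cellwiseM c1 c4)) (cellwise_Ex dl0 (cellwiseM c2 c3)).
rewrite /a; ring.
Qed.

End fourth_moment_cellwise.

(** ** Approximation by dyadic grid functions *)

Section dyadic.
Context (R : realType).
Let leb := @lebesgue_measure R.
Variable Dlt : R.
Hypothesis Dlt0 : 0 < Dlt.
Implicit Types f h : R -> R.

Definition mesh (k : nat) : R := Dlt / (2 ^ k)%:R.

(** Meshes are halved so that any two such functions live on a common grid, and they
    divide [Dlt] so that shifts by [Dlt] are shifts by whole cells. *)
Definition dyadic (k m : nat) f := cellwise (mesh k) (m * 2 ^ k)%N f.

Lemma mesh_gt0 k : 0 < mesh k.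
Proof. by rewrite divr_gt0// ltr0n expn_gt0. Qed.

Lemma mesh_le k : mesh k <= Dlt.
Proof. by rewrite ler_pdivrMr ?ltr0n ?expn_gt0// ler_peMr ?ler1n ?expn_gt0// ltW. Qed.

Lemma meshM k m : (m * 2 ^ k)%:R * mesh k = m%:R * Dlt :> R.
Proof. by rewrite natrM /mesh; field; rewrite pnatr_eq0 expn_eq0. Qed.

Lemma mesh_cvg : mesh k @[k --> \oo] --> (0 : R).
Proof.
apply: (@cvg_norm_le _ _ _ _ _ (fun k => Dlt * k.+1%:R^-1)).
  move=> k; rewrite subr0 ger0_norm; last exact/ltW/mesh_gt0.
  rewrite /mesh ler_wpM2l ?(ltW Dlt0)// lef_pV2 ?posrE ?ltr0n ?expn_gt0//.
  by rewrite ler_nat ltn_expl.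
rewrite -[X in _ --> X](mulr0 Dlt); apply: cvgM; [exact: cvg_cst|exact: cvg_harmonic].
Qed.

Lemma dyadic_raise k k' m m' f : (k <= k')%N -> (m <= m')%N -> dyadic k m f -> dyadic k' m' f.
Proof.
move=> kk' mm' fd.
have e : mesh k = (2 ^ (k' - k))%N%:R * mesh k'.
  by rewrite /mesh -{2}(subnK kk') expnD natrM; field; rewrite !pnatr_eq0 !expn_eq0.
apply: (@cellwise_widen _ _ (m * 2 ^ k')%N); [exact: mesh_gt0|by rewrite leq_mul2r mm' orbT|].
have -> : (m * 2 ^ k' = m * 2 ^ k * 2 ^ (k' - k))%N by rewrite -mulnA -expnD subnKC.
apply: cellwise_refine; [by rewrite expn_gt0|exact: mesh_gt0|by rewrite -e].
Qed.

Lemma dyadic_supp k m f x : dyadic k m f -> ~~ (- (m%:R * Dlt) < x <= m%:R * Dlt) -> f x = 0.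
Proof. by move=> [_ f0]; rewrite -(meshM k); exact: f0. Qed.

Lemma dyadic_L2 k m f : dyadic k m f -> L2 leb f.
Proof. exact: cellwise_L2 (mesh_gt0 k). Qed.

Lemma dyadicM k m f g : dyadic k m f -> dyadic k m g -> dyadic k m (fun x => f x * g x).
Proof. exact: cellwiseM. Qed.

(** Sampling at left end points: step functions are locally constant on the left, so the
    samples converge at every point. *)
Definition sample (k : nat) h (x : R) : R := h ((Num.ceil (x / mesh k) - 1)%:~R * mesh k).

Definition locally_constant_left h := forall x : R, exists2 e : R, 0 < e &
  forall y, x - e < y -> y <= x -> h y = h x.

Lemma sample_point k x : x - mesh k <= (Num.ceil (x / mesh k) - 1)%:~R * mesh k < x.
Proof.
have /andP[h1 h2] := ceil_itv (x / mesh k); have m0 := mesh_gt0 k.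
rewrite -ltr_pdivlMr// h1 andbT intrB mulrBl mul1r lerD2r.
by rewrite -ler_pdivrMr.
Qed.

Lemma sample_cvg h x : locally_constant_left h -> sample k h x @[k --> \oo] --> h x.
Proof.
move=> /(_ x)[e e0 he]; apply: cvg_near_cst.
have /cvgrPdist_lt/(_ _ e0) := mesh_cvg; apply: filterS => k.
rewrite sub0r normrN ger0_norm ?(ltW (mesh_gt0 k))// => ke.
rewrite /sample; have /andP[h1 /ltW h2] := sample_point k x.
by rewrite (he _ _ h2) ?eqxx//; apply: lt_le_trans h1; rewrite ltrD2l ltrN2.
Qed.

Lemma sample_dyadic k m h : (forall x, ~~ (- (m%:R * Dlt) < x <= m%:R * Dlt) -> h x = 0) ->
  dyadic k m.+1 (sample k h).
Proof.
move=> h0; have m0 := mesh_gt0 k; split => [i x Hi|x].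
  have ce y : (i - 1)%:~R * mesh k < y <= i%:~R * mesh k -> Num.ceil (y / mesh k) = i.
    by move=> Hy; apply: ceil_def; rewrite ltr_pdivlMr// ler_pdivrMr.
  rewrite /sample (ce x)// (ce (i%:~R * mesh k))// lexx andbT ltr_pM2r// ltr_int; lia.
rewrite meshM => /negP xm; apply: h0; apply/negP => /andP[h1 h2]; apply: xm.
have /andP[s1 s2] := sample_point k x; have := mesh_le k; rewrite -natr1 mulrDl mul1r.
by move: h1 h2 s1 s2; lra.
Qed.

Lemma locally_constant_left_itv (a b : R) : locally_constant_left (\1_`]a, b] : R -> R).
Proof.
move=> x; have [xa|ax] := leP x a.
  exists 1 => // y _ yx; rewrite !indicE !mem_setE !in_itv/= !ltNge xa.
  by rewrite (le_trans yx xa).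
have [xb|bx] := leP x b.
  exists (x - a); first by rewrite subr_gt0.
  move=> y; rewrite opprB addrCA subrr addr0 => ay yx.
  by rewrite !indicE !mem_setE !in_itv/= ay ax xb (le_trans yx xb).
exists (x - b); first by rewrite subr_gt0.
move=> y; rewrite opprB addrCA subrr addr0 => ay yx.
by rewrite !indicE !mem_setE !in_itv/= !leNgt ay bx !andbF.
Qed.

Lemma locally_constant_left2 (F : R -> R -> R) h h' : locally_constant_left h ->
  locally_constant_left h' -> locally_constant_left (fun x => F (h x) (h' x)).
Proof.
move=> hl hl' x; have [e e0 he] := hl x; have [e' e'0 he'] := hl' x.
exists (Num.min e e'); first by rewrite lt_min e0.
move=> y y1 y2; rewrite he// ?he'//; apply: le_lt_trans y1; rewrite lerD2l lerN2 ge_min lexx ?orbT//.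
Qed.

Lemma locally_constant_left_step (g : step_data R) : locally_constant_left (step_fun g).
Proof.
elim: g => [|u g IH].
  by move=> x; exists 1 => // y _ _; rewrite /step_fun !big_nil.
have -> : step_fun (u :: g) = fun x => u.1 * \1_`]u.2.1, u.2.2] x + step_fun g x.
  by apply/funext => x; rewrite /step_fun big_cons.
exact: (locally_constant_left2 (fun a b => u.1 * a + b) (@locally_constant_left_itv _ _) IH).
Qed.

(** The product is controlled separately: it enters the fourth moments, and it does not
    depend continuously on the factors in L^2. *)
Definition pair_close (e : R) (f1 f2 g1 g2 : R -> R) := [/\
  nrm leb (fun x => g1 x - f1 x) <= e, nrm leb (fun x => g2 x - f2 x) <= e &
  nrm leb (fun x => g1 x * g2 x - f1 x * f2 x) <= e].

Definition pairL2 (f1 f2 : R -> R) :=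
  [/\ L2 leb f1, L2 leb f2 & L2 leb (fun x => f1 x * f2 x)].

Lemma dyadic_pairL2 k m f1 f2 : dyadic k m f1 -> dyadic k m f2 -> pairL2 f1 f2.
Proof.
by move=> d1 d2; split; [exact: dyadic_L2 d1|exact: dyadic_L2 d2|exact: dyadic_L2 (dyadicM d1 d2)].
Qed.

Lemma pair_close_trans e e' f1 f2 g1 g2 h1 h2 :
  pairL2 f1 f2 -> pairL2 g1 g2 -> pairL2 h1 h2 -> pair_close e f1 f2 g1 g2 -> pair_close e' g1 g2 h1 h2 -> pair_close (e + e') f1 f2 h1 h2.
Proof.
move=> [F1 F2 F3] [G1 G2 G3] [H1 H2 H3] [a1 a2 a3] [b1 b2 b3].
have tri (u v w : R -> R) (x y : R) : L2 leb u -> L2 leb v -> L2 leb w ->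
    nrm leb (fun t => v t - u t) <= x -> nrm leb (fun t => w t - v t) <= y ->
    nrm leb (fun t => w t - u t) <= x + y.
  move=> u2 v2 w2 h h'; apply: le_trans (lerD h h').
  apply: le_trans (nrm_tri (L2B v2 u2) (L2B w2 v2)).
  by rewrite le_eqVlt; apply/orP; left; apply/eqP; apply: (@eq_nrm _ _ R leb) => t; ring.
split; [exact: tri a1 b1|exact: tri a2 b2|exact: tri a3 b3].
Qed.

Definition box (m : nat) : R -> R := \1_`]- (m%:R * Dlt), m%:R * Dlt].

Lemma box_out m x : ~~ (- (m%:R * Dlt) < x <= m%:R * Dlt) -> box m x = 0.
Proof. by move=> h; rewrite /box indicE mem_setE in_itv/= (negbTE h). Qed.

Lemma box_bound m x : `|box m x| <= 1.
Proof. by rewrite /box indicE; case: (_ \in _); rewrite ?normr1 ?normr0. Qed.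

Lemma box_cvg x : box m x @[m --> \oo] --> (1 : R).
Proof.
apply: cvg_near_cst; near=> m; rewrite /box indicE mem_setE in_itv/=.
have h : `|x| / Dlt < m%:R by near: m; exact: nbhs_infty_gtr.
rewrite ltr_pdivrMr// in h; have := ler_norm x; have := ler_norm (- x); rewrite normrN => h1 h2.
have -> : - (m%:R * Dlt) < x by lra.
by have -> : x <= m%:R * Dlt by lra.
Unshelve. all: by end_near. Qed.

Lemma measurable_box m : measurable_fun setT (box m).
Proof. exact: measurable_indic. Qed.

Lemma box_mul_L2 m f : L2 leb f -> L2 leb (fun x => box m x * f x).
Proof.
move=> f2; apply: (L2_le _ _ f2); first exact: measurable_funM (measurable_box m) (L2_measurable f2).
by move=> x; rewrite normrM ler_piMl// box_bound.
Qed.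

Lemma pair_close_ex (u1 u2 : nat -> R -> R) f1 f2 :
  nrm leb (fun x => u1 n x - f1 x) @[n --> \oo] --> (0 : R) ->
  nrm leb (fun x => u2 n x - f2 x) @[n --> \oo] --> (0 : R) ->
  nrm leb (fun x => u1 n x * u2 n x - f1 x * f2 x) @[n --> \oo] --> (0 : R) ->
  forall e : R, 0 < e -> exists n, pair_close e f1 f2 (u1 n) (u2 n).
Proof.
move=> h1 h2 h3 e e0.
have pos (a : R) : 0 <= a -> `|0 - a| <= e -> a <= e.
  by move=> a0; rewrite sub0r normrN ger0_norm.
have /cvgrPdist_le/(_ _ e0) k1 := h1; have /cvgrPdist_le/(_ _ e0) k2 := h2.
have /cvgrPdist_le/(_ _ e0) k3 := h3.
have : \forall n \near \oo, pair_close e f1 f2 (u1 n) (u2 n).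
  by apply: filterS3 k1 k2 k3 => n a b c; split; apply: pos; rewrite ?nrm_ge0.
by move=> [N _ /(_ N (leqnn N))] H; exists N.
Qed.

Lemma nrm_dominated_leb (F : nat -> R -> R) f g :
  (forall n, measurable_fun setT (F n)) -> measurable_fun setT f ->
  (forall x, F n x @[n --> \oo] --> f x) -> L2 leb g ->
  (forall n x, `|F n x| <= g x) -> nrm leb (fun x => F n x - f x) @[n --> \oo] --> (0 : R).
Proof. by move=> *; exact: (@nrm_dominated _ (measurableTypeR R) R leb F f g). Qed.

(** Clipping decreases absolute values, so the products are dominated by the product of
    the given functions. *)
Lemma clip_box_approx m f1 f2 : L2 leb f1 -> L2 leb f2 -> L2 leb (fun x => f1 x * f2 x) ->
  forall e : R, 0 < e -> exists n, pair_close e (fun x => box m x * f1 x) (fun x => box m x * f2 x)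
    (fun x => box m x * clip n%:R (f1 x)) (fun x => box m x * clip n%:R (f2 x)).
Proof.
move=> F1 F2 F3.
have mb := measurable_box m; have b1 := box_bound m.
have one f : L2 leb f -> nrm leb (fun x => box m x * clip n%:R (f x) - box m x * f x) @[n --> \oo] --> (0 : R).
  move=> f2'; have [mf _] := f2'; apply: (nrm_dominated_leb (g := fun x => `|f x|)).
  - by move=> n; apply: measurable_funM => //; exact: measurable_clip.
  - exact: measurable_funM.
  - by move=> x; apply: cvgM; [exact: cvg_cst|exact: clip_cvg].
  - exact: L2_abs.
  - by move=> n x; rewrite normrM; apply: le_trans (ler_piMl _ (b1 x)) (clip_le _ _).
apply: (@pair_close_ex (fun n x => box m x * clip n%:R (f1 x)) (fun n x => box m x * clip n%:R (f2 x)) _ _ (one _ F1) (one _ F2)).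
have [mf1 _] := F1; have [mf2 _] := F2.
apply: (nrm_dominated_leb (g := fun x => `|f1 x * f2 x|)).
- by move=> n; apply: measurable_funM; apply: measurable_funM => //; exact: measurable_clip.
- by apply: measurable_funM; exact: measurable_funM.
- by move=> x; apply: cvgM; apply: cvgM; first [exact: cvg_cst|exact: clip_cvg].
- exact: L2_abs.
- move=> n x; rewrite !normrM; apply: ler_pM; rewrite ?mulr_ge0//.
    exact: le_trans (ler_piMl _ (b1 x)) (clip_le _ _).
  exact: le_trans (ler_piMl _ (b1 x)) (clip_le _ _).
Qed.

Definition step_approximable f := exists g : nat -> step_data R,
  nrm leb (fun x => step_fun (g n) x - f x) @[n --> \oo] --> (0 : R).

(** Clipped functions are bounded, so convergence of the factors implies convergence of
    the product, and clipping is a contraction. *)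
Lemma step_box_approx m (n : nat) f1 f2 : L2 leb f1 -> L2 leb f2 ->
  step_approximable f1 -> step_approximable f2 ->
  forall e : R, 0 < e -> exists g1 g2 : step_data R, pair_close e
    (fun x => box m x * clip n%:R (f1 x)) (fun x => box m x * clip n%:R (f2 x))
    (fun x => box m x * clip n%:R (step_fun g1 x)) (fun x => box m x * clip n%:R (step_fun g2 x)).
Proof.
move=> F1 F2 [g1 G1] [g2 G2].
have mb := measurable_box m; have b1 := box_bound m.
have n0 : 0 <= n%:R :> R by exact: ler0n.
have mc f : measurable_fun setT f -> measurable_fun setT (fun x => box m x * clip n%:R (f x)).
  by move=> mf; apply: measurable_funM => //; exact: measurable_clip.
have ms (g : step_data R) : measurable_fun setT (step_fun g) := L2_measurable (step_fun_L2 g).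
have lip f f' x : `|box m x * clip n%:R (f x) - box m x * clip n%:R (f' x)| <= `|f x - f' x|.
  by rewrite -mulrBr normrM; apply: le_trans (ler_piMl _ (b1 x)) (clip_lipschitz _ _ _).
have bd f x : `|box m x * clip n%:R (f x)| <= n%:R.
  by rewrite normrM; apply: le_trans (ler_piMl _ (b1 x)) (clip_bound _ _).
have one f (g : nat -> step_data R) : L2 leb f ->
    nrm leb (fun x => step_fun (g j) x - f x) @[j --> \oo] --> (0 : R) ->
    nrm leb (fun x => box m x * clip n%:R (step_fun (g j) x) - box m x * clip n%:R (f x)) @[j --> \oo] --> (0 : R).
  move=> f2' H; have [mf _] := f2'.
  apply: (@cvg_norm_le _ _ _ _ _ (fun j => nrm leb (fun x => step_fun (g j) x - f x))) => // j.
  rewrite subr0 ger0_norm ?nrm_ge0//; apply: nrm_le.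
  - by apply: measurable_funB; exact: mc.
  - by move=> x; exact: lip.
  - exact: L2B (step_fun_L2 _) f2'.
move=> e e0; have := @pair_close_ex (fun j x => box m x * clip n%:R (step_fun (g1 j) x))
  (fun j x => box m x * clip n%:R (step_fun (g2 j) x)) _ _ (one _ _ F1 G1) (one _ _ F2 G2).
move=> /(_ _ _ e0)[|j Hj]; last by exists (g1 j), (g2 j).
have [mf1 _] := F1; have [mf2 _] := F2.
apply: (@cvg_norm_le _ _ _ _ _ (fun j => n%:R * (nrm leb (fun x => step_fun (g1 j) x - f1 x) +
  nrm leb (fun x => step_fun (g2 j) x - f2 x)))); last first.
  rewrite [X in _ --> X](_ : _ = n%:R * (0 + 0)); last by rewrite addr0 mulr0.
  by apply: cvgM; [exact: cvg_cst|exact: cvgD].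
move=> j; rewrite subr0 ger0_norm ?nrm_ge0//.
have D1 := L2B (step_fun_L2 (g1 j)) F1; have D2 := L2B (step_fun_L2 (g2 j)) F2.
have D12 := L2D (L2_abs D1) (L2_abs D2).
apply: (@le_trans _ _ (nrm leb (fun x => n%:R * (`|step_fun (g1 j) x - f1 x| + `|step_fun (g2 j) x - f2 x|)))).
  apply: nrm_le; [|move=> x|exact: L2Z].
    by apply: measurable_funB; apply: measurable_funM; exact: mc.
  rewrite [leRHS]ger0_norm ?mulr_ge0 ?addr_ge0//.
  set u1 := box m x * clip _ (step_fun (g1 j) x); set u2 := box m x * clip _ (step_fun (g2 j) x).
  set w1 := box m x * clip _ (f1 x); set w2 := box m x * clip _ (f2 x).
  have -> : u1 * u2 - w1 * w2 = (u1 - w1) * u2 + w1 * (u2 - w2) by ring.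
  apply: le_trans (ler_normD _ _) _; rewrite [leRHS]mulrDr; apply: lerD; rewrite normrM.
    by rewrite mulrC ler_pM//; [exact: bd|exact: lip].
  by rewrite ler_pM//; [exact: bd|exact: lip].
rewrite nrmZ// ger0_norm// ler_wpM2l//; apply: le_trans (nrm_tri (L2_abs D1) (L2_abs D2)) _.
by rewrite !nrm_abs.
Qed.

(** Clip, replace by clipped step functions, and sample.  The support grows by less than
    one unit because sampling looks back by at most one cell. *)
Lemma dyadic_box_approx m f1 f2 : L2 leb f1 -> L2 leb f2 -> L2 leb (fun x => f1 x * f2 x) ->
  step_approximable f1 -> step_approximable f2 -> forall e : R, 0 < e ->
  exists k a1 a2, [/\ dyadic k m.+1 a1, dyadic k m.+1 a2 &
    pair_close e (fun x => box m x * f1 x) (fun x => box m x * f2 x) a1 a2].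
Proof.
move=> F1 F2 F3 A1 A2 e e0.
have e30 : 0 < e / 3 by rewrite divr_gt0.
have [n Hn] := clip_box_approx m F1 F2 F3 e30.
have [g1 [g2 Hg]] := step_box_approx m n F1 F2 A1 A2 e30.
have mb := measurable_box m; have b1 := box_bound m.
have n0 : 0 <= n%:R :> R by exact: ler0n.
pose h (g : step_data R) x := box m x * clip n%:R (step_fun g x).
have hl g : locally_constant_left (h g).
  exact: (locally_constant_left2 (fun a b => a * clip n%:R b) (@locally_constant_left_itv _ _)
    (@locally_constant_left_step g)).
have hb g x : `|h g x| <= n%:R.
  by rewrite normrM; apply: le_trans (ler_piMl _ (b1 x)) (clip_bound _ _).
have h0 g x : ~~ (- (m%:R * Dlt) < x <= m%:R * Dlt) -> h g x = 0.
  by move=> xm; rewrite /h box_out// mul0r.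
have sd k g : dyadic k m.+1 (sample k (h g)) by apply: sample_dyadic; exact: h0.
have mh g : measurable_fun setT (h g).
  by apply: measurable_funM => //; apply: measurable_clip; exact: L2_measurable (step_fun_L2 g).
have b2 (c : R) : L2 leb (fun x => c * box m.+1 x) by apply: L2Z; exact: L2_itv.
have dom k g x : `|sample k (h g) x| <= n%:R * box m.+1 x.
  have [xin|xout] := boolP (- (m.+1%:R * Dlt) < x <= m.+1%:R * Dlt).
    by rewrite /box indicE mem_setE in_itv/= xin mulr1; exact: hb.
  by rewrite (dyadic_supp (sd k g) xout) box_out// mulr0 normr0.
have one g : nrm leb (fun x => sample k (h g) x - h g x) @[k --> \oo] --> (0 : R).
  apply: (nrm_dominated_leb _ _ _ (b2 n%:R)) => //.
  - by move=> k; exact: L2_measurable (dyadic_L2 (sd k g)).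
  - by move=> x; exact: sample_cvg.
have [k Hk] : exists k, pair_close (e / 3) (h g1) (h g2) (sample k (h g1)) (sample k (h g2)).
  apply: (@pair_close_ex (fun k => sample k (h g1)) (fun k => sample k (h g2))) => //.
  apply: (nrm_dominated_leb _ _ _ (b2 (n%:R * n%:R))).
  - by move=> k; apply: measurable_funM; exact: L2_measurable (dyadic_L2 (sd k _)).
  - exact: measurable_funM.
  - by move=> x; apply: cvgM; exact: sample_cvg.
  - move=> k x; rewrite normrM; apply: le_trans (ler_pM _ _ (dom k g1 x) (dom k g2 x)) _ => //.
    by rewrite /box indicE; case: (_ \in _); rewrite ?mulr1 ?mulr0// mulr0.
exists k, (sample k (h g1)), (sample k (h g2)); split => //.
have clipL2 (u : R -> R) : measurable_fun setT u -> L2 leb (fun x => box m x * clip n%:R (u x)).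
  move=> mu; apply: (L2_le _ _ (L2Z n%:R (L2_itv (- (m%:R * Dlt)) (m%:R * Dlt)))).
    by apply: measurable_funM => //; exact: measurable_clip.
  move=> x; rewrite !normrM mulrC (ger0_norm n0).
  by rewrite ler_wpM2r//; exact: clip_bound.
have clipL22 (u v : R -> R) : measurable_fun setT u -> measurable_fun setT v ->
    L2 leb (fun x => box m x * clip n%:R (u x) * (box m x * clip n%:R (v x))).
  move=> mu mv; apply: (L2_le _ _ (L2Z n%:R (clipL2 u mu))).
    by apply: measurable_funM; apply: measurable_funM => //; exact: measurable_clip.
  move=> x; rewrite [leLHS]normrM [leRHS]normrM mulrC (ger0_norm n0).
  rewrite ler_wpM2r// normrM; apply: le_trans (ler_piMl _ (b1 x)) (clip_bound _ _) => //.
have box2 : L2 leb (fun x => box m x * f1 x * (box m x * f2 x)).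
  apply: (L2_le _ _ F3).
    by apply: measurable_funM; apply: measurable_funM => //; [exact: L2_measurable F1|exact: L2_measurable F2].
  move=> x; rewrite !normrM; apply: ler_pM; rewrite ?mulr_ge0//; exact: ler_piMl.
have [mf1 _] := F1; have [mf2 _] := F2.
have ms (g : step_data R) : measurable_fun setT (step_fun g) := L2_measurable (step_fun_L2 g).
have -> : e = e / 3 + e / 3 + e / 3 by field.
have p1 : pairL2 (fun x => box m x * f1 x) (fun x => box m x * f2 x).
  by split; [exact: box_mul_L2|exact: box_mul_L2|exact: box2].
have p2 : pairL2 (fun x => box m x * clip n%:R (f1 x)) (fun x => box m x * clip n%:R (f2 x)).
  by split; [exact: clipL2|exact: clipL2|exact: clipL22].
have p3 : pairL2 (h g1) (h g2).
  by split; [exact: clipL2|exact: clipL2|exact: clipL22].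
have p4 : pairL2 (sample k (h g1)) (sample k (h g2)) by exact: dyadic_pairL2 (sd k g1) (sd k g2).
exact: (pair_close_trans p1 p3 p4 (pair_close_trans p1 p2 p3 Hn Hg) Hk).
Qed.

End dyadic.

Section dyadic_density.
Context (R : realType).
Let leb := @lebesgue_measure R.
Variable Dlt : R.
Hypothesis Dlt0 : 0 < Dlt.

Lemma box_pairL2 m f1 f2 : pairL2 f1 f2 ->
  pairL2 (fun x => box Dlt m x * f1 x) (fun x => box Dlt m x * f2 x).
Proof.
move=> [F1 F2 F3]; split; [exact: box_mul_L2|exact: box_mul_L2|].
apply: (L2_le _ _ F3).
  by apply: measurable_funM; apply: measurable_funM;
    [exact: measurable_box|exact: L2_measurable F1|exact: measurable_box|exact: L2_measurable F2].
move=> x; rewrite !normrM; apply: ler_pM; rewrite ?mulr_ge0//; exact: ler_piMl (box_bound _ _ _).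
Qed.

Lemma box_pair_cvg f1 f2 : pairL2 f1 f2 -> [/\
  nrm leb (fun x => box Dlt m x * f1 x - f1 x) @[m --> \oo] --> (0 : R),
  nrm leb (fun x => box Dlt m x * f2 x - f2 x) @[m --> \oo] --> (0 : R) &
  nrm leb (fun x => box Dlt m x * f1 x * (box Dlt m x * f2 x) - f1 x * f2 x)
    @[m --> \oo] --> (0 : R)].
Proof.
move=> [F1 F2 F3].
have bc f x : box Dlt m x * f x @[m --> \oo] --> (f x : R).
  by rewrite -[X in _ --> X]mul1r; apply: cvgM; [exact: box_cvg|exact: cvg_cst].
have bl f m x : `|box Dlt m x * f x| <= `|f x : R|.
  by rewrite normrM; exact: ler_piMl (box_bound _ _ _).
have mbf f m : measurable_fun setT f -> measurable_fun setT (fun x => box Dlt m x * f x).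
  by move=> mf; apply: measurable_funM => //; exact: measurable_box.
have [mf1 _] := F1; have [mf2 _] := F2; have [mf3 _] := F3.
have one f : L2 leb f -> nrm leb (fun x => box Dlt m x * f x - f x) @[m --> \oo] --> (0 : R).
  move=> F; have [mf _] := F; apply: (nrm_dominated_leb _ mf (bc f) (L2_abs F)) => //.
  by move=> n; exact: mbf.
split; [exact: one|exact: one|].
apply: (nrm_dominated_leb _ mf3 _ (L2_abs F3)).
- by move=> n; apply: measurable_funM; exact: mbf.
- by move=> x; apply: cvgM; exact: bc.
- by move=> n x; rewrite !normrM -!normrM [leRHS]normrM normrM ler_pM.
Qed.

Lemma dyadic_approx f1 f2 : pairL2 f1 f2 -> step_approximable f1 -> step_approximable f2 ->
  forall e : R, 0 < e -> exists k m a1 a2,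
    [/\ dyadic Dlt k m a1, dyadic Dlt k m a2 & pair_close e f1 f2 a1 a2].
Proof.
move=> F A1 A2 e e0; have e20 : 0 < e / 2 by rewrite divr_gt0.
have [c1 c2 c3] := box_pair_cvg F.
have [m Hm] := @pair_close_ex _ (fun m x => box Dlt m x * f1 x) (fun m x => box Dlt m x * f2 x)
  f1 f2 c1 c2 c3 _ e20.
have [F1 F2 F3] := F.
have [k [a1 [a2 [d1 d2 H]]]] := dyadic_box_approx Dlt0 m F1 F2 F3 A1 A2 e20.
exists k, m.+1, a1, a2; split => //; rewrite (splitr e).
exact: (pair_close_trans F (box_pairL2 m F) (dyadic_pairL2 Dlt0 d1 d2) Hm H).
Qed.

End dyadic_density.

Section product_limit.
Context d (T : measurableType d) (R : realType) (P : probability T R).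

(** The L^1 limit identifies the limit in probability; Fatou's lemma in l, applied to
    V_n - V_l, then gives the rate. *)
Lemma L2_cauchy_limit (V_ : nat -> T -> R) V : (forall n, L2 P (V_ n)) -> measurable_fun setT V ->
  L1 P V ->
  (forall e : R, 0 < e -> exists N, forall n l, (N <= n)%N -> (N <= l)%N ->
    nrm P (fun w => V_ n w - V_ l w) <= e) ->
  Ex P (fun w => `|V_ n w - V w|) @[n --> \oo] --> (0 : R) ->
  L2 P V /\ nrm P (fun w => V_ n w - V w) @[n --> \oo] --> (0 : R).
Proof.
move=> V2 mV V1 Vc VV.
have V_1 n := L2_L1 (V2 n); have mV_ n := L2_measurable (V2 n).
have prob : cvg_in_probability P V_ V.
  move=> e e0; pose S n w := Num.sqrt `|V_ n w - V w|.
  have se0 : 0 < Num.sqrt e by rewrite sqrtr_gt0.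
  have mS n : measurable_fun setT (S n).
    apply: (measurableT_comp (continuous_measurable_fun (@sqrt_continuous R))).
    by apply: measurable_abs; exact: measurable_funB.
  have Ssq n w : S n w ^+ 2 = `|V_ n w - V w| by rewrite sqr_sqrtr.
  have S2 n : L2 P (S n).
    by split => //; apply: (@eq_L1 _ _ _ P (fun w => `|V_ n w - V w|)) => //; exact/L1_abs/L1B.
  have E n : P [set w | e <= `|V_ n w - V w|] = P [set w | Num.sqrt e <= `|S n w|].
    congr (P _); apply/seteqP; split => w /=; rewrite (ger0_norm (sqrtr_ge0 _)) ler_psqrt// nnegrE ?(ltW e0)//.
  apply/fine_cvgP; split.
    by apply/nearW => n; rewrite E fin_num_measure//; exact: measurable_abs_ge.
  apply: (@cvg_norm_le _ _ _ _ _ (fun n => Ex P (fun w => `|V_ n w - V w|) / e)); last first.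
    by rewrite -[X in _ --> X](mul0r e^-1); apply: cvgM => //; exact: cvg_cst.
  move=> n /=; rewrite subr0 ger0_norm ?fine_ge0// E.
  apply: le_trans (chebyshev (S2 n) se0) _.
  by rewrite sqr_sqrtr ?(ltW e0)// (eq_Ex (g := fun w => `|V_ n w - V w|)).
have key (e : R) : 0 < e -> exists N, forall n, (N <= n)%N ->
    L2 P (fun w => V_ n w - V w) /\ nrm P (fun w => V_ n w - V w) <= e.
  move=> e0; have [N HN] := Vc e e0; exists N => n Nn.
  apply: (@Ex_sqr_fatou_probability _ _ _ P (fun l w => V_ n w - V_ l w)).
  - by move=> l; exact: L2B.
  - exact: measurable_funB.
  - move=> e' e'0; have := prob e' e'0; apply: cvg_trans; apply: near_eq_cvg; apply/nearW => k.
    congr (P _); apply/seteqP; split => w /=;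
      rewrite (_ : V_ n w - V_ k w - (V_ n w - V w) = - (V_ k w - V w)) ?normrN//; ring.
  - exact: ltW.
  - move=> e' e'0; exists N => // l /= Nl; apply: le_trans (HN _ _ Nn Nl) _.
    by rewrite lerDl ltW.
split.
  have [N /(_ N (leqnn N))[h _]] := key 1 ltr01.
  by apply: eq_L2 (L2B (V2 N) h) => w; ring.
apply/cvgrPdist_le => e e0; have [N HN] := key e e0; exists N => // n /= Nn.
by rewrite sub0r normrN ger0_norm ?nrm_ge0//; have [] := HN n Nn.
Qed.

Lemma L1_product_cvg (A B : nat -> T -> R) Y Z :
  (forall n, L2 P (A n)) -> (forall n, L2 P (B n)) -> L2 P Y -> L2 P Z ->
  nrm P (fun w => A n w - Y w) @[n --> \oo] --> (0 : R) ->
  nrm P (fun w => B n w - Z w) @[n --> \oo] --> (0 : R) ->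
  Ex P (fun w => `|A n w * B n w - Y w * Z w|) @[n --> \oo] --> (0 : R).
Proof.
move=> A2 B2 Y2 Z2 AY BZ.
pose a n := nrm P (fun w => A n w - Y w); pose b n := nrm P (fun w => B n w - Z w).
apply: (@cvg_norm_le _ _ _ _ _ (fun n => a n * (nrm P Z + b n) + nrm P Y * b n)); last first.
  rewrite [X in _ --> X](_ : _ = 0 * (nrm P Z + 0) + nrm P Y * 0); last by ring.
  apply: cvgD; apply: cvgM => //; first by apply: cvgD => //; exact: cvg_cst.
  exact: cvg_cst.
move=> n; rewrite subr0 ger0_norm; last by apply: Ex_ge0.
have AY2 := L2B (A2 n) Y2; have BZ2 := L2B (B2 n) Z2.
have m1 := L2M (L2_abs AY2) (L2_abs (B2 n)); have m2 := L2M (L2_abs Y2) (L2_abs BZ2).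
apply: (@le_trans _ _ (Ex P (fun w => `|A n w - Y w| * `|B n w| + `|Y w| * `|B n w - Z w|))).
  apply: le_Ex => [||w]; [by apply/L1_abs/L1B; exact: L2M|exact: L1D|].
  rewrite -!normrM; apply: le_trans (ler_normD _ _).
  by rewrite le_eqVlt; apply/orP; left; apply/eqP; congr (`| _ |); ring.
rewrite ExD//; apply: lerD.
  apply: le_trans (le_trans (ler_norm _) (ler_dot_nrm (L2_abs AY2) (L2_abs (B2 n)))) _.
  rewrite !nrm_abs ler_wpM2l ?nrm_ge0//.
  have := nrm_tri Z2 BZ2; apply: le_trans; rewrite le_eqVlt; apply/orP; left; apply/eqP.
  by apply: eq_nrm => w; ring.
apply: le_trans (le_trans (ler_norm _) (ler_dot_nrm (L2_abs Y2) (L2_abs BZ2))) _.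
by rewrite !nrm_abs.
Qed.

End product_limit.

Section fourth_moment.
Context d (T : measurableType d) (R : realType) (P : probability T R).
Variables (L : R -> T -> R) (sigma2 kappa4 : R).
Hypothesis HN : levy_noise P L sigma2 kappa4.
Let leb := @lebesgue_measure R.
Variable Dlt : R.
Hypothesis Dlt0 : 0 < Dlt.

Let dot (f g : R -> R) : R := Ex leb (fun x => f x * g x).

(** The fourth moment of stochastic integrals: one cumulant and three pairings. *)
Definition moment4 (f1 f2 g1 g2 : R -> R) : R :=
  kappa4 * Ex leb (fun x => f1 x * f2 x * (g1 x * g2 x)) +
  sigma2 ^+ 2 * (dot f1 f2 * dot g1 g2 + dot f1 g1 * dot f2 g2 + dot f1 g2 * dot f2 g1).

Lemma moment4_cvg (I : Type) (F : set_system I) (FF : ProperFilter F)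
    (a1 a2 b1 b2 : I -> R -> R) f1 f2 g1 g2 :
  (forall i, pairL2 (a1 i) (a2 i)) -> (forall i, pairL2 (b1 i) (b2 i)) ->
  pairL2 f1 f2 -> pairL2 g1 g2 ->
  nrm leb (fun x => a1 i x - f1 x) @[i --> F] --> (0 : R) ->
  nrm leb (fun x => a2 i x - f2 x) @[i --> F] --> (0 : R) ->
  nrm leb (fun x => a1 i x * a2 i x - f1 x * f2 x) @[i --> F] --> (0 : R) ->
  nrm leb (fun x => b1 i x - g1 x) @[i --> F] --> (0 : R) ->
  nrm leb (fun x => b2 i x - g2 x) @[i --> F] --> (0 : R) ->
  nrm leb (fun x => b1 i x * b2 i x - g1 x * g2 x) @[i --> F] --> (0 : R) ->
  moment4 (a1 i) (a2 i) (b1 i) (b2 i) @[i --> F] --> moment4 f1 f2 g1 g2.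
Proof.
move=> A B [f12 f22 f32] [g12 g22 g32] a1c a2c a3c b1c b2c b3c.
have A1 i : L2 leb (a1 i) by have [] := A i.
have A2 i : L2 leb (a2 i) by have [] := A i.
have A3 i : L2 leb (fun x => a1 i x * a2 i x) by have [] := A i.
have B1 i : L2 leb (b1 i) by have [] := B i.
have B2 i : L2 leb (b2 i) by have [] := B i.
have B3 i : L2 leb (fun x => b1 i x * b2 i x) by have [] := B i.
have k1 := cvg_dot FF A3 B3 f32 g32 a3c b3c.
have k2 := cvg_dot FF A1 A2 f12 f22 a1c a2c.
have k3 := cvg_dot FF B1 B2 g12 g22 b1c b2c.
have k4 := cvg_dot FF A1 B1 f12 g12 a1c b1c.
have k5 := cvg_dot FF A2 B2 f22 g22 a2c b2c.
have k6 := cvg_dot FF A1 B2 f12 g22 a1c b2c.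
have k7 := cvg_dot FF A2 B1 f22 g12 a2c b1c.
rewrite /moment4 /dot; apply: cvgD; apply: cvgM; [exact: cvg_cst|exact: k1|exact: cvg_cst|].
apply: cvgD; [apply: cvgD|]; apply: cvgM;
  [exact: k2|exact: k3|exact: k4|exact: k5|exact: k6|exact: k7].
Qed.

Lemma wiener_dyadic k m a : dyadic Dlt k m a ->
  wiener P L a (step_integral L (grid_step (mesh Dlt k) (m * 2 ^ k)%N a)).
Proof.
move=> da; have m0 := mesh_gt0 Dlt0 k.
have := wiener_step HN (grid_step_wf (m * 2 ^ k)%N a m0).
by congr (wiener _ _ _ _); apply/funext => x; exact: step_fun_grid.
Qed.

Lemma wiener_dyadic_L4 k m a Y : dyadic Dlt k m a -> wiener P L a Y -> L4 P Y.
Proof. exact: (wiener_cellwise_L4 HN (mesh_gt0 Dlt0 k)). Qed.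

Lemma fourth_moment_dyadic k1 m1 k2 m2 a1 a2 b1 b2 Y1 Y2 Z1 Z2 :
  dyadic Dlt k1 m1 a1 -> dyadic Dlt k1 m1 a2 -> dyadic Dlt k2 m2 b1 -> dyadic Dlt k2 m2 b2 ->
  wiener P L a1 Y1 -> wiener P L a2 Y2 -> wiener P L b1 Z1 -> wiener P L b2 Z2 ->
  Ex P (fun w => Y1 w * Y2 w * (Z1 w * Z2 w)) = moment4 a1 a2 b1 b2.
Proof.
move=> d1 d2 e1 e2 w1 w2 v1 v2.
pose k := maxn k1 k2; pose m := maxn m1 m2.
have kl : (k1 <= k)%N := leq_maxl _ _; have kr : (k2 <= k)%N := leq_maxr _ _.
have ml : (m1 <= m)%N := leq_maxl _ _; have mr : (m2 <= m)%N := leq_maxr _ _.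
have m0 := mesh_gt0 Dlt0 k.
exact: (fourth_moment_cellwise HN m0 (dyadic_raise Dlt0 kl ml d1) (dyadic_raise Dlt0 kl ml d2)
  (dyadic_raise Dlt0 kr mr e1) (dyadic_raise Dlt0 kr mr e2) w1 w2 v1 v2).
Qed.

Lemma wiener_approximable f Y : wiener P L f Y -> step_approximable f.
Proof. by move=> [_ _ [g [_ gf _]]]; exists g. Qed.

(** The integrals of dyadic approximations are in L^4, so their products are in L^2, and by
    the fourth moment formula these products form a Cauchy sequence.  The product of the
    two integrals is their limit; this is also why it is square-integrable. *)
Lemma pair_approximation f1 f2 Y1 Y2 : pairL2 f1 f2 -> wiener P L f1 Y1 -> wiener P L f2 Y2 ->
  exists (k m : nat -> nat) (a1 a2 : nat -> R -> R) (A1 A2 : nat -> T -> R),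
  [/\ forall n, dyadic Dlt (k n) (m n) (a1 n) /\ dyadic Dlt (k n) (m n) (a2 n),
      forall n, wiener P L (a1 n) (A1 n) /\ wiener P L (a2 n) (A2 n),
      [/\ nrm leb (fun x => a1 n x - f1 x) @[n --> \oo] --> (0 : R),
        nrm leb (fun x => a2 n x - f2 x) @[n --> \oo] --> (0 : R) &
        nrm leb (fun x => a1 n x * a2 n x - f1 x * f2 x) @[n --> \oo] --> (0 : R)],
      L2 P (fun w => Y1 w * Y2 w) &
      nrm P (fun w => A1 n w * A2 n w - Y1 w * Y2 w) @[n --> \oo] --> (0 : R)].
Proof.
move=> F w1 w2.
have e0 n : 0 < n.+1%:R^-1 :> R by rewrite invr_gt0.
have /choice[c Hc] : forall n, exists c : nat * nat * (R -> R) * (R -> R),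
    [/\ dyadic Dlt c.1.1.1 c.1.1.2 c.1.2, dyadic Dlt c.1.1.1 c.1.1.2 c.2 &
     pair_close n.+1%:R^-1 f1 f2 c.1.2 c.2].
  move=> n; have [k [m [a1 [a2 [d1 d2 H]]]]] := dyadic_approx Dlt0 F
    (wiener_approximable w1) (wiener_approximable w2) (e0 n).
  by exists (k, m, a1, a2).
pose k n := (c n).1.1.1; pose m n := (c n).1.1.2; pose a1 n := (c n).1.2; pose a2 n := (c n).2.
have d1 n : dyadic Dlt (k n) (m n) (a1 n) by have [] := Hc n.
have d2 n : dyadic Dlt (k n) (m n) (a2 n) by have [] := Hc n.
pose A (a : nat -> R -> R) n := step_integral L (grid_step (mesh Dlt (k n)) (m n * 2 ^ k n)%N (a n)).
have v1 n : wiener P L (a1 n) (A a1 n) by exact: wiener_dyadic.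
have v2 n : wiener P L (a2 n) (A a2 n) by exact: wiener_dyadic.
have to0 (u : nat -> R) : (forall n, 0 <= u n <= n.+1%:R^-1) -> u @ \oo --> (0 : R).
  move=> un; apply: (@cvg_norm_le _ _ _ _ _ (fun n => n.+1%:R^-1)); last exact: cvg_harmonic.
  by move=> n; have /andP[u0 u1] := un n; rewrite subr0 ger0_norm.
have c1 : nrm leb (fun x => a1 n x - f1 x) @[n --> \oo] --> (0 : R).
  by apply: to0 => n; rewrite nrm_ge0; have [_ _ []] := Hc n.
have c2 : nrm leb (fun x => a2 n x - f2 x) @[n --> \oo] --> (0 : R).
  by apply: to0 => n; rewrite nrm_ge0; have [_ _ []] := Hc n.
have c3 : nrm leb (fun x => a1 n x * a2 n x - f1 x * f2 x) @[n --> \oo] --> (0 : R).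
  by apply: to0 => n; rewrite nrm_ge0; have [_ _ []] := Hc n.
have toP (a : nat -> R -> R) f Y : wiener P L f Y -> (forall n, wiener P L (a n) (A a n)) ->
    nrm leb (fun x => a n x - f x) @[n --> \oo] --> (0 : R) ->
    nrm P (fun w => A a n w - Y w) @[n --> \oo] --> (0 : R).
  move=> w v h; rewrite [X in X @ _ --> _](_ : _ = fun n => Num.sqrt sigma2 * nrm leb (fun x => a n x - f x)).
    by rewrite -[X in _ --> X](mulr0 (Num.sqrt sigma2)); apply: cvgM => //; exact: cvg_cst.
  by apply/funext => n; exact: (wiener_nrmB HN (v n) w).
have C1 := toP _ _ _ w1 v1 c1; have C2 := toP _ _ _ w2 v2 c2.
have Y12 := wiener_L2 w1; have Y22 := wiener_L2 w2.
have A12 n := wiener_L2 (v1 n); have A22 n := wiener_L2 (v2 n).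
have AA n : L2 P (fun w => A a1 n w * A a2 n w).
  by apply: L4M; [exact: wiener_dyadic_L4 (d1 n) (v1 n)|exact: wiener_dyadic_L4 (d2 n) (v2 n)].
have pa n : pairL2 (a1 n) (a2 n) := dyadic_pairL2 Dlt0 (d1 n) (d2 n).
have cauchy (e : R) : 0 < e -> exists N, forall n l, (N <= n)%N -> (N <= l)%N ->
    nrm P (fun w => A a1 n w * A a2 n w - A a1 l w * A a2 l w) <= e.
  move=> e0'.
  pose I := moment4 f1 f2 f1 f2.
  pose M n l := moment4 (a1 n) (a2 n) (a1 l) (a2 l).
  pose FF := filter_prod (\oo : set_system nat) (\oo : set_system nat).
  have EM n l : Ex P (fun w => A a1 n w * A a2 n w * (A a1 l w * A a2 l w)) = M n l.
    exact: (fourth_moment_dyadic (d1 n) (d2 n) (d1 l) (d2 l) (v1 n) (v2 n) (v1 l) (v2 l)).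
  (* All three moments in the square of a difference converge to I along the product filter. *)
  have MI (u v : nat * nat -> nat) : u @ FF --> \oo -> v @ FF --> \oo ->
      M (u p) (v p) @[p --> FF] --> I.
    move=> uo vo; apply: (@moment4_cvg _ FF) => //.
    - exact: (cvg_comp u _ uo c1).
    - exact: (cvg_comp u _ uo c2).
    - exact: (cvg_comp u _ uo c3).
    - exact: (cvg_comp v _ vo c1).
    - exact: (cvg_comp v _ vo c2).
    - exact: (cvg_comp v _ vo c3).
  have fo : fst @ FF --> \oo by exact: cvg_fst.
  have so : snd @ FF --> \oo by exact: cvg_snd.
  have lim : M p.1 p.1 - 2 * M p.1 p.2 + M p.2 p.2 @[p --> FF] --> (0 : R).
    rewrite [X in _ --> X](_ : _ = I - 2 * I + I); last by ring.
    apply: cvgD; [apply: cvgB|]; [exact: MI| |exact: MI].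
    by apply: cvgM; [exact: cvg_cst|exact: MI].
  have e20 : 0 < e ^+ 2 by rewrite exprn_gt0.
  have /cvgrPdist_le/(_ _ e20) := lim.
  move=> [[S1 S2] [[N1 _ HN1] [N2 _ HN2]] HS]; exists (maxn N1 N2) => n l.
  rewrite !geq_max => /andP[n1 n2] /andP[l1 l2].
  have := HS (n, l) (conj (HN1 _ n1) (HN2 _ l2)) => /=; rewrite sub0r normrN => h.
  rewrite -(ger0_norm (ltW e0')) -sqrtr_sqr; apply: nrm_le_sqrt; apply: le_trans h.
  apply: le_trans (ler_norm _); rewrite -!EM sqr_nrm.
  have q1 := L2M (AA n) (AA n); have q2 := L2M (AA n) (AA l); have q3 := L2M (AA l) (AA l).
  rewrite -ExZ// -ExB//; last exact: L1Z.
  rewrite -ExD//; last by apply: L1B => //; exact: L1Z.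
  by rewrite le_eqVlt; apply/orP; left; apply/eqP; apply: eq_Ex => w; ring.
have Y1Y2 := L2M Y12 Y22.
have [Y2' lim] := L2_cauchy_limit AA (L1_measurable Y1Y2) Y1Y2 cauchy
  (L1_product_cvg A12 A22 Y12 Y22 C1 C2).
by exists k, m, a1, a2, (A a1), (A a2).
Qed.

Lemma fourth_moment f1 f2 g1 g2 Y1 Y2 Z1 Z2 : pairL2 f1 f2 -> pairL2 g1 g2 ->
  wiener P L f1 Y1 -> wiener P L f2 Y2 -> wiener P L g1 Z1 -> wiener P L g2 Z2 ->
  Ex P (fun w => Y1 w * Y2 w * (Z1 w * Z2 w)) = moment4 f1 f2 g1 g2.
Proof.
move=> F G w1 w2 v1 v2.
have [k [m [a1 [a2 [A1 [A2 [da wa [c1 c2 c3] Y2' limA]]]]]]] := pair_approximation F w1 w2.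
have [k' [m' [b1 [b2 [B1 [B2 [db wb [e1 e2 e3] Z2' limB]]]]]]] := pair_approximation G v1 v2.
have pL4 (a1' a2' : nat -> R -> R) (k_ m_ : nat -> nat) (X1 X2 : nat -> T -> R) :
    (forall n, dyadic Dlt (k_ n) (m_ n) (a1' n) /\ dyadic Dlt (k_ n) (m_ n) (a2' n)) ->
    (forall n, wiener P L (a1' n) (X1 n) /\ wiener P L (a2' n) (X2 n)) ->
    forall n, L2 P (fun w => X1 n w * X2 n w).
  move=> d' w' n; have [d1 d2] := d' n; have [u1 u2] := w' n.
  by apply: L4M; [exact: wiener_dyadic_L4 d1 u1|exact: wiener_dyadic_L4 d2 u2].
have lim1 := cvg_dot eventually_filter (pL4 _ _ _ _ _ _ da wa) (pL4 _ _ _ _ _ _ db wb) Y2' Z2' limA limB.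
have pa n : pairL2 (a1 n) (a2 n) by have [d1 d2] := da n; exact: (dyadic_pairL2 Dlt0 d1 d2).
have pb n : pairL2 (b1 n) (b2 n) by have [d1 d2] := db n; exact: (dyadic_pairL2 Dlt0 d1 d2).
have lim2 := moment4_cvg eventually_filter pa pb F G c1 c2 c3 e1 e2 e3.
have E n : Ex P (fun w => A1 n w * A2 n w * (B1 n w * B2 n w)) = moment4 (a1 n) (a2 n) (b1 n) (b2 n).
  have [d1 d2] := da n; have [d3 d4] := db n; have [u1 u2] := wa n; have [u3 u4] := wb n.
  exact: (fourth_moment_dyadic d1 d2 d3 d4 u1 u2 u3 u4).
rewrite (funext E) in lim1.
by rewrite -(cvg_lim _ lim1)// (cvg_lim _ lim2).
Qed.

Lemma wiener_product_L2 f1 f2 Y1 Y2 : pairL2 f1 f2 -> wiener P L f1 Y1 -> wiener P L f2 Y2 ->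
  L2 P (fun w => Y1 w * Y2 w).
Proof.
by move=> F w1 w2; have [k [m [a1 [a2 [A1 [A2 []]]]]]] := pair_approximation F w1 w2.
Qed.

End fourth_moment.

(** * Sums over the integers *)

Section integer_sums.
Context (R : realType).
Implicit Types a b : int -> R.

(** The integers as two copies of the natural numbers. *)
Lemma esum_int (b : int -> \bar R) : (forall s, (0 <= b s)%E) ->
  (\esum_(s in [set: int]) b s = \sum_(k <oo) (b (Posz k) + b (Negz k)))%E.
Proof.
move=> b0; rewrite (esumID (range Posz))// !setTI.
have -> : (\esum_(i in range Posz) b i = \esum_(k in [set: nat]) b (Posz k))%E.
  apply: reindex_esum; split => [k _|j k _ _ []//|s [k _ <-]]; first exact: imageP.
  by exists k.
have -> : (\esum_(i in ~` range Posz) b i = \esum_(k in [set: nat]) b (Negz k))%E.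
  apply: reindex_esum; split.
  - by move=> k _ [j _].
  - by move=> j k _ _ [].
  - by move=> [k|k] /= h; [case: h; exists k|exists k].
by rewrite -esumD// nneseries_esumT// => k; exact: adde_ge0.
Qed.

Definition zsummable a := summable [set: int] (fun s => (a s)%:E).

(** The lags from - n to n - 1, since [Negz k] is - (k + 1). *)
Definition zpartial a (n : nat) : R := \sum_(0 <= k < n) (a (Posz k) + a (Negz k)).

Lemma zsummable_ge0 a : (forall s, 0 <= a s) ->
  zsummable a <-> (\esum_(s in [set: int]) (a s)%:E < +oo)%E.
Proof.
move=> a0; rewrite /zsummable /summable.
by under eq_esum do rewrite gee0_abs ?lee_fin//.
Qed.

Lemma zsummable_abs a : zsummable a <-> zsummable (fun s => `|a s|).
Proof.
by rewrite /zsummable /summable; under [X in _ <-> (X < _)%E]eq_esum do rewrite /= normr_id.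
Qed.

Lemma zsummable_le a b : (forall s, `|a s| <= b s) -> zsummable b -> zsummable a.
Proof.
move=> ab; rewrite /zsummable /summable; apply: le_lt_trans; apply: le_esum => s _.
by rewrite lee_fin (le_trans (ab s))// ler_norm.
Qed.

Lemma zsummableD a b : zsummable a -> zsummable b -> zsummable (fun s => a s + b s).
Proof. by move=> a1 b1; have := summableD a1 b1. Qed.

Lemma zsummableZ (c : R) a : zsummable a -> zsummable (fun s => c * a s).
Proof.
rewrite zsummable_abs => a1; rewrite zsummable_abs.
have k1 (k : nat) : zsummable (fun s => k%:R * `|a s|).
  elim: k => [|k IH].
    rewrite (_ : (fun _ => _) = fun=> 0); last by apply/funext => s; rewrite mul0r.
    by rewrite /zsummable /summable esum1// => s _; rewrite abse0.
  rewrite (_ : (fun _ => _) = fun s => k%:R * `|a s| + `|a s|); first exact: zsummableD.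
  by apply/funext => s; rewrite -natr1 mulrDl mul1r.
apply: zsummable_le (k1 (Num.bound `|c|)) => s.
by rewrite normr_id normrM ler_wpM2r// ltW// archi_boundP.
Qed.

Lemma zsummable_reindex (e : int -> int) a : bijective e -> zsummable a -> zsummable (fun s => a (e s)).
Proof.
move=> be; rewrite /zsummable /summable.
rewrite (reindex_esum [set: int] [set: int] e (fun s => `|(a s)%:E|%E))//.
by rewrite setTT_bijective.
Qed.

Lemma zpartial_cvg_ge0 a : (forall s, 0 <= a s) -> zsummable a ->
  zpartial a n @[n --> \oo] --> fine (\esum_(s in [set: int]) (a s)%:E).
Proof.
move=> a0 a1; pose f (k : nat) := (a (Posz k) + a (Negz k))%:E.
have f0 k : (0 <= f k)%E by rewrite lee_fin addr_ge0.
have E : (\esum_(s in [set: int]) (a s)%:E = \sum_(k <oo) f k)%E.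
  by rewrite esum_int.
have T : (fun k : nat => is_true (xpredT k)) = [set: nat] by apply/seteqP.
have fs : summable (fun k : nat => is_true (xpredT k)) f.
  rewrite /summable T; under eq_esum do rewrite gee0_abs//.
  by rewrite -nneseries_esumT// -E; exact: (zsummable_ge0 a0).1.
have := @summable_nneseries_lim R xpredT f (fun k _ => f0 k) fs; rewrite -E => ->.
exact: (@summable_cvg R xpredT f (fun k _ => f0 k) fs).
Qed.

Lemma zpartial_cat a n m : (n <= m)%N ->
  zpartial a m = zpartial a n + \sum_(n <= k < m) (a (Posz k) + a (Negz k)).
Proof. by move=> nm; rewrite /zpartial (big_cat_nat _ nm). Qed.

Lemma zpartialB a b n : zpartial (fun s => a s - b s) n = zpartial a n - zpartial b n.
Proof. by rewrite /zpartial -sumrB; apply: eq_bigr => k _; ring. Qed.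

Lemma zpartialD a b n : zpartial (fun s => a s + b s) n = zpartial a n + zpartial b n.
Proof. by rewrite /zpartial -big_split; apply: eq_bigr => k _ /=; ring. Qed.

Lemma zpartialZ (c : R) a n : zpartial (fun s => c * a s) n = c * zpartial a n.
Proof. by rewrite /zpartial mulr_sumr; apply: eq_bigr => k _; ring. Qed.

Lemma zsum_sub a b : (forall s, 0 <= a s) -> (forall s, 0 <= b s) -> zsummable a -> zsummable b ->
  zsum (fun s => a s - b s) =
  fine (\esum_(s in [set: int]) (a s)%:E) - fine (\esum_(s in [set: int]) (b s)%:E).
Proof.
move=> a0 b0 a1 b1; rewrite /zsum.
have := esumB a1 b1; rewrite /= => -> //; [|by move=> s _; rewrite lee_fin..].
have fin c : (forall s, 0 <= c s) -> zsummable c -> (\esum_(s in [set: int]) (c s)%:E)%E \is a fin_num.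
  move=> c0 c1; rewrite ge0_fin_numE; first exact: (zsummable_ge0 c0).1.
  by apply: esum_ge0 => s _; rewrite lee_fin.
exact: (fineB (fin _ a0 a1) (fin _ b0 b1)).
Qed.

Lemma zpartial_cvg a : zsummable a -> zpartial a n @[n --> \oo] --> zsum a.
Proof.
move=> a1; pose ap s := Num.max (a s) 0; pose am s := Num.max (- a s) 0.
have apm s : a s = ap s - am s by rewrite /ap /am; case: leP => ?; case: leP => ?; lra.
have ap0 s : 0 <= ap s by rewrite /ap le_max lexx orbT.
have am0 s : 0 <= am s by rewrite /am le_max lexx orbT.
have a1' := (zsummable_abs a).1 a1.
have ap1 : zsummable ap.
  by apply: zsummable_le a1' => s; rewrite ger0_norm// ge_max ler_norm normr_ge0.
have am1 : zsummable am.
  apply: zsummable_le a1' => s; by rewrite ger0_norm// ge_max -normrN ler_norm normr_ge0.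
rewrite (_ : a = fun s => ap s - am s); last exact/funext.
rewrite zsum_sub// (_ : zpartial _ = fun n => zpartial ap n - zpartial am n); last first.
  by apply/funext => n; exact: zpartialB.
by apply: cvgB; exact: zpartial_cvg_ge0.
Qed.

(** Tails of a dominating summable family control tails uniformly. *)
Lemma zpartial_tail b (e : R) : (forall s, 0 <= b s) -> zsummable b -> 0 < e ->
  exists N, forall n, (N <= n)%N -> zpartial b n - zpartial b N <= e.
Proof.
move=> b0 b1 e0; have e20 : 0 < e / 2 by rewrite divr_gt0.
have /cvgrPdist_le/(_ _ e20)[N _ HN] := zpartial_cvg b1.
exists N => n Nn; have := HN N (leqnn N); have := HN n Nn.
rewrite /= !ler_norml => /andP[h1 h2] /andP[h3 h4]; lra.
Qed.

(** Dominated convergence for series, in a form uniform in the length of the partial sums: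
    the tail is controlled by the dominating family and the rest is a finite sum. *)
Lemma tannery (b : int -> R) (g : nat -> int -> R) (e : R) : zsummable b ->
  (forall m s, `|g m s| <= b s) -> (forall s, g m s @[m --> \oo] --> (0 : R)) -> 0 < e ->
  \forall m \near \oo, forall n, zpartial (fun s => `|g m s|) n <= e.
Proof.
move=> b1 gb g0 e0; have b0 s : 0 <= b s by apply: le_trans (gb 0%N s).
have e20 : 0 < e / 2 by rewrite divr_gt0.
have [N HN] := zpartial_tail b0 b1 e20.
have lim : zpartial (fun s => `|g m s|) N @[m --> \oo] --> (0 : R).
  have gn s : `|g m s| @[m --> \oo] --> (0 : R).
    by rewrite -(@normr0 _ R); apply: cvg_norm; exact: g0.
  elim: {HN} N => [|N IH].
    by rewrite (_ : (fun m => _) = fun=> 0) ?[X in X @ _]/=; [exact: cvg_cst|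
      apply/funext => m; rewrite /zpartial big_geq].
  rewrite (_ : (fun m => _) = fun m => zpartial (fun s => `|g m s|) N + (`|g m (Posz N)| + `|g m (Negz N)|)).
    by rewrite -[X in _ --> X]addr0 -[X in _ + X]addr0; apply: cvgD => //; apply: cvgD; exact: gn.
  by apply/funext => m; rewrite /zpartial big_nat_recr.
have /cvgrPdist_le/(_ _ e20) := lim; apply: filterS => m.
rewrite sub0r normrN => /(le_trans (ler_norm _)) hm n.
have mono : {homo zpartial (fun s => `|g m s|) : i j / (i <= j)%N >-> i <= j}.
  move=> i j ij; rewrite (zpartial_cat _ ij) lerDl.
  by apply: sumr_ge0 => k _; rewrite addr_ge0.
have [nN|/ltnW Nn] := leqP n N.
  by apply: le_trans (mono _ _ nN) _; apply: le_trans hm _; rewrite ler_pdivrMr// ler_peMr ?(ltW e0)// ler1n.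
have := HN n Nn; rewrite !(zpartial_cat _ Nn) addrAC subrr add0r => h.
rewrite (splitr e); apply: lerD => //; apply: le_trans h.
by apply: ler_sum => k _; apply: lerD.
Qed.

(** Covariances of a stationary sequence: the double sum over a square counts each
    lag as often as it occurs, and Cesaro's theorem gives the long-run variance. *)
Lemma double_sum_lags a (n : nat) :
  \sum_(s < n) \sum_(t < n) a ((t%:Z - s%:Z)%R) =
  \sum_(0 <= j < n) (\sum_(0 <= k < j.+1) a (Posz k) + \sum_(0 <= k < j) a (Negz k)).
Proof.
elim: n => [|n IH]; first by rewrite big_ord0 big_geq.
rewrite big_nat_recr//= -IH big_ord_recr /=.
under eq_bigr do rewrite big_ord_recr /=.
rewrite big_split /= -addrA; congr (_ + _).
rewrite big_ord_recr /= subrr !big_mkord big_ord_recl /= [a 0 + _]addrC -!addrA; congr (_ + _).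
  rewrite (reindex_inj rev_ord_inj) /=; apply: eq_bigr => i _; congr (a _).
  by have := ltn_ord i; rewrite /bump /=; lia.
rewrite addrC; congr (_ + _).
rewrite (reindex_inj rev_ord_inj) /=; apply: eq_bigr => i _; congr (a _).
by have := ltn_ord i; lia.
Qed.

(** Every row of the square contains each lag at most once. *)
Lemma double_sum_le a (n : nat) :
  \sum_(s < n) \sum_(t < n) a ((t%:Z - s%:Z)%R) <= n%:R * zpartial (fun s => `|a s|) n.
Proof.
have -> : n%:R * zpartial (fun s => `|a s|) n = \sum_(j < n) zpartial (fun s => `|a s|) n.
  by rewrite sumr_const card_ord mulr_natl.
rewrite double_sum_lags big_mkord; apply: ler_sum => j _.
rewrite /zpartial big_split /=; apply: lerD.
  apply: (@le_trans _ _ (\sum_(0 <= k < j.+1) `|a (Posz k)|)).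
    by apply: ler_sum => k _; exact: ler_norm.
  by rewrite [leRHS](big_cat_nat _ (ltn_ord j))//= lerDl; exact: sumr_ge0.
apply: (@le_trans _ _ (\sum_(0 <= k < j) `|a (Negz k)|)).
  by apply: ler_sum => k _; exact: ler_norm.
by rewrite [leRHS](big_cat_nat _ (ltnW (ltn_ord j)))//= lerDl; exact: sumr_ge0.
Qed.

Lemma double_sum_cesaro a : zsummable a ->
  n%:R^-1 * \sum_(s < n) \sum_(t < n) a ((t%:Z - s%:Z)%R) @[n --> \oo] --> zsum a.
Proof.
move=> a1.
pose u (j : nat) := \sum_(0 <= k < j.+1) a (Posz k) + \sum_(0 <= k < j) a (Negz k).
have uE j : u j = zpartial a j + a (Posz j).
  by rewrite /u /zpartial big_split big_nat_recr//= addrAC.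
have a0 : a (Posz j) @[j --> \oo] --> (0 : R).
  have c1 := zpartial_cvg ((zsummable_abs a).1 a1).
  have c2 : zpartial (fun s => `|a s|) n.+1 @[n --> \oo] --> zsum (fun s => `|a s|).
    by have := c1; rewrite -(cvg_shiftS _ _).
  have c3 : zpartial (fun s => `|a s|) n.+1 - zpartial (fun s => `|a s|) n @[n --> \oo] --> (0 : R).
    by rewrite -(subrr (zsum (fun s => `|a s|))); exact: (cvgB c2 c1).
  apply: (@cvg_norm_le _ _ _ _ _ _ 0 _ c3) => j; rewrite subr0 /= /zpartial big_nat_recr//= addrAC subrr add0r.
  by rewrite lerDl.
have ul : u @ \oo --> zsum a.
  rewrite (_ : u = fun j => zpartial a j + a (Posz j)); last exact/funext.
  by rewrite -[X in _ --> X]addr0; apply: cvgD => //; exact: zpartial_cvg.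
rewrite -(cvg_shiftS _ _); have := cesaro ul; apply: cvg_trans; apply: near_eq_cvg.
by apply/nearW => n; rewrite /arithmetic_mean /series /= double_sum_lags.
Qed.

End integer_sums.

(** * Lebesgue measure and periodization *)

Section invariance.
Context (R : realType).
Let leb := @lebesgue_measure R.
Local Notation mR := (measurableTypeR R).

(** Half-open intervals determine Lebesgue measure, so its image under c is Lebesgue
    measure again. *)
Lemma ge0_integral_preserving (c : {mfun mR >-> mR}) (g : R -> \bar R) :
  (forall a b : R, leb (c @^-1` `]a, b]) = leb `]a, b]) ->
  measurable_fun [set: R] g -> (forall x, (0 <= g x)%E) ->
  (\int[leb]_x g (c x) = \int[leb]_x g x)%E.
Proof.
move=> hc mg g0.
have hA A : measurable A -> leb A = pushforward leb c A.
  apply: lebesgue_measure_unique => _ [[a b]] _ <-.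
  by rewrite /pushforward; apply/esym/hc.
have := @ge0_integral_pushforward _ _ mR mR R c (measurable_funP c) leb setT g measurableT mg.
rewrite preimage_setT => <-//.
by apply: eq_measure_integral => A mA _; exact: (esym (hA A mA)).
Qed.

Lemma ge0_integral_shift (a : R) (g : R -> \bar R) : measurable_fun [set: R] g ->
  (forall x, (0 <= g x)%E) -> (\int[leb]_x g (x + a)%R = \int[leb]_x g x)%E.
Proof.
have mc : measurable_fun [set: mR] ((fun x => x + a) : mR -> mR) by exact: measurable_funD.
pose c : {mfun mR >-> mR} := HB.pack (fun x : mR => x + a : mR)
  (isMeasurableFun.Build _ _ _ _ _ mc).
apply: (@ge0_integral_preserving c) => u v.
have -> : c @^-1` `]u, v] = `]u - a, v - a]%classic.
  by apply/seteqP; split => x /=; rewrite !in_itv/= ltrBlDr lerBrDr.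
by rewrite /leb !leb_itv; congr (Num.max 0 _)%:E; ring.
Qed.

Lemma ge0_integral_opp (g : R -> \bar R) : measurable_fun [set: R] g ->
  (forall x, (0 <= g x)%E) -> (\int[leb]_x g (- x)%R = \int[leb]_x g x)%E.
Proof.
have mc : measurable_fun [set: mR] ((fun x => - x) : mR -> mR) by exact: measurable_funN.
pose c : {mfun mR >-> mR} := HB.pack (fun x : mR => - x : mR)
  (isMeasurableFun.Build _ _ _ _ _ mc).
apply: (@ge0_integral_preserving c) => u v.
have -> : c @^-1` `]u, v] = `[- v, - u[%classic.
  by apply/seteqP; split => x /=; rewrite !in_itv/= ltrNr lerNl andbC.
rewrite /leb leb_itv lebesgue_measure_itv/= lte_fin ltrN2; case: ltP => uv.
  by rewrite -EFinD max_r ?subr_ge0 ?ltW//; congr _%:E; ring.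
by rewrite max_l// subr_le0.
Qed.

(** Positive and negative parts reduce this to nonnegative functions. *)
Lemma Ex_preserving (c : R -> R) (f : R -> R) :
  (forall g : R -> \bar R, measurable_fun [set: R] g -> (forall x, (0 <= g x)%E) ->
    (\int[leb]_x g (c x) = \int[leb]_x g x)%E) ->
  measurable_fun [set: R] f -> Ex leb (fun x => f (c x)) = Ex leb f.
Proof.
move=> hc mf; rewrite /Ex /Rintegral; congr fine.
have mF : measurable_fun [set: R] (EFin \o f) by exact/measurable_EFinP.
rewrite integralE [RHS]integralE; congr (_ - _)%E.
  have := hc (EFin \o f)^\+%E (measurable_funepos mF) (funepos_ge0 _).
  by rewrite unlock.
have := hc (EFin \o f)^\-%E (measurable_funeneg mF) (funeneg_ge0 _).
by rewrite unlock.
Qed.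

Lemma L1_preserving (c : R -> R) (f : R -> R) :
  (forall g : R -> \bar R, measurable_fun [set: R] g -> (forall x, (0 <= g x)%E) ->
    (\int[leb]_x g (c x) = \int[leb]_x g x)%E) -> measurable_fun [set: R] c ->
  L1 leb f -> L1 leb (fun x => f (c x)).
Proof.
move=> hc mc f1; have mf := L1_measurable f1; apply/integrableP; split.
  by apply/measurable_EFinP; exact: (@measurableT_comp _ _ _ mR mR mR f _ c mf mc).
rewrite (hc (fun x => `|(f x)%:E|%E)); first by have /integrableP[] := f1.
  exact/measurableT_comp/measurable_EFinP.
by move=> x; exact: abse_ge0.
Qed.

Lemma measurable_shift (a : R) : measurable_fun [set: R] (fun x : R => x + a).
Proof. exact: measurable_funD. Qed.

Lemma Ex_shift (a : R) (f : R -> R) : measurable_fun [set: R] f ->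
  Ex leb (fun x => f (x + a)) = Ex leb f.
Proof. by move=> mf; apply: (@Ex_preserving (fun x => x + a)) => // g; exact: ge0_integral_shift. Qed.

Lemma Ex_opp (f : R -> R) : measurable_fun [set: R] f -> Ex leb (fun x => f (- x)) = Ex leb f.
Proof. by move=> mf; apply: (@Ex_preserving (fun x => - x)) => // g; exact: ge0_integral_opp. Qed.

Lemma L1_shift (a : R) (f : R -> R) : L1 leb f -> L1 leb (fun x => f (x + a)).
Proof.
apply: (@L1_preserving (fun x => x + a)); last exact: measurable_shift.
by move=> g; exact: ge0_integral_shift.
Qed.

Lemma L1_opp (f : R -> R) : L1 leb f -> L1 leb (fun x => f (- x)).
Proof.
apply: (@L1_preserving (fun x => - x)); last exact: measurable_funN.
by move=> g; exact: ge0_integral_opp.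
Qed.

Lemma L2_shift (a : R) (f : R -> R) : L2 leb f -> L2 leb (fun x => f (x + a)).
Proof.
move=> [mf f2]; split; last exact: L1_shift f2.
exact: (@measurableT_comp _ _ _ mR mR mR f _ _ mf (measurable_shift a)).
Qed.

Lemma L2_opp (f : R -> R) : L2 leb f -> L2 leb (fun x => f (- x)).
Proof.
move=> [mf f2]; split; last exact: L1_opp f2.
by apply: (@measurableT_comp _ _ _ mR mR mR f _ (fun x => - x) mf); exact: measurable_funN.
Qed.

Lemma nrm_shift (a : R) (f : R -> R) : measurable_fun [set: R] f ->
  nrm leb (fun x => f (x + a)) = nrm leb f.
Proof.
by move=> mf; rewrite /nrm (Ex_shift a (f := fun x => f x ^+ 2))//; exact: measurable_funX.
Qed.

End invariance.

Section periodization.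
Context (R : realType).
Let leb := @lebesgue_measure R.
Local Notation mR := (measurableTypeR R).
Variable Dlt : R.
Hypothesis Dlt0 : 0 < Dlt.

Definition cell0 : set R := `]0%R, Dlt].

Lemma measurable_cell0 : measurable (cell0 : set mR).
Proof. exact: measurable_itv. Qed.

Definition periodize (g : R -> \bar R) (t : R) : \bar R :=
  (\esum_(s in [set: int]) g (t + s%:~R * Dlt)%R)%E.

Lemma periodize_ge0 g t : (forall x, (0 <= g x)%E) -> (0 <= periodize g t)%E.
Proof. by move=> g0; exact: esum_ge0. Qed.

Lemma measurable_comp_shift (a : R) (g : R -> \bar R) : measurable_fun [set: R] g ->
  measurable_fun [set: mR] (fun x : mR => g (x + a)%R).
Proof.
by move=> mg; exact: (@measurableT_comp _ _ _ mR mR (\bar R) g _ _ mg (measurable_shift a)).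
Qed.

(** The factor may be infinite: periodizations are, on a null set. *)
Lemma esumZl (c : \bar R) (b : int -> \bar R) : (0 <= c)%E -> (forall s, (0 <= b s)%E) ->
  (\esum_(s in [set: int]) (c * b s) = c * \esum_(s in [set: int]) b s)%E.
Proof.
move=> c0 b0; case: c c0 => [c| |] // c0.
  rewrite !esum_int//; last by move=> s; exact: mule_ge0.
  under eq_eseriesr do rewrite -ge0_muleDr//.
  by rewrite nneseriesZl// => k _; exact: adde_ge0.
have [bz|/existsNP[s /eqP bs]] := pselect (forall s, b s = 0%E).
  by rewrite !esum1 ?mule0// => s _; rewrite bz// mule0.
have bs0 : (0 < b s)%E by rewrite lt0e bs b0.
have le1 (a : int -> \bar R) : (forall r, (0 <= a r)%E) -> (a s <= \esum_(r in [set: int]) a r)%E.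
  by move=> a0; rewrite (esumID [set s])// setTI esum_set1// leeDl// esum_ge0.
rewrite gt0_mulye; last exact: lt_le_trans (le1 _ b0).
apply/eqP; rewrite -leye_eq; have := le1 (fun r => +oo * b r)%E.
by rewrite gt0_mulye//; apply => r; exact: mule_ge0.
Qed.

Lemma measurable_esum_int (b : R -> int -> \bar R) :
  (forall s, measurable_fun [set: mR] (fun x : mR => b x s)) -> (forall x s, (0 <= b x s)%E) ->
  measurable_fun [set: mR] (fun x : mR => \esum_(s in [set: int]) b x s)%E.
Proof.
move=> mb b0.
rewrite (_ : (fun x => _) = fun x => (\sum_(k <oo) (b x (Posz k) + b x (Negz k)))%E); last first.
  by apply/funext => x; rewrite esum_int.
apply: ge0_emeasurable_sum => [k x _ _|k _]; first exact: adde_ge0.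
exact: emeasurable_funD.
Qed.

Lemma measurable_periodize g : measurable_fun [set: R] g -> (forall x, (0 <= g x)%E) ->
  measurable_fun [set: mR] (periodize g).
Proof. by move=> mg g0; apply: measurable_esum_int => // s; exact: measurable_comp_shift. Qed.

Lemma integral_esum_int (D : set mR) (b : R -> int -> \bar R) : measurable D ->
  (forall s, measurable_fun [set: mR] (fun x : mR => b x s)) -> (forall x s, (0 <= b x s)%E) ->
  (\int[leb]_(x in D) (\esum_(s in [set: int]) b x s) =
   \esum_(s in [set: int]) \int[leb]_(x in D) b x s)%E.
Proof.
move=> mD mb b0; have mbD s : measurable_fun D (fun x : mR => b x s).
  by apply: measurable_funTS; exact: mb.
rewrite esum_int; last by move=> s; apply: integral_ge0 => x _.
under eq_integral do rewrite esum_int//.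
rewrite integral_nneseries//; last 2 first.
- by move=> k; exact: emeasurable_funD.
- by move=> k x _; exact: adde_ge0.
by apply: eq_eseriesr => k _; rewrite ge0_integralD.
Qed.

(** The translates of one cell partition the line. *)
Lemma cell0_index (x : R) : (\esum_(s in [set: int]) ((\1_cell0 (x - s%:~R * Dlt) : R)%R%:E) = 1)%E.
Proof.
have [i Hi] := cell_index x Dlt0.
have ind s : \1_cell0 (x - s%:~R * Dlt) = (s == i - 1)%:R :> R.
  rewrite indicE; congr ((nat_of_bool _)%:R); rewrite /cell0 mem_setE in_itv/= subr_gt0.
  have /andP[h1 h2] := Hi; rewrite lerBlDr -{2}(mul1r Dlt) -mulrDl.
  apply/idP/idP => [/andP[h3 h4]|/eqP ->].
    have g1 := lt_le_trans h3 h2; have g2 := lt_le_trans h1 h4.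
    rewrite ltr_pM2r// ltr_int in g1.
    rewrite -[1]/(1%:~R) -intrD ltr_pM2r// ltr_int in g2.
    by lia.
  by rewrite h1 /= -[1]/(1%:~R) -intrD addrC subrK.
under eq_esum do rewrite ind.
rewrite (esumID [set i - 1]); last by move=> s _; rewrite lee_fin.
rewrite setTI esum_set1 ?eqxx ?lee_fin// esum1 ?adde0//.
by move=> s [_ /= /eqP/negbTE ->].
Qed.

(** The line is the disjoint union of the translates of one cell, and translations
    preserve integrals. *)
Lemma unfolding (g : R -> \bar R) : measurable_fun [set: R] g -> (forall x, (0 <= g x)%E) ->
  (\int[leb]_x g x = \int[leb]_(x in cell0) periodize g x)%E.
Proof.
move=> mg g0.
have m1 : measurable_fun [set: mR] (fun x : mR => ((\1_cell0 x : R)%:E)).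
  by apply/measurable_EFinP; apply: measurable_indic; exact: measurable_cell0.
have m1s s : measurable_fun [set: mR] (fun x : mR => ((\1_cell0 (x - s%:~R * Dlt) : R)%R%:E)).
  exact: (measurable_comp_shift (- (s%:~R * Dlt)) m1).
have i0 (x : R) : (0 <= (\1_cell0 x : R)%:E)%E by rewrite lee_fin.
transitivity (\int[leb]_x \esum_(s in [set: int]) (g x * (\1_cell0 (x - s%:~R * Dlt) : R)%R%:E))%E.
  apply: eq_integral => x _.
  by rewrite esumZl// cell0_index mule1.
rewrite integral_esum_int//; last 2 first.
- by move=> s; exact: emeasurable_funM.
- by move=> x s; exact: mule_ge0.
rewrite /periodize integral_esum_int//; last 2 first.
- exact: measurable_cell0.
- by move=> s; exact: measurable_comp_shift.
apply: eq_esum => s _.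
rewrite -(ge0_integral_shift (s%:~R * Dlt)); last 2 first.
- exact: (@emeasurable_funM _ mR R _ _ _ mg (m1s s)).
- by move=> x; exact: mule_ge0.
rewrite [RHS]integral_mkcond; apply: eq_integral => x _.
rewrite addrK patchE indicE; case: ifPn => xi; rewrite ?mule1 ?mule0//.
Qed.

Lemma periodize_shift g (t : R) (s : int) : (forall x, (0 <= g x)%E) ->
  periodize g (t + s%:~R * Dlt)%R = periodize g t.
Proof.
move=> g0; rewrite /periodize [RHS](reindex_esum [set: int] [set: int] (fun r => s + r)).
  by apply: eq_esum => r _; congr g; rewrite intrD; ring.
rewrite setTT_bijective; exists (fun r => r - s) => r; lia.
Qed.

(** Tonelli: summing over the lags replaces q by its periodization, and unfolding the
    integral of p times a periodic function replaces p by its periodization. *)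
Lemma esum_correlation (p q : R -> \bar R) : measurable_fun [set: R] p -> measurable_fun [set: R] q ->
  (forall x, (0 <= p x)%E) -> (forall x, (0 <= q x)%E) ->
  (\esum_(h in [set: int]) \int[leb]_x (p x * q (x + h%:~R * Dlt)%R) =
   \int[leb]_(t in cell0) (periodize p t * periodize q t))%E.
Proof.
move=> mp mq p0 q0.
have mqs h : measurable_fun [set: mR] (fun x : mR => q (x + h%:~R * Dlt)%R).
  exact: measurable_comp_shift.
rewrite -integral_esum_int//; last 2 first.
- by move=> h; exact: emeasurable_funM.
- by move=> x h; exact: mule_ge0.
under eq_integral do rewrite esumZl//.
rewrite unfolding; last 2 first.
- by apply: emeasurable_funM => //; exact: measurable_periodize.
- by move=> x; apply: mule_ge0 => //; exact: periodize_ge0.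
apply: eq_integral => t _; rewrite /periodize -/(periodize q t).
have E s : (p (t + s%:~R * Dlt)%R * (\esum_(h in [set: int]) q (t + s%:~R * Dlt + h%:~R * Dlt)%R) =
    periodize q t * p (t + s%:~R * Dlt)%R)%E.
  by rewrite muleC -/(periodize q _) periodize_shift.
under eq_esum do rewrite E.
by rewrite esumZl// 1?muleC// periodize_ge0.
Qed.

End periodization.

Section folding.
Context (R : realType).
Let leb := @lebesgue_measure R.
Local Notation mR := (measurableTypeR R).
Variable Dlt : R.
Hypothesis Dlt0 : 0 < Dlt.
Variable p : R -> R.
Hypothesis mp : measurable_fun [set: R] p.
Local Notation per a := (periodize Dlt (fun x => (a x)%:E)).
Local Notation normp := (fun x : R => `|p x|).
Hypothesis p2 : (\int[leb]_(t in cell0 Dlt) (per normp t * per normp t) < +oo)%E.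

(** Real-valued, hence 0 where the periodization is infinite; by [per_finite] this happens
    on a null set. *)
Definition fold (a : R -> R) (t : R) : R := \1_(cell0 Dlt) t * fine (per a t).

Definition dominated (a : R -> R) :=
  [/\ measurable_fun [set: R] a, forall x, 0 <= a x & forall x, a x <= `|p x|].

Lemma dominated_per_measurable a : dominated a -> measurable_fun [set: mR] (per a).
Proof.
move=> [ma a0 _]; apply: (measurable_periodize Dlt); first exact/measurable_EFinP.
by move=> x; rewrite lee_fin.
Qed.

Lemma dominated_per_ge0 a t : dominated a -> (0 <= per a t)%E.
Proof. by move=> [_ a0 _]; apply: periodize_ge0 => x; rewrite lee_fin. Qed.

Lemma dominated_abs : dominated normp.
Proof. by split=> //; exact: measurable_abs mp. Qed.

Lemma dominated_per_le a t : dominated a -> (per a t <= per normp t)%E.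
Proof. by move=> [_ _ ap]; apply: le_esum => s _; rewrite lee_fin. Qed.

(** The integrand of the hypothesis on p is finite almost everywhere. *)
Lemma per_finite a : dominated a -> {ae leb, forall t, cell0 Dlt t -> per a t \is a fin_num}.
Proof.
move=> da.
have mN := dominated_per_measurable dominated_abs.
have N0 t := dominated_per_ge0 t dominated_abs.
have iN : leb.-integrable (cell0 Dlt) (fun t => per normp t * per normp t)%E.
  apply/integrableP; split.
    by apply: (@measurable_funTS _ _ mR); exact: emeasurable_funM.
  by under eq_integral do rewrite gee0_abs ?mule_ge0//.
have := integrable_ae (measurable_cell0 Dlt) iN.
apply: filterS => t ht /ht; rewrite ge0_fin_numE ?mule_ge0// => h.
rewrite ge0_fin_numE ?dominated_per_ge0//; apply: le_lt_trans (dominated_per_le t da) _.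
by rewrite ltey; apply/eqP => e; move: h; rewrite e mulyy.
Qed.

Lemma measurable_fold a : dominated a -> measurable_fun [set: R] (fold a).
Proof.
move=> da; apply: (@measurable_funM _ mR).
  by apply: measurable_indic; exact: measurable_cell0.
by apply: (measurableT_comp (@fine_measurable R setT measurableT)); exact: dominated_per_measurable.
Qed.

Lemma measurable_restrict_cell (g : mR -> \bar R) : measurable_fun [set: mR] g ->
  measurable_fun [set: mR] (g \_ (cell0 Dlt)).
Proof.
move=> mg; apply/(measurable_restrictT g (measurable_cell0 Dlt)); exact: measurable_funTS.
Qed.

Lemma fold_integral a b : dominated a -> dominated b ->
  (\int[leb]_(t in cell0 Dlt) (per a t * per b t) = \int[leb]_t (fold a t * fold b t)%:E)%E.
Proof.
move=> da db; rewrite integral_mkcond; apply: ge0_ae_eq_integral => //.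
- by apply: measurable_restrict_cell; apply: emeasurable_funM; exact: dominated_per_measurable.
- apply/measurable_EFinP; apply: (@measurable_funM _ mR); exact: measurable_fold.
- by move=> t _; rewrite patchE; case: ifPn => // _; rewrite mule_ge0// dominated_per_ge0.
- move=> t _; rewrite lee_fin /fold indicE.
  by rewrite mulr_ge0// mulr_ge0// ?ler0n// fine_ge0// dominated_per_ge0.
have fa := per_finite da; have fb := per_finite db.
apply: (@filterS2 _ _ (ae_filter_ringOfSetsType (@lebesgue_measure R)) _ _ _ _ fa fb) => t ha hb _; rewrite patchE /fold indicE.
case: ifPn => [/set_mem ct|_]; last by rewrite !mul0r.
by rewrite !mul1r EFinM !fineK//; [exact: hb|exact: ha].
Qed.

Lemma fold_integral_lty a b : dominated a -> dominated b ->
  (\int[leb]_(t in cell0 Dlt) (per a t * per b t) < +oo)%E.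
Proof.
move=> da db; apply: le_lt_trans p2; apply: ge0_le_integral => //.
- exact: measurable_cell0.
- by move=> t _; rewrite mule_ge0// dominated_per_ge0.
- by apply: (@measurable_funTS _ _ mR); apply: emeasurable_funM; exact: dominated_per_measurable.
- by apply: (@measurable_funTS _ _ mR); apply: emeasurable_funM;
    exact: dominated_per_measurable dominated_abs.
- by move=> t _; apply: lee_pmul; rewrite ?dominated_per_ge0 ?dominated_per_le.
Qed.

Lemma fold_L2 a : dominated a -> L2 leb (fold a).
Proof.
move=> da; split; first exact: measurable_fold.
apply: L1_ge0.
- by apply: (@measurable_funX _ mR); exact: measurable_fold.
- by move=> t; exact: sqr_ge0.
- by rewrite (_ : (fun t => _) = fun t => (fold a t * fold a t)%:E)// -fold_integral// fold_integral_lty.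
Qed.

Lemma correlation_measurable a b (h : int) : dominated a -> dominated b ->
  measurable_fun [set: mR] (fun x : mR => a x * b (x + h%:~R * Dlt)).
Proof.
move=> [ma _ _] [mb _ _]; apply: measurable_funM => //.
exact: (@measurableT_comp _ _ _ mR mR mR b _ _ mb (measurable_shift (h%:~R * Dlt))).
Qed.

Lemma esum_dominated a b : dominated a -> dominated b ->
  (\esum_(h in [set: int]) \int[leb]_x (a x * b (x + h%:~R * Dlt))%:E =
   (Ex leb (fun t => fold a t * fold b t))%:E)%E.
Proof.
move=> da db; rewrite -EFin_Ex; last by apply: L2M; exact: fold_L2.
rewrite -fold_integral// -esum_correlation//.
- by case: da => ma _ _; exact/measurable_EFinP.
- by case: db => mb _ _; exact/measurable_EFinP.
- by case: da => _ a0 _ x; rewrite lee_fin.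
- by case: db => _ b0 _ x; rewrite lee_fin.
Qed.

Lemma correlation_ge0 a b x y : dominated a -> dominated b -> 0 <= a x * b y.
Proof. by move=> [_ a0 _] [_ b0 _]; rewrite mulr_ge0. Qed.

Lemma correlation_L1 a b (h : int) : dominated a -> dominated b ->
  L1 leb (fun x => a x * b (x + h%:~R * Dlt)).
Proof.
move=> da db; apply: L1_ge0; first exact: correlation_measurable.
  by move=> x; exact: correlation_ge0.
apply: (@le_lt_trans _ _ (\esum_(h in [set: int]) \int[leb]_x (a x * b (x + h%:~R * Dlt))%:E)%E).
  rewrite (esumID [set h]).
    rewrite setTI esum_set1.
      by rewrite leeDl// esum_ge0// => s _; apply: integral_ge0 => x _; rewrite lee_fin correlation_ge0.
    by apply: integral_ge0 => x _; rewrite lee_fin correlation_ge0.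
  by move=> s _; apply: integral_ge0 => x _; rewrite lee_fin correlation_ge0.
by rewrite esum_dominated// ltry.
Qed.

Lemma esum_correlation_Ex a b : dominated a -> dominated b ->
  (\esum_(h in [set: int]) (Ex leb (fun x => a x * b (x + h%:~R * Dlt)))%:E =
   (Ex leb (fun t => fold a t * fold b t))%:E)%E.
Proof.
move=> da db; rewrite -esum_dominated//; apply: eq_esum => h _.
by rewrite -EFin_Ex//; exact: correlation_L1.
Qed.

Lemma zsummable_correlation a b : dominated a -> dominated b ->
  zsummable (fun h : int => Ex leb (fun x => a x * b (x + h%:~R * Dlt))).
Proof.
move=> da db; apply/zsummable_ge0.
  by move=> h; apply: Ex_ge0 => x; exact: correlation_ge0.
by rewrite esum_correlation_Ex// ltry.
Qed.

Let pp x := Num.max (p x) 0.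
Let pm x := Num.max (- p x) 0.

Lemma dominated_pos : dominated pp.
Proof.
split; first by apply: (@measurable_maxr _ mR).
  by move=> x; rewrite /pp le_max lexx orbT.
by move=> x; rewrite /pp ge_max ler_norm normr_ge0.
Qed.

Lemma dominated_neg : dominated pm.
Proof.
split; first by apply: (@measurable_maxr _ mR) => //; exact: measurable_funN.
  by move=> x; rewrite /pm le_max lexx orbT.
by move=> x; rewrite /pm ge_max normr_ge0 -normrN ler_norm.
Qed.

Lemma zsum_fold t : cell0 Dlt t ->
  per pp t \is a fin_num -> per pm t \is a fin_num ->
  zsum (fun s : int => p (t + s%:~R * Dlt)) = fold pp t - fold pm t.
Proof.
move=> ct fp fm; rewrite /zsum /fold indicE mem_set// !mul1r.
have -> : esum [set: int] (fun s => (p (t + s%:~R * Dlt))%:E)^\+%E = per pp t.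
  by apply: eq_esum => s _; rewrite unlock /= EFin_max.
have -> : esum [set: int] (fun s => (p (t + s%:~R * Dlt))%:E)^\-%E = per pm t.
  by apply: eq_esum => s _; rewrite unlock /= EFin_max.
by rewrite fineB.
Qed.

(** Splitting into positive and negative parts reduces the identity to four nonnegative
    ones. *)
Lemma zsum_correlation :
  zsum (fun h : int => Ex leb (fun x => p x * p (x + h%:~R * Dlt))) =
  \int[leb]_(t in `[0, Dlt]) (zsum (fun s : int => p (t + s%:~R * Dlt))) ^+ 2.
Proof.
have [dp dm] := (dominated_pos, dominated_neg).
have [Fp Fm] := (fold_L2 dp, fold_L2 dm).
transitivity (Ex leb (fun t => (fold pp t - fold pm t) ^+ 2)).
  pose c a b (h : int) := Ex leb (fun x => a x * b (x + h%:~R * Dlt)).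
  have c0 a b h : dominated a -> dominated b -> 0 <= c a b h.
    by move=> da db; apply: Ex_ge0 => x; exact: correlation_ge0.
  have E h : Ex leb (fun x => p x * p (x + h%:~R * Dlt)) =
      (c pp pp h + c pm pm h) - (c pp pm h + c pm pp h).
    rewrite /c -!ExD; [|exact: correlation_L1..].
    rewrite -ExB; [|apply: L1D; exact: correlation_L1..].
    apply: (@eq_Ex _ _ R leb) => x; rewrite /pp /pm.
    have apm y : p y = Num.max (p y) 0 - Num.max (- p y) 0.
      by case: (leP (p y)) => ?; case: (leP (- p y)) => ?; lra.
    by rewrite {1}(apm x) {1}(apm (x + _)); ring.
  under eq_fun do rewrite E.
  have zc a b : dominated a -> dominated b -> zsummable (c a b) by exact: zsummable_correlation.
  have ec a b : dominated a -> dominated b ->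
      (\esum_(h in [set: int]) (c a b h)%:E = (Ex leb (fun t => fold a t * fold b t))%:E)%E.
    exact: esum_correlation_Ex.
  rewrite zsum_sub; last 4 first.
  - by move=> h; rewrite addr_ge0// c0.
  - by move=> h; rewrite addr_ge0// c0.
  - by apply: zsummableD; exact: zc.
  - by apply: zsummableD; exact: zc.
  under eq_esum do rewrite EFinD.
  rewrite esumD => [|h _|h _]; [|by rewrite lee_fin c0..].
  under [X in _ - fine X]eq_esum do rewrite EFinD.
  rewrite [X in _ - fine X]esumD => [|h _|h _]; [|by rewrite lee_fin c0..].
  rewrite !ec// -!EFinD /= -!ExD; [|by apply: L2M..].
  rewrite -ExB; [|by apply: L1D; apply: L2M..].
  by apply: (@eq_Ex _ _ R leb) => t; ring.
pose z t := zsum (fun s : int => p (t + s%:~R * Dlt)).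
have mF : measurable_fun [set: mR] (fun t : mR => ((fold pp t - fold pm t) ^+ 2)%:E).
  apply/measurable_EFinP; apply: (@measurable_funX _ mR); apply: (@measurable_funB _ mR);
    exact: measurable_fold.
have mz : measurable_fun [set: mR] (fun t : mR => (z t ^+ 2)%:E).
  apply/measurable_EFinP; apply: (@measurable_funX _ mR).
  rewrite (_ : z = fun t => fine (per pp t - per pm t)%E).
    apply: (measurableT_comp (@fine_measurable R setT measurableT)).
    by apply: emeasurable_funB; exact: dominated_per_measurable.
  apply/funext => t; rewrite /z /zsum; congr (fine (_ - _)%E);
    by apply: eq_esum => s _; rewrite unlock /= EFin_max.
rewrite /Rintegral -integral_itv_obnd_cbnd; last exact: (@measurable_funTS _ _ mR).
rewrite /Ex /Rintegral; congr fine; rewrite [RHS]integral_mkcond.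
apply: ge0_ae_eq_integral => //.
- exact: measurable_restrict_cell mz.
- by move=> t _; rewrite lee_fin sqr_ge0.
- by move=> t _; rewrite patchE; case: ifPn => // _; rewrite lee_fin sqr_ge0.
apply: (@filterS2 _ _ (ae_filter_ringOfSetsType (@lebesgue_measure R)) _ _ _ _ (per_finite dp) (per_finite dm)) => t hp hm _; rewrite patchE.
case: ifPn => [/set_mem ct|ct]; first by rewrite zsum_fold//; [exact: hp|exact: hm].
by rewrite /fold indicE (negbTE ct) !mul0r subrr expr0n.
Qed.

End folding.

(** ** Conjugate exponents *)

Section conjugate_exponents.
Context (R : realType).

Lemma zsummable_bounded_mul (a b : int -> R) : (forall s, 0 <= a s) -> (forall s, 0 <= b s) ->
  (ereal_sup [set `|(a s)%:E|%E | s in [set: int]] < +oo)%E -> zsummable b ->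
  zsummable (fun s => a s * b s).
Proof.
move=> a0 b0 sa sb.
have as_ s : ((a s)%:E <= ereal_sup [set `|(a s)%:E|%E | s in [set: int]])%E.
  by apply: ereal_sup_ubound; exists s => //; rewrite gee0_abs ?lee_fin.
have fin : ereal_sup [set `|(a s)%:E|%E | s in [set: int]] \is a fin_num.
  by rewrite ge0_fin_numE//; apply: le_trans (as_ 0); rewrite lee_fin.
pose C := fine (ereal_sup [set `|(a s)%:E|%E | s in [set: int]]).
apply: (@zsummable_le _ _ (fun s => C * b s)); last exact: zsummableZ.
move=> s; rewrite ger0_norm ?mulr_ge0// ler_wpM2r//.
by rewrite -lee_fin fineK.
Qed.

Lemma in_lp1_zsummable (b : int -> R) : (forall s, 0 <= b s) ->
  in_lp 1%:E (fun s => (b s)%:E) -> zsummable b.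
Proof.
move=> b0 /= h; apply/zsummable_ge0 => //; apply: le_lt_trans h.
by apply: le_esum => s _; rewrite powRr1// lee_fin ler_norm.
Qed.

Lemma in_lp_zsummable (r : R) (a : int -> R) : (forall s, 0 <= a s) ->
  in_lp r%:E (fun s => (a s)%:E) -> zsummable (fun s => a s `^ r).
Proof.
move=> a0 /= h; apply/zsummable_ge0; first by move=> s; exact: powR_ge0.
apply: le_lt_trans h; apply: le_esum => s _.
by rewrite ger0_norm.
Qed.

(** Young's inequality, except for the pairs (1, +oo) and (+oo, 1), where one of the factors
    is bounded. *)
Lemma zsummable_conjugate (p q : \bar R) (a b : int -> R) :
  (forall s, 0 <= a s) -> (forall s, 0 <= b s) ->
  (1 <= p)%E -> (1 <= q)%E -> (p^-1 + q^-1 = 1)%E ->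
  in_lp p (fun s => (a s)%:E) -> in_lp q (fun s => (b s)%:E) ->
  zsummable (fun s => a s * b s).
Proof.
move=> a0 b0; case: p => [p| |]//; case: q => [q| |]//; rewrite ?lee_fin => p1 q1.
- have [p0 q0] : 0 < p /\ 0 < q by split; exact: lt_le_trans p1 || exact: lt_le_trans q1.
  rewrite !inver !gt_eqF// -EFinD => -[pq] la lb.
  apply: (@zsummable_le _ _ (fun s => p^-1 * a s `^ p + q^-1 * b s `^ q)).
    move=> s; rewrite ger0_norm ?mulr_ge0//.
    by have := conjugate_powR (a0 s) (b0 s) p0 q0 pq; rewrite !(mulrC _^-1).
  by apply: zsummableD; apply: zsummableZ; exact: in_lp_zsummable.
- rewrite invey adde0 inver gt_eqF; last exact: lt_le_trans p1.
  move=> [/(congr1 GRing.inv)]; rewrite invrK invr1 => -> la lb.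
  under eq_fun do rewrite mulrC.
  exact: zsummable_bounded_mul (in_lp1_zsummable a0 la).
- rewrite invey add0e inver gt_eqF; last exact: lt_le_trans q1.
  move=> [/(congr1 GRing.inv)]; rewrite invrK invr1 => -> la lb.
  exact: zsummable_bounded_mul (in_lp1_zsummable b0 lb).
- by rewrite invey adde0 => /eqP; rewrite eqe (eq_sym 0) oner_eq0.
Qed.

(** By 2 x y <= x^2 + y^2; the reflected family has the same sum of squares. *)
Lemma zsummable_sqr_reflect (a : int -> R) : (forall s, 0 <= a s) ->
  in_lp 2%:E (fun s => (a s)%:E) -> zsummable (fun s => a s * a (- s)).
Proof.
move=> a0 la.
have s2 : zsummable (fun s => a s ^+ 2).
  by have := in_lp_zsummable a0 la; under eq_fun do rewrite -[2]/(2%:R) powR_mulrn//.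
apply: (@zsummable_le _ _ (fun s => a s ^+ 2 + a (- s) ^+ 2)).
  move=> s; rewrite ger0_norm ?mulr_ge0//.
  by have := sqr_ge0 (a s - a (- s)); have := mulr_ge0 (a0 s) (a0 (- s)); rewrite !expr2; nra.
apply: zsummableD => //; apply: (zsummable_reindex (e := fun s => - s)) s2.
by exists (fun s => - s) => s; rewrite opprK.
Qed.

End conjugate_exponents.

(** * Covariances of products of moving averages *)

Section lagged_pairs.
Context (R : realType).
Let leb := @lebesgue_measure R.
Local Notation mR := (measurableTypeR R).
Variables (Dlt sigma2 kappa4 : R).
Local Notation signal := ((R -> R) * (R -> R))%type.
Local Notation dot f g := (Ex leb (fun x => f x * g x)).
Implicit Types f g : signal.

Definition lag (h : int) (a : R -> R) (x : R) : R := a (x - h%:~R * Dlt).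

Lemma lag_L2 h a : L2 leb a -> L2 leb (lag h a).
Proof. exact: L2_shift. Qed.

Lemma lag0 a : lag 0 a = a.
Proof. by apply/funext => x; rewrite /lag mul0r subr0. Qed.

Lemma Ex_lag h a : measurable_fun setT a -> Ex leb (lag h a) = Ex leb a.
Proof. exact: Ex_shift. Qed.

Lemma nrm_lag h a : measurable_fun setT a -> nrm leb (lag h a) = nrm leb a.
Proof. exact: nrm_shift. Qed.

Definition lag2 h f : signal := (lag h f.1, lag h f.2).

Definition square_integrable f := pairL2 f.1 f.2.

Lemma lag_square_integrable h f : square_integrable f -> square_integrable (lag2 h f).
Proof.
by move=> [f1 f2 f12]; split; [exact: lag_L2|exact: lag_L2|exact: (lag_L2 h f12)].
Qed.

(** The covariance between the product built on [f] at time 0 and the one built on [g] at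
    time [h]: the fourth moment without the pairing that is the product of the means. *)
Definition cov (h : int) f g : R :=
  kappa4 * dot (fun x => f.1 x * f.2 x) (fun x => lag h g.1 x * lag h g.2 x) +
  sigma2 ^+ 2 * (dot f.1 (lag h g.1) * dot f.2 (lag h g.2) +
                 dot f.1 (lag h g.2) * dot f.2 (lag h g.1)).

(** The covariance at lag [h] of the difference of the processes built on [f] and on [g]. *)
Definition covdiff (h : int) f g : R :=
  cov h f f - cov h f g - cov h g f + cov h g g.

Definition signal_cvg (u : nat -> signal) f := [/\
  nrm leb (fun x => (u i).1 x - f.1 x) @[i --> \oo] --> (0 : R),
  nrm leb (fun x => (u i).2 x - f.2 x) @[i --> \oo] --> (0 : R) &
  nrm leb (fun x => (u i).1 x * (u i).2 x - f.1 x * f.2 x) @[i --> \oo] --> (0 : R)].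

Lemma signal_cvg_cst f : signal_cvg (fun=> f) f.
Proof.
have z (a : R -> R) : nrm leb (fun x => a x - a x) = 0.
  by rewrite (_ : (fun x => _) = fun=> 0);
    [rewrite /nrm expr0n Ex0 sqrtr0|apply/funext => x; rewrite subrr].
by split; rewrite z; exact: cvg_cst.
Qed.

Lemma cov_cvg h (u v : nat -> signal) f g : (forall i, square_integrable (u i)) ->
  (forall i, square_integrable (v i)) -> square_integrable f -> square_integrable g ->
  signal_cvg u f -> signal_cvg v g -> cov h (u i) (v i) @[i --> \oo] --> cov h f g.
Proof.
move=> U V [F1 F2 F3] [G1 G2 G3] [u1 u2 u3] [v1 v2 v3].
have lagc (a : nat -> R -> R) (b : R -> R) : (forall i, L2 leb (a i)) -> L2 leb b ->
    nrm leb (fun x => a i x - b x) @[i --> \oo] --> (0 : R) ->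
    nrm leb (fun x => lag h (a i) x - lag h b x) @[i --> \oo] --> (0 : R).
  move=> a2 b2 ab.
  rewrite (_ : (fun i => _) = fun i => nrm leb (fun x => a i x - b x))//; apply/funext => i.
  by apply: (@nrm_lag h (fun x => a i x - b x)); exact: (L2_measurable (L2B (a2 i) b2)).
have U1 i : L2 leb (u i).1 by have [] := U i.
have U2 i : L2 leb (u i).2 by have [] := U i.
have U3 i : L2 leb (fun x => (u i).1 x * (u i).2 x) by have [] := U i.
have V1 i : L2 leb (v i).1 by have [] := V i.
have V2 i : L2 leb (v i).2 by have [] := V i.
have V3 i : L2 leb (fun x => (v i).1 x * (v i).2 x) by have [] := V i.
have L1' i := lag_L2 h (V1 i); have L2' i := lag_L2 h (V2 i); have L3' i := lag_L2 h (V3 i).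
have k1 := cvg_dot eventually_filter U3 L3' F3 (lag_L2 h G3) u3 (lagc _ _ V3 G3 v3).
have k4 := cvg_dot eventually_filter U1 L1' F1 (lag_L2 h G1) u1 (lagc _ _ V1 G1 v1).
have k5 := cvg_dot eventually_filter U2 L2' F2 (lag_L2 h G2) u2 (lagc _ _ V2 G2 v2).
have k6 := cvg_dot eventually_filter U1 L2' F1 (lag_L2 h G2) u1 (lagc _ _ V2 G2 v2).
have k7 := cvg_dot eventually_filter U2 L1' F2 (lag_L2 h G1) u2 (lagc _ _ V1 G1 v1).
rewrite /cov; apply: cvgD; apply: cvgM; [exact: cvg_cst|exact: k1|exact: cvg_cst|].
by apply: cvgD; apply: cvgM; [exact: k4|exact: k5|exact: k6|exact: k7].
Qed.

Lemma covdiff_cvg h (u v : nat -> signal) f g : (forall i, square_integrable (u i)) ->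
  (forall i, square_integrable (v i)) -> square_integrable f -> square_integrable g ->
  signal_cvg u f -> signal_cvg v g -> covdiff h (u i) (v i) @[i --> \oo] --> covdiff h f g.
Proof.
move=> U V F G uf vg; rewrite /covdiff.
by apply: cvgD; [apply: cvgB; [apply: cvgB|]|]; exact: cov_cvg.
Qed.

Lemma covdiffxx h f : covdiff h f f = 0.
Proof. by rewrite /covdiff subrr sub0r addNr. Qed.

Definition abs_dot (h : int) (a b : R -> R) : R := Ex leb (fun x => `|a x| * `|lag h b x|).

(** Absolute values inside all integrals, so that one bound serves every pair of signals
    that [f] dominates. *)
Definition cov_bound f (h : int) : R :=
  `|kappa4| * Ex leb (fun x => `|f.1 x * f.2 x| * `|lag h f.1 x * lag h f.2 x|) +
  sigma2 ^+ 2 * (abs_dot h f.1 f.1 * abs_dot h f.2 f.2 + abs_dot h f.1 f.2 * abs_dot h f.2 f.1).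

Definition dominates f g := (forall x, `|g.1 x| <= `|f.1 x|) /\ (forall x, `|g.2 x| <= `|f.2 x|).

Lemma dominates_refl f : dominates f f. Proof. by split. Qed.

Lemma dot_le (a b c e : R -> R) : L2 leb a -> L2 leb b -> L2 leb c -> L2 leb e ->
  (forall x, `|c x| <= `|a x|) -> (forall x, `|e x| <= `|b x|) ->
  `|dot c e| <= Ex leb (fun x => `|a x| * `|b x|).
Proof.
move=> a2 b2 c2 e2 ca eb; apply: le_trans (ler_norm_Ex (L2M c2 e2)) _.
apply: le_Ex; [exact/L1_abs/L2M|by apply: L2M; exact: L2_abs|].
by move=> x; rewrite normrM ler_pM.
Qed.

Lemma cov_le h f g g' : square_integrable f -> square_integrable g -> square_integrable g' ->
  dominates f g -> dominates f g' -> `|cov h g g'| <= cov_bound f h.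
Proof.
move=> [F1 F2 F3] [G1 G2 G3] [H1 H2 H3] [d1 d2] [e1 e2].
apply: le_trans (ler_normD _ _) _.
rewrite !(normrM kappa4) (normrM (sigma2 ^+ 2)); apply: lerD.
  apply: ler_wpM2l => //; apply: dot_le => //; first exact: (lag_L2 h F3).
  - exact: (lag_L2 h H3).
  - by move=> x; rewrite !normrM ler_pM.
  - by move=> x; rewrite !normrM ler_pM//; [exact: e1|exact: e2].
rewrite ger0_norm ?sqr_ge0//; apply: ler_wpM2l; first exact: sqr_ge0.
apply: le_trans (ler_normD _ _) _; rewrite !normrM.
have LF1 := lag_L2 h F1; have LF2 := lag_L2 h F2.
have LH1 := lag_L2 h H1; have LH2 := lag_L2 h H2.
have l1 x : `|lag h g'.1 x| <= `|lag h f.1 x| by exact: e1.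
have l2 x : `|lag h g'.2 x| <= `|lag h f.2 x| by exact: e2.
by apply: lerD; apply: ler_pM => //; apply: dot_le.
Qed.

Lemma covdiff_le h f g : square_integrable f -> square_integrable g -> dominates f g ->
  `|covdiff h f g| <= 4 * cov_bound f h.
Proof.
move=> F G d; have r := dominates_refl f.
have c1 := cov_le h F F F r r; have c2 := cov_le h F F G r d.
have c3 := cov_le h F G F d r; have c4 := cov_le h F G G d d.
rewrite /covdiff; move: c1 c2 c3 c4; rewrite !ler_norml.
by move=> /andP[? ?] /andP[? ?] /andP[? ?] /andP[? ?]; apply/andP; split; lra.
Qed.

Lemma dot_disjoint (a b : R -> R) (A : R -> bool) : (forall x, ~~ A x -> a x = 0) ->
  (forall x, A x -> b x = 0) -> dot a b = 0.
Proof.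
move=> a0 b0; rewrite (_ : (fun x => _) = fun=> 0) ?Ex0//.
apply/funext => x; have [Ax|Ax] := boolP (A x); first by rewrite b0// mulr0.
by rewrite a0// mul0r.
Qed.

(** All integrals in the covariance vanish when the supports are disjoint. *)
Lemma cov_disjoint h f g (A : R -> bool) :
  (forall x, ~~ A x -> f.1 x = 0 /\ f.2 x = 0) ->
  (forall x, A x -> lag h g.1 x = 0 /\ lag h g.2 x = 0) -> cov h f g = 0.
Proof.
move=> f0 g0.
have f1 x (Ax : ~~ A x) := (f0 x Ax).1; have f2 x (Ax : ~~ A x) := (f0 x Ax).2.
have g1 x (Ax : A x) := (g0 x Ax).1; have g2 x (Ax : A x) := (g0 x Ax).2.
rewrite /cov (dot_disjoint f1 g1) (dot_disjoint f1 g2) (dot_disjoint (A := A)).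
- by rewrite !mul0r !mulr0 addr0 mulr0 addr0.
- by move=> x Ax; rewrite f1// mul0r.
- by move=> x Ax; rewrite g1// mul0r.
Qed.

End lagged_pairs.

Section product_processes.
Context d (T : measurableType d) (R : realType) (P : probability T R).
Variables (L : R -> T -> R) (sigma2 kappa4 : R).
Hypothesis HN : levy_noise P L sigma2 kappa4.
Let leb := @lebesgue_measure R.
Local Notation mR := (measurableTypeR R).
Variable Dlt : R.
Hypothesis Dlt0 : 0 < Dlt.
Local Notation signal := ((R -> R) * (R -> R))%type.
Local Notation dot f g := (Ex leb (fun x => f x * g x)).
Local Notation cov := (cov Dlt sigma2 kappa4).
Local Notation covdiff := (covdiff Dlt sigma2 kappa4).
Local Notation lag := (lag Dlt).
Implicit Types f g : signal.

(** Time is counted in units of [Dlt].  Integrals are determined up to null sets, so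
    some choice of versions is part of the data. *)
Definition product_process f (V : nat -> T -> R) : Prop :=
  square_integrable f /\ exists Y1 Y2 : nat -> T -> R, forall t : nat,
    [/\ wiener P L (lag t f.1) (Y1 t), wiener P L (lag t f.2) (Y2 t) &
        forall w, V t w = Y1 t w * Y2 t w].

Lemma product_process_L2 f V t : product_process f V -> L2 P (V t).
Proof.
move=> [F [Y1 [Y2 /(_ t)[w1 w2 E]]]].
apply: (eq_L2 (fun w => esym (E w))).
exact: (wiener_product_L2 HN Dlt0 (lag_square_integrable Dlt t F) w1 w2).
Qed.

(** Translation invariance: only the difference of the lags matters. *)
Lemma dot_lag (s t : int) (a b : R -> R) : L2 leb a -> L2 leb b ->
  dot (lag s a) (lag t b) = dot a (lag (t - s) b).
Proof.
move=> a2 b2; have ab := L1_measurable (L2M a2 (lag_L2 Dlt (t - s) b2)).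
rewrite -(Ex_lag Dlt s ab); apply: (@eq_Ex _ _ R leb) => x; rewrite /lag; congr (_ * b _).
by rewrite intrB; ring.
Qed.

Lemma product_mean f V t : product_process f V -> Ex P (V t) = sigma2 * dot f.1 f.2.
Proof.
move=> [[F1 F2 F3] [Y1 [Y2 /(_ t)[w1 w2 E]]]].
by rewrite (@eq_Ex _ _ R P _ _ E) (wiener_dot HN w1 w2) dot_lag// subrr lag0.
Qed.

Definition centered (V : nat -> T -> R) (t : nat) (w : T) : R := V t w - Ex P (V t).

Lemma centered_L2 f V t : product_process f V -> L2 P (centered V t).
Proof. by move=> fV; apply: L2B; [exact: product_process_L2 fV|exact: L2_cst]. Qed.

(** The pairing inside each product is the product of the means and cancels. *)
Lemma product_cov f g V U (s t : nat) : product_process f V -> product_process g U ->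
  Ex P (fun w => centered V s w * centered U t w) = cov (t%:Z - s%:Z)%R f g.
Proof.
move=> fV gU; have V2 := product_process_L2 s fV; have U2 := product_process_L2 t gU.
have -> : Ex P (fun w => centered V s w * centered U t w) =
    Ex P (fun w => V s w * U t w) - Ex P (V s) * Ex P (U t).
  have c2 := centered_L2 t gU.
  transitivity (Ex P (fun w => (V s w * U t w - Ex P (U t) * V s w) - Ex P (V s) * centered U t w)).
    by apply: eq_Ex => w; rewrite /centered; ring.
  rewrite ExB; [|by apply: L1B; [exact: L2M|exact/L1Z/L2_L1]|exact/L1Z/L2_L1].
  rewrite ExB; [|exact: L2M|exact/L1Z/L2_L1].
  rewrite !ExZ; [|exact: L2_L1..].
  rewrite (_ : Ex P (centered U t) = 0); first by ring.
  by rewrite ExB ?Ex_cst ?subrr//; [exact: L2_L1|exact: L1_cst].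
rewrite (product_mean s fV) (product_mean t gU).
have [F [Y1 [Y2 /(_ s)[w1 w2 E]]]] := fV; have [G [Z1 [Z2 /(_ t)[v1 v2 E']]]] := gU.
rewrite (@eq_Ex _ _ R P _ _ (fun w => congr2 *%R (E w) (E' w))).
rewrite (fourth_moment HN Dlt0 (lag_square_integrable Dlt s F)
  (lag_square_integrable Dlt t G) w1 w2 v1 v2).
have [F1 F2 F3] := F; have [G1 G2 G3] := G.
have F12 : Ex leb (fun x => lag s f.1 x * lag s f.2 x * (lag t g.1 x * lag t g.2 x)) =
    dot (fun x => f.1 x * f.2 x) (fun x => lag (t%:Z - s%:Z) g.1 x * lag (t%:Z - s%:Z) g.2 x).
  exact: (dot_lag s t F3 G3).
by rewrite /moment4 F12 !dot_lag// !subrr !lag0 /cov; ring.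
Qed.

Lemma product_covdiff f g V U (s t : nat) : product_process f V -> product_process g U ->
  Ex P (fun w => (centered V s w - centered U s w) * (centered V t w - centered U t w)) =
  covdiff (t%:Z - s%:Z)%R f g.
Proof.
move=> fV gU.
have Vs := centered_L2 s fV; have Vt := centered_L2 t fV.
have Us := centered_L2 s gU; have Ut := centered_L2 t gU.
transitivity (Ex P (fun w => centered V s w * centered V t w - centered V s w * centered U t w
   - centered U s w * centered V t w + centered U s w * centered U t w)).
  by apply: eq_Ex => w; ring.
rewrite ExD; [|by apply: L1B; [apply: L1B; exact: L2M|exact: L2M]|exact: L2M].
rewrite ExB; [|by apply: L1B; exact: L2M|exact: L2M].
rewrite ExB; [|exact: L2M..].
by rewrite (product_cov _ _ fV fV) (product_cov _ _ fV gU) (product_cov _ _ gU fV) (product_cov _ _ gU gU).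
Qed.

Definition normalized_sum (V : nat -> T -> R) (n : nat) (w : T) : R :=
  (Num.sqrt n%:R)^-1 * \sum_(t < n) centered V t w.

Lemma normalized_sum_L2 f V n : product_process f V -> L2 P (normalized_sum V n).
Proof. by move=> fV; apply: L2Z; apply: L2_sum => t _; exact: centered_L2 fV. Qed.

Lemma Ex_sqr_normalized (n : nat) (y : nat -> T -> R) : (forall t, L2 P (y t)) ->
  Ex P (fun w => ((Num.sqrt n%:R)^-1 * \sum_(t < n) y t w) ^+ 2) =
  n%:R^-1 * \sum_(s < n) \sum_(t < n) Ex P (fun w => y s w * y t w).
Proof.
move=> y2; rewrite -Ex_sqr_sum// -ExZ; last by apply: L2_sqr; apply: L2_sum => t _.
by apply: eq_Ex => w; rewrite exprMn exprVn sqr_sqrtr.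
Qed.

Lemma normalized_sum_sqr f V n : product_process f V ->
  Ex P (fun w => normalized_sum V n w ^+ 2) =
  n%:R^-1 * \sum_(s < n) \sum_(t < n) cov (t%:Z - s%:Z)%R f f.
Proof.
move=> fV; rewrite Ex_sqr_normalized; last by move=> t; exact: centered_L2 fV.
congr (_ * _); apply: eq_bigr => s _; apply: eq_bigr => t _; exact: product_cov.
Qed.

Lemma normalized_sum_sqrB f g V U n : product_process f V -> product_process g U ->
  nrm P (fun w => normalized_sum V n w - normalized_sum U n w) ^+ 2 =
  n%:R^-1 * \sum_(s < n) \sum_(t < n) covdiff (t%:Z - s%:Z)%R f g.
Proof.
move=> fV gU; rewrite sqr_nrm.
transitivity (Ex P (fun w => ((Num.sqrt n%:R)^-1 * \sum_(t < n) (centered V t w - centered U t w)) ^+ 2)).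
  apply: (@eq_Ex _ _ R P) => w; rewrite /normalized_sum; by rewrite -mulrBr -sumrB.
rewrite (Ex_sqr_normalized n (y := fun t w => centered V t w - centered U t w)); last first.
  by move=> t; apply: L2B; [exact: centered_L2 fV|exact: centered_L2 gU].
by congr (_ * _); apply: eq_bigr => s _; apply: eq_bigr => t _; exact: product_covdiff.
Qed.

(** With finitely many correlated neighbours, the error at lag zero controls the error of
    the sums. *)
Lemma normalized_sumB_short_range f g V U n (M : nat) : product_process f V -> product_process g U ->
  (forall h : int, (M < `|h|)%N -> covdiff h f g = 0) ->
  nrm P (fun w => normalized_sum V n w - normalized_sum U n w) ^+ 2 <=
  (2 * M + 1)%:R * covdiff 0 f g.
Proof.
move=> fV gU far; case: n => [|n].
  have z w : normalized_sum V 0 w - normalized_sum U 0 w = 0.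
    by rewrite /normalized_sum !big_ord0 !mulr0 subrr.
  rewrite (@eq_nrm _ _ R P _ _ z) nrm_cst normr0 expr0n mulr_ge0//.
  rewrite -(product_covdiff 0 0 fV gU).
  by apply: Ex_ge0 => w; rewrite -expr2 sqr_ge0.
rewrite (normalized_sum_sqrB _ fV gU) mulrC ler_pdivrMr ?ltr0n// mulrC.
pose y t w := centered V t w - centered U t w.
have y2 t : L2 P (y t) by apply: L2B; [exact: centered_L2 fV|exact: centered_L2 gU].
have -> : \sum_(s < n.+1) \sum_(t < n.+1) covdiff (t%:Z - s%:Z)%R f g =
    Ex P (fun w => (\sum_(t < n.+1) y t w) ^+ 2).
  rewrite Ex_sqr_sum//; apply: eq_bigr => s _; apply: eq_bigr => t _.
  by apply/esym; exact: product_covdiff.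
apply: Ex_sqr_sum_short_range => //.
- move=> s t st; rewrite (product_covdiff s t fV gU) far//.
  by move: st; rewrite /close; lia.
- move=> t; rewrite -(subrr (t%:Z)) -(product_covdiff t t fV gU).
  by rewrite (_ : (fun w => y t w ^+ 2) = fun w => y t w * y t w).
Qed.

End product_processes.

Section dyadic_processes.
Context d (T : measurableType d) (R : realType) (P : probability T R).
Variables (L : R -> T -> R) (sigma2 kappa4 : R).
Hypothesis HN : levy_noise P L sigma2 kappa4.
Variable Dlt : R.
Hypothesis Dlt0 : 0 < Dlt.
Local Notation signal := ((R -> R) * (R -> R))%type.
Local Notation cov := (cov Dlt sigma2 kappa4).
Local Notation covdiff := (covdiff Dlt sigma2 kappa4).
Local Notation lag := (lag Dlt).
Implicit Types f g : signal.

Definition shift_step (s : R) (g : step_data R) : step_data R :=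
  [seq (u.1, (u.2.1 + s, u.2.2 + s)) | u <- g].

Lemma shift_step_wf s (g : step_data R) : step_wf g -> step_wf (shift_step s g).
Proof. by rewrite /step_wf all_map; apply: sub_all => u /=; rewrite lerD2r. Qed.

Lemma step_fun_shift s (g : step_data R) x : step_fun (shift_step s g) x = step_fun g (x - s).
Proof.
rewrite /step_fun big_map; apply: eq_bigr => u _ /=; congr (_ * _).
by rewrite !indicE !mem_setE !in_itv/= ltrBrDr lerBlDr.
Qed.

(** The noise of all shifts of a dyadic kernel is read from one grid, which starts at
    [- m * Dlt]; a shift by [Dlt] moves the window by [2 ^ k] cells. *)
Definition dyadic_integral (k m : nat) (a : R -> R) (t : nat) (w : T) : R :=
  \sum_(j < 2 * (m * 2 ^ k)) a ((j.+1%:R - (m * 2 ^ k)%:R) * mesh Dlt k) *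
    grid_noise L (m * 2 ^ k) (mesh Dlt k) (t * 2 ^ k + j) w.

Lemma dyadic_integral_wiener k m a (t : nat) : dyadic Dlt k m a ->
  wiener P L (lag t a) (dyadic_integral k m a t).
Proof.
move=> da; have m0 := mesh_gt0 Dlt0 k.
have := wiener_step HN (shift_step_wf (t%:R * Dlt) (grid_step_wf (m * 2 ^ k)%N a m0)).
congr (wiener _ _ _ _).
  by apply/funext => x; rewrite step_fun_shift (step_fun_grid _ m0 da).
apply/funext => w; rewrite /step_integral /shift_step /grid_step -map_comp big_map.
rewrite -[X in iota 0 X]subn0 -/(index_iota 0 _) big_mkord; apply: eq_bigr => j _ /=; congr (_ * _).
have tD : t%:R * Dlt = (t * 2 ^ k)%:R * mesh Dlt k by rewrite meshM.
rewrite /grid_noise /incr; congr (L _ w - L _ w); rewrite tD -mulrDl; congr (_ * _);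
  by rewrite -?addnS natrD; ring.
Qed.

Definition dyadic_product (k m : nat) f (t : nat) (w : T) : R :=
  dyadic_integral k m f.1 t w * dyadic_integral k m f.2 t w.

Lemma dyadic_product_process k m f : dyadic Dlt k m f.1 -> dyadic Dlt k m f.2 ->
  product_process P L Dlt f (dyadic_product k m f).
Proof.
move=> d1 d2; split; first exact: dyadic_pairL2 d1 d2.
exists (dyadic_integral k m f.1), (dyadic_integral k m f.2) => t.
by split; [exact: dyadic_integral_wiener|exact: dyadic_integral_wiener|].
Qed.

Lemma dyadic_product_stein k m f : stein_clt P (normalized_sum P (dyadic_product k m f)).
Proof.
have m0 := mesh_gt0 Dlt0 k.
have := @linear_product_stein_clt _ _ _ P (grid_noise L (m * 2 ^ k) (mesh Dlt k)) _ _ _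
  (2 ^ k)%N (2 * (m * 2 ^ k)) _
  (fun j => f.1 ((j.+1%:R - (m * 2 ^ k)%:R) * mesh Dlt k))
  (fun j => f.2 ((j.+1%:R - (m * 2 ^ k)%:R) * mesh Dlt k)).
apply.
- by move=> j; exact: (grid_noise_L4 HN).
- by move=> n; exact: noise_indep HN _ _ _ m0.
- by move=> j; exact: noise_same HN _ _ _ m0.
- by rewrite expn_gt0.
Qed.

(** A lag of more than [2 * m] moves the support ]- m Dlt, m Dlt] off itself. *)
Lemma dyadic_far k k' m f g (h : int) : dyadic Dlt k m f.1 -> dyadic Dlt k m f.2 ->
  dyadic Dlt k' m g.1 -> dyadic Dlt k' m g.2 -> (2 * m < `|h|)%N -> cov h f g = 0.
Proof.
move=> f1 f2 g1 g2 hm.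
apply: (@cov_disjoint _ _ _ _ _ _ _ (fun x => - (m%:R * Dlt) < x <= m%:R * Dlt)).
  by move=> x Ax; rewrite (dyadic_supp f1 Ax) (dyadic_supp f2 Ax).
move=> x /andP[x1 x2].
have Bx : ~~ (- (m%:R * Dlt) < x - h%:~R * Dlt <= m%:R * Dlt).
  have hh : (2 * m%:R < h%:~R :> R) \/ (h%:~R < - (2 * m%:R) :> R).
    have E2 : (Posz (2 * m))%:~R = 2 * m%:R :> R by rewrite -pmulrn natrM.
    have [] : (Posz (2 * m) < h)%R \/ (h < - Posz (2 * m))%R by lia.
      by rewrite -(ltr_int R) E2; left.
    by rewrite -(ltr_int R) mulrNz E2; right.
  apply/negP => /andP[y1 y2]; case: hh => hh; rewrite -(ltr_pM2r Dlt0) in hh; lra.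
by rewrite /lag (dyadic_supp g1 Bx) (dyadic_supp g2 Bx).
Qed.

Lemma dyadic_covdiff_far k k' m f g (h : int) : dyadic Dlt k m f.1 -> dyadic Dlt k m f.2 ->
  dyadic Dlt k' m g.1 -> dyadic Dlt k' m g.2 -> (2 * m < `|h|)%N -> covdiff h f g = 0.
Proof.
move=> f1 f2 g1 g2 hm; rewrite /covdiff (dyadic_far f1 f2 f1 f2)// (dyadic_far f1 f2 g1 g2)//.
by rewrite (dyadic_far g1 g2 f1 f2)// (dyadic_far g1 g2 g1 g2)// !subr0 addr0.
Qed.

End dyadic_processes.

Section product_clt.
Context d (T : measurableType d) (R : realType) (P : probability T R).
Variables (L : R -> T -> R) (sigma2 kappa4 : R).
Hypothesis HN : levy_noise P L sigma2 kappa4.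
Let leb := @lebesgue_measure R.
Variable Dlt : R.
Hypothesis Dlt0 : 0 < Dlt.
Local Notation signal := ((R -> R) * (R -> R))%type.
Local Notation cov := (cov Dlt sigma2 kappa4).
Local Notation covdiff := (covdiff Dlt sigma2 kappa4).
Local Notation lag := (lag Dlt).
Variables (f : signal) (V : nat -> T -> R).
Hypothesis fV : product_process P L Dlt f V.
Hypothesis bound : zsummable (cov_bound Dlt sigma2 kappa4 f).
Local Notation W := (normalized_sum P V).

Lemma cov_zsummable : zsummable (fun h => cov h f f).
Proof.
have [F _] := fV; apply: zsummable_le bound => h.
by apply: cov_le => //; exact: dominates_refl.
Qed.

(** Cesaro's theorem for the double sum of the covariances. *)
Lemma normalized_sum_variance :
  Ex P (fun w => W n w ^+ 2) @[n --> \oo] --> zsum (fun h => cov h f f).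
Proof.
rewrite (_ : (fun n => _) =
  fun n : nat => n%:R^-1 * \sum_(s < n) \sum_(t < n) cov (t%:Z - s%:Z)%R f f).
  exact: double_sum_cesaro cov_zsummable.
by apply/funext => n; rewrite (normalized_sum_sqr HN Dlt0 n fV).
Qed.

Let trunc (m : nat) : signal := (fun x => box Dlt m x * f.1 x, fun x => box Dlt m x * f.2 x).

Lemma trunc_square_integrable m : square_integrable (trunc m).
Proof. by have [F _] := fV; exact: (box_pairL2 Dlt m F). Qed.

Lemma trunc_cvg : signal_cvg trunc f.
Proof. by have [F _] := fV; exact: (box_pair_cvg Dlt0 F). Qed.

(** Lag by lag the truncation error vanishes by continuity of the covariance, and it is
    dominated by a summable family. *)
Lemma trunc_error (e : R) : 0 < e ->
  exists m, forall n, zpartial (fun h => `|covdiff h f (trunc m)|) n <= e.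
Proof.
move=> e0; have [F _] := fV.
have b4 : zsummable (fun h => 4 * cov_bound Dlt sigma2 kappa4 f h) by exact: zsummableZ.
have [] := @tannery _ _ (fun m h => covdiff h f (trunc m)) e b4 _ _ e0.
- move=> m h; apply: covdiff_le => //; first exact: trunc_square_integrable.
  by split => x; rewrite normrM ler_piMl// box_bound.
- move=> h; rewrite -(covdiffxx Dlt sigma2 kappa4 h f).
  apply: covdiff_cvg => //; [exact: trunc_square_integrable|exact: signal_cvg_cst|exact: trunc_cvg].
by move=> m _ Hm; exists m; exact: (Hm m (leqnn m)).
Qed.

(** The approximants keep a fixed support, so that the range of dependence is the same
    for all of them. *)
Lemma trunc_dyadic m : exists (k : nat -> nat) (a : nat -> signal),
  (forall j, dyadic Dlt (k j) m.+1 (a j).1 /\ dyadic Dlt (k j) m.+1 (a j).2) /\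
  signal_cvg a (trunc m).
Proof.
have [[F1 F2 F3] [Y1 [Y2 /(_ 0%N)[w1 w2 _]]]] := fV.
rewrite !lag0 in w1 w2.
have e0 j : 0 < j.+1%:R^-1 :> R by rewrite invr_gt0.
have /choice[c Hc] : forall j, exists c : nat * signal,
    [/\ dyadic Dlt c.1 m.+1 c.2.1, dyadic Dlt c.1 m.+1 c.2.2 &
     pair_close j.+1%:R^-1 (trunc m).1 (trunc m).2 c.2.1 c.2.2].
  move=> j; have [k [a1 [a2 [d1 d2 H]]]] := dyadic_box_approx Dlt0 m F1 F2 F3
    (wiener_approximable w1) (wiener_approximable w2) (e0 j).
  by exists (k, (a1, a2)).
exists (fun j => (c j).1), (fun j => (c j).2); split; first by move=> j; have [] := Hc j.
have to0 (u : nat -> R) : (forall n, 0 <= u n <= n.+1%:R^-1) -> u @ \oo --> (0 : R).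
  move=> un; apply: (@cvg_norm_le _ _ _ _ _ (fun n => n.+1%:R^-1)); last exact: cvg_harmonic.
  by move=> n; have /andP[u0 u1] := un n; rewrite subr0 ger0_norm.
by split; apply: to0 => j; rewrite nrm_ge0; have [_ _ []] := Hc j.
Qed.

Lemma double_sum_cvg (u : nat -> int -> R) (v : int -> R) (n : nat) :
  (forall h, u j h @[j --> \oo] --> v h) ->
  n%:R^-1 * \sum_(s < n) \sum_(t < n) u j (t%:Z - s%:Z)%R @[j --> \oo] -->
  n%:R^-1 * \sum_(s < n) \sum_(t < n) v (t%:Z - s%:Z)%R.
Proof.
move=> uv; apply: cvgM; first exact: cvg_cst.
have sums (N : nat) (g : nat -> 'I_N -> R) (l : 'I_N -> R) :
    (forall i, g j i @[j --> \oo] --> l i) ->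
    \sum_(i < N) g j i @[j --> \oo] --> \sum_(i < N) l i.
  elim: N g l => [|N IH] g l gl.
    rewrite big_ord0 (_ : (fun j => _) = fun=> 0); first exact: cvg_cst.
    by apply/funext => j; rewrite big_ord0.
  rewrite big_ord_recl (_ : (fun j => _) = fun j => g j ord0 + \sum_(i < N) g j (lift ord0 i)).
    by apply: cvgD => //; apply: IH => i; exact: gl.
  by apply/funext => j; rewrite big_ord_recl.
by apply: (sums n) => s; apply: (sums n) => t; exact: uv.
Qed.

(** No integral of the truncated kernel is given.  The sums for [f] are therefore compared
    with those for one dyadic pair through a second dyadic pair, which runs to the
    truncation while [n] is fixed; the resulting bound does not depend on [n]. *)
Lemma product_stein_clt : stein_clt P W.
Proof.
have [F _] := fV.
have W2 n : L2 P (W n) := normalized_sum_L2 HN Dlt0 n fV.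
have [B HB] : exists B, forall n, nrm P (W n) <= B.
  have /cvg_seq_bounded[C [_ HC]] := cvgP _ normalized_sum_variance.
  exists (Num.sqrt (`|C| + 1)) => n; apply: nrm_le_sqrt; rewrite sqr_nrm.
  apply: le_trans (ler_norm _) _; apply: (HC (`|C| + 1)) => //.
  by rewrite ltr_pwDr// ler_norm.
apply: (stein_clt_approx W2 HB) => e e0.
have e40 : 0 < (e / 4) ^+ 2 by rewrite exprn_gt0// divr_gt0.
have e42 : (e / 4) ^+ 2 < (e / 2) ^+ 2 by rewrite ltr_pXn2r ?nnegrE ?divr_ge0 ?ltW//; lra.
have [m Hm] := trunc_error e40; have [k [a [da ca]]] := trunc_dyadic m.
have d1 j := (da j).1; have d2 j := (da j).2.
have aL j : square_integrable (a j) by exact: dyadic_pairL2 (d1 j) (d2 j).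
have tL := trunc_square_integrable m.
pose U j := dyadic_product L Dlt (k j) m.+1 (a j).
have aU j : product_process P L Dlt (a j) (U j) by exact: (dyadic_product_process HN Dlt0 (d1 j) (d2 j)).
(* The supports lie in ]- (m + 1) Dlt, (m + 1) Dlt], so larger lags do not interact. *)
pose M := (2 * m.+1)%N.
have [j Hj] : exists j, (2 * M + 1)%:R * covdiff 0 (trunc m) (a j) < (e / 4) ^+ 2.
  have : (2 * M + 1)%:R * covdiff 0 (trunc m) (a j) @[j --> \oo] --> (0 : R).
    rewrite -[X in _ --> X](mulr0 (2 * M + 1)%:R) -(covdiffxx Dlt sigma2 kappa4 0 (trunc m)).
    apply: cvgM; first exact: cvg_cst.
    by apply: covdiff_cvg => //; exact: signal_cvg_cst.
  by move=> /cvgr_lt/(_ _ e40)[N _ HN']; exists N; exact: (HN' N (leqnn N)).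
exists (normalized_sum P (U j)); split.
- by move=> n; exact: (normalized_sum_L2 HN Dlt0 n (aU j)).
- exact: (dyadic_product_stein HN Dlt0).
exists 0%N => // n _.
(* The first comparison is bounded by the truncation error. *)
have c1 : nrm P (fun w => W n w - normalized_sum P (U i) n w) ^+ 2 @[i --> \oo] -->
    n%:R^-1 * \sum_(s < n) \sum_(t < n) covdiff (t%:Z - s%:Z)%R f (trunc m).
  rewrite (_ : (fun i => _) = fun i => n%:R^-1 * \sum_(s < n) \sum_(t < n) covdiff (t%:Z - s%:Z)%R f (a i)).
    by apply: (@double_sum_cvg (fun i h => covdiff h f (a i)) (fun h => covdiff h f (trunc m))) => h; apply: covdiff_cvg => //; exact: signal_cvg_cst.
  by apply/funext => i; exact: (normalized_sum_sqrB HN Dlt0 n fV (aU i)).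
have l1 : n%:R^-1 * \sum_(s < n) \sum_(t < n) covdiff (t%:Z - s%:Z)%R f (trunc m) < (e / 2) ^+ 2.
  apply: le_lt_trans e42; apply: le_trans (Hm n).
  case: {c1} n => [|n].
    by rewrite big_ord0 mulr0 /zpartial big_geq.
  by rewrite mulrC ler_pdivrMr ?ltr0n// mulrC; exact: double_sum_le (fun h => covdiff h f (trunc m)) _.
(* The second comparison is between kernels of one bounded support. *)
have c2 : (2 * M + 1)%:R * covdiff 0 (a i) (a j) @[i --> \oo] -->
    (2 * M + 1)%:R * covdiff 0 (trunc m) (a j).
  by apply: cvgM; [exact: cvg_cst|apply: covdiff_cvg => //; exact: signal_cvg_cst].
have [i [Hi1 Hi2]] : exists i, nrm P (fun w => W n w - normalized_sum P (U i) n w) ^+ 2 < (e / 2) ^+ 2 /\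
    (2 * M + 1)%:R * covdiff 0 (a i) (a j) < (e / 2) ^+ 2.
  have [N1 _ H1] := cvgr_lt _ c1 _ l1; have [N2 _ H2] := cvgr_lt _ c2 _ (lt_trans Hj e42).
  by exists (maxn N1 N2); split; [apply: H1; exact: leq_maxl|apply: H2; exact: leq_maxr].
have e20 : 0 <= e / 2 by rewrite divr_ge0// ltW.
have sq (x : R) : 0 <= x -> x ^+ 2 < (e / 2) ^+ 2 -> x <= e / 2.
  by move=> x0; rewrite ltr_pXn2r// => /ltW.
apply: le_trans (nrm_sub_tri (W2 n) (normalized_sum_L2 HN Dlt0 n (aU i)) (normalized_sum_L2 HN Dlt0 n (aU j))) _.
rewrite (splitr e); apply: lerD; first by apply: sq; rewrite ?nrm_ge0.
apply: sq; first exact: nrm_ge0.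
apply: le_lt_trans Hi2; apply: (normalized_sumB_short_range HN Dlt0 n (aU i) (aU j)) => h hM.
exact: (dyadic_covdiff_far sigma2 kappa4 Dlt0 (d1 i) (d2 i) (d1 j) (d2 j) hM).
Qed.

Lemma product_clt : 0 <= zsum (fun h => cov h f f) /\
  cvg_in_distribution P W (gaussian 0 (zsum (fun h => cov h f f))).
Proof.
have z0 : 0 <= zsum (fun h => cov h f f).
  have c := normalized_sum_variance; rewrite -(cvg_lim (@Rhausdorff R) c).
  apply: limr_ge; first exact: cvgP c.
  by near=> n; apply: Ex_ge0 => w; exact: sqr_ge0.
split => //; apply: stein_criterion z0 normalized_sum_variance product_stein_clt.
by move=> n; exact: (normalized_sum_L2 HN Dlt0 n fV).
Unshelve. all: by end_near. Qed.

End product_clt.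

(** * Assembling the hypotheses *)

Section zsum_linear.
Context (R : realType).
Implicit Types a b : int -> R.

Lemma zsumD a b : zsummable a -> zsummable b -> zsum (fun s => a s + b s) = zsum a + zsum b.
Proof.
move=> a1 b1; have c := zpartial_cvg (zsummableD a1 b1).
rewrite -(cvg_lim (@Rhausdorff R) c); apply: (cvg_lim (@Rhausdorff R)).
rewrite (_ : (fun n => _) = fun n => zpartial a n + zpartial b n).
  by apply: cvgD; exact: zpartial_cvg.
by apply/funext => n; rewrite zpartialD.
Qed.

Lemma zsumZ c a : zsummable a -> zsum (fun s => c * a s) = c * zsum a.
Proof.
move=> a1; have h := zpartial_cvg (zsummableZ c a1).
rewrite -(cvg_lim (@Rhausdorff R) h); apply: (cvg_lim (@Rhausdorff R)).
rewrite (_ : (fun n => _) = fun n => c * zpartial a n).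
  by apply: cvgM; [exact: cvg_cst|exact: zpartial_cvg].
by apply/funext => n; rewrite zpartialZ.
Qed.

End zsum_linear.

Section reflection.
Context (R : realType).
Let leb := @lebesgue_measure R.
Local Notation mR := (measurableTypeR R).
Implicit Types (a b : R -> R) (c h : R).

Definition reflect_at c a (x : R) : R := a (c - x).

Lemma reflect_L2 c a : L2 leb a -> L2 leb (reflect_at c a).
Proof.
move=> /(L2_shift c)/(@L2_opp R).
by apply: eq_L2 => x; rewrite /reflect_at addrC.
Qed.

Lemma Ex_reflect c a : measurable_fun setT a -> Ex leb (reflect_at c a) = Ex leb a.
Proof.
move=> ma.
have mac : measurable_fun [set: R] (fun x => a (x + c)).
  exact: (@measurableT_comp _ _ _ mR mR mR a _ _ ma (measurable_shift c)).
rewrite -(Ex_shift c ma) -(Ex_opp mac).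
by apply: (@eq_Ex _ _ R leb) => x; rewrite /reflect_at addrC.
Qed.

(** The change of variables x |-> c - x turns a difference of reflection points into a lag. *)
Lemma Ex_reflectM c h a b : L2 leb a -> L2 leb b ->
  Ex leb (fun x => reflect_at c a x * reflect_at (c + h) b x) = Ex leb (fun x => a x * b (x + h)).
Proof.
move=> a2 b2; have ab := L1_measurable (L2M a2 (L2_shift h b2)).
rewrite -(Ex_reflect c ab); apply: (@eq_Ex _ _ R leb) => x.
by rewrite /reflect_at; congr (_ * b _); ring.
Qed.

Lemma abs_corr_Ex a b h : L2 leb a -> L2 leb b ->
  abs_corr a b h = (Ex leb (fun x => `|a x| * `|b (x + h)|))%:E.
Proof.
move=> a2 b2; rewrite -EFin_Ex; last first.
  by have := L2M (L2_abs a2) (L2_abs (L2_shift h b2)).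
by apply: eq_integral => x _; rewrite normrM.
Qed.

End reflection.

Section summability.
Context (R : realType).
Let leb := @lebesgue_measure R.
Local Notation mR := (measurableTypeR R).
Variables (Dlt sigma2 kappa4 : R) (phi1 phi2 : R -> R).
Hypothesis Dlt0 : 0 < Dlt.
Hypothesis L2_1 : L2 leb phi1.
Hypothesis L2_2 : L2 leb phi2.
Let p x := phi1 x * phi2 x.
Local Notation lag := (lag Dlt).
Hypothesis Hi : exists alpha1 alpha2 : \bar R,
        [/\ (1 <= alpha1)%E, (1 <= alpha2)%E,
            (alpha1^-1 + alpha2^-1 = 1)%E,
            in_lp alpha1 (fun s : int => abs_corr phi1 phi1 (s%:~R * Dlt)) &
            in_lp alpha2 (fun s : int => abs_corr phi2 phi2 (s%:~R * Dlt))].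
Hypothesis Hii : in_lp 2%:E (fun s : int => abs_corr phi1 phi2 (s%:~R * Dlt)).
Hypothesis Hiii : (\int[leb]_(t in cell0 Dlt) (periodize Dlt (fun x => `|p x|%:E) t *
  periodize Dlt (fun x => `|p x|%:E) t) < +oo)%E.

(** Reflecting the kernels at [Dlt] turns the moving averages at times [(t + 1) * Dlt] into
    integrals of kernels lagged by [t * Dlt]. *)
Definition kernels : (R -> R) * (R -> R) := (reflect_at Dlt phi1, reflect_at Dlt phi2).

Let mp : measurable_fun setT p.
Proof.
exact: (@measurable_funM _ mR R setT phi1 phi2 (L2_measurable L2_1) (L2_measurable L2_2)).
Qed.

Let corr (a b : R -> R) (h : int) : R := Ex leb (fun x => a x * b (x + h%:~R * Dlt)).
Let acorr (a b : R -> R) (h : int) : R := Ex leb (fun x => `|a x| * `|b (x + h%:~R * Dlt)|).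

(** The term of lag zero in the summable family of correlations. *)
Lemma product_L2 : L2 leb p.
Proof.
split; first exact: mp.
have dp := dominated_abs mp.
have := correlation_L1 Dlt0 mp Hiii 0 dp dp.
by apply: eq_L1 => x; rewrite mul0r addr0 -normrM -expr2 ger0_norm// sqr_ge0.
Qed.

Lemma kernels_square_integrable : square_integrable kernels.
Proof. by split; [exact: reflect_L2|exact: reflect_L2|exact: (reflect_L2 Dlt product_L2)]. Qed.

Lemma lag_reflect h a : lag h (reflect_at Dlt a) = reflect_at (Dlt + h%:~R * Dlt) a.
Proof. by apply/funext => x; rewrite /lag /reflect_at; congr a; ring. Qed.

Lemma corr_kernels h (a b : R -> R) : L2 leb a -> L2 leb b ->
  Ex leb (fun x => reflect_at Dlt a x * lag h (reflect_at Dlt b) x) = corr a b h.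
Proof. by move=> a2 b2; rewrite lag_reflect; exact: Ex_reflectM. Qed.

Lemma acorr_kernels h (a b : R -> R) : L2 leb a -> L2 leb b ->
  Ex leb (fun x => `|reflect_at Dlt a x| * `|lag h (reflect_at Dlt b) x|) = acorr a b h.
Proof. by move=> a2 b2; exact: (corr_kernels h (L2_abs a2) (L2_abs b2)). Qed.

Lemma acorr_ge0 a b h : 0 <= acorr a b h.
Proof. by apply: Ex_ge0 => x; rewrite mulr_ge0. Qed.

(** Exchanging the two functions reverses the lag. *)
Lemma acorrC a b h : L2 leb a -> L2 leb b -> acorr a b h = acorr b a (- h).
Proof.
move=> a2 b2; have m := L1_measurable (L2M (L2_abs a2) (L2_abs (L2_shift (h%:~R * Dlt) b2))).
rewrite /acorr -(Ex_shift (- (h%:~R * Dlt)) m); apply: (@eq_Ex _ _ R leb) => x.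
by rewrite mulrC mulrNz mulNr subrK.
Qed.

Lemma corr_le a b h : L2 leb a -> L2 leb b -> `|corr a b h| <= acorr a b h.
Proof.
move=> a2 b2; have b2' := L2_shift (h%:~R * Dlt) b2.
apply: le_trans (ler_norm_Ex (L2M a2 b2')) _; apply: le_Ex.
- exact/L1_abs/L2M.
- by apply: L2M; exact: L2_abs.
- by move=> x; rewrite normrM.
Qed.

Lemma zsummable_acorr_diagonal : zsummable (fun h => acorr phi1 phi1 h * acorr phi2 phi2 h).
Proof.
have [p1 [p2 [? ? pq la lb]]] := Hi.
apply: zsummable_conjugate pq _ _ => //; try exact: acorr_ge0.
  by move: la; under eq_fun do rewrite abs_corr_Ex//.
by move: lb; under eq_fun do rewrite abs_corr_Ex//.
Qed.

Lemma zsummable_acorr_cross : zsummable (fun h => acorr phi1 phi2 h * acorr phi2 phi1 h).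
Proof.
under eq_fun do rewrite (acorrC (a := phi2))//.
apply: zsummable_sqr_reflect; first exact: acorr_ge0.
by move: Hii; under eq_fun do rewrite abs_corr_Ex//.
Qed.

Lemma zsummable_acorr_product : zsummable (acorr p p).
Proof. by have dp := dominated_abs mp; exact: (zsummable_correlation Dlt0 mp Hiii dp dp). Qed.

Lemma cov_bound_zsummable : zsummable (cov_bound Dlt sigma2 kappa4 kernels).
Proof.
rewrite (_ : cov_bound _ _ _ _ = fun h => `|kappa4| * acorr p p h +
  sigma2 ^+ 2 * (acorr phi1 phi1 h * acorr phi2 phi2 h + acorr phi1 phi2 h * acorr phi2 phi1 h)).
  apply: zsummableD; apply: zsummableZ; first exact: zsummable_acorr_product.
  by apply: zsummableD; [exact: zsummable_acorr_diagonal|exact: zsummable_acorr_cross].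
apply/funext => h; rewrite /cov_bound /abs_dot /= !acorr_kernels//.
by rewrite -(acorr_kernels h product_L2 product_L2).
Qed.

Lemma cov_kernels h : cov Dlt sigma2 kappa4 h kernels kernels =
  kappa4 * corr p p h + (sigma2 * corr phi1 phi1 h * (sigma2 * corr phi2 phi2 h) +
  sigma2 * corr phi1 phi2 h * (sigma2 * corr phi2 phi1 h)).
Proof.
rewrite /cov /= !corr_kernels//.
rewrite (_ : Ex leb _ = corr p p h); first by ring.
by rewrite -(corr_kernels h product_L2 product_L2).
Qed.

Lemma zsum_cov_kernels : zsum (fun h => cov Dlt sigma2 kappa4 h kernels kernels) =
  kappa4 * \int[leb]_(t in `[0, Dlt]) (zsum (fun s : int => p (t + s%:~R * Dlt))) ^+ 2 +
  zsum (fun h => sigma2 * corr phi1 phi1 h * (sigma2 * corr phi2 phi2 h)) +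
  zsum (fun h => sigma2 * corr phi1 phi2 h * (sigma2 * corr phi2 phi1 h)).
Proof.
under eq_fun do rewrite cov_kernels.
have prod (a b a' b' : R -> R) : L2 leb a -> L2 leb b -> L2 leb a' -> L2 leb b' ->
    zsummable (fun h => acorr a b h * acorr a' b' h) ->
    zsummable (fun h => sigma2 * corr a b h * (sigma2 * corr a' b' h)).
  move=> a2 b2 a'2 b'2 /(zsummableZ (sigma2 ^+ 2)); apply: zsummable_le => h.
  rewrite mulrACA -expr2 normrM ger0_norm ?sqr_ge0// ler_wpM2l ?sqr_ge0// normrM.
  by apply: ler_pM => //; exact: corr_le.
have z1 := prod _ _ _ _ L2_1 L2_1 L2_2 L2_2 zsummable_acorr_diagonal.
have z2 := prod _ _ _ _ L2_1 L2_2 L2_2 L2_1 zsummable_acorr_cross.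
have z0 : zsummable (corr p p).
  by apply: zsummable_le zsummable_acorr_product => h; exact: corr_le product_L2 product_L2.
rewrite zsumD; [|exact: zsummableZ|exact: zsummableD].
rewrite zsumD// zsumZ// addrA; congr (_ * _ + _ + _).
exact: (zsum_correlation Dlt0 mp Hiii).
Qed.

End summability.

Theorem theorem3p1 (R : realType) (d : measure_display) (T : measurableType d)
    (P : probability T R)
    (L : R -> T -> R) (HL : two_sided_levy P L)
    (HL1 : ('E_P[L 1%R] = 0)%E)
    (HL4 : ('E_P[fun w => ((L 1 w) ^+ 4)%R] < +oo)%E)
    (phi1 phi2 : R -> R)
    (Hphi1 : phi1 \in Lfun (@lebesgue_measure R) 2%:E)
    (Hphi2 : phi2 \in Lfun (@lebesgue_measure R) 2%:E)
    (X1 X2 : R -> T -> R)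
    (HX1 : forall t, is_levy_integral P L (fun s => phi1 (t - s)) (X1 t))
    (HX2 : forall t, is_levy_integral P L (fun s => phi2 (t - s)) (X2 t))
    (Delta : R) (HDelta : 0 < Delta)
    (Hi : exists alpha1 alpha2 : \bar R,
        [/\ (1 <= alpha1)%E, (1 <= alpha2)%E,
            (alpha1^-1 + alpha2^-1 = 1)%E,
            in_lp alpha1 (fun s : int => abs_corr phi1 phi1 (s%:~R * Delta)) &
            in_lp alpha2 (fun s : int => abs_corr phi2 phi2 (s%:~R * Delta))])
    (Hii : in_lp 2%:E (fun s : int => abs_corr phi1 phi2 (s%:~R * Delta)))
    (Hiii : (\int[@lebesgue_measure R]_(t in `[0%R, Delta])
        (\esum_(s in [set: int])
           `|phi1 (t + s%:~R * Delta) * phi2 (t + s%:~R * Delta)|%:E) ^+ 2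
        < +oo)%E) :
  let S := fun (n : nat) (w : T) =>
    \sum_(1 <= t < n.+1) X1 (t%:R * Delta) w * X2 (t%:R * Delta) w in
  let sigma2 := fine ('E_P[fun w => ((L 1 w) ^+ 2)%R])%E in
  let kappa4 := fine ('E_P[fun w => ((L 1 w) ^+ 4)%R])%E - 3 * sigma2 ^+ 2 in
  let gamma11 := cross_cov P X1 X1 in
  let gamma12 := cross_cov P X1 X2 in
  let gamma21 := cross_cov P X2 X1 in
  let gamma22 := cross_cov P X2 X2 in
  let eta2 :=
    kappa4 * \int[@lebesgue_measure R]_(t in `[0, Delta])
        (zsum (fun s : int =>
           phi1 (t + s%:~R * Delta) * phi2 (t + s%:~R * Delta))) ^+ 2
    + zsum (fun s : int => gamma11 (s%:~R * Delta) * gamma22 (s%:~R * Delta))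
    + zsum (fun s : int => gamma12 (s%:~R * Delta) * gamma21 (s%:~R * Delta)) in
  0 <= eta2 /\
  cvg_in_distribution P
    (fun n w => (S n w - fine ('E_P[S n])%E) / Num.sqrt n%:R)
    (gaussian 0 eta2).

Proof.
move=> S sigma2 kappa4 gamma11 gamma12 gamma21 gamma22 eta2.
pose leb := @lebesgue_measure R.
have [U [V [HU HV UV indUV LE]]] := HL.
have L1E : L 1 = U 1 by apply/funext => w; rewrite LE ler01.
have mU1 : measurable_fun setT (U 1) by exact: levy_measurable HU _ ler01.
have EE (Y : T -> R) : fine ('E_P[Y])%E = Ex P Y by rewrite unlock.
have U4 : L4 P (U 1).
  split => //; split; first exact: measurable_funX.
  apply: L1_ge0; first by apply: measurable_funX; exact: measurable_funX.
    by move=> w; exact: sqr_ge0.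
  move: HL4; rewrite L1E unlock; apply: le_lt_trans.
  by rewrite le_eqVlt; apply/orP; left; apply/eqP; apply: eq_integral => w _; rewrite -exprM.
have U0 : Ex P (U 1) = 0 by rewrite -EE -L1E HL1.
have HN0 := two_sided_levy_noise HU HV UV indUV U4 U0 LE.
have s2E : sigma2 = Ex P (fun w => U 1 w ^+ 2) by rewrite /sigma2 EE L1E.
have k4E : kappa4 = Ex P (fun w => U 1 w ^+ 4) - 3 * Ex P (fun w => U 1 w ^+ 2) ^+ 2.
  by rewrite /kappa4 EE L1E s2E.
have HN : levy_noise P L sigma2 kappa4 by rewrite k4E s2E.
have P1 := Lfun2_L2 Hphi1; have P2 := Lfun2_L2 Hphi2.
(* The kernel s |-> phi1 (t - s) is phi1 reflected. *)
have W1 (t : R) : wiener P L (reflect_at t phi1) (X1 t).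
  exact: (levy_integral_wiener HN (reflect_L2 t P1) (HX1 t)).
have W2 (t : R) : wiener P L (reflect_at t phi2) (X2 t).
  exact: (levy_integral_wiener HN (reflect_L2 t P2) (HX2 t)).
have Hiii' : (\int[leb]_(t in cell0 Delta) (periodize Delta (fun x => `|phi1 x * phi2 x|%:E) t *
  periodize Delta (fun x => `|phi1 x * phi2 x|%:E) t) < +oo)%E.
  rewrite /leb /cell0 integral_itv_obnd_cbnd//.
  have mp : measurable_fun setT (fun x => phi1 x * phi2 x).
    exact: (@measurable_funM _ (measurableTypeR R) R setT phi1 phi2 (L2_measurable P1) (L2_measurable P2)).
  have mper : measurable_fun [set: measurableTypeR R] (periodize Delta (fun x => `|phi1 x * phi2 x|%:E)).
    apply: measurable_periodize => //; apply/measurable_EFinP; exact: measurable_abs mp.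
  by apply: (@measurable_funTS _ _ (measurableTypeR R)); exact: emeasurable_funM.
pose f := kernels Delta phi1 phi2.
(* Summation starts at time 1, which is why the kernels are reflected at Delta. *)
pose Y (t : nat) (w : T) := X1 (t.+1%:R * Delta) w * X2 (t.+1%:R * Delta) w.
have fY : product_process P L Delta f Y.
  split; first exact: (kernels_square_integrable HDelta P1 P2 Hiii').
  exists (fun t => X1 (t.+1%:R * Delta)), (fun t => X2 (t.+1%:R * Delta)) => t.
  have lagE (a : R -> R) : lag Delta t (reflect_at Delta a) = reflect_at (t.+1%:R * Delta) a.
    by rewrite lag_reflect (_ : Delta + _ = t.+1%:R * Delta)// -natr1; ring.
  by split => //=; rewrite lagE; [exact: W1|exact: W2].
have bnd := cov_bound_zsummable sigma2 kappa4 HDelta P1 P2 Hi Hii Hiii'.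
have gammaE (a b : R -> R) (Xa Xb : R -> T -> R) (h : int) : L2 leb a -> L2 leb b ->
    (forall t, wiener P L (reflect_at t a) (Xa t)) -> (forall t, wiener P L (reflect_at t b) (Xb t)) ->
    cross_cov P Xa Xb (h%:~R * Delta) = sigma2 * Ex leb (fun x => a x * b (x + h%:~R * Delta)).
  move=> a2 b2 wa wb; rewrite /cross_cov EE (wiener_dot HN (wa 0) (wb _)).
  by rewrite -(Ex_reflectM 0 (h%:~R * Delta) a2 b2) add0r.
have etaE : eta2 = zsum (fun h => cov Delta sigma2 kappa4 h f f).
  rewrite (zsum_cov_kernels sigma2 kappa4 HDelta P1 P2 Hi Hii Hiii').
  have g11 h := gammaE _ _ _ _ h P1 P1 W1 W1; have g22 h := gammaE _ _ _ _ h P2 P2 W2 W2.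
  have g12 h := gammaE _ _ _ _ h P1 P2 W1 W2; have g21 h := gammaE _ _ _ _ h P2 P1 W2 W1.
  by congr (_ + zsum _ + zsum _); apply/funext => h; [rewrite -g11 -g22|rewrite -g12 -g21].
have [e0 cvg] := product_clt HN HDelta fY bnd.
rewrite etaE; split => //.
rewrite (_ : (fun n w => _) = normalized_sum P Y)//; apply/funext => n; apply/funext => w.
rewrite EE /normalized_sum mulrC; congr (_ * _).
have SE v : S n v = \sum_(t < n) Y t v by rewrite /S big_add1 /= big_mkord.
have Y1 t : L1 P (Y t) by apply: L2_L1; exact: (product_process_L2 HN HDelta t fY).
by rewrite SE (@eq_Ex _ _ R P _ _ SE) Ex_sum// -sumrB.
Qed.
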